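(* Let $K\in\mathcal W_{\mathcal Q}$. There is $b_0=b_0(K)$ such that for every fixed real $b\ge b_0$ the following holds for every finite positive Borel measure $\mu$ on $\mathbb D$. There exists a constant $C<\infty$ such that $$\int_{\mathbb D}|f(z)|^2\,d\mu(z)\le C\,\|f\|_{Q_K,*}^2\qquad\text{for all } f\in\mathring Q_K$$ if and only if $C^{(b)}_{K,\mathcal R}(\mu)<\infty$. Moreover, $C^{(b)}_{K,\mathcal R}(\mu)\asymp C_{\mathring Q_K}(\mu)$, where $$C_{\mathring Q_K}(\mu)=\sup\Bigl\{\int_{\mathbb D}|f|^2\,d\mu: f\in\mathring Q_K,\ \|f\|_{Q_K,*}\le1\Bigr\},$$ with comparison constants depending only on $K$ and $b$ (not on $\mu$).
   Context: Notation: $\mathbb D$ is the open unit disc, $\mathbb T=\partial\mathbb D$, $dA=\frac1\pi dx\,dy$, $\varphi_a(z)=\frac{a-z}{1-\bar a z}$ for $a\in\mathbb D$. For two quantities, $A\asymp B$ means $A\le CB$ and $B\le CA$ for some constant $C>0$. Class $\mathcal W_{\mathcal Q}$: all non-decreasing, right-continuous $K:[0,\infty)\to[0,\infty)$ such that (K1) $K(0)=0$ and $K(t)>0$ for $t>0$; (K2) $\int_0^1K(\log\frac1r)\,2r\,dr<\infty$; (K3) there is $\sigma>0$ with $\int_0^1\frac{\varphi_K(s)}{s}ds<\infty$ and $\int_1^\infty\frac{\varphi_K(s)}{s^{1+\sigma}}ds<\infty$, where $\varphi_K(s)=\sup_{0<t\le1}\frac{K(st)}{K(t)}$; (K4) there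 is $C_K\ge1$ with $K(2t)\le C_KK(t)$ for all $t\in[0,1/2]$. Space $Q_K$: analytic $f$ on $\mathbb D$ with $\|f\|_{Q_K}=|f(0)|+\|f\|_{Q_K,*}<\infty$, where $\|f\|_{Q_K,*}^2=\sup_{a\in\mathbb D}\int_{\mathbb D}|f'(z)|^2K(1-|\varphi_a(z)|^2)\,dA(z)$. Put $\mathring Q_K=\{f\in Q_K:f(0)=0\}$. Carleson boxes: for an arc $I\subseteq\mathbb T$, $|I|$ is its normalized arclength ($|\mathbb T|=1$) and $Q_I=\{re^{i\theta}\in\mathbb D:e^{i\theta}\in I,\ 1-|I|\le r<1\}$, $Q_{\mathbb T}=\mathbb D$. Polar dyadic resolution $\mathcal R=\{\mathcal R_N\}_{N\ge0}$: $\mathcal R_N=\{R_{N,j,k}:0\le j,k\le2^N-1\}$, $R_{N,j,k}=\{re^{i\theta}:\frac j{2^N}\le r^2<\frac{j+1}{2^N},\ \frac{2\pi k}{2^N}\le\theta<\frac{2\pi(k+1)}{2^N}\}$. Packets: $dA_b(w)=(b+1)(1-|w|^2)^b\,dA(w)$, $L_b(z,w)=\int_0^z\frac{d\xi}{(1-\xi\bar w)^{b+2}}$ (principal branch), and $\Psi^{(b)}_R(z)=\int_RL_b(z,w)\,dA_b(w)$ for $R\in\mathcal R_N$. Discrete norm: for $c=\{c_R\}_{R\in\mathcal R_N}\subset\mathbb C$, $\|c\|_{X_{K,N}}^2=\sup_{I\subseteq\mathbb T}\sum_{R\in\mathcal R_N}|c_R|^2\int_{R\cap Q_I}K\bigl(\frac{1-|z|}{|I|}\bigr)dA(z)$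 (supremum over all arcs $I$). Capacity: $C^{(b)}_{K,\mathcal R}(\mu)=\sup_{N\ge0}\ \sup_{\|c\|_{X_{K,N}}\le1}\int_{\mathbb D}\bigl|\sum_{R\in\mathcal R_N}c_R\Psi^{(b)}_R(z)\bigr|^2d\mu(z)$. *)

(* Defs.v *)
From HB Require Import structures.
From mathcomp Require Import all_boot all_order all_algebra.
From mathcomp Require Import complex.
From mathcomp Require Import all_classical all_reals all_analysis.

Set Implicit Arguments.
Unset Strict Implicit.
Unset Printing Implicit Defensive.

Import Order.TTheory GRing.Theory Num.Theory.
Import numFieldNormedType.Exports.

Local Open Scope classical_set_scope.
Local Open Scope complex_scope.
Local Open Scope ring_scope.

(* Measure theory takes place on [R * R], whose product sigma-algebra is the
   Borel one, and complex analysis on [R[i]]; [cplx] identifies the two. *)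
Notation plane R := (measurableTypeR R * measurableTypeR R)%type.

Definition cplx (R : realType) (p : plane R) : R[i] := p.1 +i* p.2.

Definition polar (R : realType) (r t : R) : plane R := (r * cos t, r * sin t).

(* The norm [`|z|] of [z : R[i]] is an element of [R[i]]; [cmod z] is the same
   number as an element of [R]. *)
Definition cmod (R : realType) (z : R[i]) : R := ComplexField.Normc.normc z.

Definition disc (R : realType) : set (plane R) := [set p | cmod (cplx p) < 1].

Lemma invpi_ge0 (R : realType) : 0 <= (pi : R)^-1.
Proof. by rewrite invr_ge0 pi_ge0. Qed.

Definition dA (R : realType) : {measure set (plane R) -> \bar R} :=
  mscale (NngNum (invpi_ge0 R)) (lebesgue_measure \x lebesgue_measure)%E.

Section complex_analysis.
Variable R : realType.
Implicit Types (f : R[i] -> R[i]) (a z w u : R[i]).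

(* [R[i]^o] is [R[i]] as a normed space over itself, so that the difference
   quotients are complex ones. *)
Definition cderivable f z : Prop := @derivable R[i] R[i]^o R[i]^o f z 1.

Definition cderive f z : R[i] := @derive1 R[i] R[i]^o f z.

(* Members of spaces of functions on the disc are represented by total
   functions, whose values outside the disc are irrelevant. *)
Definition analytic_on_disc f : Prop :=
  forall z, cmod z < 1 -> cderivable f z.

Definition cintegral d (T : measurableType d) (mu : {measure set T -> \bar R})
    (D : set T) (F : T -> R[i]) : R[i] :=
  Rintegral mu D (fun x => complex.Re (F x))
    +i* Rintegral mu D (fun x => complex.Im (F x)).

(* Principal argument, with values in ]-pi, pi]. *)
Definition carg u : R :=
  let t := acos (complex.Re u / cmod u) in
  if 0 <= complex.Im u then t else - t.

(* Principal branch of u ^ s; used only for u != 0. *)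
Definition cpow u (s : R) : R[i] :=
  (cmod u `^ s * cos (s * carg u)) +i* (cmod u `^ s * sin (s * carg u)).

Definition mobius a z : R[i] := (a - z) / (1 - a^* * z).

End complex_analysis.

Section weights.
Variables (R : realType) (K : R -> R).
Local Open Scope ereal_scope.

Definition phiK (s : R) : \bar R :=
  ereal_sup [set (K (s * t)%R / K t)%:E | t in `]0%R, 1%R]].

(* Only the values of [K] on [0, +oo[ are constrained or used. *)
Record WQ : Prop := {
  WQ_ge0 : forall t : R, (0 <= t)%R -> (0 <= K t)%R;
  WQ_nondecreasing :
    forall s t : R, (0 <= s)%R -> (s <= t)%R -> (K s <= K t)%R;
  WQ_right_continuous :
    forall t : R, (0 <= t)%R -> K x @[x --> t^'+] --> K t;
  WQ_K1 : K 0%R = 0%R /\ forall t : R, (0 < t)%R -> (0 < K t)%R;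
  WQ_K2 :
    \int[lebesgue_measure]_(r in `]0%R, 1%R[) (K (ln r^-1) * (2 * r))%:E < +oo;
  WQ_K3 : exists sigma : R, [/\ (0 < sigma)%R,
    \int[lebesgue_measure]_(s in `]0%R, 1%R[) (phiK s * s^-1%:E) < +oo &
    \int[lebesgue_measure]_(s in `[1%R, +oo[)
      (phiK s * ((s `^ (1 + sigma))^-1)%:E) < +oo];
  WQ_K4 : exists2 CK : R, (1 <= CK)%R &
    forall t : R, (0 <= t <= 2^-1)%R -> (K (2 * t) <= CK * K t)%R }.

End weights.

Section QK_space.
Variables (R : realType) (K : R -> R).
Implicit Type f : R[i] -> R[i].
Local Open Scope ereal_scope.

(* The square of the seminorm ||f||_{Q_K,*}. *)
Definition QK_seminorm_sqr f : \bar R :=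
  ereal_sup [set \int[dA R]_(p in @disc R)
                   (cmod (cderive f (cplx p)) ^+ 2 *
                    K (1 - cmod (mobius a (cplx p)) ^+ 2))%:E
            | a in [set a : R[i] | (cmod a < 1)%R]].

Definition QK_seminorm f : \bar R := sqrte (QK_seminorm_sqr f).

Definition QK_norm f : \bar R := (cmod (f 0%R))%:E + QK_seminorm f.

Definition QK : set (R[i] -> R[i]) :=
  [set f | analytic_on_disc f /\ QK_norm f < +oo].

Definition QK0 : set (R[i] -> R[i]) := [set f | QK f /\ f 0%R = 0%R].

Definition L2_sqr (mu : {measure set (plane R) -> \bar R}) f : \bar R :=
  \int[mu]_(p in @disc R) (cmod (f (cplx p)) ^+ 2)%:E.

Definition QK0_capacity (mu : {measure set (plane R) -> \bar R}) : \bar R :=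
  ereal_sup [set L2_sqr mu f | f in [set f | QK0 f /\ QK_seminorm f <= 1]].

End QK_space.

Section discrete.
Variables (R : realType) (K : R -> R).

(* [is_arc I h]: [I] is an arc of the unit circle (with or without its
   endpoints) of normalized length [h > 0]; for [h = 1] it is the whole circle,
   possibly minus one point. *)
Definition is_arc (I : set (plane R)) (h : R) : Prop :=
  0 < h <= 1 /\
  exists (a : R) (bl br : bool), I = [set polar 1 t
    | t in [set` Interval (BSide bl a) (BSide br (a + 2 * pi * h))]].

Definition carleson_box (I : set (plane R)) (h : R) : set (plane R) :=
  [set p | exists r t : R,
    [/\ 0 <= r, 1 - h <= r < 1, I (polar 1 t) & p = polar r t]].

Definition polar_box (N : nat) (j k : 'I_(2 ^ N)) : set (plane R) :=
  [set p | exists r t : R,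
    [/\ 0 <= r,
        j%:R / 2 ^+ N <= r ^+ 2 < j.+1%:R / 2 ^+ N,
        2 * pi * k%:R / 2 ^+ N <= t < 2 * pi * k.+1%:R / 2 ^+ N &
        p = polar r t]].

(* Integral over the segment [0, z] parametrized by xi = t z; the integrand is
   analytic in xi on the disc, so the path is immaterial. *)
Definition Lker (b : R) (z w : R[i]) : R[i] :=
  cintegral lebesgue_measure `[0, 1]
    (fun t : R => z / cpow (1 - (t%:C * z) * w^*) (b + 2)).

Definition packet (b : R) (N : nat) (j k : 'I_(2 ^ N)) (z : R[i]) : R[i] :=
  cintegral (dA R) (polar_box j k)
    (fun q => Lker b z (cplx q) *
       ((b + 1) * (1 - cmod (cplx q) ^+ 2) `^ b)%:C).

Definition X_norm_sqr (N : nat) (c : 'I_(2 ^ N) -> 'I_(2 ^ N) -> R[i]) :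
    \bar R :=
  ereal_sup [set (\sum_(j < 2 ^ N) \sum_(k < 2 ^ N)
                   (cmod (c j k) ^+ 2)%:E *
                   \int[dA R]_(p in polar_box j k `&` carleson_box Ih.1 Ih.2)
                     (K ((1 - cmod (cplx p)) / Ih.2))%:E)%E
            | Ih in [set Ih : set (plane R) * R | is_arc Ih.1 Ih.2]].

Definition X_norm (N : nat) (c : 'I_(2 ^ N) -> 'I_(2 ^ N) -> R[i]) : \bar R :=
  sqrte (X_norm_sqr c).

Definition packet_sum (b : R) (N : nat)
    (c : 'I_(2 ^ N) -> 'I_(2 ^ N) -> R[i]) (z : R[i]) : R[i] :=
  \sum_(j < 2 ^ N) \sum_(k < 2 ^ N) c j k * packet b j k z.

Definition discrete_capacity (b : R)
    (mu : {measure set (plane R) -> \bar R}) : \bar R :=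
  ereal_sup (range (fun N : nat =>
    ereal_sup [set L2_sqr mu (packet_sum b c)
              | c in [set c : 'I_(2 ^ N) -> 'I_(2 ^ N) -> R[i]
                     | (X_norm c <= 1)%E]])).

End discrete.

(* Main.v *)
Require Import Defs.
From HB Require Import structures.
From mathcomp Require Import all_boot all_order all_algebra.
From mathcomp Require Import complex.
From mathcomp Require Import all_classical all_reals all_analysis measurable_realfun.
From mathcomp Require Import ring lra.
Set Implicit Arguments.
Unset Strict Implicit.
Unset Printing Implicit Defensive.
Import Order.TTheory GRing.Theory Num.Theory.
Import numFieldNormedType.Exports.
Local Open Scope classical_set_scope.
Local Open Scope complex_scope.
Local Open Scope ring_scope.

(* Put d(w) = 1 - |w|. A packet sum is the transform
   F(z) = int L_b(z,w) c(w) dA_b(w) of the step function c = sum_R c_R 1_R, and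
   F'(z) = int c(w) dA_b(w) / (1 - z conj(w))^(b+2).

   If 2^p dominates the doubling constant of K and b >= p, then |F'(z)| is at
   most a constant times int |c(w)| d(w)^p / |1 - z conj(w)|^(p+2) dA(w). Schur's
   test with the weight d^(-1/2) together with Forelli-Rudin estimates bounds
   int_B |F'|^2 K(d/delta) over every disc B of radius delta centred on the
   circle by ||c||_X^2; since K(1 - |phi_a|^2) is dominated by a sum over
   dyadic discs whose coefficients are summable by (K3), the Q_K seminorm of F
   is at most a constant times ||c||_X.

   Conversely, for f in Q_K with f(0) = 0 and rho < 1 put
   g = f' ((rho^2 - |w|^2)_+ / (1 - |w|^2))^b. Then |g| <= |f'|, and by a
   reproducing formula for the weight (rho^2 - |w|^2)^b on |w| < rho the
   transform of g is a constant times f(rho^2 z). Uniform approximation of g by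
   step functions c with |c| <= |f'|, whose X-norm is controlled by the
   seminorm of f, gives packet sums converging pointwise to a multiple of f as
   rho tends to 1, and Fatou's lemma applies. *)

(** * Complex differentiability *)

(** Since f' may be unbounded, it need not be a uniform limit of step functions. The factor in g
    vanishes for |w| >= rho and never exceeds 1, so g is uniformly continuous while the step
    functions stay below |f'| itself; no dilate of f has to be estimated in norm. The reproducing
    formula has no boundary term: (rho^2 - |w|^2)^(b+1) vanishes on |w| = rho, and the d-bar
    derivative of (rho^2 - |w|^2)^(b+1) (1 - z conj(w))^(-b-1) phi(w) is (b+1) (rho^2 - |w|^2)^b (1
    - z conj(w))^(-b-2) (rho^2 z - w) phi(w). The last linear factor is what makes rho^2 z the point
    of evaluation. The condition b >= p comes from doubling: moving the weight K from z to w costs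
    the p-th power of |1 - z conj(w)| / (1 - |w|), which the factor (1 - |w|^2)^b pays for.
    Analyticity means bare complex differentiability. Goursat's theorem therefore supplies
    primitives, and the reproducing formula, applied to a second primitive of f, shows that f' is
    again differentiable, hence continuous and measurable. *)

Section cmod_theory.
Variable R : realType.
Implicit Types (z w u : R[i]) (r : R).

Lemma cmodE z : cmod z = Num.sqrt (complex.Re z ^+ 2 + complex.Im z ^+ 2).
Proof. by case: z. Qed.

Lemma norm_cmod z : `|z| = (cmod z)%:C.
Proof. by rewrite normc_def -cmodE. Qed.

Lemma cmod_ge0 z : 0 <= cmod z.
Proof. by rewrite cmodE sqrtr_ge0. Qed.

Lemma cmod0 : cmod (0 : R[i]) = 0. Proof. exact: Normc.normc0. Qed.

Lemma cmod1 : cmod (1 : R[i]) = 1. Proof. exact: Normc.normc1. Qed.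

Lemma cmod_eq0 z : cmod z = 0 -> z = 0. Proof. exact: Normc.eq0_normc. Qed.

Lemma cmod_gt0 z : (0 < cmod z) = (z != 0).
Proof.
rewrite lt_neqAle cmod_ge0 andbT; congr (~~ _); apply/eqP/eqP => [/esym/cmod_eq0//|->].
by rewrite cmod0.
Qed.

Lemma cmodM z w : cmod (z * w) = cmod z * cmod w.
Proof. exact: Normc.normcM. Qed.

Lemma cmodV z : cmod z^-1 = (cmod z)^-1. Proof. exact: Normc.normcV. Qed.

Lemma cmodX z n : cmod (z ^+ n) = cmod z ^+ n.
Proof. by elim: n => [|n IH]; rewrite ?expr0 ?cmod1 // !exprS cmodM IH. Qed.

Lemma cmodN z : cmod (- z) = cmod z.
Proof. by rewrite !cmodE; case: z => a b /=; rewrite !sqrrN. Qed.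

Lemma cmodD z w : cmod (z + w) <= cmod z + cmod w.
Proof. exact: le_normcD. Qed.

Lemma cmodB z w : cmod (z - w) <= cmod z + cmod w.
Proof. by rewrite -(cmodN w) cmodD. Qed.

Lemma cmodBC z w : cmod (z - w) = cmod (w - z).
Proof. by rewrite -cmodN opprB. Qed.

Lemma cmod_conj z : cmod (z^*) = cmod z.
Proof. by rewrite !cmodE; case: z => a b /=; rewrite sqrrN. Qed.

Lemma cmod_real r : cmod r%:C = `|r|.
Proof. by rewrite cmodE /= expr0n /= addr0 sqrtr_sqr. Qed.

Lemma cmod_sqr z : cmod z ^+ 2 = complex.Re z ^+ 2 + complex.Im z ^+ 2.
Proof. by rewrite cmodE sqr_sqrtr // addr_ge0 ?sqr_ge0. Qed.

Lemma Re_le_cmod z : `|complex.Re z| <= cmod z.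
Proof.
rewrite -[leLHS]sqrtr_sqr cmodE ler_wsqrtr // lerDl; exact: sqr_ge0.
Qed.

Lemma Im_le_cmod z : `|complex.Im z| <= cmod z.
Proof.
rewrite -[leLHS]sqrtr_sqr cmodE ler_wsqrtr // lerDr; exact: sqr_ge0.
Qed.

Lemma cmod_le_ReIm z : cmod z <= `|complex.Re z| + `|complex.Im z|.
Proof.
rewrite cmodE -[leRHS]ger0_norm ?addr_ge0 // -sqrtr_sqr ler_wsqrtr //.
rewrite -(real_normK (num_real (complex.Re z))) -(real_normK (num_real (complex.Im z))).
have := normr_ge0 (complex.Re z); have := normr_ge0 (complex.Im z); nra.
Qed.

Lemma cReD z w : complex.Re (z + w) = complex.Re z + complex.Re w.
Proof. by case: z; case: w. Qed.
Lemma cImD z w : complex.Im (z + w) = complex.Im z + complex.Im w.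
Proof. by case: z; case: w. Qed.
Lemma cReN z : complex.Re (- z) = - complex.Re z.
Proof. by case: z. Qed.
Lemma cImN z : complex.Im (- z) = - complex.Im z.
Proof. by case: z. Qed.
Lemma cReB z w : complex.Re (z - w) = complex.Re z - complex.Re w.
Proof. by case: z; case: w. Qed.
Lemma cImB z w : complex.Im (z - w) = complex.Im z - complex.Im w.
Proof. by case: z; case: w. Qed.
Lemma cReM z w : complex.Re (z * w) = complex.Re z * complex.Re w - complex.Im z * complex.Im w.
Proof. by case: z; case: w. Qed.
Lemma cImM z w : complex.Im (z * w) = complex.Re z * complex.Im w + complex.Im z * complex.Re w.
Proof. by case: z; case: w. Qed.
Lemma cRe_conj z : complex.Re (z^*) = complex.Re z. Proof. by case: z. Qed.
Lemma cIm_conj z : complex.Im (z^*) = - complex.Im z. Proof. by case: z. Qed.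

Lemma complexP z w : complex.Re z = complex.Re w -> complex.Im z = complex.Im w -> z = w.
Proof. by case: z; case: w => a b c d /= -> ->. Qed.

Lemma conj_real r : (r%:C)^* = r%:C.
Proof. by apply: complexP; rewrite ?cRe_conj ?cIm_conj //= oppr0. Qed.

Lemma mulc_conj z : z * z^* = (cmod z ^+ 2)%:C.
Proof.
apply: complexP; rewrite ?cReM ?cImM cRe_conj cIm_conj /= ?cmod_sqr; ring.
Qed.

Lemma cmod_dist z w : `|cmod z - cmod w| <= cmod (z - w).
Proof.
rewrite ler_norml; apply/andP; split.
  rewrite lerBrDr addrC lerBlDr; have := cmodD (w - z) z.
  by rewrite subrK cmodBC addrC.
by rewrite lerBlDr; have := cmodD (z - w) w; rewrite subrK.
Qed.

End cmod_theory.

Section hol.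
Variable R : realType.
Implicit Types (f g : R[i] -> R[i]) (z w d : R[i]) (r e : R).

Definition hol f z d := forall e, 0 < e -> exists2 r, 0 < r &
  forall h, cmod h < r -> cmod (f (z + h) - f z - d * h) <= e * cmod h.

(** In the partial order of [R[i]] the positive elements are real, so complex epsilons and radii
    reduce to real ones, and the limit of difference quotients becomes a first-order expansion. *)
Lemma cderivableP f z d : hol f z d <-> cderivable f z /\ cderive f z = d.
Proof.
have key : hol f z d <-> (h^-1 *: ((f (h + z) : R[i]^o) - (f z : R[i]^o)) @[h --> (0 : R[i]^o)^'] --> (d : R[i]^o)).
  split.
  - move=> H; apply/cvgrPdist_le => /= e e0.
    have eR : e = (complex.Re e)%:C.
      move: e0; rewrite ltcE => /andP[/eqP h _]; exact: complexP.
    move: e0; rewrite eR ltcR => /H [r r0 Hr].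
    have r0' : 0 < r%:C by rewrite ltcR.
    rewrite /dnbhs /within /=; exists r%:C => //= h hb h0.
    have hr : cmod h < r by rewrite -ltcR -norm_cmod -normrN -sub0r.
    have := Hr _ hr; rewrite (addrC z) distrC => Hh.
    rewrite norm_cmod lecR -[h^-1 *: _]/(h^-1 * _).
    have -> : h^-1 * (f (h + z) - f z) - d = h^-1 * (f (h + z) - f z - d * h).
      by field.
    rewrite cmodM cmodV ler_pdivrMl ?cmod_gt0 // [leRHS]mulrC //.
  - move=> H e e0.
    have e0' : 0 < e%:C by rewrite ltcR.
    move/cvgrPdist_le : H => /(_ _ e0').
    rewrite /dnbhs /within /= => -[r /= r0 Hr].
    have rR : r = (complex.Re r)%:C.
      move: r0; rewrite ltcE => /andP[/eqP h _]; exact: complexP.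
    exists (complex.Re r); first by move: r0; rewrite rR ltcR.
    move=> h hr; have [->|h0] := eqVneq h 0.
      by rewrite addr0 subrr mulr0 subr0 cmod0 mulr0.
    have hr' : `|0 - h| < r by rewrite sub0r normrN norm_cmod rR ltcR.
    have := Hr h hr' h0; rewrite norm_cmod lecR -[h^-1 *: _]/(h^-1 * _) => Hh.
    have -> : f (z + h) - f z - d * h = (d - h^-1 * (f (h + z) - f z)) * - h.
      by rewrite (addrC z); field.
    by rewrite cmodM cmodN ler_wpM2r // cmod_ge0.
rewrite key; split.
  move=> H; split; last by rewrite /cderive /derive1; apply: (cvg_lim (@norm_hausdorff _ R[i]^o)).
  rewrite /cderivable /derivable /=; apply/cvg_ex; exists d.
  move: H; under eq_fun do rewrite -[X in f (X + z)]mulr1; exact.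
move=> [H <-].
rewrite /cderive /derive1.
move: H; rewrite /cderivable /derivable /=.
by under eq_fun do rewrite -[_ *: 1]/(_ * 1) mulr1.
Qed.

(* [A] is the set of admissible increments: everything for complex
   differentiability, [reals] for the derivative along a horizontal line. *)
Definition diffw (A : set R[i]) f z d := forall e, 0 < e -> exists2 r, 0 < r &
  forall h, A h -> cmod h < r -> cmod (f (z + h) - f z - d * h) <= e * cmod h.

Definition reals : set R[i] := [set h | complex.Im h = 0].

Lemma hol_diffw f z d A : hol f z d -> diffw A f z d.
Proof. by move=> H e /H[r r0 Hr]; exists r => // h _ /Hr. Qed.

Lemma diffwT f z d : diffw setT f z d -> hol f z d.
Proof. by move=> H e /H[r r0 Hr]; exists r => // h /Hr; exact. Qed.

Section diffw_theory.
Variable A : set R[i].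

Lemma diffw_ext f g z d r : 0 < r -> (forall h, A h -> cmod h < r -> f (z + h) = g (z + h)) ->
  f z = g z -> diffw A f z d -> diffw A g z d.
Proof.
move=> r0 H Hz Hf e /Hf[r' r'0 Hr]; exists (Num.min r r').
  by rewrite lt_min r0.
by move=> h Ah; rewrite lt_min => /andP[h1 h2]; rewrite -H // -Hz; exact: Hr.
Qed.

Lemma diffw_lip f z d : diffw A f z d -> exists2 r, 0 < r &
  forall h, A h -> cmod h < r -> cmod (f (z + h) - f z) <= (cmod d + 1) * cmod h.
Proof.
move=> /(_ 1 ltr01)[r r0 Hr]; exists r => // h Ah /(Hr h Ah) H.
have -> : f (z + h) - f z = (f (z + h) - f z - d * h) + d * h by rewrite subrK.
by apply: le_trans (cmodD _ _) _; rewrite cmodM mulrDl addrC lerD2l.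
Qed.

Lemma diffw_cont f z d : diffw A f z d -> forall e, 0 < e -> exists2 r, 0 < r &
  forall h, A h -> cmod h < r -> cmod (f (z + h) - f z) <= e.
Proof.
move=> /diffw_lip[r r0 Hr] e e0.
have k0 : 0 < cmod d + 1 by rewrite ltr_wpDl // cmod_ge0.
exists (Num.min r (e / (cmod d + 1))); first by rewrite lt_min r0 divr_gt0.
move=> h Ah; rewrite lt_min => /andP[/(Hr h Ah) H h2]; apply: le_trans H _.
by rewrite mulrC -ler_pdivlMr // ltW.
Qed.

Lemma diffw_cst c z : diffw A (fun=> c) z 0.
Proof. by move=> e e0; exists 1 => // h _ _; rewrite subrr mul0r subr0 cmod0 mulr_ge0 ?cmod_ge0 // ltW. Qed.

Lemma diffw_id z : diffw A id z 1.
Proof.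
move=> e e0; exists 1 => // h _ _.
by rewrite mul1r addrAC addrK addrN cmod0 mulr_ge0 ?cmod_ge0 // ltW.
Qed.

Lemma diffwD f g z d d' : diffw A f z d -> diffw A g z d' ->
  diffw A (fun x => f x + g x) z (d + d').
Proof.
move=> Hf Hg e e0; have e2 : 0 < e / 2 by rewrite divr_gt0.
have [r r0 Hr] := Hf _ e2; have [r' r'0 Hr'] := Hg _ e2.
exists (Num.min r r'); first by rewrite lt_min r0.
move=> h Ah; rewrite lt_min => /andP[/(Hr h Ah) h1 /(Hr' h Ah) h2].
have -> : f (z + h) + g (z + h) - (f z + g z) - (d + d') * h =
  (f (z + h) - f z - d * h) + (g (z + h) - g z - d' * h) by ring.
by apply: le_trans (cmodD _ _) _; rewrite [e]splitr mulrDl lerD.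
Qed.

Lemma diffwM f g z d d' : diffw A f z d -> diffw A g z d' ->
  diffw A (fun x => f x * g x) z (d * g z + f z * d').
Proof.
move=> Hf Hg e e0.
have [rg rg0 Lg] := diffw_lip Hg.
(* A single M > 1 dominates |f z|, |d|, |d'| + 1 and |g| near z, so that each of the three parts of
   the remainder is at most e/3 times |h|. *)
set M := cmod (g z) + cmod (f z) + cmod d + cmod d' + 2.
have M0 : 1 < M.
  rewrite /M; have := cmod_ge0 (g z); have := cmod_ge0 (f z).
  have := cmod_ge0 d; have := cmod_ge0 d'; lra.
have e1 : 0 < e / (3 * M) by rewrite divr_gt0 // mulr_gt0 //; lra.
have [r r0 Hr] := Hf _ e1; have [r' r'0 Hr'] := Hg _ e1.
exists (Num.min (Num.min r r') (Num.min (Num.min rg 1) (e / (3 * M) / M))).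
  by rewrite !lt_min r0 r'0 rg0 ltr01 /= divr_gt0 //; lra.
move=> h Ah; rewrite !lt_min => /andP[/andP[h1 h2] /andP[/andP[h3 h4] h5]].
have H1 := Hr h Ah h1; have H2 := Hr' h Ah h2; have H3 := Lg h Ah h3.
have -> : f (z + h) * g (z + h) - f z * g z - (d * g z + f z * d') * h =
  (f (z + h) - f z - d * h) * g (z + h) + d * h * (g (z + h) - g z) +
  f z * (g (z + h) - g z - d' * h) by ring.
have B1 : cmod (g (z + h)) <= M.
  have -> : g (z + h) = g z + (g (z + h) - g z) by rewrite subrKC.
  apply: le_trans (cmodD _ _) _; rewrite /M.
  have := cmod_ge0 (g z); have := cmod_ge0 (f z).
  have := cmod_ge0 d; have := cmod_ge0 d'; have := cmod_ge0 h; nra.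
have B2 : cmod (f z) <= M.
  rewrite /M; have := cmod_ge0 (g z); have := cmod_ge0 d; have := cmod_ge0 d'; lra.
have B3 : cmod d <= M.
  rewrite /M; have := cmod_ge0 (g z); have := cmod_ge0 (f z); have := cmod_ge0 d'; lra.
have B4 : cmod d' + 1 <= M.
  rewrite /M; have := cmod_ge0 (g z); have := cmod_ge0 (f z); have := cmod_ge0 d; lra.
have h0 := cmod_ge0 h.
have M0' : 0 < M by lra.
have eE : e / (3 * M) * M = e / 3 by field; lra.
have T1 : cmod ((f (z + h) - f z - d * h) * g (z + h)) <= e / 3 * cmod h.
  rewrite cmodM -eE mulrAC; apply: ler_pM => //; exact: cmod_ge0.
have T3 : cmod (f z * (g (z + h) - g z - d' * h)) <= e / 3 * cmod h.
  rewrite cmodM -eE mulrAC [leRHS]mulrC; apply: ler_pM => //; exact: cmod_ge0.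
have T2 : cmod (d * h * (g (z + h) - g z)) <= e / 3 * cmod h.
  rewrite 2!cmodM.
  have k : cmod h <= e / (3 * M) / M by exact: ltW.
  move: k; rewrite ler_pdivlMr // => k.
  apply: (@le_trans _ _ (M * cmod h * (e / (3 * M)))).
    apply: ler_pM => //; rewrite ?mulr_ge0 ?cmod_ge0 //; first by rewrite ler_wpM2r.
    by apply: le_trans H3 _; rewrite mulrC (le_trans _ k) // ler_wpM2l.
  by rewrite mulrC mulrA eE.
apply: le_trans (cmodD _ _) _; apply: le_trans (lerD (cmodD _ _) (lexx _)) _; lra.
Qed.

Lemma diffw_comp f g z d d' : diffw A g z d' -> hol f (g z) d ->
  diffw A (f \o g) z (d * d').
Proof.
move=> Hg Hf e e0.
have [rg rg0 Lg] := diffw_lip Hg.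
have k0 : 0 < cmod d' + 1 by rewrite ltr_wpDl // cmod_ge0.
have k1 : 0 < cmod d + 1 by rewrite ltr_wpDl // cmod_ge0.
have e1 : 0 < e / 2 / (cmod d' + 1) by rewrite !divr_gt0.
have e2 : 0 < e / 2 / (cmod d + 1) by rewrite !divr_gt0.
have [r r0 Hr] := Hf _ e1; have [r' r'0 Hr'] := Hg _ e2.
exists (Num.min (Num.min r' rg) (r / (cmod d' + 1))).
  by rewrite !lt_min r'0 rg0 divr_gt0.
move=> h Ah; rewrite !lt_min => /andP[/andP[h1 h2] h3].
have H1 := Hr' h Ah h1; have H2 := Lg h Ah h2.
have h0 := cmod_ge0 h.
have hk : cmod (g (z + h) - g z) < r.
  by apply: le_lt_trans H2 _; rewrite mulrC -ltr_pdivlMr.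
have := Hr _ hk; rewrite subrKC => H3.
have -> : (f \o g) (z + h) - (f \o g) z - d * d' * h =
  (f (g (z + h)) - f (g z) - d * (g (z + h) - g z)) + d * (g (z + h) - g z - d' * h).
  by rewrite /=; ring.
apply: le_trans (cmodD _ _) _; rewrite cmodM [e]splitr mulrDl; apply: lerD.
  apply: le_trans H3 _; apply: le_trans (ler_wpM2l (ltW e1) H2) _.
  by rewrite mulrA divfK ?gt_eqF.
apply: le_trans (ler_wpM2l (cmod_ge0 _) H1) _; rewrite mulrA ler_wpM2r //.
rewrite mulrA ler_pdivrMr // mulrC ler_wpM2l ?(ltW (divr_gt0 e0 _)) //; lra.
Qed.

Lemma diffwZ c f z d : diffw A f z d -> diffw A (fun x => c * f x) z (c * d).
Proof. by move=> /(diffwM (diffw_cst c z)); rewrite mul0r add0r. Qed.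

Lemma diffwN f z d : diffw A f z d -> diffw A (fun x => - f x) z (- d).
Proof.
move=> /(diffwZ (-1)); rewrite mulN1r; apply: diffw_ext ltr01 _ _ => *; by rewrite mulN1r.
Qed.

Lemma diffwB f g z d d' : diffw A f z d -> diffw A g z d' ->
  diffw A (fun x => f x - g x) z (d - d').
Proof. by move=> Hf /diffwN; exact: diffwD. Qed.

End diffw_theory.

Lemma holM f g z d d' : hol f z d -> hol g z d' ->
  hol (fun x => f x * g x) z (d * g z + f z * d').
Proof. by move=> /hol_diffw Hf /hol_diffw Hg; apply/diffwT/diffwM. Qed.

Lemma holD f g z d d' : hol f z d -> hol g z d' -> hol (fun x => f x + g x) z (d + d').
Proof. by move=> /hol_diffw Hf /hol_diffw Hg; apply/diffwT/diffwD. Qed.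

Lemma holB f g z d d' : hol f z d -> hol g z d' -> hol (fun x => f x - g x) z (d - d').
Proof. by move=> /hol_diffw Hf /hol_diffw Hg; apply/diffwT/diffwB. Qed.

Lemma holZ c f z d : hol f z d -> hol (fun x => c * f x) z (c * d).
Proof. by move=> /hol_diffw Hf; apply/diffwT/diffwZ. Qed.

Lemma hol_cst c z : hol (fun=> c) z 0.
Proof. exact/diffwT/diffw_cst. Qed.

Lemma hol_id z : hol id z 1.
Proof. exact/diffwT/diffw_id. Qed.

Lemma hol_comp f g z d d' : hol g z d' -> hol f (g z) d -> hol (f \o g) z (d * d').
Proof. by move=> /hol_diffw Hg Hf; apply/diffwT/diffw_comp. Qed.

Lemma hol_cont f z d : hol f z d -> forall e, 0 < e -> exists2 r, 0 < r &
  forall h, cmod h < r -> cmod (f (z + h) - f z) <= e.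
Proof.
move=> /hol_diffw-/(_ setT)/diffw_cont H e /H[r r0 Hr]; exists r => // h; exact: Hr.
Qed.

Lemma hol_inv u : u != 0 -> hol (fun x => x^-1) u (- u^-1 ^+ 2).
Proof.
move=> u0 e e0; have c0 : 0 < cmod u by rewrite cmod_gt0.
exists (Num.min (cmod u / 2) (e * cmod u ^+ 3 / 2)).
  by rewrite lt_min !divr_gt0 // mulr_gt0 // exprn_gt0.
move=> h; rewrite lt_min => /andP[h1 h2].
have huc : cmod u / 2 <= cmod (u + h).
  have := cmodB (u + h) h; rewrite addrK; lra.
have hu : u + h != 0 by rewrite -cmod_gt0; apply: lt_le_trans huc; exact: divr_gt0.
have -> : (u + h)^-1 - u^-1 - - u^-1 ^+ 2 * h = h ^+ 2 * (u ^+ 2 * (u + h))^-1.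
  by field; rewrite u0 hu.
rewrite cmodM cmodV cmodX cmodM cmodX expr2 -mulrA mulrC ler_wpM2r ?cmod_ge0 //.
rewrite ler_pdivrMr ?mulr_gt0 ?exprn_gt0 // ?(lt_le_trans _ huc) ?divr_gt0 //.
have k0 : 0 < e * cmod u ^+ 2 by rewrite mulr_gt0 // exprn_gt0.
have k1 : e * cmod u ^+ 3 / 2 = e * cmod u ^+ 2 * (cmod u / 2) by field.
rewrite mulrA; apply: le_trans (ltW h2) _; rewrite k1; nra.
Qed.

Definition rderiv (F : R -> R) (t d : R) := forall e, 0 < e -> exists2 r, 0 < r &
  forall s, `|s| < r -> `|F (t + s) - F t - d * s| <= e * `|s|.

Lemma rdP (F : R -> R) (t d : R) : is_derive t 1 F d <-> rderiv F t d.
Proof.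
have key : rderiv F t d <-> (h^-1 *: (F (h + t) - F t) @[h --> 0^'] --> d).
  split.
  - move=> H; apply/cvgrPdist_le => /= e e0.
    have [r r0 Hr] := H _ e0.
    rewrite /dnbhs /within /=; exists r => //= h hb h0.
    have hr : `|h| < r by rewrite -normrN -sub0r.
    rewrite distrC; have -> : h^-1 *: (F (h + t) - F t) - d = h^-1 * (F (h + t) - F t - d * h).
      by rewrite -[_ *: _]/(_ * _); field.
    by rewrite normrM normrV ?unitfE // ler_pdivrMl ?normr_gt0 // [leRHS]mulrC (addrC h); exact: Hr.
  - move=> H e e0; move/cvgrPdist_le : H => /(_ _ e0).
    rewrite /dnbhs /within /= => -[r /= r0 Hr]; exists r => // s sr.
    have [->|s0] := eqVneq s 0; first by rewrite addr0 subrr mulr0 subr0 normr0 mulr0.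
    have := Hr s; rewrite /= sub0r normrN => /(_ sr s0).
    have -> : F (t + s) - F t - d * s = (d - s^-1 *: (F (s + t) - F t)) * - s.
      by rewrite -[_ *: _]/(_ * _) (addrC t); field.
    by move=> H; rewrite normrM normrN ler_wpM2r.
rewrite key; split.
  move=> [H1 <-]; move: H1; rewrite /derive /derivable /=.
  by under eq_fun do rewrite -[_ *: 1]/(_ * 1) mulr1.
move=> H.
have E : (fun h : R => h^-1 *: ((F \o shift t) (h *: (1 : R)) - F t)) =
    fun h => h^-1 *: (F (h + t) - F t).
  by apply/funext => h /=; rewrite -[_ *: 1]/(_ * 1) mulr1.
split; first by rewrite /derivable E; apply/cvg_ex; exists d.
by rewrite /derive E; apply: (cvg_lim (@norm_hausdorff _ _)).
Qed.

Lemma diffw_rderiv (F : R -> R) (t d : R) : rderiv F t d ->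
  diffw reals (fun z => (F (complex.Re z))%:C) t%:C d%:C.
Proof.
move=> H e /H[r r0 Hr]; exists r => // h h0.
have -> : h = (complex.Re h)%:C by exact: complexP.
rewrite cmod_real => /Hr; rewrite cReD.
set u := F _ - _ - _.
have -> // : (F (complex.Re t%:C + complex.Re (complex.Re h)%:C))%:C - (F (complex.Re t%:C))%:C
   - d%:C * (complex.Re h)%:C = u%:C.
  by apply: complexP; rewrite /u ?cReB ?cImB ?cReM ?cImM /=; ring.
by rewrite cmod_real.
Qed.

Lemma rderiv_Re f (t : R) d : diffw reals f t%:C d ->
  rderiv (fun s => complex.Re (f s%:C)) t (complex.Re d).
Proof.
move=> H e /H[r r0 Hr]; exists r => // s sr.
have := Hr s%:C erefl; rewrite cmod_real => /(_ sr); apply: le_trans.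
apply: le_trans (Re_le_cmod _).
by rewrite cReB cReB cReM /= mulr0 subr0 -[t%:C + _]/((t + s) +i* (0 + 0)) addr0.
Qed.

Lemma rderiv_Im f (t : R) d : diffw reals f t%:C d ->
  rderiv (fun s => complex.Im (f s%:C)) t (complex.Im d).
Proof.
move=> H e /H[r r0 Hr]; exists r => // s sr.
have := Hr s%:C erefl; rewrite cmod_real => /(_ sr); apply: le_trans.
apply: le_trans (Im_le_cmod _).
by rewrite cImB cImB cImM /= mulr0 add0r -[t%:C + _]/((t + s) +i* (0 + 0)) addr0.
Qed.

(** Conjugation is not complex differentiable, but a real increment is its own conjugate, so along
    real lines it passes through the expansion. *)
Lemma diffw_conj f (z d : R[i]) : diffw reals f z d -> diffw reals (fun x => (f x)^*) z (d^*).
Proof.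
move=> H e /H[r r0 Hr]; exists r => // h h0 /(Hr h h0).
rewrite -[cmod (_ - _ - d * h)]cmod_conj; congr (cmod _ <= _).
by rewrite !rmorphB rmorphM /=; congr (_ - _ * _); apply: complexP; rewrite ?cRe_conj ?cIm_conj ?h0 ?oppr0.
Qed.

End hol.

(** * Complex powers *)

Section cpow_theory.
Variable R : realType.
Implicit Types (z w u h : R[i]) (r s t x y e : R).

Lemma rderiv_lip (F : R -> R) t d : rderiv F t d -> exists2 r, 0 < r &
  forall s, `|s| < r -> `|F (t + s) - F t| <= (`|d| + 1) * `|s|.
Proof.
move=> /(_ 1 ltr01)[r r0 Hr]; exists r => // s /Hr H.
have -> : F (t + s) - F t = (F (t + s) - F t - d * s) + d * s by rewrite subrK.
by apply: le_trans (ler_normD _ _) _; rewrite normrM mulrDl addrC lerD2l.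
Qed.

Definition cexp z : R[i] :=
  (expR (complex.Re z) * cos (complex.Im z)) +i* (expR (complex.Re z) * sin (complex.Im z)).

Lemma cexpD z w : cexp (z + w) = cexp z * cexp w.
Proof.
by apply: complexP; rewrite ?cReM ?cImM /= cReD cImD expRD ?cosD ?sinD; ring.
Qed.

Lemma cexp0 : cexp 0 = 1.
Proof. by apply: complexP; rewrite /= expR0 ?cos0 ?sin0 mul1r. Qed.

Lemma cmod_cexp z : cmod (cexp z) = expR (complex.Re z).
Proof.
rewrite cmodE /= !exprMn -mulrDr cos2Dsin2 mulr1 sqrtr_sqr ger0_norm //.
Qed.

Lemma cexp_neq0 z : cexp z != 0.
Proof. by rewrite -cmod_gt0 cmod_cexp expR_gt0. Qed.

Lemma cexpN z : cexp (- z) = (cexp z)^-1.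
Proof.
apply: (mulfI (cexp_neq0 z)); rewrite divff ?cexp_neq0 //.
by rewrite -cexpD subrr cexp0.
Qed.

(** The functional equation carries this expansion to every other point; at 0 it is assembled from
    the real derivatives of exp, cos and sin. *)
Lemma hol_cexp0 : hol cexp 0 1.
Proof.
move=> e e0; pose e1 := Num.min 1 (e / 10).
have e10 : 0 < e1 by rewrite lt_min ltr01 divr_gt0.
have e1e : e1 <= e / 10 by rewrite ge_min lexx orbT.
have e11 : e1 <= 1 by rewrite ge_min lexx.
have /rdP/(_ _ e10)[r1 r10 H1] := is_derive_expR (0 : R).
have /rdP/(_ _ e10)[r2 r20 H2] := is_derive_cos (0 : R).
have /rdP/(_ _ e10)[r3 r30 H3] := is_derive_sin (0 : R).
exists (Num.min (Num.min r1 r2) (Num.min r3 (Num.min (1/2) (e / 10)))).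
  by rewrite !lt_min r10 r20 r30 !divr_gt0.
move=> h; rewrite !lt_min => /andP[/andP[h1 h2] /andP[h3 /andP[h4 h5]]].
have hR := Re_le_cmod h; have hI := Im_le_cmod h.
have := H1 _ (le_lt_trans hR h1); have := H2 _ (le_lt_trans hI h2).
have := H3 _ (le_lt_trans hI h3).
rewrite !add0r expR0 cos0 sin0 oppr0 mul0r !subr0 ?addr0 !mul1r => A3 A2 A1.
rewrite cexp0.
set x := complex.Re h in hR A1 *; set y := complex.Im h in hI A2 A3 *.
have E : cexp h - 1 - 1 * h = (expR x - 1 - x)%:C + (expR x)%:C * ((cos y - 1) +i* (sin y - y))
   + (expR x - 1)%:C * (0 +i* y).
  by apply: complexP; rewrite !(cReB,cImB,cReM,cImM,cReD,cImD) /cexp /= -/x -/y; ring.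
rewrite -[X in _ - _ - X]mul1r E.
have h0 := cmod_ge0 h.
have Ex : `|expR x - 1| <= 2 * `|x|.
  have -> : expR x - 1 = (expR x - 1 - x) + x by rewrite subrK.
  apply: le_trans (ler_normD _ _) _; have := normr_ge0 x; nra.
have Ex2 : `|expR x| <= 2.
  have -> : expR x = (expR x - 1) + 1 by rewrite subrK.
  apply: le_trans (ler_normD _ _) _; rewrite normr1; lra.
have B1 : cmod (expR x - 1 - x)%:C <= e1 * cmod h.
  rewrite cmod_real; apply: le_trans A1 _; rewrite ler_wpM2l //; exact: ltW.
have B2 : cmod ((expR x)%:C * ((cos y - 1) +i* (sin y - y))) <= 4 * e1 * cmod h.
  rewrite cmodM cmod_real.
  have -> : 4 * e1 * cmod h = 2 * (e1 * cmod h + e1 * cmod h) by ring.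
  apply: ler_pM => //; first exact: cmod_ge0.
  apply: le_trans (cmod_le_ReIm _) _ => /=; apply: lerD.
    by apply: le_trans A2 _; rewrite ler_wpM2l // ltW.
  by apply: le_trans A3 _; rewrite ler_wpM2l // ltW.
have B3 : cmod ((expR x - 1)%:C * (0 +i* y)) <= e / 5 * cmod h.
  rewrite cmodM cmod_real [X in _ * X]cmodE /= expr0n /= add0r sqrtr_sqr.
  apply: ler_pM => //; lra.
apply: le_trans (cmodD _ _) _; apply: le_trans (lerD (cmodD _ _) (lexx _)) _.
by nra.
Qed.

Lemma hol_cexp z : hol cexp z (cexp z).
Proof.
move=> e e0; have e1 : 0 < e / cmod (cexp z) by rewrite divr_gt0 // cmod_cexp expR_gt0.
have [r r0 Hr] := hol_cexp0 e1; exists r => // h /Hr.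
rewrite add0r cexp0 mul1r => H.
have -> : cexp (z + h) - cexp z - cexp z * h = cexp z * (cexp h - 1 - h) by rewrite cexpD; ring.
rewrite cmodM; apply: le_trans (ler_wpM2l (cmod_ge0 _) H) _.
by rewrite mulrA (mulrC _ (e / _)) divfK // cmod_cexp gt_eqF // expR_gt0.
Qed.

Definition clog u : R[i] := ln (cmod u) +i* carg u.

(** Powers are only taken of 1 - z conj(w) with |z| < 1 and |w| <= 1, which lies in the right
    half-plane. There the argument is an arctangent and the branch cut is never met. *)
Lemma carg_atan u : 0 < complex.Re u -> carg u = atan (complex.Im u / complex.Re u).
Proof.
move=> u0; have key x y : 0 < x -> 0 <= y -> acos (x / cmod (x +i* y)) = atan (y / x).
  move=> x0 y0.
  have E : cmod (x +i* y) = x * Num.sqrt (1 + (y / x) ^+ 2).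
    rewrite cmodE /= -[X in X * _](gtr0_norm x0) -sqrtr_sqr -sqrtrM ?sqr_ge0 //.
    by congr Num.sqrt; field; rewrite gt_eqF.
  have c1 : 0 < Num.sqrt (1 + (y / x) ^+ 2) by rewrite sqrtr_gt0 ltr_pwDl // sqr_ge0.
  have -> : x / cmod (x +i* y) = cos (atan (y / x)).
    by rewrite cos_atan E; field; rewrite !gt_eqF.
  rewrite cosK // in_itv /=.
  have a0 : 0 <= atan (y / x) by rewrite -(@atan0 R) le_atan // divr_ge0 // ltW.
  by rewrite a0 (le_trans (ltW (atan_ltpi2 _))) // ler_pdivrMr // ler_peMr ?pi_ge0 // ler1n.
case: u u0 => x y /= x0; rewrite /carg /=; case: ifPn => y0; first exact: key.
rewrite -(sqrrN y) -[Num.sqrt _]/(cmod (x +i* (- y))) key // ?mulNr ?atanN ?opprK // oppr_ge0 ltW // ltNge //.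
Qed.

Lemma cexp_clog u : 0 < complex.Re u -> cexp (clog u) = u.
Proof.
move=> u0; have c0 : 0 < cmod u by apply: lt_le_trans (Re_le_cmod u); rewrite gtr0_norm.
rewrite /cexp /= lnK ?posrE // carg_atan //.
set q := complex.Im u / complex.Re u.
have c1 : 0 < Num.sqrt (1 + q ^+ 2) by rewrite sqrtr_gt0 ltr_pwDl // sqr_ge0.
have E : cmod u = complex.Re u * Num.sqrt (1 + q ^+ 2).
  rewrite cmodE -[X in X * _](gtr0_norm u0) -sqrtr_sqr -sqrtrM ?sqr_ge0 //.
  by congr Num.sqrt; rewrite /q; field; rewrite gt_eqF.
have S : sin (atan q) = q * cos (atan q).
  have := atanK q; rewrite /tan => {2}<-; rewrite divfK // cos_atan invr_eq0 gt_eqF //.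
apply: complexP; rewrite /= ?S cos_atan E; first by field; rewrite gt_eqF.
by rewrite /q; field; rewrite !gt_eqF.
Qed.

Lemma clog_lip u : 0 < complex.Re u -> exists2 r, 0 < r & exists2 k, 0 < k &
  forall h, cmod h < r -> cmod (clog (u + h) - clog u) <= k * cmod h.
Proof.
move=> u0; have c0 : 0 < cmod u by apply: lt_le_trans (Re_le_cmod u); rewrite gtr0_norm.
have /rdP/rderiv_lip[r1 r10 H1] := is_derive1_ln c0.
have /rdP/rderiv_lip[r2 r20 H2] := is_derive1_atan (complex.Im u / complex.Re u).
set k1 := `|(cmod u)^-1| + 1 in H1; set k2 := `|_| + 1 in H2.
have k10 : 0 < k1 by rewrite /k1 ltr_wpDl.
have k20 : 0 < k2 by rewrite /k2 ltr_wpDl.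
(* A Lipschitz constant of Im / Re near u: for |h| < Re u / 2 the denominator Re (u + h) stays above
   Re u / 2, whence the factor 2. *)
pose k3 := 2 * (complex.Re u + `|complex.Im u|) / complex.Re u ^+ 2.
have k30 : 0 < k3 by rewrite divr_gt0 ?exprn_gt0 // mulr_gt0 // ltr_pwDl.
exists (Num.min (Num.min r1 (r2 / k3)) (complex.Re u / 2)).
  by rewrite !lt_min r10 /= (divr_gt0 r20 k30) divr_gt0.
exists (k1 + k2 * k3); first by rewrite addr_gt0 // mulr_gt0.
move=> h; rewrite !lt_min => /andP[/andP[h1 h2] h3].
have h0 := cmod_ge0 h.
have hR := Re_le_cmod h; have hI := Im_le_cmod h.
have hp : complex.Re u / 2 <= complex.Re (u + h).
  by rewrite cReD; move: hR h3; rewrite ler_norml => /andP[]; lra.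
have hp0 : 0 < complex.Re (u + h) by apply: lt_le_trans hp; rewrite divr_gt0.
set s := complex.Im (u + h) / complex.Re (u + h) - complex.Im u / complex.Re u.
have sE : s = (complex.Im h * complex.Re u - complex.Im u * complex.Re h) /
    (complex.Re (u + h) * complex.Re u).
  rewrite /s; move: hp0; rewrite cReD cImD => hp0; field; rewrite !gt_eqF //.
have sle : `|s| <= k3 * cmod h.
  rewrite sE normrM normfV (gtr0_norm (mulr_gt0 hp0 u0)) ler_pdivrMr ?mulr_gt0 //.
  apply: (@le_trans _ _ ((complex.Re u + `|complex.Im u|) * cmod h)).
    apply: le_trans (ler_normB _ _) _; rewrite !normrM (gtr0_norm u0) mulrDl.
    by apply: lerD; rewrite ?ler_wpM2l // mulrC ler_wpM2l // ltW.
  have -> : k3 * cmod h * (complex.Re (u + h) * complex.Re u) =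
    (complex.Re u + `|complex.Im u|) * cmod h * (complex.Re (u + h) * (2 / complex.Re u)).
    by rewrite /k3; field; rewrite gt_eqF.
  rewrite ler_peMr // ?mulr_ge0 ?addr_ge0 // ?(ltW u0) //.
  by rewrite mulrA ler_pdivlMr // mul1r; lra.
apply: le_trans (cmod_le_ReIm _) _; rewrite cReB cImB /= mulrDl; apply: lerD.
  have -> : cmod (u + h) = cmod u + (cmod (u + h) - cmod u) by rewrite subrKC.
  have hd : `|cmod (u + h) - cmod u| <= cmod h.
    by have := cmod_dist (u + h) u; rewrite (addrC u) addrK.
  apply: le_trans (H1 _ _) _; first exact: le_lt_trans hd h1.
  by rewrite ler_wpM2l // ltW.
rewrite !carg_atan //.
have -> : complex.Im (u + h) / complex.Re (u + h) = complex.Im u / complex.Re u + s.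
  by rewrite /s subrKC.
apply: le_trans (H2 _ _) _.
  by apply: le_lt_trans sle _; rewrite mulrC -ltr_pdivlMr.
by rewrite -mulrA ler_wpM2l // ltW.
Qed.

(** Inverse function argument: with v the increment of [clog], exp v = (u + h) / u, and [clog_lip]
    makes v of order |h|, so the expansion of exp at 0 gives that of the logarithm. *)
Lemma hol_clog u : 0 < complex.Re u -> hol clog u u^-1.
Proof.
move=> u0; have c0 : 0 < cmod u by apply: lt_le_trans (Re_le_cmod u); rewrite gtr0_norm.
have un0 : u != 0 by rewrite -cmod_gt0.
have [r1 r10 [k k0 Hk]] := clog_lip u0.
move=> e e0; have e1 : 0 < e / k by rewrite divr_gt0.
have [r2 r20 H2] := hol_cexp0 e1.
exists (Num.min (Num.min r1 (r2 / k)) (complex.Re u)).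
  by rewrite !lt_min r10 u0 divr_gt0.
move=> h; rewrite !lt_min => /andP[/andP[h1 h2] h3].
have uh : 0 < complex.Re (u + h).
  by rewrite cReD; have := Re_le_cmod h; rewrite ler_norml => /andP[]; lra.
set v := clog (u + h) - clog u.
have vle : cmod v <= k * cmod h by exact: Hk.
have vr : cmod v < r2 by apply: le_lt_trans vle _; rewrite mulrC -ltr_pdivlMr.
have := H2 _ vr; rewrite add0r cexp0 mul1r /v cexpD cexpN !cexp_clog // -/v => H.
have -> : v - u^-1 * h = - ((u + h) / u - 1 - v) by field.
rewrite cmodN; apply: le_trans H _; apply: le_trans (ler_wpM2l (ltW e1) vle) _.
by rewrite mulrA divfK // gt_eqF.
Qed.

Lemma cpowE u s : 0 < complex.Re u -> cpow u s = cexp (s%:C * clog u).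
Proof.
move=> u0; have c0 : 0 < cmod u by apply: lt_le_trans (Re_le_cmod u); rewrite gtr0_norm.
rewrite /cpow /cexp cReM cImM /= !mul0r subr0 addr0 /powR gt_eqF //.
Qed.

Lemma cmod_cpow u s : cmod (cpow u s) = cmod u `^ s.
Proof.
rewrite cmodE /= !exprMn -mulrDr cos2Dsin2 mulr1 sqrtr_sqr ger0_norm //.
exact: powR_ge0.
Qed.

Lemma cpow_neq0 u s : 0 < complex.Re u -> cpow u s != 0.
Proof. by move=> u0; rewrite cpowE // cexp_neq0. Qed.

Lemma hol_ext (f g : R[i] -> R[i]) z d r : 0 < r ->
  (forall h, cmod h < r -> f (z + h) = g (z + h)) -> hol f z d -> hol g z d.
Proof.
move=> r0 H /hol_diffw-/(_ setT) Hf; apply/diffwT.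
apply: (diffw_ext r0 _ _ Hf) => [h _|]; first exact: H.
by have := H 0; rewrite addr0 cmod0; apply.
Qed.

Lemma hol_cpow u s : 0 < complex.Re u -> hol (fun u => cpow u s) u (s%:C * cpow u s / u).
Proof.
move=> u0; have H := hol_comp (holZ s%:C (hol_clog u0)) (hol_cexp (s%:C * clog u)).
rewrite cpowE //; have -> : s%:C * cexp (s%:C * clog u) / u = cexp (s%:C * clog u) * (s%:C / u).
  by rewrite mulrAC mulrC.
apply: hol_ext u0 _ H => h hu /=; rewrite cpowE // cReD.
by have := Re_le_cmod h; rewrite ler_norml => /andP[]; lra.
Qed.

Lemma cpowD u s t : 0 < complex.Re u -> cpow u (s + t) = cpow u s * cpow u t.
Proof.
move=> u0; rewrite !cpowE //; move: (clog u) => L.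
have -> : (s + t)%:C * L = s%:C * L + t%:C * L.
  by apply: complexP; rewrite !(cReD,cImD,cReM,cImM) /=; ring.
exact: cexpD.
Qed.

Lemma cpow1 u : 0 < complex.Re u -> cpow u 1 = u.
Proof. by move=> u0; rewrite cpowE // mul1r cexp_clog. Qed.

Lemma conj_cpow u s : 0 < complex.Re u -> (cpow u s)^* = cpow (u^*) s.
Proof.
move=> u0; rewrite /cpow cmod_conj !carg_atan ?cRe_conj // cIm_conj mulNr atanN mulrN cosN sinN.
by apply: complexP; rewrite ?cRe_conj ?cIm_conj /= ?mulrN.
Qed.

(** The Bergman-type kernel (1 - z conj(w))^(-s), holomorphic in z and antiholomorphic in w. *)
Definition Bk s z w : R[i] := (cpow (1 - z * w^*) s)^-1.

Lemma Re_1zw z w : cmod z < 1 -> cmod w <= 1 -> 1 - cmod z <= complex.Re (1 - z * w^*).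
Proof.
move=> z1 w1; rewrite cReB /= lerD2l lerN2; apply: le_trans (ler_norm _) _.
apply: le_trans (Re_le_cmod _) _; rewrite cmodM cmod_conj ler_piMr //; exact: cmod_ge0.
Qed.

Lemma Re_1zw_gt0 z w : cmod z < 1 -> cmod w <= 1 -> 0 < complex.Re (1 - z * w^*).
Proof. by move=> z1 w1; apply: lt_le_trans (Re_1zw z1 w1); rewrite subr_gt0. Qed.

Lemma cmod_1zw z w : cmod z < 1 -> cmod w <= 1 -> 1 - cmod z <= cmod (1 - z * w^*).
Proof.
move=> z1 w1; apply: le_trans (Re_1zw z1 w1) _; apply: le_trans (ler_norm _) _.
exact: Re_le_cmod.
Qed.

Lemma cmod_1zw_gt0 z w : cmod z < 1 -> cmod w <= 1 -> 0 < cmod (1 - z * w^*).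
Proof. by move=> z1 w1; apply: lt_le_trans (cmod_1zw z1 w1); rewrite subr_gt0. Qed.

Lemma cmod_Bk s z w : cmod (Bk s z w) = cmod (1 - z * w^*) `^ (- s).
Proof. by rewrite cmodV cmod_cpow powRN. Qed.

Lemma cmod_Bk_le s z w : 0 <= s -> cmod z < 1 -> cmod w <= 1 ->
  cmod (Bk s z w) <= (1 - cmod z) `^ (- s).
Proof.
move=> s0 z1 w1; rewrite cmodV cmod_cpow powRN lef_pV2 ?posrE ?powR_gt0 ?subr_gt0 //.
  by rewrite ge0_ler_powR ?nnegrE ?cmod_ge0 ?cmod_1zw // subr_ge0 ltW.
exact: cmod_1zw_gt0.
Qed.

Lemma BkS s z w : cmod z < 1 -> cmod w <= 1 -> Bk (s + 1) z w = Bk s z w / (1 - z * w^*).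
Proof.
by move=> z1 w1; rewrite /Bk cpowD ?cpow1 ?Re_1zw_gt0 // invfM.
Qed.

Lemma hol_Bk s z w : cmod z < 1 -> cmod w <= 1 ->
  hol (fun z => Bk s z w) z (s%:C * w^* * Bk (s + 1) z w).
Proof.
move=> z1 w1; have p0 := Re_1zw_gt0 z1 w1.
have n0 : 1 - z * w^* != 0 by rewrite -cmod_gt0 cmod_1zw_gt0.
have c0 := cpow_neq0 s p0.
have H0 : hol (fun z => 1 - z * w^*) z (- w^*).
  have := holB (hol_cst 1 z) (holM (hol_id z) (hol_cst (w^*) z)).
  by rewrite mul1r mulr0 addr0 sub0r.
have := hol_comp H0 (hol_comp (hol_cpow s p0) (hol_inv c0)).
rewrite BkS // /Bk.
set d := _ * - w^*; set d' := _ * _ * _ => H; have <- // : d = d'.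
by rewrite /d /d'; field; rewrite c0 n0.
Qed.

Lemma conj_Bk s z w : cmod z < 1 -> cmod w <= 1 -> (Bk s z w)^* = Bk s (z^*) (w^*).
Proof.
move=> z1 w1; rewrite /Bk fmorphV /= conj_cpow ?Re_1zw_gt0 //.
by rewrite rmorphB rmorph1 rmorphM.
Qed.

(** Conjugation exchanges the two variables, so regularity in w is read off from holomorphy in the
    first variable. *)
Lemma BkC s z w : cmod z < 1 -> cmod w <= 1 -> (Bk s z w)^* = Bk s w z.
Proof.
move=> z1 w1; rewrite conj_Bk //; rewrite /Bk; congr (cpow (1 - _) _)^-1.
by rewrite mulrC; congr (_ * _); exact: conjCK.
Qed.

End cpow_theory.

(** * Integration along segments and Goursat's theorem *)

Section cintegral_theory.
Variables (R : realType) (d : measure_display) (T : measurableType d).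
Variables (mu : {measure set T -> \bar R}) (D : set T) (mD : measurable D).
Implicit Types (F G : T -> R[i]) (g : T -> R) (c : R[i]).

Definition cintegrable F :=
  mu.-integrable D (fun x => (complex.Re (F x))%:E) /\
  mu.-integrable D (fun x => (complex.Im (F x))%:E).

Lemma eq_cintegral F G : (forall x, D x -> F x = G x) ->
  cintegral mu D F = cintegral mu D G.
Proof.
move=> FG; rewrite /cintegral; congr (_ +i* _); apply: eq_Rintegral => x /set_mem Dx;
  by rewrite FG.
Qed.

Lemma eq_cintegrable F G : (forall x, D x -> F x = G x) ->
  cintegrable F -> cintegrable G.
Proof.
move=> FG [H1 H2]; split; [apply: eq_integrable H1|apply: eq_integrable H2] => // x /set_mem Dx;
  by rewrite FG.
Qed.

Lemma cintegrableD F G : cintegrable F -> cintegrable G -> cintegrable (fun x => F x + G x).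
Proof.
move=> [F1 F2] [G1 G2]; split.
  by under eq_fun do rewrite cReD EFinD; exact: integrableD.
by under eq_fun do rewrite cImD EFinD; exact: integrableD.
Qed.

Lemma cintegralD F G : cintegrable F -> cintegrable G ->
  cintegral mu D (fun x => F x + G x) = cintegral mu D F + cintegral mu D G.
Proof.
move=> [F1 F2] [G1 G2]; apply: complexP; rewrite ?cReD ?cImD /=.
  by under eq_Rintegral do rewrite cReD; rewrite RintegralD.
by under eq_Rintegral do rewrite cImD; rewrite RintegralD.
Qed.

Lemma integrableZlr (f : T -> R) r : mu.-integrable D (fun x => (f x)%:E) ->
  mu.-integrable D (fun x => (r * f x)%:E).
Proof. by move=> /(integrableZl mD r); apply: eq_integrable => // x _. Qed.

Lemma cintegrableZ c F : cintegrable F -> cintegrable (fun x => c * F x).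
Proof.
move=> [F1 F2]; split.
  under eq_fun do rewrite cReM EFinB; apply: integrableB => //; exact: integrableZlr.
under eq_fun do rewrite cImM EFinD; apply: integrableD => //; exact: integrableZlr.
Qed.

Lemma cintegralZ c F : cintegrable F ->
  cintegral mu D (fun x => c * F x) = c * cintegral mu D F.
Proof.
move=> [F1 F2]; apply: complexP; rewrite ?cReM ?cImM /=.
  under eq_Rintegral do rewrite cReM.
  by rewrite RintegralB ?RintegralZl //; exact: integrableZlr.
under eq_Rintegral do rewrite cImM.
by rewrite RintegralD ?RintegralZl //; exact: integrableZlr.
Qed.

Lemma cintegrableN F : cintegrable F -> cintegrable (fun x => - F x).
Proof.
by move=> /(cintegrableZ (-1)); apply: eq_cintegrable => x _; rewrite mulN1r.
Qed.

Lemma cintegrableB F G : cintegrable F -> cintegrable G -> cintegrable (fun x => F x - G x).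
Proof. by move=> HF /cintegrableN; exact: cintegrableD. Qed.

Lemma cintegralB F G : cintegrable F -> cintegrable G ->
  cintegral mu D (fun x => F x - G x) = cintegral mu D F - cintegral mu D G.
Proof.
move=> HF HG; rewrite cintegralD //; last exact: cintegrableN.
congr (_ + _); rewrite -[RHS]mulN1r -cintegralZ //; apply: eq_cintegral => x _.
by rewrite mulN1r.
Qed.

Lemma cintegral_conj F : cintegrable F ->
  cintegral mu D (fun x => (F x)^*) = (cintegral mu D F)^*.
Proof.
move=> [F1 F2]; apply: complexP; rewrite ?cRe_conj ?cIm_conj /=.
  by apply: eq_Rintegral => x _; rewrite cRe_conj.
rewrite -[RHS]mulN1r -RintegralZl //; apply: eq_Rintegral => x _.
by rewrite cIm_conj mulN1r.
Qed.

(** Real and imaginary parts are bounded separately, which costs a factor 2 and spares a rotation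
    argument; absolute constants are immaterial here. *)
Lemma cmod_cintegral F g : cintegrable F -> mu.-integrable D (EFin \o g) ->
  (forall x, D x -> cmod (F x) <= g x) ->
  cmod (cintegral mu D F) <= 2 * Rintegral mu D g.
Proof.
move=> [F1 F2] ig Fg; apply: le_trans (cmod_le_ReIm _) _; rewrite mulr2n mulrDl mul1r.
apply: lerD => /=; (apply: le_trans (le_normr_Rintegral _ _) _ => //;
  apply: le_Rintegral => //; first exact: integrable_norm) => x Dx;
  apply: le_trans (Fg x Dx); [exact: Re_le_cmod|exact: Im_le_cmod].
Qed.

Lemma bounded_integrable (g : T -> R) k : (mu D < +oo)%E -> measurable_fun D g ->
  (forall x, D x -> `|g x| <= k) -> mu.-integrable D (fun x => (g x)%:E).
Proof.
move=> fD mg gk; apply: measurable_bounded_integrable => //.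
exists k; split; first exact: num_real.
by move=> r kr x Dx; apply: le_trans (gk x Dx) (ltW kr).
Qed.

Lemma bounded_cintegrable F k : (mu D < +oo)%E ->
  measurable_fun D (fun x => complex.Re (F x)) -> measurable_fun D (fun x => complex.Im (F x)) ->
  (forall x, D x -> cmod (F x) <= k) -> cintegrable F.
Proof.
move=> fD m1 m2 Fk; split; apply: (@bounded_integrable _ k) => // x Dx;
  apply: le_trans (Fk x Dx); [exact: Re_le_cmod|exact: Im_le_cmod].
Qed.

Lemma cmod_cintegral_bounded F k : (mu D < +oo)%E -> cintegrable F ->
  (forall x, D x -> cmod (F x) <= k) ->
  cmod (cintegral mu D F) <= 2 * (k * fine (mu D)).
Proof.
move=> fD iF Fk; rewrite -(Rintegral_cst mu mD).
apply: cmod_cintegral => //; apply: (@bounded_integrable _ `|k|) => //.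
Qed.

Lemma cintegral_cst c : cintegral mu D (fun=> c) = c * (fine (mu D))%:C.
Proof.
by apply: complexP; rewrite ?cReM ?cImM /= !Rintegral_cst ?mulr0 ?subr0 ?add0r.
Qed.

End cintegral_theory.

(** * Integrals over the unit interval: bisection and reflection *)

Section unit_interval.
Variable R : realType.
Local Notation lam := (@lebesgue_measure R).
Implicit Types (G : R -> R).

Definition R01 G := Rintegral lam `[0, 1] G.

Definition cont01 G := forall t : R, 0 <= t <= 1 -> {for t, continuous G}.

Lemma cont01_within G a b : 0 <= a -> b <= 1 -> cont01 G -> {within `[a, b], continuous G}.
Proof.
move=> a0 b1 H; apply: continuous_in_subspaceT => t; rewrite inE /= in_itv /= => /andP[at_ tb].
by apply: H; rewrite (le_trans a0) // (le_trans tb).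
Qed.

Lemma cont01_integrable G : cont01 G -> lam.-integrable `[0, 1] (fun t => (G t)%:E).
Proof.
move=> cG; apply: continuous_compact_integrable; first exact: segment_compact.
exact: cont01_within.
Qed.

Lemma affine_subst G (a b : R) : 0 < b -> {within `[a, a + b], continuous G} ->
  (\int[lam]_(x in `[a, (a + b)%R]) (G x)%:E = \int[lam]_(x in `[0%R, 1%R]) (G (a + b * x) * b)%:E)%E.
Proof.
move=> b0 cG.
have Fd (x : R) : is_derive x 1 (fun x : R => a + b * x) b.
  apply/rdP => e e0; exists 1 => // s _.
  have -> : a + b * (x + s) - (a + b * x) - b * s = 0 by ring.
  by rewrite normr0 mulr_ge0 // ltW.
have F'E : derive1 (fun x : R => a + b * x) = fun=> b.
  by apply/funext => x; rewrite derive1E; have [_] := Fd x.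
have Fc x : {for x, continuous (fun x : R => a + b * x)}.
  by apply/differentiable_continuous/derivable1_diffP; have [] := Fd x.
have := @integration_by_substitution_increasing R (fun x => a + b * x) G 0 1 ler01.
rewrite F'E mulr0 addr0 mulr1 => -> //.
- by move=> x y _ _ xy; rewrite ltrD2l ltr_pM2l.
- by move=> x _; exact: cvg_cst.
- exact: is_cvg_cst.
- exact: is_cvg_cst.
- split.
  + by move=> x _; have [] := Fd x.
  + apply: cvg_at_right_filter; exact: Fc.
  + apply: cvg_at_left_filter; exact: Fc.
Qed.

Lemma cont01_comp G (a b : R) : 0 <= a -> 0 <= b -> a + b <= 1 -> cont01 G ->
  cont01 (fun t => G (a + b * t)).
Proof.
move=> a0 b0 ab cG t /andP[t0 t1]; apply: (@continuous_comp _ _ _ (fun t : R => a + b * t) G).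
  apply: continuousD; first exact: cvg_cst.
  by apply: continuousM; [exact: cvg_cst|exact: cvg_id].
by apply: cG; nra.
Qed.

Lemma R01_split G : cont01 G ->
  R01 G = (R01 (fun t => G (t / 2)) + R01 (fun t => G (2^-1 + t / 2))) / 2.
Proof.
move=> cG; rewrite /R01.
have iG := cont01_integrable cG.
have h1 : (2^-1 : R) <= 1 by lra.
have h2 : (2^-1 + 2^-1 : R) = 1 by lra.
have := @Rintegral_itvB R G (BLeft 0) (BRight 1) 2^-1 iG.
rewrite !bnd_simp invr_ge0 ler0n h1 => /(_ isT isT).
rewrite Rintegral_itv_obnd_cbnd; last first.
  apply: (integrableS _ _ _ iG) => // x /=; rewrite !in_itv /= => /andP[x0 ->].
  by rewrite (le_trans _ (ltW x0)) // invr_ge0 ler0n.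
move=> /eqP; rewrite subr_eq => /eqP ->.
have c2 : {within `[0, 0 + 2^-1], continuous G} by apply: cont01_within; rewrite ?add0r.
have c3 : {within `[2^-1, 2^-1 + 2^-1], continuous G}.
  by apply: cont01_within; rewrite ?invr_ge0 ?ler0n // h2.
have p2 : 0 < (2^-1 : R) by rewrite invr_gt0 ltr0n.
have := affine_subst p2 c2; have := affine_subst p2 c3.
rewrite add0r h2 => E1 E2.
rewrite [X in X + _]/Rintegral [X in _ + X]/Rintegral E1 E2 mulrDl addrC; congr (_ + _).
  rewrite -/(Rintegral lam `[0, 1] (fun x => G (0 + 2^-1 * x) * 2^-1)).
  rewrite RintegralZr //.
    by congr (_ * _); apply: eq_Rintegral => x _; rewrite add0r mulrC.
  by apply: cont01_integrable; apply: cont01_comp; rewrite ?add0r ?lexx // ltW.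
rewrite -/(Rintegral lam `[0, 1] (fun x => G (2^-1 + 2^-1 * x) * 2^-1)).
rewrite RintegralZr //.
  by congr (_ * _); apply: eq_Rintegral => x _; rewrite (mulrC x).
by apply: cont01_integrable; apply: cont01_comp; rewrite ?h2 // ltW.
Qed.

Lemma R01_onem G : cont01 G -> R01 G = R01 (fun t => G (1 - t)).
Proof.
move=> cG; rewrite /R01 Rintegration_by_substitution_onem ?lexx ?ler01 //.
  by rewrite unstable.onem1.
exact: cont01_within.
Qed.

End unit_interval.

(** * Segment integrals, Goursat's theorem and primitives *)

Section segments.
Variable R : realType.
Local Notation lam := (@lebesgue_measure R).
Implicit Types (f g : R[i] -> R[i]) (a b c z w h : R[i]).

Definition ccont f z := forall e : R, 0 < e -> exists2 r, 0 < r &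
  forall h, cmod h < r -> cmod (f (z + h) - f z) <= e.

Lemma hol_ccont f z d : hol f z d -> ccont f z.
Proof. exact: hol_cont. Qed.

Lemma disc_convex a b (t r : R) : cmod a <= r -> cmod b <= r -> 0 <= t <= 1 ->
  cmod (a + t%:C * (b - a)) <= r.
Proof.
move=> a1 b1 /andP[t0 t1].
have -> : a + t%:C * (b - a) = (1 - t)%:C * a + t%:C * b.
  by apply: complexP; rewrite !(cReD,cImD,cReM,cImM,cReB,cImB) /=; ring.
apply: le_trans (cmodD _ _) _; rewrite !cmodM !cmod_real (ger0_norm t0) ger0_norm ?subr_ge0 //.
nra.
Qed.

Lemma disc_convex1 a b (t : R) : cmod a < 1 -> cmod b < 1 -> 0 <= t <= 1 ->
  cmod (a + t%:C * (b - a)) < 1.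
Proof.
move=> a1 b1 t01; apply: (@le_lt_trans _ _ (Num.max (cmod a) (cmod b))).
  by apply: disc_convex; rewrite // le_max lexx ?orbT.
by rewrite gt_max a1.
Qed.

Lemma ccont_Re f a b t : ccont f (a + t%:C * b) ->
  {for t, continuous (fun t : R => complex.Re (f (a + t%:C * b)))}.
Proof.
move=> H; apply/cvgrPdist_le => e /H[r r0 Hr].
have k0 : 0 < cmod b + 1 by rewrite ltr_wpDl // cmod_ge0.
apply/nbhs_ballP; exists (r / (cmod b + 1)); first exact: divr_gt0.
move=> s /= ts; rewrite distrC -cReB; apply: le_trans (Re_le_cmod _) _.
have -> : a + s%:C * b = (a + t%:C * b) + (s - t)%:C * b.
  by apply: complexP; rewrite !(cReD,cImD,cReM,cImM) /=; ring.
apply: Hr; rewrite cmodM cmod_real; apply: (@le_lt_trans _ _ (`|s - t| * (cmod b + 1))).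
  by rewrite ler_wpM2l // lerDl.
by rewrite -ltr_pdivlMr // distrC.
Qed.

Lemma ccont_Im f a b t : ccont f (a + t%:C * b) ->
  {for t, continuous (fun t : R => complex.Im (f (a + t%:C * b)))}.
Proof.
move=> H.
have H' : ccont (fun z => - 'i * f z) (a + t%:C * b).
  move=> e /H[r r0 Hr]; exists r => // h /Hr; congr (_ <= _).
  rewrite -mulrBr cmodM cmodN [X in _ = X * _]cmodE /= expr0n expr1n add0r sqrtr1 mul1r //.
have := ccont_Re H'.
have -> // : (fun t : R => complex.Re (- 'i * f (a + t%:C * b))) =
  (fun t : R => complex.Im (f (a + t%:C * b))).
by apply/funext => s; rewrite cReM cReN cImN /=; ring.
Qed.

Definition C01 (F : R -> R[i]) := cintegral lam `[0, 1] F.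

Definition seg f a b := C01 (fun t => (b - a) * f (a + t%:C * (b - a))).

Definition cont_disc f := forall z, cmod z < 1 -> ccont f z.

Lemma cont01_ReIm f a b : cont_disc f -> cmod a < 1 -> cmod b < 1 ->
  cont01 (fun t => complex.Re (f (a + t%:C * (b - a)))) /\
  cont01 (fun t => complex.Im (f (a + t%:C * (b - a)))).
Proof.
move=> cf a1 b1; split => t t01; [apply: ccont_Re|apply: ccont_Im];
  by apply: cf; exact: disc_convex1.
Qed.

Lemma seg_integrable f a b : cont_disc f -> cmod a < 1 -> cmod b < 1 ->
  cintegrable lam `[0, 1] (fun t => f (a + t%:C * (b - a))).
Proof. by move=> cf a1 b1; have [] := cont01_ReIm cf a1 b1; split; exact: cont01_integrable. Qed.

Lemma segE f a b : cont_disc f -> cmod a < 1 -> cmod b < 1 ->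
  seg f a b = (b - a) * C01 (fun t => f (a + t%:C * (b - a))).
Proof. by move=> cf a1 b1; rewrite /seg /C01 cintegralZ //; exact: seg_integrable. Qed.

Lemma half_disc a b : cmod a < 1 -> cmod b < 1 -> cmod ((a + b) / 2) < 1.
Proof.
move=> a1 b1; have -> : (a + b) / 2 = a + (2^-1)%:C * (b - a).
  have -> : (2^-1)%:C = (2 : R[i])^-1 by rewrite fmorphV /= rmorph_nat.
  by field.
by apply: disc_convex1 => //; lra.
Qed.

Lemma seg_split f a b : cont_disc f -> cmod a < 1 -> cmod b < 1 ->
  seg f a b = seg f a ((a + b) / 2) + seg f ((a + b) / 2) b.
Proof.
move=> cf a1 b1; have m1 := half_disc a1 b1.
rewrite !segE //.
have [cR cI] := cont01_ReIm cf a1 b1.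
have half2 : (2^-1)%:C = (2 : R[i])^-1 by rewrite fmorphV /= rmorph_nat.
have E1 (t : R) : a + t%:C * ((a + b) / 2 - a) = a + (t / 2)%:C * (b - a).
  rewrite [(t / 2)%:C]rmorphM /= half2; by field.
have E2 (t : R) : (a + b) / 2 + t%:C * (b - (a + b) / 2) = a + (2^-1 + t / 2)%:C * (b - a).
  rewrite rmorphD rmorphM /= half2; by field.
have -> : C01 (fun t => f (a + t%:C * (b - a))) =
   (C01 (fun t => f (a + (t / 2)%:C * (b - a))) +
    C01 (fun t => f (a + (2^-1 + t / 2)%:C * (b - a)))) / 2.
  have Ep := R01_split cR; have Eq := R01_split cI.
  rewrite -half2; apply: complexP; rewrite !(cReM,cImM,cReD,cImD) /= mulr0 ?subr0 ?add0r.
    exact: Ep.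
  exact: Eq.
under [in RHS]eq_fun do rewrite E1.
under [X in _ = _ + _ * C01 X]eq_fun do rewrite E2.
by field.
Qed.

Lemma seg_rev f a b : cont_disc f -> cmod a < 1 -> cmod b < 1 -> seg f b a = - seg f a b.
Proof.
move=> cf a1 b1; rewrite !segE // -mulNr opprB; congr (_ * _).
have [cR cI] := cont01_ReIm cf a1 b1.
have E (t : R) : b + t%:C * (a - b) = a + (1 - t)%:C * (b - a).
  by rewrite rmorphB rmorph1; ring.
under eq_fun do rewrite E.
by apply: complexP; [exact/esym/(R01_onem cR)|exact/esym/(R01_onem cI)].
Qed.

Lemma lam01 : lam `[0, 1]%classic = 1%E.
Proof. by rewrite lebesgue_measure_itv /= lte_fin ltr01 oppr0 adde0. Qed.

Lemma seg_bound f a b k : cont_disc f -> cmod a < 1 -> cmod b < 1 ->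
  (forall t, 0 <= t <= 1 -> cmod (f (a + t%:C * (b - a))) <= k) ->
  cmod (seg f a b) <= 2 * k * cmod (b - a).
Proof.
move=> cf a1 b1 H; rewrite segE // cmodM mulrC ler_wpM2r ?cmod_ge0 //.
have := @cmod_cintegral_bounded R _ _ lam `[0, 1] (measurable_itv _)
  (fun t => f (a + t%:C * (b - a))) k.
set m := fine _; have -> : m = 1 by exact: (congr1 fine lam01).
rewrite mulr1; apply => //; last exact: seg_integrable.
by rewrite [X in (X < _)%E]lam01 ltry.
Qed.

Lemma C01_cst c : C01 (fun=> c) = c.
Proof. rewrite /C01 cintegral_cst //; set m := fine _.
by have -> : m = 1 by [exact: (congr1 fine lam01)]; rewrite mulr1. Qed.

(** The reflection t -> 1 - t shows that the integral x satisfies x = 1 - x. *)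
Lemma C01_id : C01 (fun t => t%:C) = 2^-1.
Proof.
have H : cont01 (@id R) by move=> t _; exact: cvg_id.
have := R01_onem H; rewrite /R01 RintegralB //; last 2 first.
  apply: (@cont01_integrable R (fun=> 1)) => t _; exact: cvg_cst.
  exact: cont01_integrable.
rewrite Rintegral_cst //; set m := fine _.
have -> : m = 1 by exact: (congr1 fine lam01).
rewrite mulr1 => /eqP; rewrite -subr_eq0 => /eqP E.
have -> : (2 : R[i])^-1 = (2^-1)%:C by rewrite fmorphV /= rmorph_nat.
apply: complexP => /=; last by rewrite Rintegral_cst // mul0r.
by move: E; set x := Rintegral _ _ _ => ?; lra.
Qed.

Lemma ccont_affine A B z : ccont (fun w => A + B * w) z.
Proof.
by apply: hol_ccont (holD (hol_cst A z) (holM (hol_cst B z) (hol_id z))).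
Qed.

(** The right-hand side is the increment of a quadratic antiderivative, written with the midpoint.
    Around a triangle these increments cancel. *)
Lemma seg_affine A B a b : cmod a < 1 -> cmod b < 1 ->
  seg (fun w => A + B * w) a b = (b - a) * (A + B * ((a + b) / 2)).
Proof.
move=> a1 b1; rewrite segE //; last by move=> z _; exact: ccont_affine.
congr (_ * _).
have -> : C01 (fun t => A + B * (a + t%:C * (b - a))) =
   C01 (fun t => (A + B * a) + (B * (b - a)) * t%:C).
  by congr C01; apply/funext => t; ring.
have it : cintegrable lam `[0, 1] (fun t => t%:C).
  split; apply: cont01_integrable => t _ /=; [exact: cvg_id|exact: cvg_cst].
have ic : cintegrable lam `[0, 1] (fun t : R => A + B * a).
  split; apply: cont01_integrable => t _ /=; exact: cvg_cst.
rewrite /C01 cintegralD //; last exact: cintegrableZ.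
by rewrite cintegralZ // -!/(C01 _) C01_cst C01_id; field.
Qed.

Lemma ccontB f g z : ccont f z -> ccont g z -> ccont (fun w => f w - g w) z.
Proof.
move=> Hf Hg e e0; have e2 : 0 < e / 2 by rewrite divr_gt0.
have [r r0 Hr] := Hf _ e2; have [s s0 Hs] := Hg _ e2.
exists (Num.min r s); first by rewrite lt_min r0.
move=> h; rewrite lt_min => /andP[/Hr h1 /Hs h2].
have -> : f (z + h) - g (z + h) - (f z - g z) = (f (z + h) - f z) - (g (z + h) - g z) by ring.
by apply: le_trans (cmodB _ _) _; rewrite [e]splitr lerD.
Qed.

Lemma segB f g a b : cont_disc f -> cont_disc g -> cmod a < 1 -> cmod b < 1 ->
  seg (fun w => f w - g w) a b = seg f a b - seg g a b.
Proof.
move=> cf cg a1 b1; rewrite !segE //; last by move=> z z1; apply: ccontB; [exact: cf|exact: cg].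
by rewrite -mulrBr /C01 cintegralB //; exact: seg_integrable.
Qed.

Definition tri f (T : R[i] * R[i] * R[i]) :=
  seg f T.1.1 T.1.2 + seg f T.1.2 T.2 + seg f T.2 T.1.1.

Definition subtri1 (T : R[i] * R[i] * R[i]) := let: (a, b, c) := T in
  (a, (a + b) / 2, (c + a) / 2).
Definition subtri2 (T : R[i] * R[i] * R[i]) := let: (a, b, c) := T in
  ((a + b) / 2, b, (b + c) / 2).
Definition subtri3 (T : R[i] * R[i] * R[i]) := let: (a, b, c) := T in
  ((c + a) / 2, (b + c) / 2, c).
Definition subtri4 (T : R[i] * R[i] * R[i]) := let: (a, b, c) := T in
  ((a + b) / 2, (b + c) / 2, (c + a) / 2).

Definition tri_in_disc (r : R) (T : R[i] * R[i] * R[i]) :=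
  [/\ cmod T.1.1 <= r, cmod T.1.2 <= r & cmod T.2 <= r].

Definition perimeter (T : R[i] * R[i] * R[i]) :=
  cmod (T.1.2 - T.1.1) + cmod (T.2 - T.1.2) + cmod (T.1.1 - T.2).

(** Every side of the medial triangle is run through once in each direction and drops out; the
    remaining half-edges recombine into the edges of T. *)
Lemma tri_split f T r : r < 1 -> tri_in_disc r T -> cont_disc f ->
  tri f T = tri f (subtri1 T) + tri f (subtri2 T) + tri f (subtri3 T) + tri f (subtri4 T).
Proof.
case: T => [[a b] c] r1 [/= a1 b1 c1] cf; rewrite /tri /=.
have {}a1 := le_lt_trans a1 r1; have {}b1 := le_lt_trans b1 r1; have {}c1 := le_lt_trans c1 r1.
have ab := half_disc a1 b1; have bc := half_disc b1 c1; have ca := half_disc c1 a1.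
rewrite (seg_split cf a1 b1) (seg_split cf b1 c1) (seg_split cf c1 a1).
rewrite (seg_rev cf ab bc) (seg_rev cf bc ca) (seg_rev cf ca ab).
ring.
Qed.

Definition goursat_step f T :=
  if cmod (tri f T) <= 4 * cmod (tri f (subtri1 T)) then subtri1 T else
  if cmod (tri f T) <= 4 * cmod (tri f (subtri2 T)) then subtri2 T else
  if cmod (tri f T) <= 4 * cmod (tri f (subtri3 T)) then subtri3 T else subtri4 T.

Lemma four_lt_absurd (x y1 y2 y3 y4 z2 z3 : R) :
  4 * y1 < x -> 4 * y2 < x -> 4 * y3 < x -> 4 * y4 < x ->
  z2 <= y1 + y2 -> z3 <= z2 + y3 -> x <= z3 + y4 -> False.
Proof. lra. Qed.

(** Pigeonhole: if each of the four subtriangles carried less than a quarter of the integral, the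
    triangle inequality applied to [tri_split] would fail. *)
Lemma goursat_step_tri f T r : r < 1 -> tri_in_disc r T -> cont_disc f ->
  cmod (tri f T) <= 4 * cmod (tri f (goursat_step f T)).
Proof.
move=> r1 iT cf; rewrite /goursat_step; case: ifPn => // /negbTE h1; case: ifPn => // h2.
case: ifPn => // h3; rewrite leNgt; apply/negP => h4.
move: h1 => /negbT; rewrite -ltNge => h1; move: h2 h3; rewrite -!ltNge => h2 h3.
have := cmodD (tri f (subtri1 T) + tri f (subtri2 T) + tri f (subtri3 T)) (tri f (subtri4 T)).
have := cmodD (tri f (subtri1 T) + tri f (subtri2 T)) (tri f (subtri3 T)).
have := cmodD (tri f (subtri1 T)) (tri f (subtri2 T)).
rewrite -(tri_split r1 iT cf) => k1 k2 k3.
exact: four_lt_absurd h1 h2 h3 h4 k1 k2 k3.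
Qed.

Lemma goursat_step_ind (P : R[i] * R[i] * R[i] -> Prop) f T :
  P (subtri1 T) -> P (subtri2 T) -> P (subtri3 T) -> P (subtri4 T) -> P (goursat_step f T).
Proof. by move=> *; rewrite /goursat_step; do !case: ifP. Qed.

Lemma half_le a b r : cmod a <= r -> cmod b <= r -> cmod ((a + b) / 2) <= r.
Proof.
move=> a1 b1; have -> : (a + b) / 2 = a + (2^-1)%:C * (b - a).
  have -> : (2^-1)%:C = (2 : R[i])^-1 by rewrite fmorphV /= rmorph_nat.
  by field.
by apply: disc_convex => //; lra.
Qed.

Lemma goursat_step_tri_in_disc f T r : tri_in_disc r T -> tri_in_disc r (goursat_step f T).
Proof.
case: T => [[a b] c] [/= a1 b1 c1].
by apply: goursat_step_ind; split => //=; exact: half_le.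
Qed.

Lemma cmod_half z : cmod (z / 2) = cmod z / 2.
Proof.
have -> : z / 2 = z * (2^-1)%:C by rewrite fmorphV /= rmorph_nat.
by rewrite cmodM cmod_real ger0_norm // invr_ge0 ler0n.
Qed.

Lemma goursat_step_perimeter f T : perimeter (goursat_step f T) = perimeter T / 2.
Proof.
case: T => [[a b] c]; rewrite /perimeter [X in X / 2]/= !mulrDl -!cmod_half.
have E (x y z x' y' z' : R[i]) : x = x' -> y = y' -> z = z' ->
  cmod x + cmod y + cmod z = cmod x' + cmod y' + cmod z' by move=> -> -> ->.
have F (x y z x' y' z' : R[i]) : x = - x' -> y = - y' -> z = - z' ->
  cmod x + cmod y + cmod z = cmod x' + cmod y' + cmod z' by move=> -> -> ->; rewrite !cmodN.
rewrite /goursat_step; case: ifP => _; [|case: ifP => _; [|case: ifP => _]] => /=.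
- by apply E; field.
- by apply E; field.
- by apply E; field.
- rewrite [RHS]addrC [RHS]addrA; by apply F; field.
Qed.

Lemma goursat_step_fst f T : cmod ((goursat_step f T).1.1 - T.1.1) <= perimeter T / 2.
Proof.
case: T => [[a b] c]; rewrite /perimeter /=.
have h1 := cmod_ge0 (b - a); have h2 := cmod_ge0 (c - b); have h3 := cmod_ge0 (a - c).
have E1 : cmod ((a + b) / 2 - a) = cmod (b - a) / 2.
  by rewrite -cmod_half; congr cmod; field.
have E2 : cmod ((c + a) / 2 - a) = cmod (a - c) / 2.
  by rewrite -cmod_half -cmodN; congr cmod; field.
rewrite /goursat_step; case: ifP => _; [|case: ifP => _; [|case: ifP => _]]; rewrite /= ?subrr ?cmod0 ?E1 ?E2; lra.
Qed.

Lemma nested_intervals (u v : nat -> R) : (forall n, u n <= u n.+1) ->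
  (forall n, v n.+1 <= v n) -> (forall n, u n <= v n) -> exists x, forall n, u n <= x <= v n.
Proof.
move=> uu vv uv.
have um m n : (m <= n)%N -> u m <= u n.
  by move=> /subnK <-; elim: (n - m)%N => // k IH; rewrite addSn; apply: le_trans IH _.
have vm m n : (m <= n)%N -> v n <= v m.
  by move=> /subnK <-; elim: (n - m)%N => // k IH; rewrite addSn; apply: le_trans (vv _) IH.
have ubv n : ubound (range u) (v n).
  move=> _ [m _ <-]; case: (leqP m n) => mn; first exact: le_trans (um _ _ mn) (uv n).
  exact: le_trans (uv m) (vm _ _ (ltnW mn)).
exists (sup (range u)) => n; apply/andP; split.
  by apply: ub_le_sup; [exists (v 0%N); exact: ubv|exists n].
by apply: ge_sup; [exists (u 0%N); exists 0%N|exact: ubv].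
Qed.

Lemma half_pow_lt (k e : R) : 0 < e -> exists n : nat, k / 2 ^+ n < e.
Proof.
move=> e0; exists (Num.bound (k / e)); set n := Num.bound _.
rewrite ltr_pdivrMr ?exprn_gt0 // mulrC -ltr_pdivrMr //.
apply: le_lt_trans (ler_norm _) _; apply: lt_le_trans (archi_boundP (normr_ge0 _)) _.
have -> : Num.bound `|k / e| = Num.bound (k / e) by rewrite /Num.bound normr_id.
have H : (Num.bound (k / e))%:R <= (2 ^ Num.bound (k / e))%:R :> R by rewrite ler_nat ltnW // ltn_expl.
by apply: le_trans H _; rewrite natrX.
Qed.

(** Completeness in the form of nested intervals, for each coordinate: the geometric bound on the
    steps makes the intervals of radius p / 2^n nested. *)
Lemma contraction_limit (a : nat -> R[i]) (p : R) : 
  (forall n, cmod (a n.+1 - a n) <= p / 2 ^+ n.+1) ->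
  exists z, forall n, cmod (z - a n) <= 2 * (p / 2 ^+ n).
Proof.
move=> H.
have E n : p / 2 ^+ n = p / 2 ^+ n.+1 + p / 2 ^+ n.+1.
  by rewrite exprS; field; rewrite expf_neq0.
have p0 n : 0 <= p / 2 ^+ n by rewrite E; apply: addr_ge0; exact: le_trans (cmod_ge0 _) (H n).
have key (q : nat -> R) : (forall n, `|q n.+1 - q n| <= p / 2 ^+ n.+1) ->
    exists x, forall n, `|x - q n| <= p / 2 ^+ n.
  move=> Hq.
  have [||n|x Hx] := @nested_intervals (fun n => q n - p / 2 ^+ n) (fun n => q n + p / 2 ^+ n).
  - by move=> n; have := Hq n; rewrite ler_norml (E n) => /andP[]; lra.
  - by move=> n; have := Hq n; rewrite ler_norml (E n) => /andP[]; lra.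
  - by have := p0 n; lra.
  by exists x => n; rewrite ler_norml; have /andP[] := Hx n; lra.
have [n|x Hx] := key (fun n => complex.Re (a n)).
  by rewrite -cReB; exact: le_trans (Re_le_cmod _) (H n).
have [n|y Hy] := key (fun n => complex.Im (a n)).
  by rewrite -cImB; exact: le_trans (Im_le_cmod _) (H n).
exists (x +i* y) => n; apply: le_trans (cmod_le_ReIm _) _.
rewrite cReB cImB /=; have := Hx n; have := Hy n; lra.
Qed.

(** Bisection. At level n the integral shrinks by at most 4^n. The affine part of f at the limit
    point integrates to 0, and the remainder is small relative to the distance, hence contributes a
    small multiple of (perimeter / 2^n)^2; the two powers of 4 cancel. *)
Lemma goursat f (df : R[i] -> R[i]) T r : r < 1 -> tri_in_disc r T ->
  (forall z, cmod z < 1 -> hol f z (df z)) -> tri f T = 0.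
Proof.
move=> r1 iT hf; have cf : cont_disc f by move=> z /hf/hol_ccont.
pose S n := iter n (goursat_step f) T.
have Si n : tri_in_disc r (S n) by elim: n => // n IH; exact: goursat_step_tri_in_disc.
have Sp n : perimeter (S n) = perimeter T / 2 ^+ n.
  elim: n => [|n IH]; first by rewrite expr0 divr1.
  by rewrite /S iterS -/(S n) goursat_step_perimeter IH exprS; field; rewrite expf_neq0.
have St n : cmod (tri f T) <= 4 ^+ n * cmod (tri f (S n)).
  elim: n => [|n IH]; first by rewrite expr0 mul1r.
  apply: le_trans IH _; rewrite exprSr -mulrA ler_wpM2l ?exprn_ge0 //.
  exact: goursat_step_tri r1 (Si n) cf.
have [n|z Hz] := @contraction_limit (fun n => (S n).1.1) (perimeter T).
  have := goursat_step_fst f (S n); rewrite Sp -[goursat_step f (S n)]/(S n.+1) exprSr invfM mulrA.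
  exact.
have p0 : 0 <= perimeter T by rewrite /perimeter !addr_ge0 // cmod_ge0.
have z1 : cmod z <= r.
  rewrite leNgt; apply/negP => rz; have e0 : 0 < cmod z - r by rewrite subr_gt0.
  have [n Hn] := half_pow_lt (2 * perimeter T) e0.
  have [aS _ _] := Si n; have := Hz n; have := cmodD (z - (S n).1.1) (S n).1.1.
  by rewrite subrK; move: Hn; rewrite -mulrA; lra.
have {}z1 := le_lt_trans z1 r1.
apply: cmod_eq0; apply/eqP; rewrite eq_le cmod_ge0 andbT.
apply/ler_addgt0Pr => e e0; rewrite add0r.
(* Chosen so that the final bound e * (10 perimeter^2 / k) is at most e, also for a degenerate
   triangle. *)
pose k := 1 + 10 * perimeter T ^+ 2.
have k0 : 0 < k by rewrite /k ltr_wpDr // mulr_ge0 // sqr_ge0.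
have ek : 0 < e / k by rewrite divr_gt0.
have [s s0 Hs] := hf z z1 _ ek.
have [n Hn] := half_pow_lt (5 * perimeter T) s0.
apply: le_trans (St n) _.
pose pn := perimeter T / 2 ^+ n.
have pn0 : 0 <= pn by rewrite divr_ge0 // exprn_ge0.
pose A := f z - df z * z; pose B := df z.
(* The limit point is within 2 pn of the first vertex, hence within 4 pn of all three; a point of an
   edge adds at most pn, which gives 5 pn. *)
have D t a b : cmod (z - a) <= 4 * pn -> cmod (b - a) <= pn -> 0 <= t <= 1 ->
   cmod (f (a + t%:C * (b - a)) - (A + B * (a + t%:C * (b - a)))) <= e / k * (5 * pn).
  move=> za ba /andP[t0 t1]; set w := a + _.
  have wz : cmod (w - z) <= 5 * pn.
    have -> : w - z = t%:C * (b - a) - (z - a) by rewrite /w; ring.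
    apply: le_trans (cmodB _ _) _; rewrite cmodM cmod_real ger0_norm //.
    have := cmod_ge0 (b - a); nra.
  have := Hs (w - z); rewrite subrKC.
  have wzs : cmod (w - z) < s by apply: le_lt_trans wz _; rewrite mulrA.
  move=> /(_ wzs) Hw; have -> : f w - (A + B * w) = f w - f z - df z * (w - z) by rewrite /A /B; ring.
  by apply: le_trans Hw _; rewrite ler_wpM2l // ltW.
have [] := Si n; set a := (S n).1.1; set b := (S n).1.2; set c := (S n).2 => a1 b1 c1.
have {}a1 := le_lt_trans a1 r1; have {}b1 := le_lt_trans b1 r1; have {}c1 := le_lt_trans c1 r1.
have cA : cont_disc (fun w => A + B * w) by move=> u _; exact: ccont_affine.
have cfA : cont_disc (fun w => f w - (A + B * w)).
  by move=> u u1; apply: ccontB; [exact: cf|exact: cA].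
have E : tri f (S n) = tri (fun w => f w - (A + B * w)) (S n).
  rewrite /tri -/a -/b -/c !segB // !seg_affine //; by field.
have perE : cmod (b - a) + cmod (c - b) + cmod (a - c) = pn by rewrite /pn -Sp.
have q1 := cmod_ge0 (b - a); have q2 := cmod_ge0 (c - b); have q3 := cmod_ge0 (a - c).
have za : cmod (z - a) <= 2 * pn by exact: Hz.
have zb : cmod (z - b) <= 3 * pn.
  have -> : z - b = (z - a) - (b - a) by ring.
  by apply: le_trans (cmodB _ _) _; lra.
have zc : cmod (z - c) <= 4 * pn.
  have -> : z - c = (z - b) - (c - b) by ring.
  by apply: le_trans (cmodB _ _) _; lra.
have B1 : cmod (seg (fun w => f w - (A + B * w)) a b) <= 2 * (e / k * (5 * pn)) * cmod (b - a).
  apply: seg_bound => // t; apply: D; lra.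
have B2 : cmod (seg (fun w => f w - (A + B * w)) b c) <= 2 * (e / k * (5 * pn)) * cmod (c - b).
  apply: seg_bound => // t; apply: D; lra.
have B3 : cmod (seg (fun w => f w - (A + B * w)) c a) <= 2 * (e / k * (5 * pn)) * cmod (a - c).
  apply: seg_bound => // t; apply: D; lra.
have Bt : cmod (tri f (S n)) <= 2 * (e / k * (5 * pn)) * pn.
  rewrite E /tri -/a -/b -/c -[X in _ <= _ * X]perE [leRHS]mulrDr [X in _ <= X + _]mulrDr.
  apply: le_trans (cmodD _ _) _; apply: lerD => //.
  by apply: le_trans (cmodD _ _) _; exact: lerD.
apply: le_trans (ler_wpM2l (exprn_ge0 _ _) Bt) _ => //.
have -> : 4 ^+ n * (2 * (e / k * (5 * pn)) * pn) = e * ((10 * perimeter T ^+ 2) / k).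
  have -> : (4 : R) ^+ n = 2 ^+ n * 2 ^+ n by rewrite -exprMn; congr (_ ^+ _); ring.
  by rewrite /pn; field; rewrite expf_neq0 //= gt_eqF.
rewrite ler_piMr ?(ltW e0) // ler_pdivrMr // mul1r /k lerDr //.
Qed.

(** Goursat for the triangle 0, a, b: the integral from 0 is a primitive because its increments are
    segment integrals. *)
Lemma prim_incr f (df : R[i] -> R[i]) a b : cmod a < 1 -> cmod b < 1 ->
  (forall z, cmod z < 1 -> hol f z (df z)) -> seg f 0 b - seg f 0 a = seg f a b.
Proof.
move=> a1 b1 hf; have cf : cont_disc f by move=> z /hf/hol_ccont.
have iT : tri_in_disc (Num.max (cmod a) (cmod b)) (0, a, b).
  split.
  - by rewrite [leLHS](cmod0 R) le_max cmod_ge0.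
  - by rewrite le_max lexx.
  - by rewrite le_max lexx orbT.
have M1 : Num.max (cmod a) (cmod b) < 1 by rewrite gt_max a1 b1.
have := goursat M1 iT hf; rewrite /tri /= (@seg_rev f 0 b) ?cmod0 ?ltr01 //.
move=> /eqP; rewrite subr_eq0 => /eqP <-; by rewrite addrC addKr.
Qed.

Lemma disc_open z : cmod z < 1 -> exists2 r, 0 < r & forall h, cmod h < r -> cmod (z + h) < 1.
Proof.
move=> z1; exists (1 - cmod z); first by rewrite subr_gt0.
move=> h hr; apply: le_lt_trans (cmodD _ _) _; lra.
Qed.

Lemma seg_cst c a b : seg (fun=> c) a b = (b - a) * c.
Proof. by rewrite /seg C01_cst. Qed.

Lemma hol_prim f (df : R[i] -> R[i]) z : cmod z < 1 ->
  (forall z, cmod z < 1 -> hol f z (df z)) -> hol (seg f 0) z (f z).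
Proof.
move=> z1 hf; have cf : cont_disc f by move=> u /hf/hol_ccont.
move=> e e0; have e2 : 0 < e / 2 by rewrite divr_gt0.
have [r r0 Hr] := cf z z1 _ e2; have [s s0 Hs] := disc_open z1.
exists (Num.min r s); first by rewrite lt_min r0.
move=> h; rewrite lt_min => /andP[hr hs].
have zh := Hs h hs.
rewrite (prim_incr z1 zh hf).
have cc : cont_disc (fun=> f z) by move=> u _; exact: hol_ccont (hol_cst _ _).
have -> : f z * h = seg (fun=> f z) z (z + h) by rewrite seg_cst addrAC subrr add0r mulrC.
rewrite -segB //.
have := @seg_bound (fun w => f w - f z) z (z + h) (e / 2).
have E : z + h - z = h by rewrite addrAC subrr add0r.
rewrite E; have -> : 2 * (e / 2) = e by field.
apply => //; first by move=> u u1; apply: ccontB; [exact: cf|exact: cc].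
move=> t /andP[t0 t1]; apply: Hr; rewrite cmodM cmod_real ger0_norm //.
apply: le_lt_trans hr; rewrite ler_piMl //; exact: cmod_ge0.
Qed.

End segments.

(** * Measurability of continuous functions on the plane, and compactness of closed discs *)

Section plane_topology.
Variable R : realType.
Implicit Types (p q : plane R) (z w h : R[i]).

Definition near2 (r : R) p q := `|q.1 - p.1| < r /\ `|q.2 - p.2| < r.

(** The product sigma-algebra is generated by rectangles. A relatively open set is U intersected
    with the countably many rational squares whose trace on U lies in V. *)
Lemma relopen_measurable (U V : set (plane R)) : measurable U -> V `<=` U ->
  (forall p, V p -> exists2 r, 0 < r & forall q, U q -> near2 r p q -> V q) -> measurable V.
Proof.
move=> mU VU H.
pose sq (i : rat * rat * nat) : set (plane R) :=
  [set p | `|p.1 - ratr i.1.1| < i.2.+1%:R^-1] `&` [set p | `|p.2 - ratr i.1.2| < i.2.+1%:R^-1].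
have msq i : measurable (sq i).
  have mb (c r : R) : measurable [set x : measurableTypeR R | `|x - c| < r].
    have -> : [set x : measurableTypeR R | `|x - c| < r] = `]c - r, c + r[%classic.
      apply/seteqP; split => x /=; rewrite in_itv /= ltr_norml; first by move=> /andP[? ?]; lra.
      by move=> /andP[? ?]; apply/andP; lra.
    exact: measurable_itv.
  have -> : sq i = [set x : measurableTypeR R | `|x - ratr i.1.1| < i.2.+1%:R^-1] `*`
      [set x : measurableTypeR R | `|x - ratr i.1.2| < i.2.+1%:R^-1] by apply/seteqP; split.
  by apply: measurableX; exact: mb.
have -> : V = U `&` \bigcup_n (if unpickle n is Some i then
    [set p | sq i p /\ (sq i `&` U `<=` V)] else set0).
  apply/seteqP; split => p.
  - move=> Vp; split; first exact: VU.
    have [r r0 Hr] := H p Vp.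
    (* Two points of a square of half-side 1/(n+1) differ by less than 2/(n+1) in each coordinate,
       and this is at most r. *)
    pose n := Num.bound (2 / r).
    have n0 : 0 < n.+1%:R^-1 :> R by rewrite invr_gt0 ltr0n.
    have nr : n.+1%:R^-1 + n.+1%:R^-1 <= r.
      have := archi_boundP (ltW (divr_gt0 (ltr0n R 2) r0)); rewrite -/n => hn.
      rewrite -mulr2n -[_ *+ 2]mulr_natl ler_pdivrMr ?ltr0n // mulrC -ler_pdivrMr //.
      by apply: le_trans (ltW hn) _; rewrite ler_nat.
    have [a Ha] : exists a : rat, `|p.1 - ratr a| < n.+1%:R^-1.
      have [a] := rat_in_itvoo (ltr_pwDr n0 (lexx p.1)); rewrite in_itv /= => /andP[a1 a2].
      by exists a; rewrite distrC ger0_norm ?subr_ge0 ?ltrBlDl // ltW.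
    have [b Hb] : exists b : rat, `|p.2 - ratr b| < n.+1%:R^-1.
      have [b] := rat_in_itvoo (ltr_pwDr n0 (lexx p.2)); rewrite in_itv /= => /andP[a1 a2].
      by exists b; rewrite distrC ger0_norm ?subr_ge0 ?ltrBlDl // ltW.
    exists (pickle (a, b, n)); first exact: I.
    rewrite pickleK; split; first by split.
    move=> q [[/= q1 q2] Uq]; apply: Hr => //; split.
      have -> : q.1 - p.1 = (q.1 - ratr a) - (p.1 - ratr a) by ring.
      exact: le_lt_trans (ler_normB _ _) (lt_le_trans (ltrD q1 Ha) nr).
    have -> : q.2 - p.2 = (q.2 - ratr b) - (p.2 - ratr b) by ring.
    exact: le_lt_trans (ler_normB _ _) (lt_le_trans (ltrD q2 Hb) nr).
  - move=> [Up [n _]]; case: unpickle => // i [sp sub]; exact: sub.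
apply: measurableI => //; apply: bigcupT_measurable => n.
case: unpickle => // i.
have [sub|nsub] := pselect (sq i `&` U `<=` V).
  by have -> : [set p | sq i p /\ (sq i `&` U `<=` V)] = sq i by apply/seteqP; split => p //= [].
have -> : [set p | sq i p /\ (sq i `&` U `<=` V)] = set0 by apply/seteqP; split => p //= [].
exact: measurable0.
Qed.

Definition pcont (U : set (plane R)) (g : plane R -> R) := forall p, U p -> forall e, 0 < e ->
  exists2 r, 0 < r & forall q, U q -> near2 r p q -> `|g q - g p| <= e.

Lemma pcont_measurable U g : measurable U -> pcont U g -> measurable_fun U g.
Proof.
move=> mU cg; apply: (measurability _ (RGenOInfty.measurableE R)) => _ [_ [a ->] <-].
apply: (relopen_measurable mU) => [p []//|p [Up]].
rewrite /= in_itv /= andbT => ga.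
have e0 : 0 < (g p - a) / 2 by rewrite divr_gt0 // subr_gt0.
have [r r0 Hr] := cg p Up _ e0; exists r => // q Uq /(Hr q Uq) H.
split => //=; rewrite in_itv /= andbT; move: H; rewrite ler_norml => /andP[]; lra.
Qed.

Lemma near2_cmod r p q : near2 r p q -> cmod (cplx q - cplx p) < r + r.
Proof.
move=> [h1 h2]; apply: le_lt_trans (cmod_le_ReIm _) _; rewrite cReB cImB /=.
exact: ltrD.
Qed.

Definition pccont (U : set (plane R)) (f : R[i] -> R[i]) := forall p, U p -> forall e : R, 0 < e ->
  exists2 r, 0 < r & forall q, U q -> cmod (cplx q - cplx p) < r -> cmod (f (cplx q) - f (cplx p)) <= e.

Lemma pccont_Re U f : pccont U f -> pcont U (fun p => complex.Re (f (cplx p))).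
Proof.
move=> H p Up e e0; have [r r0 Hr] := H p Up e e0; exists (r / 2); first exact: divr_gt0.
move=> q Uq /near2_cmod; rewrite -splitr => /(Hr q Uq); apply: le_trans.
by rewrite -cReB; exact: Re_le_cmod.
Qed.

Lemma pccont_Im U f : pccont U f -> pcont U (fun p => complex.Im (f (cplx p))).
Proof.
move=> H p Up e e0; have [r r0 Hr] := H p Up e e0; exists (r / 2); first exact: divr_gt0.
move=> q Uq /near2_cmod; rewrite -splitr => /(Hr q Uq); apply: le_trans.
by rewrite -cImB; exact: Im_le_cmod.
Qed.

Lemma ccont_pccont U f : (forall p, U p -> ccont f (cplx p)) -> pccont U f.
Proof.
move=> H p Up e e0; have [r r0 Hr] := H p Up e e0; exists r => // q _ qp.
by have := Hr _ qp; rewrite subrKC.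
Qed.

Lemma cmod_cplx p : cmod (cplx p) ^+ 2 = p.1 ^+ 2 + p.2 ^+ 2.
Proof. by rewrite cmod_sqr. Qed.

Lemma measurable_cmod : measurable_fun setT (fun p : plane R => cmod (cplx p)).
Proof.
apply: pcont_measurable => // p _ e e0; exists (e / 2); first exact: divr_gt0.
move=> q _ /near2_cmod; rewrite -splitr => h; apply: le_trans (cmod_dist _ _) (ltW h).
Qed.

Definition cdisc (r : R) : set (plane R) := [set p | cmod (cplx p) < r].

Lemma measurable_cdisc r : measurable (cdisc r).
Proof.
have -> : cdisc r = setT `&` (fun p : plane R => cmod (cplx p)) @^-1` `]-oo, r[%classic.
  by rewrite setTI; apply/seteqP; split => p /=; rewrite in_itv.
exact: measurable_cmod.
Qed.

Lemma disc_cdisc : @disc R = cdisc 1. Proof. by []. Qed.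

(** Compactness of the closed disc turns a property that holds locally for all small d into one that
    holds for a common d. Boundedness and uniform continuity are both obtained from it. *)
Lemma near_disc_uniform (P : R -> R[i] -> Prop) rho :
  (forall w, cmod w <= rho -> exists2 r, 0 < r & exists2 d0, 0 < d0 &
     forall w', cmod (w' - w) < r -> forall d, 0 < d < d0 -> P d w') ->
  exists2 d0, 0 < d0 & forall d, 0 < d < d0 -> forall w, cmod w <= rho -> P d w.
Proof.
move=> H.
pose A := [set p : R * R | cmod (p.1 +i* p.2) <= rho].
have cA : compact A.
  apply: (@subclosed_compact _ A (`[- rho, rho] `*` `[- rho, rho])).
  - have cf : continuous (fun p : R * R => cmod (p.1 +i* p.2)).
      move=> p; apply/cvgrPdist_le => e e0.
      have e2 : 0 < e / 2 by rewrite divr_gt0.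
      exists (ball p.1 (e / 2), ball p.2 (e / 2)); first by split; exact: nbhsx_ballx.
      move=> [qx qy] [q1 q2]; apply: (le_trans (cmod_dist (p.1 +i* p.2) (qx +i* qy))).
      apply: le_trans (cmod_le_ReIm _) _; rewrite cReB cImB [e]splitr.
      have {}q1 : `|p.1 - qx| < e / 2 := q1; have {}q2 : `|p.2 - qy| < e / 2 := q2.
      by apply: lerD; exact: ltW.
    have -> : A = (fun p : R * R => cmod (p.1 +i* p.2)) @^-1` [set x | x <= rho] by [].
    by apply: closed_comp.
  - by apply: compact_setX; exact: segment_compact.
  - move=> p /= Ap; have h1 := Re_le_cmod (p.1 +i* p.2); have h2 := Im_le_cmod (p.1 +i* p.2).
    have hb (x c : R) : `|x| <= c -> c <= rho -> x \in `[- rho, rho].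
      by move=> xc cr; rewrite in_itv /= -ler_norml; exact: le_trans cr.
    by split; [exact: hb h1 Ap|exact: hb h2 Ap].
have [d0 /= d00 Hd] : \forall d \near 0^'+, A `<=` (fun p => P d (p.1 +i* p.2)).
  move/compact_near_coveringP: cA; apply => p Ap.
  have [r r0 [d0 d00 Hd]] := H _ Ap.
  have r2 : 0 < r / 2 by rewrite divr_gt0.
  exists (ball p.1 (r / 2) `*` ball p.2 (r / 2), [set d | 0 < d < d0]) => /=.
    split.
      by exists (ball p.1 (r / 2), ball p.2 (r / 2)) => //; split; exact: nbhsx_ballx.
    exists d0 => // d /= ; rewrite sub0r normrN => hd d1; rewrite d1 /=.
    by rewrite -(gtr0_norm d1).
  move=> [q d] /= [[hq1 hq2] hd]; apply: Hd => //.
  apply: le_lt_trans (cmod_le_ReIm _) _ => /=; rewrite [r]splitr.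
  by apply: ltrD; rewrite distrC.
exists d0 => // d /andP[d1 d2] [x y] hw.
by apply: (Hd d _ d1 (x, y)); rewrite //= sub0r normrN gtr0_norm.
Qed.

End plane_topology.

(** * A reproducing formula *)

Section green.
Variable R : realType.
Implicit Types (f g : R[i] -> R[i]) (z w h : R[i]).

Lemma ccontD f g z : ccont f z -> ccont g z -> ccont (fun w => f w + g w) z.
Proof.
move=> Hf Hg e e0; have e2 : 0 < e / 2 by rewrite divr_gt0.
have [r r0 Hr] := Hf _ e2; have [s s0 Hs] := Hg _ e2.
exists (Num.min r s); first by rewrite lt_min r0.
move=> h; rewrite lt_min => /andP[/Hr h1 /Hs h2].
have -> : f (z + h) + g (z + h) - (f z + g z) = (f (z + h) - f z) + (g (z + h) - g z) by ring.
by apply: le_trans (cmodD _ _) _; rewrite [e]splitr lerD.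
Qed.

Lemma ccontM f g z : ccont f z -> ccont g z -> ccont (fun w => f w * g w) z.
Proof.
move=> Hf Hg e e0.
pose k := cmod (f z) + cmod (g z) + 1.
have k1 : 1 <= k by rewrite lerDr addr_ge0 // cmod_ge0.
have k0 : 0 < k by lra.
pose e1 := Num.min 1 (e / (2 * k)).
have e10 : 0 < e1 by rewrite lt_min ltr01 divr_gt0 // mulr_gt0.
have e11 : e1 <= 1 by rewrite ge_min lexx.
have e12 : e1 * k <= e / 2.
  rewrite -ler_pdivlMr // ge_min; apply/orP; right.
  by have -> : e / (2 * k) = e / 2 / k by field; rewrite gt_eqF.
have [r r0 Hr] := Hf _ e10; have [s s0 Hs] := Hg _ e10.
exists (Num.min r s); first by rewrite lt_min r0.
move=> h; rewrite lt_min => /andP[/Hr h1 /Hs h2].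
have -> : f (z + h) * g (z + h) - f z * g z =
  (f (z + h) - f z) * (g (z + h) - g z) + (f (z + h) - f z) * g z + f z * (g (z + h) - g z) by ring.
have c1 := cmod_ge0 (f (z + h) - f z); have c2 := cmod_ge0 (g (z + h) - g z).
have c3 := cmod_ge0 (f z); have c4 := cmod_ge0 (g z).
apply: le_trans (cmodD _ _) _; apply: le_trans (lerD (cmodD _ _) (lexx _)) _.
rewrite !cmodM; apply: (@le_trans _ _ (e1 * k)); last by lra.
rewrite /k; move: c1 c2 c3 c4 h1 h2.
move: (cmod (f (z + h) - f z)) (cmod (g (z + h) - g z)) (cmod (f z)) (cmod (g z)) => x y u v *.
nra.
Qed.

Lemma ccont_conj f z : ccont f z -> ccont (fun w => (f w)^*) z.
Proof. by move=> Hf e /Hf[r r0 Hr]; exists r => // h /Hr; rewrite -rmorphB /= cmod_conj. Qed.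

Lemma ccont_cst c z : ccont (fun=> c) z.
Proof. exact: hol_ccont (hol_cst _ _). Qed.

Definition rcont (F : R -> R) t := forall e, 0 < e -> exists2 r, 0 < r &
  forall s, `|s| < r -> `|F (t + s) - F t| <= e.

Lemma rderiv_rcont (F : R -> R) t d : rderiv F t d -> rcont F t.
Proof.
move=> /rderiv_lip[r r0 Hr] e e0; have k0 : 0 < `|d| + 1 by rewrite ltr_wpDl.
exists (Num.min r (e / (`|d| + 1))); first by rewrite lt_min r0 divr_gt0.
move=> s; rewrite lt_min => /andP[/Hr h1 h2]; apply: le_trans h1 _.
by rewrite mulrC -ler_pdivlMr // ltW.
Qed.

Lemma ccont_rcont (F : R -> R) (S : R[i] -> R) z : rcont F (S z) ->
  ccont (fun w => (S w)%:C) z -> ccont (fun w => (F (S w))%:C) z.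
Proof.
move=> HF HS e /HF[r r0 Hr].
have r2 : 0 < r / 2 by rewrite divr_gt0.
have [s s0 Hs] := HS _ r2; exists s => // h /Hs; rewrite -!rmorphB !cmod_real => H; have := Hr (S (z + h) - S z); rewrite subrKC; apply.
by apply: le_lt_trans H _; lra.
Qed.

Lemma ccont_sqr z (r : R) : ccont (fun w => (r - cmod w ^+ 2)%:C) z.
Proof.
have H := ccontB (ccont_cst r%:C z) (ccontM (hol_ccont (hol_id z)) (ccont_conj (hol_ccont (hol_id z)))).
move=> e /H[s s0 Hs]; exists s => // h /Hs.
by rewrite !mulc_conj !rmorphB.
Qed.

(** The power of the positive part. For b > 0 it is continuous on the whole line, so the weight
    (rho^2 - |w|^2)^b extends by 0 beyond |w| = rho. *)
Definition pw (b s : R) := (Num.max 0 s) `^ b.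

Lemma pw_ge0 b s : 0 <= pw b s. Proof. exact: powR_ge0. Qed.

Lemma pw_le0 b s : 0 < b -> s <= 0 -> pw b s = 0.
Proof. by move=> b0 s0; rewrite /pw max_l // powR0 // gt_eqF. Qed.

Lemma pw_gt0E b s : 0 < s -> pw b s = s `^ b.
Proof. by move=> s0; rewrite /pw max_r // ltW. Qed.

Lemma pw_le1 b s : 0 < b -> s <= 1 -> pw b s <= 1.
Proof.
move=> b0 s1; have -> : 1 = 1 `^ b :> R by rewrite powR1.
rewrite ge0_ler_powR ?nnegrE ?(ltW b0) //.
  by rewrite le_max lexx.
by rewrite ge_max ler01.
Qed.

Lemma le_pw b s t : 0 < b -> s <= t -> pw b s <= pw b t.
Proof.
move=> b0 st; apply: ge0_ler_powR; rewrite ?nnegrE ?(ltW b0) //; try by rewrite le_max lexx.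
by rewrite ge_max; apply/andP; split; rewrite le_max ?lexx // st orbT.
Qed.

Lemma pwS b s : 0 < s -> pw (b + 1) s = pw b s * s.
Proof. by move=> s0; rewrite !pw_gt0E // powRD ?(gt_eqF s0) ?implybT // powRr1 // ltW. Qed.

Lemma rderiv_pw b s : 0 < s -> rderiv (pw b) s (b * pw (b - 1) s).
Proof.
move=> s0; have /rdP H := is_derive1_powR b s0.
rewrite pw_gt0E // => e /H[r r0 Hr]; exists (Num.min r s); first by rewrite lt_min r0.
move=> t; rewrite lt_min => /andP[/Hr ? ts]; rewrite !pw_gt0E //.
by move: ts; rewrite ltr_norml => /andP[]; lra.
Qed.

Lemma rcont_pw b s : 0 < b -> rcont (pw b) s.
Proof.
move=> b0; have [s0|s0] := ltP 0 s; first exact: rderiv_rcont (rderiv_pw b s0).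
move=> e e0; exists (e `^ b^-1); first exact: powR_gt0.
move=> t ht; rewrite (pw_le0 b0 s0) subr0 ger0_norm ?pw_ge0 //.
have -> : e = (e `^ b^-1) `^ b by rewrite -powRrM mulVf ?gt_eqF // powRr1 // ltW.
apply: ge0_ler_powR; rewrite ?nnegrE ?(ltW b0) ?powR_ge0 ?le_max ?lexx //.
rewrite ge_max powR_ge0 /=; have := ler_norm t; lra.
Qed.

Lemma diffw_eqd A f z d d' : diffw A f z d -> d = d' -> diffw A f z d'.
Proof. by move=> H <-. Qed.

Section direction.
Variables (b rho : R) (z : R[i]) (phi phi' : R[i] -> R[i]).
Hypotheses (b0 : 0 < b) (rho0 : 0 < rho) (rho1 : rho < 1) (z1 : cmod z < 1).
Hypothesis hphi : forall w, cmod w < 1 -> hol phi w (phi' w).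
Hypothesis cphi' : forall w, cmod w < 1 -> ccont phi' w.

Definition sw w := rho ^+ 2 - cmod w ^+ 2.

Definition green_fun w := (pw (b + 1) (sw w))%:C * (Bk (b + 1) w z)^* * phi w.

(** The derivative of [green_fun] at w in the real direction e, for |w| < rho. The formula remains
    continuous on the whole unit disc, which gives continuity up to the ends of the chords. *)
Definition green_dir e w :=
  (- 2 * (b + 1) * complex.Re (w * e^*) * pw b (sw w))%:C * (Bk (b + 1) w z)^* * phi w +
  (pw (b + 1) (sw w))%:C * (((b + 1)%:C * z^* * Bk (b + 1 + 1) w z * e)^* * phi w +
     (Bk (b + 1) w z)^* * (phi' w * e)).

Lemma ccont_Bk s w : cmod w < 1 -> ccont (fun w => (Bk s w z)^*) w.
Proof. by move=> w1; apply: ccont_conj; apply: hol_ccont (hol_Bk s w1 (ltW z1)). Qed.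

Lemma ccont_green_dir e w : cmod w < 1 -> ccont (green_dir e) w.
Proof.
move=> w1; have cphi := hol_ccont (hphi w1); have cp' := cphi' w1.
have cp c : 0 < c -> ccont (fun w => (pw c (sw w))%:C) w.
  by move=> c0; apply: ccont_rcont; [exact: rcont_pw|exact: ccont_sqr].
have b10 : 0 < b + 1 by rewrite addr_gt0.
apply: ccontD; last first.
  apply: ccontM (cp _ b10) _; apply: ccontD; apply: ccontM => //; last 2 first.
  - exact: ccont_Bk.
  - by apply: ccontM => //; exact: ccont_cst.
  apply: ccont_conj; apply: ccontM (ccont_cst _ _); apply: ccontM (ccont_cst _ _) _.
  exact: hol_ccont (hol_Bk _ w1 (ltW z1)).
apply: ccontM => //; apply: ccontM; last exact: ccont_Bk.
have cRe : ccont (fun w => (complex.Re (w * e^*))%:C) w.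
  have H := ccontM (hol_ccont (hol_id w)) (ccont_cst (e^*) w).
  move=> d /H[r r0 Hr]; exists r => // h /Hr; apply: le_trans.
  by rewrite -rmorphB -cReB cmod_real; exact: Re_le_cmod.
have := ccontM (ccontM (ccont_cst (- 2 * (b + 1))%:C w) cRe) (cp _ b0).
by move=> H d /H[r r0 Hr]; exists r => // h /Hr; rewrite -!rmorphM.
Qed.

Lemma rderiv_pw_line w0 e (t : R) : cmod e = 1 -> cmod (w0 + t%:C * e) < rho ->
  rderiv (fun t => pw (b + 1) (sw (w0 + t%:C * e))) t
     (- 2 * (b + 1) * complex.Re ((w0 + t%:C * e) * e^*) * pw b (sw (w0 + t%:C * e))).
Proof.
move=> e1 wr.
have e1' : complex.Re e ^+ 2 + complex.Im e ^+ 2 = 1 by rewrite -cmod_sqr e1 expr1n.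
have s0 : 0 < sw (w0 + t%:C * e).
  by rewrite /sw subr_gt0 ltr_pXn2r // ?nnegrE ?cmod_ge0 // ltW.
have H1 : rderiv (fun t => sw (w0 + t%:C * e)) t (- 2 * complex.Re ((w0 + t%:C * e) * e^*)).
  move=> d d0; exists d => // s sd.
  have -> : sw (w0 + (t + s)%:C * e) - sw (w0 + t%:C * e) -
     - 2 * complex.Re ((w0 + t%:C * e) * e^*) * s = - s ^+ 2.
    rewrite /sw !cmod_sqr !(cReM,cImM,cReD,cImD,cRe_conj,cIm_conj) /=.
    transitivity (- (s ^+ 2 * (complex.Re e ^+ 2 + complex.Im e ^+ 2))); [ring|by rewrite e1' mulr1].
  by rewrite normrN normrX expr2 ler_wpM2r // ltW.
have /rdP H2 := rderiv_pw (b + 1) s0; rewrite addrK in H2.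
move/rdP : H1 => H1; apply/rdP.
have := @is_derive1_comp R (pw (b + 1)) (fun t : R => sw (w0 + t%:C * e)) t _ _ H2 H1.
by have -> : forall x y v : R, x * y * (- 2 * v) = - 2 * x * v * y by move=> *; ring.
Qed.

Lemma diffw_green_fun w0 e (t : R) : cmod e = 1 -> cmod (w0 + t%:C * e) < rho ->
  diffw (@reals R) (fun x => green_fun (w0 + x * e)) t%:C (green_dir e (w0 + t%:C * e)).
Proof.
move=> e1 wr; have w1 : cmod (w0 + t%:C * e) < 1 by exact: lt_trans rho1.
have L : diffw (@reals R) (fun x => w0 + x * e) t%:C e.
  have := diffwD (diffw_cst (@reals R) w0 t%:C)
    (diffwM (diffw_id (@reals R) t%:C) (diffw_cst (@reals R) e t%:C)).
  by rewrite mulr0 addr0 add0r mul1r.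
have P1 := diffw_rderiv (rderiv_pw_line e1 wr).
have P2 := diffw_comp L (hphi w1).
have P3 := diffw_conj (diffw_comp L (hol_Bk (b + 1) w1 (ltW z1))).
have := diffwM (diffwM P1 P3) P2.
move=> /diffw_eqd-/(_ (green_dir e (w0 + t%:C * e))) H.
apply: diffw_ext ltr01 _ _ (H _); [move=> h h0 _|by []|by rewrite /green_dir /=; ring].
have -> // : t%:C + h = (complex.Re (t%:C + h))%:C.
by apply: complexP; rewrite ?cReD ?cImD //= h0 addr0.
Qed.

Lemma cmod_line w0 e (t : R) : cmod e = 1 -> complex.Re (w0 * e^*) = 0 ->
  cmod (w0 + t%:C * e) ^+ 2 = cmod w0 ^+ 2 + t ^+ 2.
Proof.
move=> e1 we.
have ee : complex.Re e ^+ 2 + complex.Im e ^+ 2 = 1 by rewrite -cmod_sqr e1 expr1n.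
move: we; rewrite !cmod_sqr !(cReM,cImM,cReD,cImD,cRe_conj,cIm_conj) /= => we.
transitivity (complex.Re w0 ^+ 2 + complex.Im w0 ^+ 2 +
     t ^+ 2 * (complex.Re e ^+ 2 + complex.Im e ^+ 2) +
     2 * t * (complex.Re w0 * complex.Re e - complex.Im w0 * - complex.Im e)); first by ring.
by rewrite ee we mulr1 mulr0 addr0.
Qed.

Lemma chord_integral w0 e (F : R[i] -> R) : cmod e = 1 -> complex.Re (w0 * e^*) = 0 ->
  cmod w0 < rho ->
  (F = (@complex.Re R) \/ F = (@complex.Im R)) ->
  (\int[lebesgue_measure]_(t in [set t | (cmod (w0 + t%:C * e) < rho)%R]) (F (green_dir e (w0 + t%:C * e)))%:E = 0)%E.
Proof.
move=> e1 we wr HF.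
have E (t : R) := cmod_line t e1 we.
set X := Num.sqrt (rho ^+ 2 - cmod w0 ^+ 2).
have X2p : 0 < rho ^+ 2 - cmod w0 ^+ 2.
  by rewrite subr_gt0 ltr_pXn2r // ?nnegrE ?cmod_ge0 // ltW.
have X0 : 0 < X by rewrite sqrtr_gt0.
have X2 : X ^+ 2 = rho ^+ 2 - cmod w0 ^+ 2 by rewrite sqr_sqrtr // ltW.
have XE : [set t | (cmod (w0 + t%:C * e) < rho)%R] = `]- X, X[%classic.
  apply/seteqP; split => t /=; rewrite in_itv /= -ltr_norml.
    move=> H; rewrite -(ltr_pXn2r (ltn0Sn 1)) ?nnegrE ?(ltW X0) // real_normK ?num_real // X2.
    rewrite ltrBrDl -E ltr_pXn2r // ?nnegrE ?cmod_ge0 //; exact: ltW.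
  rewrite -(ltr_pXn2r (ltn0Sn 1)) ?nnegrE ?(ltW X0) // real_normK ?num_real // X2.
  rewrite ltrBrDl -E ltr_pXn2r // ?nnegrE ?cmod_ge0 //; exact: ltW.
have Xle (t : R) : - X <= t <= X -> cmod (w0 + t%:C * e) < 1.
  rewrite -ler_norml => tX; apply: le_lt_trans rho1.
  rewrite -(ler_pXn2r (ltn0Sn 1)) ?nnegrE ?cmod_ge0 ?(ltW rho0) // E.
  by rewrite -lerBrDl -X2 -(real_normK (num_real t)) ler_pXn2r // ?nnegrE ?(ltW X0).
have cF f a c (t : R) : ccont f (a + t%:C * c) -> {for t, continuous (fun t : R => F (f (a + t%:C * c)))}.
  by case: HF => ->; [exact: ccont_Re|exact: ccont_Im].
have b10 : 0 < b + 1 by rewrite addr_gt0.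
have cGG w : cmod w < 1 -> ccont green_fun w.
  move=> w1; apply: ccontM (hol_ccont (hphi w1)); apply: ccontM (ccont_Bk _ w1).
  by apply: ccont_rcont; [exact: rcont_pw|exact: ccont_sqr].
have GG0 w : cmod w ^+ 2 = rho ^+ 2 -> green_fun w = 0.
  by move=> H; rewrite /green_fun /sw H subrr pw_le0 // !mul0r.
rewrite XE.
have mI : measurable_fun `]- X, X[ (fun t : R => F (green_dir e (w0 + t%:C * e))).
  apply: open_continuous_measurable_fun; first exact: interval_open.
  move=> t; rewrite inE /= in_itv /= => /andP[t1 t2].
  by apply: cF; apply: ccont_green_dir; apply: Xle; rewrite !ltW.
rewrite -(@integral_itv_bndoo R (- X) X _ true false); last exact/measurable_EFinP.
rewrite (@continuous_FTC2 _ _ (fun t : R => F (green_fun (w0 + t%:C * e)))).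
- rewrite !GG0 ?E ?sqrrN ?X2 ?subrKC //.
  by case: HF => -> /=; rewrite sube0.
- lra.
- apply: continuous_in_subspaceT => t; rewrite inE /= in_itv /= => tX.
  by apply: cF; apply: ccont_green_dir; exact: Xle.
- split.
  + move=> t; rewrite in_itv /= => tX.
    have : [set t | (cmod (w0 + t%:C * e) < rho)%R] t by rewrite XE /= in_itv.
    move=> /(diffw_green_fun e1) D.
    have := rderiv_Re D; have := rderiv_Im D => /rdP[D1 _] /rdP[D2 _].
    by case: HF => ->.
  + apply: cvg_at_right_filter; apply: cF; apply: cGG; apply: Xle; lra.
  + apply: cvg_at_left_filter; apply: cF; apply: cGG; apply: Xle; lra.
- move=> t; rewrite in_itv /= => tX.
  have : [set t | (cmod (w0 + t%:C * e) < rho)%R] t by rewrite XE /= in_itv.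
  move=> /(diffw_green_fun e1) D; rewrite derive1E.
  have := rderiv_Re D; have := rderiv_Im D => /rdP[_ D1] /rdP[_ D2].
  by case: HF => ->.
Qed.

Local Notation lam := (@lebesgue_measure R).
Local Notation Lam := (lam \x lam)%E.

Lemma Lam_cdisc_lty r : r <= 1 -> (Lam (cdisc r) < +oo)%E.
Proof.
move=> r1; have mS : measurable (`[(-1 : R), 1]%classic `*` `[(-1 : R), 1]%classic).
  by apply: measurableX.
apply: (@le_lt_trans _ _ (Lam (`[(-1 : R), 1]%classic `*` `[(-1 : R), 1]%classic))).
  apply: le_measure; rewrite ?inE //; first exact: measurable_cdisc.
  move=> p hp; have h1 := Re_le_cmod (cplx p); have h2 := Im_le_cmod (cplx p).
  have hb (x c : R) : `|x| <= c -> c < r -> x \in `[(-1), 1].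
    move=> xc cr; rewrite in_itv /= -ler_norml; exact: le_trans xc (le_trans (ltW cr) r1).
  by split; [exact: hb h1 hp|exact: hb h2 hp].
have fl : lam `[(-1 : R), 1]%classic \is a fin_num.
  by rewrite lebesgue_measure_itv /=; case: ifP.
rewrite product_measure1E //; apply: lte_mul_pinfty => //.
by rewrite ltey_eq; apply/orP; left; exact: fl.
Qed.

Lemma ccont_bounded f r : (forall w, cmod w <= r -> ccont f w) ->
  exists2 M, 0 <= M & forall w, cmod w <= r -> cmod (f w) <= M.
Proof.
(* The bound is encoded as d^-1, so that a smaller d is a weaker requirement. *)
move=> H; have [|d d0 Hd] := @near_disc_uniform R (fun d w => cmod (f w) <= d^-1) r.
  move=> w wr; have [s s0 Hs] := H w wr 1 ltr01; exists s => //.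
  have k0 : 0 < cmod (f w) + 1 by rewrite ltr_wpDl // cmod_ge0.
  exists (cmod (f w) + 1)^-1; first by rewrite invr_gt0.
  move=> w' hw d /andP[d0 dk]; have := Hs _ hw; rewrite subrKC => H1.
  have := cmodD (f w' - f w) (f w); rewrite subrK => H2.
  apply: (@le_trans _ _ (cmod (f w) + 1)); first by lra.
  by rewrite -[leLHS]invrK lef_pV2 ?posrE ?invr_gt0 // ltW.
have d2 : 0 < d / 2 by rewrite divr_gt0.
exists (d / 2)^-1; first by rewrite invr_ge0 ltW.
by move=> w; apply: Hd; rewrite d2 /=; lra.
Qed.

Lemma disc_measurable_ReIm r f : r <= 1 -> (forall w, cmod w < r -> ccont f w) ->
  measurable_fun (cdisc r) (fun p => complex.Re (f (cplx p))) /\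
  measurable_fun (cdisc r) (fun p => complex.Im (f (cplx p))).
Proof.
move=> r1 H; have c : pccont (cdisc r) f by apply: ccont_pccont => p; exact: H.
by split; apply: pcont_measurable (measurable_cdisc _) _; [exact: pccont_Re|exact: pccont_Im].
Qed.

Lemma ccont_cintegrable r f : r <= 1 -> (forall w, cmod w <= r -> ccont f w) ->
  cintegrable Lam (cdisc r) (fun p => f (cplx p)).
Proof.
move=> r1 H; have [M M0 HM] := ccont_bounded H.
have [m1 m2] := disc_measurable_ReIm r1 (fun w (h : cmod w < r) => H w (ltW h)).
apply: (@bounded_cintegrable _ _ _ _ _ (measurable_cdisc r) _ M) => //.
  exact: Lam_cdisc_lty.
by move=> p /ltW; exact: HM.
Qed.

Lemma green_area e (F : R[i] -> R) : e = 1 \/ e = 'i ->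
  (F = (@complex.Re R) \/ F = (@complex.Im R)) ->
  (\int[Lam]_(p in cdisc rho) (F (green_dir e (cplx p)))%:E = 0)%E.
Proof.
move=> He HF.
have ig : Lam.-integrable (cdisc rho) (fun p => (F (green_dir e (cplx p)))%:E).
  have [] := @ccont_cintegrable rho (green_dir e) (ltW rho1).
    by move=> w wr; apply: ccont_green_dir; exact: le_lt_trans wr rho1.
  by case: HF => ->.
have ir := (integrable_mkcond _ (measurable_cdisc rho)).1 ig.
rewrite integral_mkcond.
have key w0 : cmod e = 1 -> complex.Re (w0 * e^*) = 0 ->
   (\int[lam]_(t in [set t | (cmod (w0 + t%:C * e) < rho)%R]) (F (green_dir e (w0 + t%:C * e)))%:E = 0)%E.
  move=> e1 we; have [wr|wr] := ltP (cmod w0) rho; first exact: chord_integral.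
  rewrite (_ : [set t | _] = set0) ?integral_set0 //.
  apply/seteqP; split => // t /=; apply/negP; rewrite -leNgt; apply: le_trans wr _.
  rewrite -(ler_pXn2r (ltn0Sn 1)) ?nnegrE ?cmod_ge0 //.
  by rewrite cmod_line // lerDl sqr_ge0.
case: He => He.
- rewrite -integral21_prod_meas1 //; apply: integral0_eq => y _; rewrite /fubini_G.
  have h0 : complex.Re ((0 +i* y) * e^*) = 0.
    by rewrite He cReM cRe_conj cIm_conj /=; ring.
  have h1 : cmod e = 1 by rewrite He (cmod1 R).
  rewrite -(key _ h1 h0) [RHS]integral_mkcond; apply: eq_integral => x _; rewrite /patch.
  have E : 0 +i* y + x%:C * e = cplx (x, y).
    by rewrite He; apply: complexP; rewrite ?cReD ?cImD ?cReM ?cImM /=; ring.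
  rewrite E; congr (if _ then _ else _).
  apply/idP/idP => /set_mem h; apply/mem_set; first by rewrite /mkset E.
  by move: h; rewrite /mkset E.
- rewrite -integral12_prod_meas1 //; apply: integral0_eq => x _; rewrite /fubini_F.
  have h0 : complex.Re (x%:C * e^*) = 0.
    by rewrite He cReM cRe_conj cIm_conj /=; ring.
  have h1 : cmod e = 1 by rewrite He cmodE /= expr0n expr1n add0r sqrtr1.
  rewrite -(key _ h1 h0) [RHS]integral_mkcond; apply: eq_integral => y _; rewrite /patch.
  have E : x%:C + y%:C * e = cplx (x, y).
    by rewrite He; apply: complexP; rewrite ?cReD ?cImD ?cReM ?cImM /=; ring.
  rewrite E; congr (if _ then _ else _).
  apply/idP/idP => /set_mem h; apply/mem_set; first by rewrite /mkset E.
  by move: h; rewrite /mkset E.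
Qed.

(** The pointwise identity 2 d-bar = d_x + i d_y with letters for the analytic quantities: c is b +
    1, p the weight, B the kernel of exponent b + 2, u the point z, r2 is rho^2. The terms in f'
    cancel by i^2 = -1, which is the holomorphy of phi. *)
Lemma green_algebra (c p B u wc w X Y f f' r2 I : R[i]) : I * I = - 1 -> w = X + I * Y ->
  2 * c * (p * B * (r2 * u - w) * f) =
  - 2 * c * X * p * (B * (1 - u * wc)) * f +
    p * (r2 - w * wc) * (c * u * B * 1 * f + B * (1 - u * wc) * (f' * 1)) +
  I * (- 2 * c * Y * p * (B * (1 - u * wc)) * f +
    p * (r2 - w * wc) * (c * u * B * (- I) * f + B * (1 - u * wc) * (f' * I))).
Proof.
move=> HI Hw; apply/eqP; rewrite -subr_eq0; apply/eqP.
transitivity (- (I * I + 1) * (p * (r2 - w * wc) * (B * (1 - u * wc) * f' - c * u * B * f))).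
  by rewrite Hw; ring.
by rewrite HI addrC subrr oppr0 mul0r.
Qed.

(* The integrand is, up to the factor b + 1, the d-bar derivative of [green_fun],
   which vanishes on the circle |w| = rho; each partial derivative of [green_fun]
   integrates to 0 over every chord parallel to it. *)
Lemma green : cintegral Lam (cdisc rho) (fun p =>
  (pw b (sw (cplx p)))%:C * Bk (b + 1 + 1) z (cplx p) * ((rho ^+ 2)%:C * z - cplx p) * phi (cplx p)) = 0.
Proof.
have cg e w : cmod w <= rho -> ccont (green_dir e) w.
  by move=> wr; apply: ccont_green_dir; exact: le_lt_trans wr rho1.
have ig e := ccont_cintegrable (ltW rho1) (cg e).
have g0 e : e = 1 \/ e = 'i -> cintegral Lam (cdisc rho) (fun p => green_dir e (cplx p)) = 0.
  move=> He; apply: complexP; rewrite /= /Rintegral.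
    by rewrite (green_area He) //; left.
  by rewrite (green_area He) //; right.
have c0 : (2 * (b + 1))%:C != 0 :> R[i].
  by rewrite -cmod_gt0 cmod_real normr_gt0 mulf_neq0 // gt_eqF // addr_gt0.
(* After multiplication by 2 (b + 1) the integrand is [green_dir 1] plus i times [green_dir 'i], and
   both have integral 0. *)
apply: (mulfI c0); rewrite mulr0 -cintegralZ; last first.
- have cF w : cmod w <= rho -> ccont (fun w => (pw b (sw w))%:C * Bk (b + 1 + 1) z w *
      ((rho ^+ 2)%:C * z - w) * phi w) w.
    move=> wr; have w1 := le_lt_trans wr rho1.
    apply: ccontM (hol_ccont (hphi w1)); apply: ccontM; last first.
      exact: ccontB (ccont_cst _ _) (hol_ccont (hol_id _)).
    apply: ccontM; first by apply: ccont_rcont; [exact: rcont_pw|exact: ccont_sqr].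
    have [r r0 Hr] := disc_open w1.
    move=> e e0; have [s s0 Hs] := ccont_Bk (b + 1 + 1) w1 e0.
    exists (Num.min r s); first by rewrite lt_min r0.
    move=> h; rewrite lt_min => /andP[/Hr h1 /Hs].
    by rewrite !BkC // ?(ltW z1) // ?(ltW h1) //.
  exact: ccont_cintegrable (ltW rho1) cF.
- exact: measurable_cdisc.
rewrite -[RHS](addr0 0) -{1}(g0 1 (or_introl erefl)) -{1}(mulr0 'i) -{1}(g0 'i (or_intror erefl)).
rewrite -(cintegralZ (measurable_cdisc rho) 'i (ig 'i)).
rewrite -(cintegralD (measurable_cdisc rho) (ig 1) (cintegrableZ (measurable_cdisc rho) 'i (ig 'i))).
apply: eq_cintegral => p hp; have w1 : cmod (cplx p) < 1 by exact: lt_trans hp rho1.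
set w := cplx p in w1 *.
have s0 : 0 < sw w by rewrite /sw subr_gt0 ltr_pXn2r // ?nnegrE ?cmod_ge0 // ltW.
have B1 : (Bk (b + 1) w z)^* = Bk (b + 1 + 1) z w * (1 - z * w^*).
  rewrite BkC ?(ltW z1) // (BkS (b + 1)) ?(ltW w1) // divfK //.
  by rewrite -cmod_gt0 cmod_1zw_gt0 // ltW.
have wE : w = (complex.Re w)%:C + 'i * (complex.Im w)%:C.
  by apply: complexP; rewrite ?cReD ?cImD ?cReM ?cImM /=; ring.
have C e : ((b + 1)%:C * z^* * Bk (b + 1 + 1) w z * e)^* =
    (b + 1)%:C * z * Bk (b + 1 + 1) z w * e^*.
  have -> (x y u v : R[i]) : (x * y * u * v)^* = x^* * y^* * u^* * v^* by rewrite !rmorphM.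
  by rewrite conj_real BkC ?(ltW z1) // conjCK.
have D x : (- 2 * (b + 1) * x * pw b (sw w))%:C = - 2 * (b + 1)%:C * x%:C * (pw b (sw w))%:C :> R[i].
  by rewrite !rmorphM rmorphN rmorph_nat.
have S : (pw (b + 1) (sw w))%:C = (pw b (sw w))%:C * ((rho ^+ 2)%:C - w * w^*) :> R[i].
  by rewrite pwS // rmorphM [in X in _ * X]/sw rmorphB mulc_conj.
have i1 : ('i : R[i])^* = - 'i by exact: conjCi.
rewrite /green_dir !C !D B1 S rmorph1 i1.
have -> : complex.Re (w * 1) = complex.Re w by rewrite mulr1.
have -> : complex.Re (w * - 'i) = complex.Im w by rewrite cReM cReN cImN /=; ring.
have -> : (2 * (b + 1))%:C = 2 * (b + 1)%:C :> R[i] by rewrite rmorphM rmorph_nat.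
apply: green_algebra => //; exact: sqrCi.
Qed.

End direction.
End green.

(** * Evaluation at rho^2 z, the constant [kappa], and differentiation under the integral *)

Section repro.
Variable R : realType.
Implicit Types (f g : R[i] -> R[i]) (z w h : R[i]).
Local Notation lam := (@lebesgue_measure R).
Local Notation Lam := (lam \x lam)%E.

Lemma diffw_line f z (a b : R[i]) (t : R) d : hol f (a + t%:C * b) d ->
  diffw (@reals R) (fun x => f (a + x * b)) t%:C (d * b).
Proof.
move=> H; have L : diffw (@reals R) (fun x => a + x * b) t%:C b.
  have := diffwD (diffw_cst (@reals R) a t%:C)
    (diffwM (diffw_id (@reals R) t%:C) (diffw_cst (@reals R) b t%:C)).
  by rewrite mulr0 addr0 add0r mul1r.
exact: diffw_comp L H.
Qed.

(** The mean value theorem fails for complex values; it is applied to the real and imaginary parts,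
    each along the segment, whence the factor 2. *)
Lemma mvt_c f (df : R[i] -> R[i]) a b (M : R) :
  (forall t : R, 0 <= t <= 1 -> hol f (a + t%:C * (b - a)) (df (a + t%:C * (b - a)))) ->
  (forall t : R, 0 <= t <= 1 -> cmod (df (a + t%:C * (b - a))) <= M) ->
  cmod (f b - f a) <= 2 * M * cmod (b - a).
Proof.
move=> H HM.
have E0 : a + (0 : R)%:C * (b - a) = a by rewrite mul0r addr0.
have E1 : a + (1 : R)%:C * (b - a) = b by rewrite mul1r subrKC.
have key (F : R[i] -> R) : (F = (@complex.Re R) \/ F = (@complex.Im R)) ->
    `|F (f b) - F (f a)| <= M * cmod (b - a).
  move=> HF.
  have rdF (t : R) : 0 <= t <= 1 -> is_derive t 1 (fun t : R => F (f (a + t%:C * (b - a))))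
     (F (df (a + t%:C * (b - a)) * (b - a))).
    move=> /H/(diffw_line 0) D; apply/rdP.
    by case: HF => ->; [exact: (rderiv_Re D)|exact: (rderiv_Im D)].
  have [||c c01] := @MVT_segment R (fun t : R => F (f (a + t%:C * (b - a))))
     (fun t : R => F (df (a + t%:C * (b - a)) * (b - a))) 0 1 ler01.
  - by move=> t; rewrite in_itv /= => /andP[t0 t1]; apply: rdF; rewrite !ltW.
  - apply: continuous_in_subspaceT => t; rewrite inE /= in_itv /= => /rdF [D _].
    exact/differentiable_continuous/derivable1_diffP.
  rewrite E0 E1 subr0 mulr1 => ->.
  move: c01; rewrite in_itv /= => c01.
  apply: (@le_trans _ _ (cmod (df (a + c%:C * (b - a)) * (b - a)))).
    by case: HF => ->; [exact: Re_le_cmod|exact: Im_le_cmod].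
  by rewrite cmodM ler_wpM2r ?cmod_ge0 // HM.
apply: le_trans (cmod_le_ReIm _) _; rewrite cReB cImB.
have := key _ (or_introl erefl); have := key _ (or_intror erefl); lra.
Qed.

Lemma taylor2 f (df ddf : R[i] -> R[i]) u h (M : R) :
  (forall t : R, 0 <= t <= 1 -> hol f (u + t%:C * h) (df (u + t%:C * h))) ->
  (forall t : R, 0 <= t <= 1 -> hol df (u + t%:C * h) (ddf (u + t%:C * h))) ->
  (forall t : R, 0 <= t <= 1 -> cmod (ddf (u + t%:C * h)) <= M) ->
  cmod (f (u + h) - f u - df u * h) <= 4 * M * cmod h ^+ 2.
Proof.
move=> H1 H2 HM.
have M0 : 0 <= M by apply: le_trans (HM 0 _); rewrite ?cmod_ge0 // lexx ler01.
pose g w := f w - df u * w.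
have E : u + h - u = h by rewrite addrAC subrr add0r.
have -> : f (u + h) - f u - df u * h = g (u + h) - g u by rewrite /g; ring.
have := @mvt_c g (fun w => df w - df u) u (u + h) (2 * M * cmod h).
rewrite E (_ : 2 * (2 * M * cmod h) * cmod h = 4 * M * cmod h ^+ 2); last by ring.
apply.
  move=> t t01; apply: (holB (H1 t t01)).
  by have := holM (hol_cst (df u) (u + t%:C * h)) (hol_id _); rewrite mul0r add0r mulr1.
move=> t /andP[t0 t1].
have Eb : u + t%:C * h - u = t%:C * h by rewrite addrAC subrr add0r.
have := @mvt_c df ddf u (u + t%:C * h) M; rewrite Eb.
have st (s : R) : s%:C * (t%:C * h) = (s * t)%:C * h by rewrite rmorphM mulrA.
have s01 (s : R) : 0 <= s <= 1 -> 0 <= s * t <= 1 by move=> /andP[s0 s1]; apply/andP; nra.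
have P1 : forall s : R, 0 <= s <= 1 -> hol df (u + s%:C * (t%:C * h)) (ddf (u + s%:C * (t%:C * h))).
  by move=> s /s01 hs; rewrite st; exact: H2.
have P2 : forall s : R, 0 <= s <= 1 -> cmod (ddf (u + s%:C * (t%:C * h))) <= M.
  by move=> s /s01 hs; rewrite st; exact: HM.
move=> /(_ P1 P2) H; apply: le_trans H _.
rewrite ler_wpM2l ?mulr_ge0 // cmodM cmod_real ger0_norm // ler_piMl //; exact: cmod_ge0.
Qed.

(** Increments of quadratic size: n + 1 equal steps give |M 1 - M 0| <= k / (n + 1) for every n. *)
Lemma quad_const (M : R -> R[i]) (k : R) :
  (forall s t : R, 0 <= s <= 1 -> 0 <= t <= 1 -> cmod (M t - M s) <= k * (t - s) ^+ 2) -> M 1 = M 0.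
Proof.
move=> H.
have k0 : 0 <= k.
  have := H 0 1; rewrite subr0 expr1n mulr1 !lexx !ler01 => /(_ isT isT).
  by apply: le_trans; exact: cmod_ge0.
have key (n : nat) : cmod (M 1 - M 0) <= k / n.+1%:R.
  have n0 : (0 : R) < n.+1%:R by rewrite ltr0n.
  have step (j : nat) : (j <= n.+1)%N -> cmod (M (j%:R / n.+1%:R) - M 0) <= j%:R * (k / n.+1%:R ^+ 2).
    elim: j => [|j IH] jn; first by rewrite !mul0r subrr cmod0.
    have jn' : (j <= n.+1)%N by exact: ltnW.
    have -> : M (j.+1%:R / n.+1%:R) - M 0 =
      (M (j.+1%:R / n.+1%:R) - M (j%:R / n.+1%:R)) + (M (j%:R / n.+1%:R) - M 0) by ring.
    apply: le_trans (cmodD _ _) _; rewrite -[in leRHS]natr1 mulrDl mul1r addrC; apply: lerD.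
      exact: IH.
    apply: le_trans (H _ _ _ _) _.
    - by rewrite divr_ge0 //= ler_pdivrMr // mul1r ler_nat.
    - by rewrite divr_ge0 //= ler_pdivrMr // mul1r ler_nat.
    rewrite -mulrBl -natrB // subSnn mul1r exprVn //.
  have := step n.+1 (leqnn _); rewrite divff ?gt_eqF //.
  by have -> : n.+1%:R * (k / n.+1%:R ^+ 2) = k / n.+1%:R by field; rewrite gt_eqF.
apply/eqP; rewrite -subr_eq0; apply/eqP; apply: cmod_eq0; apply/eqP.
rewrite eq_le cmod_ge0 andbT; apply/ler_addgt0Pr => e e0; rewrite add0r.
have := key (Num.bound (k / e)); move/le_trans; apply.
rewrite ler_pdivrMr ?ltr0n // mulrC -ler_pdivrMr //.
apply: le_trans (ltW (archi_boundP (divr_ge0 k0 (ltW e0)))) _.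
by rewrite ler_nat.
Qed.

Lemma cpow_one (s : R) : cpow (1 : R[i]) s = 1.
Proof.
rewrite /cpow (cmod1 R) powR1 carg_atan ?ltr01 //= mul0r atan0 mulr0 cos0 sin0.
by apply: complexP; rewrite /= ?mulr1 ?mulr0.
Qed.

Lemma Bk0l (s : R) w : Bk s 0 w = 1.
Proof. by rewrite /Bk mul0r subr0 cpow_one invr1. Qed.

Section chain.
Variables (b rho : R).
Hypotheses (b0 : 0 < b) (rho0 : 0 < rho) (rho1 : rho < 1).

Let mD := @measurable_cdisc R rho.

Definition kern z w := (pw b (sw rho w))%:C * Bk (b + 1 + 1) z w.

Lemma ccont_Bkr s z w : cmod z < 1 -> cmod w < 1 -> ccont (fun w => Bk s z w) w.
Proof.
move=> z1 w1; have [r r0 Hr] := disc_open w1.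
have H : ccont (fun w => (Bk s w z)^*) w.
  by apply: ccont_conj; apply: hol_ccont (hol_Bk s w1 (ltW z1)).
move=> e e0; have [t t0 Ht] := H _ e0.
exists (Num.min r t); first by rewrite lt_min r0.
move=> h; rewrite lt_min => /andP[/Hr h1 /Ht].
by rewrite !BkC // ?(ltW z1) // ?(ltW h1).
Qed.

Lemma ccont_kern z w : cmod z < 1 -> cmod w < 1 -> ccont (kern z) w.
Proof.
move=> z1 w1; apply: ccontM (ccont_Bkr _ z1 w1).
by apply: ccont_rcont; [exact: rcont_pw|exact: ccont_sqr].
Qed.

Lemma kern_integrable z f : cmod z < 1 -> (forall w, cmod w < 1 -> ccont f w) ->
  cintegrable Lam (cdisc rho) (fun p => kern z (cplx p) * f (cplx p)).
Proof.
move=> z1 cf; apply: (@ccont_cintegrable _ rho (fun w => kern z w * f w) (ltW rho1)) => w wr.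
have w1 := le_lt_trans wr rho1.
by apply: ccontM; [exact: ccont_kern|exact: cf].
Qed.

Lemma hol_affine f d u (t : R[i]) z : hol f (u + t * z) d -> hol (fun w => f (u + t * w)) z (t * d).
Proof.
move=> H; rewrite [t * d]mulrC; apply: (@hol_comp _ f (fun w => u + t * w) z d t _ H).
have := holD (hol_cst u z) (holM (hol_cst t z) (hol_id z)).
by rewrite mul0r !add0r mulr1.
Qed.

(* M(t), the integral of kern z w * phi (zeta + t (w - zeta)) with
   zeta = rho^2 z, does not depend on t: the first-order term of M(t) - M(s)
   vanishes by [green], so that |M(t) - M(s)| = O((t - s)^2). *)
Lemma repro_const z phi phi' phi'' : cmod z < 1 ->
  (forall w, cmod w < 1 -> hol phi w (phi' w)) ->
  (forall w, cmod w < 1 -> hol phi' w (phi'' w)) ->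
  (forall w, cmod w < 1 -> ccont phi'' w) ->
  cintegral Lam (cdisc rho) (fun p => kern z (cplx p) * phi (cplx p)) =
  phi ((rho ^+ 2)%:C * z) * cintegral Lam (cdisc rho) (fun p => kern z (cplx p)).
Proof.
move=> z1 h0 h1 c2.
set zeta := (rho ^+ 2)%:C * z.
have zr : cmod zeta <= rho.
  rewrite /zeta cmodM cmod_real ger0_norm ?sqr_ge0 // expr2 -mulrA ler_piMr ?(ltW rho0) //.
  by rewrite mulr_ile1 ?cmod_ge0 // ltW.
have conv (t : R) w : 0 <= t <= 1 -> cmod w <= rho -> cmod (zeta + t%:C * (w - zeta)) <= rho.
  by move=> t01 wr; exact: disc_convex.
have conv1 (t : R) w : 0 <= t <= 1 -> cmod w < 1 -> cmod (zeta + t%:C * (w - zeta)) < 1.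
  by move=> t01 wr; apply: disc_convex1 => //; exact: le_lt_trans zr rho1.
have cphi w : cmod w < 1 -> ccont phi w by move=> /h0/hol_ccont.
have cphi' w : cmod w < 1 -> ccont phi' w by move=> /h1/hol_ccont.
pose M (t : R) := cintegral Lam (cdisc rho)
  (fun p => kern z (cplx p) * phi (zeta + t%:C * (cplx p - zeta))).
have lin (t : R) w : zeta + t%:C * (w - zeta) = (1 - t)%:C * zeta + t%:C * w.
  by rewrite rmorphB rmorph1; ring.
have aff f (df : R[i] -> R[i]) (t : R) w : 0 <= t <= 1 -> cmod w < 1 ->
   (forall w, cmod w < 1 -> hol f w (df w)) ->
   hol (fun w => f (zeta + t%:C * (w - zeta))) w (t%:C * df (zeta + t%:C * (w - zeta))).
  move=> t01 w1 hf; have := hf _ (conv1 t w t01 w1); rewrite lin => H.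
  have := hol_affine H; apply: hol_ext ltr01 _ => h _; by rewrite lin.
have iM (t : R) : 0 <= t <= 1 -> cintegrable Lam (cdisc rho)
   (fun p => kern z (cplx p) * phi (zeta + t%:C * (cplx p - zeta))).
  move=> t01; apply: (@kern_integrable z (fun w => phi (zeta + t%:C * (w - zeta)))) => // w w1.
  exact: hol_ccont (aff _ _ t w t01 w1 h0).
have [B2 B20 HB2] : exists2 B, 0 <= B & forall w, cmod w <= rho -> cmod (phi'' w) <= B.
  by apply: ccont_bounded => w wr; apply: c2; exact: le_lt_trans wr rho1.
have [Bk0 Bk00 HBk] : exists2 B, 0 <= B & forall w, cmod w <= rho -> cmod (kern z w) <= B.
  by apply: ccont_bounded => w wr; apply: ccont_kern => //; exact: le_lt_trans wr rho1.
have Lf := Lam_cdisc_lty (ltW rho1).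
have quad : forall s t : R, 0 <= s <= 1 -> 0 <= t <= 1 ->
    cmod (M t - M s) <= 2 * (Bk0 * (16 * B2) * fine (Lam (cdisc rho))) * (t - s) ^+ 2.
  move=> s t s01 t01.
  (* The t-derivative of phi(zeta + t (w - zeta)) at t = s is (w - zeta) psi(w), with psi
     holomorphic in w. This is what [green] annihilates. *)
  pose psi w := phi' (zeta + s%:C * (w - zeta)).
  have hpsi w : cmod w < 1 -> hol psi w (s%:C * phi'' (zeta + s%:C * (w - zeta))).
    by move=> w1; exact: aff.
  have cpsi w : cmod w < 1 -> ccont (fun w => s%:C * phi'' (zeta + s%:C * (w - zeta))) w.
    move=> w1; apply: ccontM (ccont_cst _ _) _.
    move=> e /(c2 _ (conv1 s w s01 w1))[r r0 Hr]; exists r => // h hr.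
    have -> : zeta + s%:C * (w + h - zeta) = (zeta + s%:C * (w - zeta)) + s%:C * h by ring.
    apply: Hr; rewrite cmodM cmod_real; apply: le_lt_trans hr.
    by move/andP: s01 => [s0 s1]; rewrite ger0_norm // ler_piMl // cmod_ge0.
  have G := green b0 rho0 rho1 z1 hpsi cpsi.
  have iG : cintegrable Lam (cdisc rho) (fun p => kern z (cplx p) * (((rho ^+ 2)%:C * z - cplx p) * psi (cplx p))).
    apply: (@kern_integrable z (fun w => ((rho ^+ 2)%:C * z - w) * psi w)) => // w w1.
    apply: ccontM (hol_ccont (hpsi w w1)); exact: ccontB (ccont_cst _ _) (hol_ccont (hol_id _)).
  have G' : cintegral Lam (cdisc rho) (fun p => kern z (cplx p) * (((rho ^+ 2)%:C * z - cplx p) * psi (cplx p))) = 0.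
    by rewrite -[RHS]G; apply: eq_cintegral => p _; rewrite /kern /sw; ring.
  have iD := cintegrableB mD (iM t t01) (iM s s01).
  have iZ := cintegrableZ mD (t - s)%:C iG.
  have E : M t - M s = cintegral Lam (cdisc rho) (fun p =>
     (kern z (cplx p) * phi (zeta + t%:C * (cplx p - zeta)) - kern z (cplx p) * phi (zeta + s%:C * (cplx p - zeta)))
     + (t - s)%:C * (kern z (cplx p) * (((rho ^+ 2)%:C * z - cplx p) * psi (cplx p)))).
    rewrite cintegralD // cintegralZ // G' mulr0 addr0 cintegralB //; [exact: iM|exact: iM].
  rewrite E (_ : 2 * (Bk0 * (16 * B2) * fine (Lam (cdisc rho))) * (t - s) ^+ 2 =
     2 * ((Bk0 * (16 * B2) * (t - s) ^+ 2) * fine (Lam (cdisc rho)))); last by ring.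
  apply: cmod_cintegral_bounded => //; first exact: cintegrableD.
  move=> p hp; have w1 : cmod (cplx p) < 1 by exact: lt_trans hp rho1.
  set w := cplx p in hp w1 *; set u := zeta + s%:C * (w - zeta).
  have -> : kern z w * phi (zeta + t%:C * (w - zeta)) - kern z w * phi u +
     (t - s)%:C * (kern z w * (((rho ^+ 2)%:C * z - w) * psi w)) =
     kern z w * (phi (u + (t - s)%:C * (w - zeta)) - phi u - phi' u * ((t - s)%:C * (w - zeta))).
    have -> : u + (t - s)%:C * (w - zeta) = zeta + t%:C * (w - zeta) by rewrite /u rmorphB; ring.
    by rewrite /psi -/u -/zeta; ring.
  rewrite cmodM -!mulrA; apply: ler_pM; rewrite ?cmod_ge0 //; first exact: HBk (ltW hp).
  have r01 (r : R) : 0 <= r <= 1 -> u + r%:C * ((t - s)%:C * (w - zeta)) =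
      zeta + (s + r * (t - s))%:C * (w - zeta) /\ 0 <= s + r * (t - s) <= 1.
    move=> /andP[r0 r1]; move/andP: s01 => [s0 s1]; move/andP: t01 => [t0 t1]; split.
      by rewrite /u !(rmorphD,rmorphM,rmorphB); ring.
    by apply/andP; nra.
  apply: le_trans (@taylor2 phi phi' phi'' u _ B2 _ _ _) _.
  - by move=> r /r01 [-> r1]; apply: h0; exact: conv1.
  - by move=> r /r01 [-> r1]; apply: h1; exact: conv1.
  - by move=> r /r01 [-> r1]; apply: HB2; apply: conv => //; exact: ltW.
  rewrite cmodM cmod_real exprMn real_normK ?num_real //.
  have wz : cmod (w - zeta) ^+ 2 <= 4.
    have : cmod (w - zeta) <= 2.
      by apply: le_trans (cmodB _ _) (le_trans (lerD (ltW w1) (le_trans zr (ltW rho1))) _); lra.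
    by have := cmod_ge0 (w - zeta); move: (cmod (w - zeta)) => x x0 x2; nra.
  (* One factor 4 comes from [taylor2], the other from |w - zeta|^2 <= 4. *)
  rewrite (_ : 16 * (B2 * (t - s) ^+ 2) = 4 * B2 * ((t - s) ^+ 2 * 4)); last by ring.
  by rewrite ler_wpM2l ?mulr_ge0 // ler_wpM2l ?sqr_ge0.
have := quad_const quad; rewrite /M => M10.
transitivity (M 1).
  by apply: eq_cintegral => p _; rewrite mul1r subrKC.
rewrite /M M10 -cintegralZ //; last first.
  have := @kern_integrable z (fun=> 1) z1 (fun w _ => ccont_cst 1 w).
  by apply: (eq_cintegrable mD) => p _; rewrite mulr1.
by apply: eq_cintegral => p _; rewrite mul0r addr0 mulrC.
Qed.

Definition kappa := Rintegral Lam (cdisc rho) (fun p => pw b (sw rho (cplx p))).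

Lemma int_kern0 : cintegral Lam (cdisc rho) (fun p => kern 0 (cplx p)) = kappa%:C.
Proof.
have E p : cdisc rho p -> kern 0 (cplx p) = (pw b (sw rho (cplx p)))%:C.
  by move=> _; rewrite /kern Bk0l mulr1.
rewrite (eq_cintegral _ E); apply: complexP => //=.
by rewrite Rintegral_cst // mul0r.
Qed.

(** At the point 0 the kernel is the bare weight, and [repro_const] there, applied to w -> (1 - w
    conj(z))^(-b-2), gives [kappa]. The conjugate of that integral is the integral of [kern z]. *)
Lemma int_kern z : cmod z < 1 ->
  cintegral Lam (cdisc rho) (fun p => kern z (cplx p)) = kappa%:C.
Proof.
move=> z1; have z1' := ltW z1.
have s w (w1 : cmod w < 1) := hol_Bk (b + 1 + 1) w1 z1'.
have o1 : cmod (0 : R[i]) < 1 by rewrite cmod0.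
have := @repro_const 0 (fun w => Bk (b + 1 + 1) w z)
   (fun w => (b + 1 + 1)%:C * z^* * Bk (b + 1 + 1 + 1) w z)
   (fun w => (b + 1 + 1)%:C * z^* * ((b + 1 + 1 + 1)%:C * z^* * Bk (b + 1 + 1 + 1 + 1) w z)) o1.
rewrite int_kern0 mulr0.
rewrite Bk0l mul1r => H.
rewrite -[RHS]conj_real -H; last 3 first.
- by move=> w w1; exact: hol_Bk.
- by move=> w w1; apply: holZ; exact: hol_Bk.
- move=> w w1; apply: ccontM (ccont_cst _ _) _; apply: ccontM (ccont_cst _ _) _.
  exact: hol_ccont (hol_Bk _ w1 z1').
rewrite -cintegral_conj //; last first.
  apply: (@kern_integrable 0 (fun w => Bk (b + 1 + 1) w z)) => // w w1.
  exact: hol_ccont (hol_Bk _ w1 z1').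
apply: eq_cintegral => p hp.
have w1 : cmod (cplx p) < 1 by exact: lt_trans hp rho1.
rewrite /kern Bk0l mulr1 rmorphM.
congr (_ * _); first exact/esym/conj_real.
by apply/esym/BkC => //; exact: ltW.
Qed.

Lemma repro z phi phi' phi'' : cmod z < 1 ->
  (forall w, cmod w < 1 -> hol phi w (phi' w)) ->
  (forall w, cmod w < 1 -> hol phi' w (phi'' w)) ->
  (forall w, cmod w < 1 -> ccont phi'' w) ->
  cintegral Lam (cdisc rho) (fun p => kern z (cplx p) * phi (cplx p)) =
  phi ((rho ^+ 2)%:C * z) * kappa%:C.
Proof. by move=> z1 h0 h1 c2; rewrite (repro_const z1 h0 h1 c2) int_kern. Qed.

Lemma kern_pw_integrable : Lam.-integrable (cdisc rho) (fun p => (pw b (sw rho (cplx p)))%:E).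
Proof.
have o1 : cmod (0 : R[i]) < 1 by rewrite cmod0.
have [H _] := @kern_integrable 0 (fun=> 1) o1 (fun w _ => ccont_cst 1 w).
apply: eq_integrable H; rewrite ?measurable_cdisc // => p _.
by rewrite mulr1 /kern Bk0l mulr1.
Qed.

(** The square with half-side 1/8 has area 1/16, and on it rho^2 - |w|^2 >= 1/4 - 1/32 > 1/8. The
    bound does not depend on rho, as the passage rho -> 1 requires. *)
Lemma kappa_lower : 2^-1 <= rho -> 16^-1 * pw b (8^-1) <= kappa.
Proof.
move=> rho2; rewrite /kappa.
pose S := (`](- 8^-1 : R), 8^-1[%classic `*` `](- 8^-1 : R), 8^-1[%classic) : set (plane R).
have mS : measurable S by apply: measurableX.
have SD : S `<=` cdisc rho.
  move=> p [/= ]; rewrite !in_itv /= => /andP[a1 a2] /andP[a3 a4].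
  apply: le_lt_trans (cmod_le_ReIm _) _ => /=.
  have h1 : `|p.1| < 8^-1 by rewrite ltr_norml a1.
  have h2 : `|p.2| < 8^-1 by rewrite ltr_norml a3.
  lra.
pose I8 : set R := `](- 8^-1 : R), 8^-1[%classic.
have l8 : lam I8 = (4^-1)%:E.
  have h : - 8^-1 < 8^-1 :> R by lra.
  rewrite /I8 lebesgue_measure_itv /= lte_fin h.
  by rewrite -EFinD; congr EFin; lra.
have LS : Lam S = (16^-1)%:E.
  have E : (lam I8 * lam I8)%E = (16^-1)%:E.
    by rewrite l8 -EFinM; congr EFin; lra.
  by rewrite -E /S product_measure1E.
have pwS p : S p -> pw b (8^-1) <= pw b (sw rho (cplx p)).
  move=> Sp; apply: le_pw => //; rewrite /sw cmod_sqr /=.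
  move: Sp => [/= ]; rewrite !in_itv /= => /andP[a1 a2] /andP[a3 a4].
  by nra.
have mD' := measurable_cdisc rho.
have ik := kern_pw_integrable.
rewrite /Rintegral -lee_fin fineK; last exact: integrable_fin_num ik.
apply: (@le_trans _ _ (\int[Lam]_(p in S) (pw b (8^-1))%:E)%E).
  by rewrite integral_cst // [X in (_ <= _ * X)%E]LS -EFinM mulrC.
apply: (@le_trans _ _ (\int[Lam]_(p in S) (pw b (sw rho (cplx p)))%:E)%E).
  apply: ge0_le_integral => //.
  - by move=> p _; rewrite lee_fin pw_ge0.
  - apply: measurable_funS SD _ => //; exact: measurable_int ik.
apply: ge0_subset_integral => //; first exact: measurable_int ik.
by move=> p _; rewrite lee_fin pw_ge0.
Qed.

Lemma kappa_gt0 : 2^-1 <= rho -> 0 < kappa.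
Proof.
move=> /kappa_lower; apply: lt_le_trans; rewrite mulr_gt0 ?invr_gt0 //.
by rewrite pw_gt0E ?powR_gt0 ?invr_gt0.
Qed.

End chain.

Section hol_integral.
Context (d : measure_display) (T : measurableType d) (mu : {measure set T -> \bar R}).
Variables (D : set T) (mD : measurable D).

Lemma cintegrable_cmod (g : T -> R[i]) : cintegrable mu D g ->
  mu.-integrable D (fun p => (`|complex.Re (g p)| + `|complex.Im (g p)|)%:E).
Proof.
move=> [g1 g2]; under eq_fun do rewrite EFinD.
by apply: integrableD => //; exact: integrable_norm.
Qed.

Lemma cintegrableM (f g : T -> R[i]) k : cintegrable mu D g ->
  measurable_fun D (fun x => complex.Re (f x)) -> measurable_fun D (fun x => complex.Im (f x)) ->
  (forall x, D x -> cmod (f x) <= k) -> cintegrable mu D (fun x => f x * g x).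
Proof.
move=> [g1 g2] m1 m2 fk.
have key (F G : R[i] -> R) : (forall z, `|F z| <= cmod z) -> measurable_fun D (fun x => F (f x)) ->
    mu.-integrable D (fun x => (G (g x))%:E) -> mu.-integrable D (fun x => (F (f x) * G (g x))%:E).
  move=> HF mF iG; have := integrableMr mD mF _ iG; apply; exists k; split; first exact: num_real.
  by move=> r kr x Dx; apply: le_trans (HF _) (le_trans (fk x Dx) (ltW kr)).
split.
  under eq_fun do rewrite cReM EFinB.
  apply: integrableB => //; apply: key => //; [exact: Re_le_cmod|exact: Im_le_cmod].
under eq_fun do rewrite cImM EFinD.
apply: integrableD => //; apply: key => //; [exact: Re_le_cmod|exact: Im_le_cmod].
Qed.

(** Differentiation under the integral sign from a remainder that is O(|h|^2) uniformly in the
    integration variable, so that no dominated convergence is called for. *)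
Lemma hol_cintegral (k : R[i] -> T -> R[i]) (k' : T -> R[i]) (g : T -> R[i]) z r M :
  0 < r -> cintegrable mu D g ->
  (forall h, cmod h < r -> cintegrable mu D (fun p => k (z + h) p * g p)) ->
  cintegrable mu D (fun p => k' p * g p) ->
  (forall h p, cmod h < r -> D p -> cmod (k (z + h) p - k z p - k' p * h) <= M * cmod h ^+ 2) ->
  hol (fun z => cintegral mu D (fun p => k z p * g p)) z (cintegral mu D (fun p => k' p * g p)).
Proof.
move=> r0 ig ik ik' H.
have ig' := cintegrable_cmod ig.
set G := Rintegral mu D (fun p => `|complex.Re (g p)| + `|complex.Im (g p)|).
have G0 : 0 <= G by apply: Rintegral_ge0 => p _; exact: addr_ge0.
pose C := 2 * (`|M| * G) + 1.
have C0 : 0 < C by rewrite /C ltr_wpDl // mulr_ge0 // mulr_ge0.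
move=> e e0; exists (Num.min r (e / C)); first by rewrite lt_min r0 divr_gt0.
move=> h; rewrite lt_min => /andP[hr he].
have ikz : cintegrable mu D (fun p => k z p * g p).
  by have := ik 0; rewrite cmod0 addr0; apply.
have ih := ik h hr.
have iZ := cintegrableZ mD h ik'.
have i1 := cintegrableB mD ih ikz.
rewrite [X in _ - _ - X]mulrC -cintegralZ // -cintegralB // -cintegralB //.
have := @cmod_cintegral _ _ _ mu D mD _ (fun p => `|M| * cmod h ^+ 2 * (`|complex.Re (g p)| + `|complex.Im (g p)|))
   (cintegrableB mD i1 iZ) (integrableZlr mD _ ig').
rewrite RintegralZl // -/G => /(_ _)/le_trans; apply.
  move=> p Dp; have -> : k (z + h) p * g p - k z p * g p - h * (k' p * g p) =
     (k (z + h) p - k z p - k' p * h) * g p by ring.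
  rewrite cmodM; apply: ler_pM; rewrite ?cmod_ge0 ?cmod_le_ReIm //.
  apply: le_trans (H h p hr Dp) _; rewrite ler_wpM2r ?sqr_ge0 //; exact: ler_norm.
have h0 := cmod_ge0 h.
have -> : 2 * (`|M| * cmod h ^+ 2 * G) = (2 * (`|M| * G)) * cmod h * cmod h by ring.
rewrite ler_wpM2r //; apply: (@le_trans _ _ (C * cmod h)).
  by rewrite ler_wpM2r // /C lerDl.
by rewrite mulrC -ler_pdivlMr // ltW.
Qed.

End hol_integral.

Lemma hol_unique f z d d' : hol f z d -> hol f z d' -> d = d'.
Proof. by move=> /cderivableP[_ <-] /cderivableP[_ <-]. Qed.

(** For |h| < (1 - |z|) / 2 the segment from z to z + h keeps the distance (1 - |z|) / 2 from the
    circle, which bounds the second derivative uniformly in w. *)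
Lemma Bk_taylor s z w h : 0 <= s -> cmod z < 1 -> cmod w <= 1 -> cmod h < (1 - cmod z) / 2 ->
  cmod (Bk s (z + h) w - Bk s z w - s%:C * w^* * Bk (s + 1) z w * h) <=
  4 * (s * (s + 1) * ((1 - cmod z) / 2) `^ (- (s + 1 + 1))) * cmod h ^+ 2.
Proof.
move=> s0 z1 w1 hz.
have zh (t : R) : 0 <= t <= 1 -> cmod (z + t%:C * h) <= cmod z + (1 - cmod z) / 2.
  move=> /andP[t0 t1]; apply: le_trans (cmodD _ _) _; rewrite lerD2l cmodM cmod_real ger0_norm //.
  by apply: le_trans (ltW hz); rewrite ler_piMl // cmod_ge0.
have zh1 (t : R) : 0 <= t <= 1 -> cmod (z + t%:C * h) < 1.
  by move=> /zh H; apply: le_lt_trans H _; lra.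
apply: (@taylor2 (fun z => Bk s z w) (fun z => s%:C * w^* * Bk (s + 1) z w)
  (fun z => s%:C * w^* * ((s + 1)%:C * w^* * Bk (s + 1 + 1) z w))).
- by move=> t t01; apply: hol_Bk => //; exact: zh1.
- by move=> t t01; apply: holZ; apply: hol_Bk => //; exact: zh1.
move=> t t01; have s1 : 0 <= s + 1 by rewrite addr_ge0.
rewrite !cmodM !cmod_real cmod_conj !ger0_norm //.
have B := cmod_Bk_le (addr_ge0 s1 ler01) (zh1 t t01) w1.
have c0 := cmod_ge0 w; have b0 := cmod_ge0 (Bk (s + 1 + 1) (z + t%:C * h) w).
have B' : cmod (Bk (s + 1 + 1) (z + t%:C * h) w) <= ((1 - cmod z) / 2) `^ (- (s + 1 + 1)).
  apply: le_trans B _; rewrite !powRN lef_pV2 ?posrE ?powR_gt0 ?subr_gt0 ?zh1 //; last by lra.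
  apply: ge0_ler_powR; rewrite ?nnegrE ?subr_ge0 ?(ltW (zh1 t t01)) //.
  - by rewrite addr_ge0.
  - lra.
  by have := zh t t01; lra.
apply: (@le_trans _ _ (s * 1 * ((s + 1) * 1 * cmod (Bk (s + 1 + 1) (z + t%:C * h) w)))).
  apply: ler_pM; rewrite ?mulr_ge0 //; first by rewrite ler_wpM2l.
  by rewrite ler_wpM2r // ler_wpM2l.
by rewrite !mulr1 mulrA ler_wpM2l // mulr_ge0.
Qed.

Lemma Bk_measurable s z : cmod z < 1 ->
  measurable_fun (cdisc 1) (fun p => complex.Re (Bk s z (cplx p))) /\
  measurable_fun (cdisc 1) (fun p => complex.Im (Bk s z (cplx p))).
Proof.
by move=> z1; apply: (@disc_measurable_ReIm _ 1 (fun w => Bk s z w) (lexx _)) => w w1; exact: ccont_Bkr.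
Qed.

Lemma hol_Bk_integral (mu : {measure set (plane R) -> \bar R}) D s (g : plane R -> R[i]) z :
  measurable D -> D `<=` cdisc 1 -> 0 <= s -> cintegrable mu D g -> cmod z < 1 ->
  hol (fun z => cintegral mu D (fun p => Bk s z (cplx p) * g p)) z
    (cintegral mu D (fun p => (s%:C * (cplx p)^* * Bk (s + 1) z (cplx p)) * g p)).
Proof.
move=> mD D1 s0 ig z1.
have r0 : 0 < (1 - cmod z) / 2 by rewrite divr_gt0 // subr_gt0.
have cB t u : 0 <= t -> cmod u < 1 -> cintegrable mu D (fun p => Bk t u (cplx p) * g p).
  move=> t0 u1; have [m1 m2] := Bk_measurable t u1.
  apply: (@cintegrableM _ _ _ D mD _ _ ((1 - cmod u) `^ (- t))) => //.
  - by apply: measurable_funS D1 m1; exact: measurable_cdisc.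
  - by apply: measurable_funS D1 m2; exact: measurable_cdisc.
  by move=> p /D1 p1; apply: cmod_Bk_le => //; exact: ltW.
apply: (hol_cintegral mD r0 ig).
- move=> h hr; apply: cB => //; apply: le_lt_trans (cmodD _ _) _; lra.
- have cc : cintegrable mu D (fun p => (cplx p)^* * (Bk (s + 1) z (cplx p) * g p)).
    have [m1 m2] := @disc_measurable_ReIm _ 1 (fun w => w^*) (lexx _)
       (fun w _ => ccont_conj (hol_ccont (hol_id w))).
    apply: (@cintegrableM _ _ _ D mD _ _ 1); first by apply: cB => //; rewrite addr_ge0.
    - by apply: measurable_funS D1 m1; exact: measurable_cdisc.
    - by apply: measurable_funS D1 m2; exact: measurable_cdisc.
    by move=> p /D1 p1; rewrite cmod_conj ltW.
  apply: (eq_cintegrable mD _ (cintegrableZ mD s%:C cc)) => p _; ring.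
- move=> h p hr /D1 p1; apply: Bk_taylor => //; exact: ltW.
Qed.

End repro.

(** * Derivatives of holomorphic functions are holomorphic; regularity of the kernel L_b *)

Section smooth.
Variable R : realType.
Implicit Types (f g : R[i] -> R[i]) (z w h : R[i]).
Local Notation lam := (@lebesgue_measure R).
Local Notation Lam := (lam \x lam)%E.

(** Both sides of phi(r z) = c P(z) are differentiated and the derivatives compared, by
    uniqueness. *)
Lemma dilate_step (phi phi' P P' : R[i] -> R[i]) (c : R[i]) (r : R) : 0 < r -> r <= 1 ->
  (forall z, cmod z < 1 -> phi (r%:C * z) = c * P z) ->
  (forall z, cmod z < 1 -> hol phi z (phi' z)) ->
  (forall z, cmod z < 1 -> hol P z (P' z)) ->
  forall z, cmod z < 1 -> phi' (r%:C * z) = c / r%:C * P' z.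
Proof.
move=> r0 r1 E hphi hP z z1.
have rz : cmod (r%:C * z) < 1.
  by rewrite cmodM cmod_real gtr0_norm //; apply: le_lt_trans z1; rewrite ler_piMl // cmod_ge0.
have rc : r%:C != 0 :> R[i] by rewrite -cmod_gt0 cmod_real normr_gt0 gt_eqF.
have H1 : hol (fun w => phi (0 + r%:C * w)) z (r%:C * phi' (r%:C * z)).
  by apply: hol_affine; rewrite add0r; exact: hphi.
have [s s0 Hs] := disc_open z1.
have H2 : hol (fun w => phi (0 + r%:C * w)) z (c * P' z).
  by apply: hol_ext s0 _ (holZ c (hP z z1)) => h /Hs hz; rewrite add0r E.
have := hol_unique H1 H2 => Eq.
by apply: (mulfI rc); rewrite Eq; field.
Qed.

(* A second primitive of [f] satisfies the hypotheses of [repro], which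
   exhibits a dilate of it as an integral of the smooth kernel [Bk]. *)
Lemma hol_deriv f df : (forall z, cmod z < 1 -> hol f z (df z)) ->
  forall z, cmod z < 1 -> exists d, hol df z d.
Proof.
move=> hf z0 z01.
(* With c = |z0| the inequality c < rho^2 reads (1 - c) (9 - c) > 0; hence z0 lies in the image of
   the disc under the dilation by rho^2. *)
pose rho := (3 + cmod z0) / 4.
have c0 := cmod_ge0 z0.
have rho0 : 0 < rho by rewrite divr_gt0 // ltr_wpDr.
have rho1 : rho < 1 by rewrite /rho; lra.
have rho2 : 2^-1 <= rho by rewrite /rho; lra.
have rr : cmod z0 < rho ^+ 2 by rewrite /rho; nra.
have r0 : 0 < rho ^+ 2 by rewrite exprn_gt0.
have r1 : rho ^+ 2 <= 1 by rewrite expr_le1 // ltW.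
have rc : (rho ^+ 2)%:C != 0 :> R[i] by rewrite -cmod_gt0 cmod_real normr_gt0 gt_eqF.
have h1 := fun (z : R[i]) (z1 : cmod z < 1) => @hol_prim R f df z z1 hf.
have h2 := fun (z : R[i]) (z1 : cmod z < 1) => @hol_prim R (seg f 0) f z z1 h1.
set F1 := seg f 0 in h1 h2; set F2 := seg F1 0 in h2.
have b0 : 0 < (1 : R) by [].
have k0 : kappa 1 rho != 0 by rewrite gt_eqF // kappa_gt0.
have kc : (kappa 1 rho)%:C != 0 :> R[i] by rewrite -cmod_gt0 cmod_real normr_gt0.
(* The weight exponent is 1, so the kernel has exponent 3. Each derivative in z brings down a factor
   conj(w), collected in [g n], and raises the exponent by one. Two derivatives lead from the second
   primitive to f, a third to df, and a fourth shows that df is differentiable. *)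
pose g (n : nat) (p : plane R) : R[i] := (cplx p)^* ^+ n * ((pw 1 (sw rho (cplx p)))%:C * F2 (cplx p)).
have mD := @measurable_cdisc R rho.
have ig n : cintegrable Lam (cdisc rho) (g n).
  apply: (@ccont_cintegrable _ rho (fun w => w^* ^+ n * ((pw 1 (sw rho w))%:C * F2 w)) (ltW rho1)) => w wr.
  have w1 := le_lt_trans wr rho1.
  apply: ccontM.
    elim: n => [|n IH]; first exact: ccont_cst.
    have := ccontM (ccont_conj (hol_ccont (hol_id w))) IH.
    by move=> H e /H[r r0' Hr]; exists r => // h /Hr; rewrite !exprS.
  apply: ccontM (hol_ccont (h2 w w1)).
  by apply: ccont_rcont; [exact: rcont_pw|exact: ccont_sqr].
pose P (n : nat) z := cintegral Lam (cdisc rho) (fun p => Bk (3 + n%:R) z (cplx p) * g n p).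
have D1 : @cdisc R rho `<=` cdisc 1 by move=> p /= hp; exact: lt_trans hp rho1.
have hP n z : cmod z < 1 -> hol (P n) z ((3 + n%:R)%:C * P n.+1 z).
  move=> z1; have s0 : 0 <= 3 + n%:R :> R by rewrite addr_ge0.
  have := hol_Bk_integral mD D1 s0 (ig n) z1; rewrite -/(P n).
  have -> // : cintegral Lam (cdisc rho) (fun p => (3 + n%:R)%:C * (cplx p)^* * Bk (3 + n%:R + 1) z (cplx p) * g n p)
    = (3 + n%:R)%:C * P n.+1 z.
  have [m1 m2] := @Bk_measurable R (3 + n.+1%:R) z z1.
  rewrite /P -cintegralZ //; last first.
    apply: (@cintegrableM _ _ _ Lam _ mD _ (g n.+1) ((1 - cmod z) `^ (- (3 + n.+1%:R)))) => //.
    - by apply: measurable_funS D1 m1; exact: measurable_cdisc.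
    - by apply: measurable_funS D1 m2; exact: measurable_cdisc.
    move=> p /D1 p1; apply: cmod_Bk_le; rewrite ?addr_ge0 //; exact: ltW.
  apply: eq_cintegral => p _; have -> : 3 + n%:R + 1 = 3 + n.+1%:R :> R by rewrite -addrA natr1.
  rewrite /g exprS; ring.
have E0 z : cmod z < 1 -> F2 ((rho ^+ 2)%:C * z) = (kappa 1 rho)%:C^-1 * P 0%N z.
  move=> z1; have cf w (w1 : cmod w < 1) := hol_ccont (hf w w1).
  have := repro b0 rho0 rho1 z1 h2 h1 cf.
  have -> : cintegral Lam (cdisc rho) (fun p => kern 1 rho z (cplx p) * F2 (cplx p)) = P 0%N z.
    apply: eq_cintegral => p _; rewrite /kern /g expr0 mul1r addr0.
    have -> : 1 + 1 + 1 = 3 :> R by ring.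
    by ring.
  by move=> ->; rewrite [RHS]mulrC mulfK.
have E1 := dilate_step r0 r1 E0 h2 (hP 0%N).
have [c1 E1'] : exists c, forall z, cmod z < 1 -> F1 ((rho ^+ 2)%:C * z) = c * P 1%N z.
  by eexists => z /E1 ->; rewrite mulrA.
have E2 := dilate_step r0 r1 E1' h1 (hP 1%N).
have [c2 E2'] : exists c, forall z, cmod z < 1 -> f ((rho ^+ 2)%:C * z) = c * P 2%N z.
  by eexists => z /E2 ->; rewrite mulrA.
have E3 := dilate_step r0 r1 E2' hf (hP 2%N).
have [c3 E3'] : exists c, forall z, cmod z < 1 -> df ((rho ^+ 2)%:C * z) = c * P 3%N z.
  by eexists => z /E3 ->; rewrite mulrA.
pose q := (rho ^+ 2)%:C^-1 * z0.
have q1 : cmod q < 1 by rewrite cmodM cmodV cmod_real gtr0_norm // mulrC ltr_pdivrMr // mul1r.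
have Hq := holZ c3 (hP 3%N q q1).
have Hq' : hol (fun w => c3 * P 3%N w) (0 + (rho ^+ 2)%:C^-1 * z0) (c3 * ((3 + 3)%:C * P 4%N q)).
  by rewrite add0r.
have := hol_affine Hq'.
set rimdist := _ * (c3 * _) => H; exists rimdist.
have s0 : 0 < rho ^+ 2 - cmod z0 by rewrite subr_gt0.
apply: hol_ext s0 _ H => h hh.
have zh : cmod (z0 + h) < rho ^+ 2 by apply: le_lt_trans (cmodD _ _) _; lra.
rewrite add0r -E3'; first by rewrite mulVKf.
by rewrite cmodM cmodV cmod_real gtr0_norm // mulrC ltr_pdivrMr // mul1r.
Qed.

Lemma LkerE b z w : Lker b z w = seg (fun x => Bk (b + 2) x w) 0 z.
Proof.
rewrite /seg /C01 /Lker; apply: eq_cintegral => t _.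
by rewrite subr0 add0r.
Qed.

Lemma cont_disc_Bk s w : cmod w <= 1 -> cont_disc (fun x => Bk s x w).
Proof. by move=> w1 x x1; exact: hol_ccont (hol_Bk s x1 w1). Qed.

(** By Goursat the increment of L_b(., w) from z to z + h is the integral of its integrand over that
    segment, which differs from the value at z times h by a quadratic term. *)
Lemma Lker_taylor b z w h : 0 <= b -> cmod z < 1 -> cmod w <= 1 -> cmod h < (1 - cmod z) / 2 ->
  cmod (Lker b (z + h) w - Lker b z w - Bk (b + 2) z w * h) <=
  4 * ((b + 2) * ((1 - cmod z) / 2) `^ (- (b + 2 + 1))) * cmod h ^+ 2.
Proof.
move=> b0 z1 w1 hz.
have zh (t : R) : 0 <= t <= 1 -> cmod (z + t%:C * h) <= cmod z + (1 - cmod z) / 2.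
  move=> /andP[t0 t1]; apply: le_trans (cmodD _ _) _; rewrite lerD2l cmodM cmod_real ger0_norm //.
  by apply: le_trans (ltW hz); rewrite ler_piMl // cmod_ge0.
have zh1 (t : R) : 0 <= t <= 1 -> cmod (z + t%:C * h) < 1.
  by move=> /zh H; apply: le_lt_trans H _; lra.
have z1h : cmod (z + h) < 1 by have := zh1 1; rewrite mul1r lexx ler01; apply.
have cB := cont_disc_Bk (b + 2) w1.
have cc : cont_disc (fun=> Bk (b + 2) z w) by move=> u _; exact: ccont_cst.
rewrite !LkerE (@prim_incr R _ (fun x => (b + 2)%:C * w^* * Bk (b + 2 + 1) x w)) //; last first.
  by move=> u u1; exact: hol_Bk.
have E : z + h - z = h by rewrite addrAC subrr add0r.
have -> : Bk (b + 2) z w * h = seg (fun=> Bk (b + 2) z w) z (z + h) by rewrite seg_cst E mulrC.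
rewrite -segB //; set M := _ * _ `^ _.
have := @seg_bound R (fun x => Bk (b + 2) x w - Bk (b + 2) z w) z (z + h) (2 * M * cmod h).
rewrite E (_ : 2 * (2 * M * cmod h) * cmod h = 4 * M * cmod h ^+ 2); last by ring.
apply => //.
  by move=> u u1; apply: ccontB; [exact: cB|exact: cc].
move=> t t01; have /andP[t0 t1] := t01.
have Eb : z + t%:C * h - z = t%:C * h by rewrite addrAC subrr add0r.
have := @mvt_c R (fun x => Bk (b + 2) x w) (fun x => (b + 2)%:C * w^* * Bk (b + 2 + 1) x w)
  z (z + t%:C * h) M; rewrite Eb.
have st (s : R) : s%:C * (t%:C * h) = (s * t)%:C * h by rewrite rmorphM mulrA.
have s01 (s : R) : 0 <= s <= 1 -> 0 <= s * t <= 1 by move=> /andP[s0 s1]; apply/andP; nra.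
have b20 : 0 <= b + 2 by rewrite addr_ge0.
have b30 : 0 <= b + 2 + 1 by rewrite !addr_ge0.
have M0 : 0 <= M by rewrite mulr_ge0 // powR_ge0.
move=> H; apply: le_trans (H _ _) _.
- by move=> s /s01 hs; rewrite st; apply: hol_Bk => //; exact: zh1.
- move=> s /s01 hs; rewrite st !cmodM cmod_real cmod_conj ger0_norm //.
  apply: ler_pM; rewrite ?mulr_ge0 ?cmod_ge0 //; first by rewrite ler_piMr.
  apply: le_trans (cmod_Bk_le b30 (zh1 _ hs) w1) _.
  rewrite !powRN lef_pV2 ?posrE ?powR_gt0 ?subr_gt0 ?zh1 //; last by lra.
  apply: ge0_ler_powR; rewrite ?nnegrE ?subr_ge0 ?(ltW (zh1 _ hs)) //; first by lra.
  by have := zh _ hs; lra.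
apply: ler_wpM2l; first by rewrite mulr_ge0.
rewrite cmodM cmod_real ger0_norm // ler_piMl //; exact: cmod_ge0.
Qed.

Lemma cmod_Lker b z w : 0 <= b -> cmod z < 1 -> cmod w <= 1 ->
  cmod (Lker b z w) <= 2 * (1 - cmod z) `^ (- (b + 2)).
Proof.
move=> b0 z1 w1; rewrite LkerE.
have b20 : 0 <= b + 2 by rewrite addr_ge0.
have o1 : cmod (0 : R[i]) < 1 by rewrite (cmod0 R).
apply: le_trans (@seg_bound R _ 0 z ((1 - cmod z) `^ (- (b + 2))) (cont_disc_Bk _ w1) o1 z1 _) _.
  move=> t /andP[t0 t1]; rewrite add0r subr0.
  have tz : cmod (t%:C * z) <= cmod z.
    by rewrite cmodM cmod_real ger0_norm // ler_piMl // cmod_ge0.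
  have tz1 := le_lt_trans tz z1.
  apply: le_trans (cmod_Bk_le b20 tz1 w1) _.
  rewrite !powRN lef_pV2 ?posrE ?powR_gt0 ?subr_gt0 //.
  by apply: ge0_ler_powR; rewrite ?nnegrE ?subr_ge0 ?(ltW z1) ?(ltW tz1) // lerD2l lerN2.
by rewrite subr0 ler_piMr ?mulr_ge0 ?powR_ge0 // ltW.
Qed.

(** By [BkC] the integrand is the conjugate of a holomorphic function of w. Its Lipschitz constant
    near w depends only on 1 - |w|, so it survives the integration over [0, z]. *)
Lemma ccont_Lker b z w : 0 <= b -> cmod z < 1 -> cmod w < 1 -> ccont (Lker b z) w.
Proof.
move=> b0 z1 w1.
have b20 : 0 <= b + 2 by rewrite addr_ge0.
have b30 : 0 <= b + 2 + 1 by rewrite !addr_ge0.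
set M := (b + 2) * ((1 - cmod w) / 2) `^ (- (b + 2 + 1)).
have M0 : 0 <= M by rewrite mulr_ge0 // powR_ge0.
have key h x : cmod h < (1 - cmod w) / 2 -> cmod x < 1 ->
    cmod (Bk (b + 2) x (w + h) - Bk (b + 2) x w) <= 2 * M * cmod h.
  move=> hw x1.
  have zh (t : R) : 0 <= t <= 1 -> cmod (w + t%:C * h) <= cmod w + (1 - cmod w) / 2.
    move=> /andP[t0 t1]; apply: le_trans (cmodD _ _) _; rewrite lerD2l cmodM cmod_real ger0_norm //.
    by apply: le_trans (ltW hw); rewrite ler_piMl // cmod_ge0.
  have zh1 (t : R) : 0 <= t <= 1 -> cmod (w + t%:C * h) < 1.
    by move=> /zh H; apply: le_lt_trans H _; lra.
  have z1h : cmod (w + h) < 1 by have := zh1 1; rewrite mul1r lexx ler01; apply.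
  have x1' := ltW x1.
  rewrite -(BkC (b + 2) z1h x1') -(BkC (b + 2) w1 x1').
  have -> (u v : R[i]) : u^* - v^* = (u - v)^* by rewrite rmorphB.
  rewrite cmod_conj.
  have := @mvt_c R (fun v => Bk (b + 2) v x) (fun v => (b + 2)%:C * x^* * Bk (b + 2 + 1) v x)
    w (w + h) M.
  have Eb : w + h - w = h by rewrite addrAC subrr add0r.
  rewrite Eb; apply.
  - by move=> s hs; apply: hol_Bk => //; exact: zh1.
  - move=> s hs; rewrite !cmodM cmod_real cmod_conj ger0_norm //.
    apply: ler_pM; rewrite ?mulr_ge0 ?cmod_ge0 //; first by rewrite ler_piMr.
    apply: le_trans (cmod_Bk_le b30 (zh1 _ hs) x1') _.
    rewrite !powRN lef_pV2 ?posrE ?powR_gt0 ?subr_gt0 ?zh1 //; last by lra.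
    apply: ge0_ler_powR; rewrite ?nnegrE ?subr_ge0 ?(ltW (zh1 _ hs)) //; first by lra.
    by have := zh _ hs; lra.
move=> e e0.
have k0 : 0 < 4 * M + 1 by rewrite ltr_wpDl // mulr_ge0.
exists (Num.min ((1 - cmod w) / 2) (e / (4 * M + 1))).
  by rewrite lt_min !divr_gt0 // subr_gt0.
move=> h; rewrite lt_min => /andP[hw he].
have z1h : cmod (w + h) < 1 by apply: le_lt_trans (cmodD _ _) _; lra.
have o1 : cmod (0 : R[i]) < 1 by rewrite (cmod0 R).
have c1 := cont_disc_Bk (b + 2) (ltW z1h); have c2 := cont_disc_Bk (b + 2) (ltW w1).
rewrite !LkerE -segB //.
apply: le_trans (@seg_bound R _ 0 z (2 * M * cmod h) _ o1 z1 _) _.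
- by move=> u u1; apply: ccontB; [exact: c1|exact: c2].
- by move=> t t01; apply: key => //; exact: disc_convex1.
rewrite subr0; apply: (@le_trans _ _ (2 * (2 * M * cmod h))).
  apply: ler_piMr; last exact: ltW.
  exact: mulr_ge0 (ler0n _ 2) (mulr_ge0 (mulr_ge0 (ler0n _ 2) M0) (cmod_ge0 h)).
have : cmod h * (4 * M + 1) <= e by rewrite -ler_pdivlMr // ltW.
have := cmod_ge0 h; nra.
Qed.

Lemma hol_Lker_integral (mu : {measure set (plane R) -> \bar R}) D b (g : plane R -> R[i]) z :
  measurable D -> D `<=` cdisc 1 -> 0 <= b -> cintegrable mu D g -> cmod z < 1 ->
  hol (fun z => cintegral mu D (fun p => Lker b z (cplx p) * g p)) z
    (cintegral mu D (fun p => Bk (b + 2) z (cplx p) * g p)).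
Proof.
move=> mD D1 b0 ig z1.
have r0 : 0 < (1 - cmod z) / 2 by rewrite divr_gt0 // subr_gt0.
have b20 : 0 <= b + 2 by rewrite addr_ge0.
apply: (hol_cintegral mD r0 ig).
- move=> h hr; have zh : cmod (z + h) < 1 by apply: le_lt_trans (cmodD _ _) _; lra.
  have [m1 m2] := @disc_measurable_ReIm _ 1 (Lker b (z + h)) (lexx _) (fun w => ccont_Lker b0 zh).
  apply: (@cintegrableM _ _ _ _ D mD _ _ (2 * (1 - cmod (z + h)) `^ (- (b + 2)))) => //.
  - by apply: measurable_funS D1 m1; exact: measurable_cdisc.
  - by apply: measurable_funS D1 m2; exact: measurable_cdisc.
  by move=> p /D1 p1; apply: cmod_Lker => //; exact: ltW.
- have [m1 m2] := Bk_measurable (b + 2) z1.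
  apply: (@cintegrableM _ _ _ _ D mD _ _ ((1 - cmod z) `^ (- (b + 2)))) => //.
  - by apply: measurable_funS D1 m1; exact: measurable_cdisc.
  - by apply: measurable_funS D1 m2; exact: measurable_cdisc.
  by move=> p /D1 p1; apply: cmod_Bk_le => //; exact: ltW.
- by move=> h p hr /D1 p1; apply: Lker_taylor => //; exact: ltW.
Qed.

End smooth.

(** * Integrals of powers of the distance to the circle *)

Section dyadic.
Variable R : realType.

(** Gives the index of the geometric ring to which a point belongs; Bernoulli's inequality shows
    that the powers of c exceed x. *)
Lemma pow_bracket (c x : R) : 1 < c -> 1 <= x -> exists n : nat, c ^+ n <= x < c ^+ n.+1.
Proof.
move=> c1 x1; have c0 : 0 < c by exact: lt_trans c1.
have ber n : 1 + n%:R * (c - 1) <= c ^+ n.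
  elim: n => [|n IH]; first by rewrite mul0r addr0 expr0.
  rewrite exprS; apply: (@le_trans _ _ (c * (1 + n%:R * (c - 1)))); last by rewrite ler_pM2l.
  rewrite -natr1; set m := n%:R; have m0 : 0 <= m by exact: ler0n.
  rewrite -subr_ge0; have -> : c * (1 + m * (c - 1)) - (1 + (m + 1) * (c - 1)) = m * (c - 1) ^+ 2 by ring.
  by rewrite mulr_ge0 ?sqr_ge0.
have ex : exists n : nat, x < c ^+ n.
  have c10 : 0 < c - 1 by rewrite subr_gt0.
  exists (Num.bound (x / (c - 1))); apply: lt_le_trans (ber _).
  have /archi_boundP H : 0 <= x / (c - 1) by rewrite divr_ge0 ?ltW //; exact: lt_le_trans x1.
  rewrite ltr_pdivrMr // in H; apply: (lt_trans H); rewrite ltrDr //.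
case: (ex_minnP ex) => m Hm Hmin.
case: m Hm Hmin => [|m] Hm Hmin.
  by move: Hm; rewrite expr0 ltNge x1.
exists m; rewrite Hm andbT leNgt; apply/negP => /Hmin; by rewrite ltnn.
Qed.

(** The form in which all ring decompositions are used: every point is served by one term of the
    series, so the rings need neither be disjoint nor measurable themselves. *)
Lemma int_le_series d (T : measurableType d) (mu : {measure set T -> \bar R}) (U : set T)
  (f : T -> R) (g : nat -> T -> R) (b : nat -> R) (S : R) : measurable U ->
  measurable_fun U f -> (forall n, measurable_fun U (g n)) ->
  (forall x, U x -> 0 <= f x) -> (forall n x, U x -> 0 <= g n x) ->
  (forall x, U x -> exists n, f x <= g n x) ->
  (forall n, (\int[mu]_(x in U) (g n x)%:E <= (b n)%:E)%E) ->
  (forall N, \sum_(0 <= n < N) b n <= S) -> (\int[mu]_(x in U) (f x)%:E <= S%:E)%E.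
Proof.
move=> mU mf mg f0 g0 fg gb bS.
have mgE n : measurable_fun U (fun x => (g n x)%:E) by apply/measurable_EFinP.
apply: (@le_trans _ _ (\int[mu]_(x in U) (\sum_(n <oo) (g n x)%:E))%E).
  apply: ge0_le_integral => //.
  - by apply/measurable_EFinP.
  - by apply: ge0_emeasurable_sum => // n x Ux _; rewrite lee_fin g0.
  - move=> x Ux; have [n fn] := fg x Ux.
    apply: (@le_trans _ _ (g n x)%:E); first by rewrite lee_fin.
    rewrite (@nneseriesD1 _ _ n) // ?leeDl //.
      by apply: nneseries_ge0 => k _ _; rewrite lee_fin g0.
    by move=> k _; rewrite lee_fin g0.
rewrite integral_nneseries //.
apply: lime_le.
  by apply: is_cvg_nneseries => n _ _; apply: integral_ge0 => x Ux; rewrite lee_fin g0.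
apply: nearW => N; apply: (@le_trans _ _ (\sum_(0 <= n < N) (b n)%:E)%E).
  by apply: lee_sum => n _; exact: gb.
by rewrite sumEFin lee_fin.
Qed.

Lemma geo_half N : \sum_(0 <= n < N) (2^-1 : R) ^+ n <= 2.
Proof.
have -> : \sum_(0 <= n < N) (2^-1 : R) ^+ n = 2 - 2 * 2^-1 ^+ N.
  elim: N => [|N IH]; first by rewrite big_geq // expr0 mulr1 subrr.
  by rewrite big_nat_recr //= IH exprS; field.
by rewrite gerBl mulr_ge0 // exprn_ge0.
Qed.

Section tonelli.
Context d1 d2 (T1 : measurableType d1) (T2 : measurableType d2).
Variables (m1 : {sigma_finite_measure set T1 -> \bar R}) (m2 : {sigma_finite_measure set T2 -> \bar R}).
Variables (A : set T1) (B : set T2) (f : T1 -> T2 -> R) (mA : measurable A) (mB : measurable B).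
Hypothesis mf : measurable_fun (A `*` B) (fun p => f p.1 p.2).
Hypothesis f0 : forall x y, A x -> B y -> 0 <= f x y.

(** Measurability and positivity are only known on the rectangle; the extension by 0 makes Tonelli's
    theorem on the whole product applicable. *)
Let F := ((fun p : T1 * T2 => (f p.1 p.2)%:E) \_ (A `*` B)).

Let mF : measurable_fun setT F.
Proof. by apply/(measurable_restrictT _ _).1; [exact: measurableX | apply/measurable_EFinP]. Qed.

Let F0 p : (0 <= F p)%E.
Proof. by rewrite /F patchE; case: ifPn => //; rewrite inE => -[Ap Bp]; rewrite lee_fin; exact: f0. Qed.

Lemma tonelli_on1 :
  (\int[(m1 \x m2)%E]_(p in A `*` B) (f p.1 p.2)%:E = \int[m1]_(x in A) \int[m2]_(y in B) (f x y)%:E)%E.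
Proof.
rewrite [LHS]integral_mkcond [RHS]integral_mkcond fubini_tonelli1 //.
apply: eq_integral => x _; rewrite patchE /fubini_F; case: ifPn => [|/negP]; rewrite inE => Ax.
  rewrite [RHS]integral_mkcond; apply: eq_integral => y _; rewrite /F !patchE.
  case: ifPn => [|/negP]; rewrite inE => Axy; first by case: Axy => _ By; rewrite ifT ?inE.
  by rewrite ifF //; apply/negP; rewrite inE => By; apply: Axy.
rewrite -[RHS](integral0 m2 setT); apply: eq_integral => y _.
by rewrite patchE ifF //; apply/negP; rewrite inE => -[].
Qed.

Lemma tonelli_on2 :
  (\int[(m1 \x m2)%E]_(p in A `*` B) (f p.1 p.2)%:E = \int[m2]_(y in B) \int[m1]_(x in A) (f x y)%:E)%E.
Proof.
rewrite [LHS]integral_mkcond [RHS]integral_mkcond fubini_tonelli2 //.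
apply: eq_integral => y _; rewrite patchE /fubini_G; case: ifPn => [|/negP]; rewrite inE => By.
  rewrite [RHS]integral_mkcond; apply: eq_integral => x _; rewrite /F !patchE.
  case: ifPn => [|/negP]; rewrite inE => Axy; first by case: Axy => Ax _; rewrite ifT ?inE.
  by rewrite ifF //; apply/negP; rewrite inE => Ax; apply: Axy.
rewrite -[RHS](integral0 m1 setT); apply: eq_integral => x _.
by rewrite patchE ifF //; apply/negP; rewrite inE => -[].
Qed.

Lemma tonelli_on :
  (\int[m1]_(x in A) \int[m2]_(y in B) (f x y)%:E = \int[m2]_(y in B) \int[m1]_(x in A) (f x y)%:E)%E.
Proof. by rewrite -tonelli_on1 tonelli_on2. Qed.

Lemma measurable_tonelli1 : measurable_fun A (fun x => \int[m2]_(y in B) (f x y)%:E)%E.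
Proof.
have := measurable_fun_fubini_tonelli_F (m2 := m2) F mF F0 => /(measurable_funS measurableT (@subsetT _ A)).
apply: eq_measurable_fun => x; rewrite inE => Ax; rewrite /fubini_F [RHS]integral_mkcond.
apply: eq_integral => y _; rewrite /F !patchE.
case: ifPn => [|/negP]; rewrite inE => Axy; first by case: Axy => _ By; rewrite ifT ?inE.
by rewrite ifF //; apply/negP; rewrite inE => By; apply: Axy.
Qed.

Lemma measurable_tonelli2 : measurable_fun B (fun y => \int[m1]_(x in A) (f x y)%:E)%E.
Proof.
have := measurable_fun_fubini_tonelli_G (m1 := m1) F mF F0 => /(measurable_funS measurableT (@subsetT _ B)).
apply: eq_measurable_fun => y; rewrite inE => By; rewrite /fubini_G [RHS]integral_mkcond.
apply: eq_integral => x _; rewrite /F !patchE.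
case: ifPn => [|/negP]; rewrite inE => Axy; first by case: Axy => Ax _; rewrite ifT ?inE.
by rewrite ifF //; apply/negP; rewrite inE => Ax; apply: Axy.
Qed.

End tonelli.

End dyadic.

(** * The integral of |x - c|^(-1/2) over an interval *)

Section onedim.
Variable R : realType.
Local Notation lam := (@lebesgue_measure R).

(* [rsqrt 0 = 0]. *)
Definition rsqrt (s : R) := (Num.sqrt s)^-1.

Lemma rsqrt_ge0 s : 0 <= rsqrt s. Proof. by rewrite invr_ge0 sqrtr_ge0. Qed.

Lemma rsqrt_gt0 s : 0 < s -> 0 < rsqrt s. Proof. by move=> s0; rewrite invr_gt0 sqrtr_gt0. Qed.

Lemma rsqrt_le s t : 0 < s -> s <= t -> rsqrt t <= rsqrt s.
Proof. by move=> s0 st; rewrite lef_pV2 ?posrE ?sqrtr_gt0 ?(lt_le_trans s0 st) // ler_wsqrtr. Qed.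

Lemma qsM c s : 0 <= c -> rsqrt (c * s) = rsqrt c * rsqrt s.
Proof. by move=> c0; rewrite /rsqrt sqrtrM // invfM. Qed.

Lemma rsqrt_sqr c : 0 <= c -> rsqrt (c ^+ 2) = c^-1.
Proof. by move=> c0; rewrite /rsqrt sqrtr_sqr ger0_norm. Qed.

Lemma measurable_funV_ge0 d (T : measurableType d) (D : set T) (f : T -> R) :
  (forall x, 0 <= f x) -> measurable_fun D f -> measurable_fun D (fun x => (f x)^-1).
Proof.
move=> f0 mf; have -> : (fun x => (f x)^-1) = (fun x => f x `^ (-1)).
  by apply/funext => x; rewrite powR_inv1.
exact: (measurableT_comp (measurable_powR (-1))).
Qed.

Lemma measurable_rsqrt d (T : measurableType d) (D : set T) (f : T -> R) :
  measurable_fun D f -> measurable_fun D (fun x => rsqrt (f x)).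
Proof.
move=> mf; apply: measurable_funV_ge0; first by move=> x; exact: sqrtr_ge0.
have := measurableT_comp (continuous_measurable_fun (@sqrt_continuous R)) mf.
exact.
Qed.

Lemma int_indic_le d (T : measurableType d) (mu : {measure set T -> \bar R}) (U A : set T) k :
  0 <= k -> measurable U -> measurable A ->
  (\int[mu]_(x in U) (k * \1_A x)%:E <= k%:E * mu (A `&` U))%E.
Proof.
move=> k0 mU mA; rewrite -integral_indic // -ge0_integralZl_EFin //.
by apply/measurable_EFinP; exact: measurable_indic.
Qed.

Lemma lebesgue_itv_oo (a e : R) : 0 <= e -> lam `]a - e, a + e[ = (2 * e)%:E.
Proof.
move=> e0; rewrite lebesgue_measure_itv /= lte_fin.
have H : ((a + e)%:E + (- (a - e))%:E)%E = (2 * e)%:E by rewrite -EFinD; congr EFin; ring.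
case: ifPn => [_|]; first exact: H.
rewrite -leNgt => h; have -> : e = 0 by apply/le_anti; rewrite e0 andbT; lra.
by rewrite mulr0.
Qed.

Lemma int_rsqrt (a c d : R) : 0 < d ->
  (\int[lam]_(x in `](a - d)%R, (a + d)%R[) (rsqrt `|x - c|)%:E <= (20 * Num.sqrt d)%:E)%E.
Proof.
move=> d0; set s := Num.sqrt d; have s0 : 0 < s by rewrite sqrtr_gt0.
have ds : d = s ^+ 2 by rewrite sqr_sqrtr // ltW.
pose A n := `]c - d / 4 ^+ n * 2, c + d / 4 ^+ n * 2[%classic : set R.
(* The term of index 0 takes care of |x - c| >= d, the term of index m + 1 of the ring of radius
   about d / 4^m. The integrals are 2 s and at most 8 s / 2^m, in total at most 18 s. *)
pose g n x := if n is m.+1 then 2 ^+ m.+1 / s * \1_(A m) x else s^-1 * \1_(setT : set R) x.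
pose b n := if n is m.+1 then 8 * s * 2^-1 ^+ m else 2 * s.
have g0 n : 0 <= (if n is m.+1 then 2 ^+ m.+1 / s else s^-1).
  by case: n => [|n]; rewrite ?divr_ge0 ?invr_ge0 ?exprn_ge0 // ltW.
have mq : measurable_fun `]a - d, (a + d)%R[ (fun x : R => rsqrt `|x - c|).
  apply: measurable_rsqrt; apply: measurableT_comp => //.
  by apply: measurable_funB.
have mA n : measurable (A n) by exact: measurable_itv.
apply: (@int_le_series R _ _ lam `]a - d, (a + d)%R[ _ g b) => //.
- by move=> [|n]; rewrite /g; apply: measurable_funM => //; apply: measurable_indic => //; exact: measurable_itv.
- by move=> x _; exact: rsqrt_ge0.
- by move=> [|n] x _; rewrite /g mulr_ge0 // ?(g0 0%N) ?(g0 n.+1).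
(* At x = c the integrand is 0 by the convention on [rsqrt]. *)
- move=> x _; have [xc|xc] := eqVneq `|x - c| 0.
    by exists 0%N; rewrite xc /rsqrt sqrtr0 invr0 mulr_ge0 // (g0 0%N).
  have u0 : 0 < `|x - c| by rewrite lt_neqAle eq_sym xc normr_ge0.
  have [dx|dx] := leP d `|x - c|.
    by exists 0%N; rewrite /g indicE in_setT mulr1; apply: rsqrt_le.
  have x1 : 1 <= d / `|x - c| by rewrite ler_pdivlMr // mul1r ltW.
  have c14 : 1 < 4 :> R by rewrite ltr1n.
  have [n /andP[H1 H2]] := pow_bracket c14 x1.
  have p0 m : 0 < (4 : R) ^+ m by rewrite exprn_gt0.
  exists n.+1; rewrite /g indicE mem_set ?mulr1; last first.
    rewrite /A /= in_itv /= -ltr_distlC distrC.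
    rewrite ler_pdivlMr // in H1; apply: (@le_lt_trans _ _ (d / 4 ^+ n)).
      by rewrite ler_pdivlMr // mulrC.
    by rewrite ltr_pMr ?ltr1n // divr_gt0.
  rewrite ltr_pdivrMr // in H2.
  apply: (@le_trans _ _ (rsqrt (d / 4 ^+ n.+1))).
    by apply: rsqrt_le; rewrite ?divr_gt0 // ler_pdivrMr // mulrC ltW.
  have -> : d / 4 ^+ n.+1 = (s / 2 ^+ n.+1) ^+ 2.
    by rewrite ds expr_div_n -exprM mulnC exprM; congr (_ / _ ^+ _); ring.
  by rewrite rsqrt_sqr ?divr_ge0 ?exprn_ge0 ?(ltW s0) // invf_div.
- move=> [|n]; rewrite /g /b.
    apply: (le_trans (@int_indic_le _ _ lam `]a - d, a + d[%classic setT s^-1 (g0 0%N) (measurable_itv _) measurableT)).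
    rewrite [X in (_ * X)%E](_ : _ = (2 * d)%:E); last by rewrite setTI; exact: lebesgue_itv_oo (ltW d0).
    rewrite -EFinM lee_fin ds.
    by have -> : s^-1 * (2 * s ^+ 2) = 2 * s by field; rewrite gt_eqF.
  apply: (le_trans (@int_indic_le _ _ lam `]a - d, a + d[%classic (A n) _ (g0 n.+1) (measurable_itv _) (mA n))).
  apply: (@le_trans _ _ ((2 ^+ n.+1 / s)%:E * lam (A n))%E).
    apply: lee_wpmul2l; first by rewrite lee_fin (g0 n.+1).
    by apply: le_measure; rewrite ?inE //; [apply: measurableI; exact: measurable_itv | exact: measurable_itv].
  rewrite [X in (_ * X)%E](_ : _ = (2 * (d / 4 ^+ n * 2))%:E); last first.
    by apply: lebesgue_itv_oo; rewrite ?mulr_ge0 ?(ltW d0) ?invr_ge0 ?exprn_ge0.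
  rewrite -EFinM lee_fin ds.
  rewrite (_ : 4 = 2 ^+ 2) -?exprM ?[(2 * n)%N]mulnC ?exprM; last by ring.
  rewrite exprVn exprS; set P := 2 ^+ n.
  have P0 : P != 0 by rewrite gt_eqF // exprn_gt0.
  by rewrite le_eqVlt; apply/orP; left; apply/eqP; field; rewrite P0 gt_eqF.
- case=> [|N]; first by rewrite big_geq // mulr_ge0 // ltW.
  rewrite big_nat_recl //= -mulr_sumr.
  have := geo_half R N; set S := \sum_(_ <= _ < _) _ => HS.
  apply: (@le_trans _ _ (2 * s + 8 * s * 2)); last by lra.
  by rewrite lerD2l ler_wpM2l // mulr_ge0 // ltW.
Qed.

End onedim.

(** * The integral of (1 - |w|)^(-1/2) over small discs *)

Section balls.
Variable R : realType.
Local Notation lam := (@lebesgue_measure R).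
Local Notation Lam := (lam \x lam)%E.
Implicit Types (zt z w : R[i]) (p q : plane R).

Definition rimdist p := 1 - cmod (cplx p).

Definition rimball zt (dl : R) : set (plane R) := [set p | cmod (cplx p) < 1 /\ cmod (zt - cplx p) < dl].

Lemma measurable_rimdist D : measurable_fun D rimdist.
Proof.
apply: (@measurable_funS _ _ _ _ setT) => //; apply: measurable_funB => //; exact: measurable_cmod.
Qed.

Lemma measurable_cdist zt : measurable_fun setT (fun p => cmod (zt - cplx p)).
Proof.
have -> : (fun p => cmod (zt - cplx p)) =
  (fun p : plane R => Num.sqrt ((complex.Re zt - p.1) ^+ 2 + (complex.Im zt - p.2) ^+ 2)).
  by apply/funext => -[x y]; rewrite cmodE cReB cImB.
apply: (measurableT_comp (continuous_measurable_fun (@sqrt_continuous R))).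
by apply: measurable_funD; apply: measurable_funX; apply: measurable_funB.
Qed.

Lemma measurable_rimball zt dl : measurable (rimball zt dl).
Proof.
have -> : rimball zt dl = cdisc 1 `&` (fun p => cmod (zt - cplx p)) @^-1` `]-oo, dl[.
  by apply/seteqP; split => p /=; rewrite /cdisc /rimball /= in_itv /=.
apply: measurableI; first exact: measurable_cdisc.
by rewrite -[X in measurable X]setTI; apply: measurable_cdist.
Qed.

Let centered_itv (c dl : R) : set R := `]c - dl, c + dl[%classic.

(** The singular set is a graph over the second coordinate, later an arc of the circle; integrating
    first across the graph reduces to [int_rsqrt]. *)
Lemma int_rect1 (a1 a2 dl : R) (c : R -> R) : 0 < dl -> measurable_fun setT c ->
  (\int[Lam]_(p in centered_itv a1 dl `*` centered_itv a2 dl) (rsqrt `|p.1 - c p.2|)%:E <= (40 * dl * Num.sqrt dl)%:E)%E.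
Proof.
move=> dl0 mc.
have mI a : measurable (centered_itv a dl) by exact: measurable_itv.
have mf : measurable_fun (centered_itv a1 dl `*` centered_itv a2 dl) (fun p => rsqrt `|p.1 - c p.2|).
  apply: (measurable_funS _ (@subsetT _ _)) => //.
  apply: measurable_rsqrt; apply: measurableT_comp => //; apply: measurable_funB => //.
  exact: (measurableT_comp mc measurable_snd).
have f0 x y : 0 <= rsqrt `|x - c y| by exact: rsqrt_ge0.
rewrite (@tonelli_on2 _ _ _ _ _ lam lam _ _ (fun x y => rsqrt `|x - c y|)) //.
apply: (@le_trans _ _ (\int[lam]_(y in centered_itv a2 dl) (20 * Num.sqrt dl)%:E)%E).
  apply: ge0_le_integral => //.
  - exact: measurable_itv.
  - by move=> x _; apply: integral_ge0 => y _; rewrite lee_fin rsqrt_ge0.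
  - by apply: (@measurable_tonelli2 _ _ _ _ _ lam _ _ (fun x y => rsqrt `|x - c y|)) => //; exact: measurable_itv.
  - by move=> y _; exact: int_rsqrt.
rewrite (@integral_cst _ _ _ lam (centered_itv a2 dl) (measurable_itv _)) [X in (_ * X)%E](_ : _ = (2 * dl)%:E); last by exact: lebesgue_itv_oo (ltW dl0).
by rewrite -EFinM lee_fin le_eqVlt; apply/orP; left; apply/eqP; ring.
all: exact: measurable_itv.
Qed.

Lemma int_rect2 (a1 a2 dl : R) (c : R -> R) : 0 < dl -> measurable_fun setT c ->
  (\int[Lam]_(p in centered_itv a1 dl `*` centered_itv a2 dl) (rsqrt `|p.2 - c p.1|)%:E <= (40 * dl * Num.sqrt dl)%:E)%E.
Proof.
move=> dl0 mc.
have mI a : measurable (centered_itv a dl) by exact: measurable_itv.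
have mf : measurable_fun (centered_itv a1 dl `*` centered_itv a2 dl) (fun p => rsqrt `|p.2 - c p.1|).
  apply: (measurable_funS _ (@subsetT _ _)) => //.
  apply: measurable_rsqrt; apply: measurableT_comp => //; apply: measurable_funB => //.
  exact: (measurableT_comp mc measurable_fst).
have f0 x y : 0 <= rsqrt `|y - c x| by exact: rsqrt_ge0.
rewrite (@tonelli_on1 _ _ _ _ _ lam lam _ _ (fun x y => rsqrt `|y - c x|)) //.
apply: (@le_trans _ _ (\int[lam]_(y in centered_itv a1 dl) (20 * Num.sqrt dl)%:E)%E).
  apply: ge0_le_integral => //.
  - exact: measurable_itv.
  - by move=> x _; apply: integral_ge0 => y _; rewrite lee_fin rsqrt_ge0.
  - by apply: (@measurable_tonelli1 _ _ _ _ _ lam _ _ (fun x y => rsqrt `|y - c x|)) => //; exact: measurable_itv.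
  - by move=> y _; exact: int_rsqrt.
rewrite (@integral_cst _ _ _ lam (centered_itv a1 dl) (measurable_itv _)) [X in (_ * X)%E](_ : _ = (2 * dl)%:E); last by exact: lebesgue_itv_oo (ltW dl0).
by rewrite -EFinM lee_fin le_eqVlt; apply/orP; left; apply/eqP; ring.
all: exact: measurable_itv.
Qed.

(** With X = sqrt (1 - y^2) one has (1 - r) (1 + r) = (X - |x|) (X + |x|), so for |x| >= 1/4 the
    radial distance to the circle is comparable to the horizontal one. The factor 1/16 is generous
    and a perfect square. *)
Lemma rsqrt_chord (x y r : R) : 0 <= r -> r < 1 -> r ^+ 2 = x ^+ 2 + y ^+ 2 -> 4^-1 <= `|x| ->
  rsqrt (1 - r) <= 4 * (rsqrt `|x - Num.sqrt (1 - y ^+ 2)| + rsqrt `|x - - Num.sqrt (1 - y ^+ 2)|).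
Proof.
move=> r0 r1 rE x4; set X := Num.sqrt _.
have y1 : 0 <= 1 - y ^+ 2 by nra.
have X2 : X ^+ 2 = 1 - y ^+ 2 by rewrite sqr_sqrtr.
have X0 : 0 <= X by rewrite sqrtr_ge0.
have X1 : X <= 1 by nra.
have ax2 : `|x| ^+ 2 = x ^+ 2 by rewrite real_normK ?num_real.
have xX : `|x| < X by nra.
set u := X - `|x|; have u0 : 0 < u by rewrite subr_gt0.
have ur : 16^-1 * u <= 1 - r.
  have : (1 - r) * (1 + r) = u * (X + `|x|) by rewrite /u; nra.
  by rewrite /u in u0 *; nra.
have H : rsqrt (1 - r) <= 4 * rsqrt u.
  apply: le_trans (rsqrt_le _ ur) _; first by rewrite mulr_gt0 // invr_gt0.
  have -> : 16^-1 = (4^-1) ^+ 2 :> R by rewrite -[16]/((4 * 4)%N%:R) natrM; field.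
  by rewrite qsM ?exprn_ge0 ?invr_ge0 // rsqrt_sqr ?invr_ge0 // invrK.
apply: (le_trans H); rewrite ler_pM2l //.
case: (leP 0 x) => xs.
  have -> : u = `|x - X| by move: u0; rewrite /u (ger0_norm xs) distrC => u0; rewrite ger0_norm // ltW.
  by rewrite lerDl rsqrt_ge0.
have -> : u = `|x - - X|.
  by move: u0; rewrite /u (ltr0_norm xs) !opprK addrC => u0; rewrite ger0_norm // ltW.
by rewrite lerDr rsqrt_ge0.
Qed.

(** Away from the circle both sides are bounded: the left by 2, and [rsqrt] on the right is at least
    rsqrt 4 = 1/2. *)
Lemma rsqrt_center (x y r : R) : 0 <= r -> r ^+ 2 = x ^+ 2 + y ^+ 2 -> `|x| < 4^-1 -> `|y| < 4^-1 ->
  rsqrt (1 - r) <= 4 * rsqrt `|x - Num.sqrt (1 - y ^+ 2)|.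
Proof.
move=> r0 rE; rewrite !ltr_norml => /andP[x1 x2] /andP[y1 y2]; set X := Num.sqrt _.
have y3 : 0 <= 1 - y ^+ 2 by nra.
have X2 : X ^+ 2 = 1 - y ^+ 2 by rewrite sqr_sqrtr.
have X0 : 0 <= X by rewrite sqrtr_ge0.
have X1 : X <= 1 by nra.
have X3 : 2^-1 <= X by nra.
have r2 : r <= 2^-1 by nra.
have e1 : rsqrt (4 : R) = 2^-1 by rewrite -(@rsqrt_sqr R 2) //; congr rsqrt; rewrite expr2 -natrM.
have e2 : rsqrt (4^-1 : R) = 2.
  by rewrite -[2 in RHS]invrK -(@rsqrt_sqr R 2^-1) ?invr_ge0 //; congr rsqrt; rewrite exprVn expr2 -natrM.
apply: (@le_trans _ _ (4 * 2^-1)).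
  have -> : 4 * 2^-1 = 2 :> R by field.
  by rewrite -e2; apply: rsqrt_le; lra.
rewrite ler_pM2l // -e1; apply: rsqrt_le.
  by rewrite normr_gt0 subr_eq0; apply/eqP => xX; lra.
rewrite ler_norml; apply/andP; split; lra.
Qed.

(** The ball lies in a square of half-side dl. Where |x| >= 1/4 the circle is viewed as two graphs
    over y, where |y| >= 1/4 as two graphs over x. *)
Lemma int_rimball zt dl : 0 < dl ->
  (\int[Lam]_(p in rimball zt dl) (rsqrt (rimdist p))%:E <= (640 * dl * Num.sqrt dl)%:E)%E.
Proof.
move=> dl0.
pose X (y : R) := Num.sqrt (1 - y ^+ 2).
have mX : measurable_fun setT X.
  apply: (measurableT_comp (continuous_measurable_fun (@sqrt_continuous R))).
  by apply: measurable_funB => //; exact: measurable_funX.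
have mNX : measurable_fun setT (fun y => - X y) by exact: measurableT_comp.
pose Q := centered_itv (complex.Re zt) dl `*` centered_itv (complex.Im zt) dl.
have mQ : measurable Q by apply: measurableX; exact: measurable_itv.
pose g p := (rsqrt `|p.1 - X p.2| + rsqrt `|p.1 - - X p.2|) + (rsqrt `|p.2 - X p.1| + rsqrt `|p.2 - - X p.1|).
have g1 : measurable_fun setT (fun p : plane R => rsqrt `|p.1 - X p.2|).
  apply: measurable_rsqrt; apply: measurableT_comp => //; apply: measurable_funB => //.
  exact: (measurableT_comp mX measurable_snd).
have g2 : measurable_fun setT (fun p : plane R => rsqrt `|p.1 - - X p.2|).
  apply: measurable_rsqrt; apply: measurableT_comp => //; apply: measurable_funB => //.
  exact: (measurableT_comp mNX measurable_snd).
have g3 : measurable_fun setT (fun p : plane R => rsqrt `|p.2 - X p.1|).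
  apply: measurable_rsqrt; apply: measurableT_comp => //; apply: measurable_funB => //.
  exact: (measurableT_comp mX measurable_fst).
have g4 : measurable_fun setT (fun p : plane R => rsqrt `|p.2 - - X p.1|).
  apply: measurable_rsqrt; apply: measurableT_comp => //; apply: measurable_funB => //.
  exact: (measurableT_comp mNX measurable_fst).
have mQf (f : plane R -> R) : measurable_fun setT f -> measurable_fun Q (EFin \o f).
  move=> mf; apply/measurable_EFinP; exact: (measurable_funS measurableT (@subsetT _ Q)).
have mg : measurable_fun setT g by apply: measurable_funD; apply: measurable_funD.
have q0 (s : R) : (0%:E <= (rsqrt s)%:E)%E by rewrite lee_fin rsqrt_ge0.
have g0 p : 0 <= g p by rewrite /g !addr_ge0 // rsqrt_ge0.
have BQ : rimball zt dl `<=` Q.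
  move=> p [_ pd]; split; rewrite /centered_itv /= in_itv /= -ltr_distlC distrC; apply: le_lt_trans pd.
    by rewrite distrC -[p.1]/(complex.Re (cplx p)) -cReB; exact: Re_le_cmod.
  by rewrite distrC -[p.2]/(complex.Im (cplx p)) -cImB; exact: Im_le_cmod.
apply: (@le_trans _ _ (\int[Lam]_(p in Q) (4 * g p)%:E)%E).
  apply: (@le_trans _ _ (\int[Lam]_(p in rimball zt dl) (4 * g p)%:E)%E).
    apply: ge0_le_integral => //.
    - exact: measurable_rimball.
    - by apply/measurable_EFinP; apply: measurable_rsqrt; exact: measurable_rimdist.
    - apply/measurable_EFinP; apply: measurable_funM => //.
      exact: (measurable_funS measurableT (@subsetT _ _)).
    - move=> p [p1 _]; rewrite lee_fin.
      have r0 := cmod_ge0 (cplx p); have E := cmod_cplx p.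
      have [h|h] := leP 4^-1 `|p.1|.
        apply: (le_trans (rsqrt_chord r0 p1 E h)); rewrite ler_pM2l //.
        by rewrite lerDl addr_ge0 // rsqrt_ge0.
      have [h'|h'] := leP 4^-1 `|p.2|.
        rewrite addrC in E.
        apply: (le_trans (rsqrt_chord r0 p1 E h')); rewrite ler_pM2l //.
        by rewrite lerDr addr_ge0 // rsqrt_ge0.
      apply: (le_trans (rsqrt_center r0 E h h')); rewrite ler_pM2l //.
      by rewrite /g -addrA lerDl !addr_ge0 // rsqrt_ge0.
  apply: ge0_subset_integral => //.
  - exact: measurable_rimball.
  - by apply: mQf; exact: measurable_funM.
  - by move=> p _; rewrite lee_fin mulr_ge0.
have -> : (\int[Lam]_(p in Q) (4 * g p)%:E = 4%:E * \int[Lam]_(p in Q) (g p)%:E)%E.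
  by rewrite -ge0_integralZl_EFin //; do ?[exact: mQf | by move=> p _; rewrite lee_fin].
rewrite [X in (_ * X)%E](_ : _ = (\int[Lam]_(p in Q) (rsqrt `|p.1 - X p.2|)%:E
   + \int[Lam]_(p in Q) (rsqrt `|p.1 - - X p.2|)%:E)
   + (\int[Lam]_(p in Q) (rsqrt `|p.2 - X p.1|)%:E
   + \int[Lam]_(p in Q) (rsqrt `|p.2 - - X p.1|)%:E))%E; last first.
  rewrite -!ge0_integralD //; do ?exact: mQf; do ?(by move=> p _; rewrite adde_ge0).
  - by apply: emeasurable_funD; apply: mQf.
  - by apply: emeasurable_funD; apply: mQf.
(* Four graphs contribute 40 each, and the comparison with the radial distance costs a factor 4. *)
have -> : 640 * dl * Num.sqrt dl = 4 * ((40 * dl * Num.sqrt dl + 40 * dl * Num.sqrt dl) +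
   (40 * dl * Num.sqrt dl + 40 * dl * Num.sqrt dl)) by ring.
rewrite EFinM; apply: lee_wpmul2l => //; rewrite !EFinD.
apply: leeD; apply: leeD.
- exact: (int_rect1 _ _ dl0 mX).
- exact: (int_rect1 _ _ dl0 mNX).
- exact: (int_rect2 _ _ dl0 mX).
- exact: (int_rect2 _ _ dl0 mNX).
Qed.

End balls.

(** * Forelli-Rudin estimates *)

Section forelli_rudin.
Variable R : realType.
Local Notation lam := (@lebesgue_measure R).
Local Notation Lam := (lam \x lam)%E.
Implicit Types (zt z w a : R[i]) (p q : plane R).

(** On the disc it dominates each of 1 - |z|, 1 - |w| and |z - w|, and so serves as a distance
    between z and w that sees the boundary. *)
Definition kerdist z w := cmod (1 - z * w^*).

Lemma ozC z w : kerdist z w = kerdist w z.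
Proof. rewrite /kerdist -cmod_conj; congr cmod; have -> : (1 - z * w^*)^* = 1^* - (z * w^*)^* by rewrite rmorphB.
by rewrite rmorph1 rmorphM /= conjCK mulrC. Qed.

Lemma kerdist_ge0 z w : 0 <= kerdist z w. Proof. exact: cmod_ge0. Qed.

Lemma ge_kerdist z w : cmod z < 1 -> cmod w < 1 -> 1 - cmod z <= kerdist z w.
Proof. by move=> z1 w1; apply: cmod_1zw => //; exact: ltW. Qed.

Lemma ge_oz2 z w : cmod z < 1 -> cmod w < 1 -> 1 - cmod w <= kerdist z w.
Proof. by move=> z1 w1; rewrite ozC; exact: ge_kerdist. Qed.

Lemma kerdist_gt0 z w : cmod z < 1 -> cmod w < 1 -> 0 < kerdist z w.
Proof. by move=> z1 w1; apply: lt_le_trans (ge_kerdist z1 w1); rewrite subr_gt0. Qed.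

(** Divided by [kerdist z w ^+ 2] this is the identity for 1 - |phi_w(z)|^2. *)
Lemma kerdist_sqr z w : kerdist z w ^+ 2 = cmod (z - w) ^+ 2 + (1 - cmod z ^+ 2) * (1 - cmod w ^+ 2).
Proof.
rewrite /kerdist !cmod_sqr !cReB !cImB cReM cImM cRe_conj cIm_conj.
have -> : complex.Re (1 : R[i]) = 1 by []; have -> : complex.Im (1 : R[i]) = 0 by [].
by ring.
Qed.

Lemma kerdist_dist z w : cmod z < 1 -> cmod w < 1 -> cmod (z - w) <= kerdist z w.
Proof.
move=> z1 w1; rewrite -(ler_pXn2r (n := 2)) ?nnegrE ?cmod_ge0 // kerdist_sqr lerDl mulr_ge0 //.
  by rewrite subr_ge0 exprn_ile1 ?cmod_ge0 // ltW.
by rewrite subr_ge0 exprn_ile1 ?cmod_ge0 // ltW.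
Qed.

Lemma cmod_tri z w a : cmod (z - a) <= cmod (z - w) + cmod (w - a).
Proof. by rewrite -[z - a](subrKA w); exact: cmodD. Qed.

Lemma circle_proj w : cmod w < 1 -> exists2 om, cmod om = 1 & cmod (om - w) = 1 - cmod w.
Proof.
move=> w1; have [->|w0] := eqVneq w 0.
  by exists 1; rewrite ?cmod1 // cmod0 !subr0 cmod1.
have cw : cmod w != 0 by rewrite gt_eqF // cmod_gt0.
have cw0 : (cmod w)%:C != 0 :> R[i] by apply/eqP => /(congr1 (@complex.Re R)) /= /eqP; rewrite (negbTE cw).
exists (w / (cmod w)%:C); first by rewrite cmodM cmodV cmod_real ger0_norm ?cmod_ge0 // divff.
have -> : w / (cmod w)%:C - w = (w / (cmod w)%:C) * (1 - cmod w)%:C.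
  by rewrite rmorphB /= rmorph1 mulrBr mulr1 divfK.
rewrite !cmodM cmodV !cmod_real (ger0_norm (cmod_ge0 _)) divff // mul1r ger0_norm //.
by rewrite subr_ge0 ltW.
Qed.

Lemma d_le_dist zt w : cmod zt = 1 -> 1 - cmod w <= cmod (zt - w).
Proof.
by move=> z1; rewrite -z1; apply: le_trans (cmod_dist _ _); exact: ler_norm.
Qed.

Lemma measurable_ozg d (T : measurableType d) (D : set T) (x y u v : T -> R) :
  measurable_fun D x -> measurable_fun D y -> measurable_fun D u -> measurable_fun D v ->
  measurable_fun D (fun t => kerdist (x t +i* y t) (u t +i* v t)).
Proof.
move=> mx my mu mv.
have -> : (fun t => kerdist (x t +i* y t) (u t +i* v t)) =
  (fun t => Num.sqrt ((1 - (x t * u t + y t * v t)) ^+ 2 + (y t * u t - x t * v t) ^+ 2)).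
  apply/funext => t; rewrite /kerdist cmodE cReB cImB cReM cImM cRe_conj cIm_conj.
  have -> : complex.Re (1 : R[i]) = 1 by []; have -> : complex.Im (1 : R[i]) = 0 by [].
  rewrite /=; congr Num.sqrt; ring.
apply: (measurableT_comp (continuous_measurable_fun (@sqrt_continuous R))).
apply: measurable_funD; apply: measurable_funX; apply: measurable_funB => //.
- by apply: measurable_funD; apply: measurable_funM.
- by apply: measurable_funM.
- by apply: measurable_funM.
Qed.

Lemma measurable_kerdist D w : measurable_fun D (fun p => kerdist (cplx p) w).
Proof.
case: w => u v; apply: (measurable_funS measurableT (@subsetT _ D)).
by apply: measurable_ozg.
Qed.

Lemma measurable_oz2 D : measurable_fun D (fun pq : plane R * plane R => kerdist (cplx pq.1) (cplx pq.2)).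
Proof.
apply: (measurable_funS measurableT (@subsetT _ D)).
apply: measurable_ozg.
- exact: (measurableT_comp measurable_fst measurable_fst).
- exact: (measurableT_comp measurable_snd measurable_fst).
- exact: (measurableT_comp measurable_fst measurable_snd).
- exact: (measurableT_comp measurable_snd measurable_snd).
Qed.

Lemma measurable_frk D w : measurable_fun D (fun p => rsqrt (rimdist p) / kerdist (cplx p) w ^+ 2).
Proof.
apply: measurable_funM; first by apply: measurable_rsqrt; exact: measurable_rimdist.
apply: measurable_funV_ge0; first by move=> p; rewrite exprn_ge0 ?kerdist_ge0.
apply: measurable_funX; exact: measurable_kerdist.
Qed.

Lemma frk_ge0 p w : 0 <= rsqrt (rimdist p) / kerdist (cplx p) w ^+ 2.
Proof. by rewrite divr_ge0 ?rsqrt_ge0 ?exprn_ge0 ?kerdist_ge0. Qed.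

Lemma int_rimball_ex : exists2 B : R, 0 < B & forall zt dl, 0 < dl ->
  (\int[Lam]_(p in rimball zt dl) (rsqrt (rimdist p))%:E <= (B * dl * Num.sqrt dl)%:E)%E.
Proof. by exists 640; [rewrite ltr0n | exact: int_rimball]. Qed.

(** With e = 1 - |w|, the points with kerdist about P = 4^n e lie in a disc of radius O(P) about the
    boundary point nearest to w. There [int_rimball] gives P^(3/2), and division by P^2 leaves
    2^(-n) e^(-1/2). *)
Lemma forelli_rudin : exists2 C : R, 0 < C & forall w, cmod w < 1 ->
  (\int[Lam]_(p in @disc R) (rsqrt (rimdist p) / kerdist (cplx p) w ^+ 2)%:E <= (C * rsqrt (1 - cmod w))%:E)%E.
Proof.
have [B B0 HB] := int_rimball_ex.
have [C C0 CE] : exists2 C : R, 0 < C & C = B * 64 by exists (B * 64); rewrite ?mulr_gt0.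
exists (C * 2); first exact: mulr_gt0.
move=> w w1; set e := 1 - cmod w; have e0 : 0 < e by rewrite subr_gt0.
have [om om1 omw] := circle_proj w1.
(* On the ring kerdist < 4 * (4^n e), so the distance to [om] is below twice that; 8 is rounded up
   to the perfect square 16. *)
pose dl n := 16 * (4 ^+ n * e).
have p0 n : 0 < (4 : R) ^+ n * e by rewrite mulr_gt0 // exprn_gt0.
have dl0 n : 0 < dl n by rewrite mulr_gt0.
pose g n p := (4 ^+ n * e) ^- 2 * (rsqrt (rimdist p) * \1_(rimball om (dl n)) p).
have mdisc : measurable (@disc R) by rewrite disc_cdisc; exact: measurable_cdisc.
have mq n : measurable_fun (@disc R) (fun p => rsqrt (rimdist p) * \1_(rimball om (dl n)) p).
  apply: measurable_funM; first by apply: measurable_rsqrt; exact: measurable_rimdist.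
  by apply: measurable_indic; exact: measurable_rimball.
apply: (@int_le_series R _ _ Lam (@disc R) _ g (fun n => C * rsqrt e * 2^-1 ^+ n)) => //.
- exact: measurable_frk.
- by move=> n; apply: measurable_funM.
- by move=> p _; exact: frk_ge0.
- by move=> n p _; rewrite /g mulr_ge0 ?invr_ge0 ?exprn_ge0 ?(ltW (p0 n)) // mulr_ge0 ?rsqrt_ge0.
- move=> p p1; have oz0 := kerdist_gt0 p1 w1.
  have x1 : 1 <= kerdist (cplx p) w / e by rewrite ler_pdivlMr // mul1r; exact: ge_oz2.
  have c14 : 1 < 4 :> R by rewrite ltr1n.
  have [n /andP[H1 H2]] := pow_bracket c14 x1.
  rewrite ler_pdivlMr // in H1; rewrite ltr_pdivrMr // exprS -mulrA in H2.
  exists n; rewrite /g indicE mem_set ?mulr1; last first.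
    split => //; apply: (@le_lt_trans _ _ (2 * kerdist (cplx p) w)).
      apply: (le_trans (cmod_tri _ w _)); rewrite omw mulr2n mulrDl mul1r; apply: lerD; first exact: ge_oz2.
      by rewrite ozC; exact: kerdist_dist.
    have := p0 n; rewrite /dl; set P := 4 ^+ n * e in H1 H2 *; lra.
  rewrite mulrC ler_wpM2r ?rsqrt_ge0 // lef_pV2 ?posrE ?exprn_gt0 //.
  by rewrite ler_pXn2r ?nnegrE ?(ltW oz0) ?(ltW (p0 n)).
- move=> n; set P := 4 ^+ n * e in g *.
  rewrite (_ : (\int[Lam]_(p in @disc R) (g n p)%:E = (P ^- 2)%:E * \int[Lam]_(p in @disc R) (rsqrt (rimdist p) * \1_(rimball om (dl n)) p)%:E)%E); last first.
    rewrite -ge0_integralZl_EFin //.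
    - by move=> p _; rewrite lee_fin mulr_ge0 ?rsqrt_ge0.
    - by apply/measurable_EFinP.
    - by rewrite invr_ge0 exprn_ge0 // ltW // p0.
  have int_indic : (\int[Lam]_(p in @disc R) (rsqrt (rimdist p) * \1_(rimball om (dl n)) p)%:E
      <= \int[Lam]_(p in rimball om (dl n)) (rsqrt (rimdist p))%:E)%E.
    rewrite [leLHS]integral_mkcond [leRHS]integral_mkcond le_eqVlt; apply/orP; left; apply/eqP.
    apply: eq_integral => p _; rewrite !patchE indicE.
    case: (boolP (p \in rimball om (dl n))) => [|_]; last by rewrite mulr0; case: ifP.
    by rewrite inE => -[p1 _]; rewrite mulr1 ifT // inE.
  apply: (@le_trans _ _ ((P ^- 2)%:E * (B * dl n * Num.sqrt (dl n))%:E)%E).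
    apply: lee_wpmul2l; first by rewrite lee_fin invr_ge0 exprn_ge0 // ltW // p0.
    exact: (le_trans int_indic (HB _ _ (dl0 n))).
  rewrite -EFinM lee_fin /dl -/P.
  have s0 : 0 < Num.sqrt e by rewrite sqrtr_gt0.
  have sE : e = Num.sqrt e ^+ 2 by rewrite sqr_sqrtr // ltW.
  have PE : P = (2 ^+ n * Num.sqrt e) ^+ 2.
    by rewrite exprMn -sE /P -exprM [(n * 2)%N]mulnC exprM; congr (_ ^+ n * _); rewrite expr2 -natrM.
  have -> : Num.sqrt (16 * P) = 4 * (2 ^+ n * Num.sqrt e).
    have -> : 16 * P = (4 * (2 ^+ n * Num.sqrt e)) ^+ 2 by rewrite PE; ring.
    by rewrite sqrtr_sqr ger0_norm // !mulr_ge0 ?exprn_ge0 ?(ltW s0).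
  rewrite PE /rsqrt exprVn CE; set Q := 2 ^+ n; set s := Num.sqrt e in s0 *.
  have Q0 : Q != 0 by rewrite gt_eqF // exprn_gt0.
  by rewrite le_eqVlt; apply/orP; left; apply/eqP; field; rewrite Q0 gt_eqF.
- move=> N; rewrite -mulr_sumr -mulrA [C * 2 * _](_ : _ = C * rsqrt e * 2); last by ring.
  by rewrite mulrA ler_wpM2l ?geo_half // mulr_ge0 ?rsqrt_ge0 ?mulr_ge0 // ltW.
Qed.

(** On a disc of radius dl about zt the gain is dl / (dl + |zt - w|). If |zt - w| < 2 dl this factor
    is at least 1/3 and the global estimate suffices; otherwise the kernel is nearly constant on the
    disc. *)
Lemma forelli_rudin_local : exists2 C : R, 0 < C & forall zt w dl, cmod zt = 1 -> cmod w < 1 -> 0 < dl ->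
  (\int[Lam]_(p in rimball zt dl) (rsqrt (rimdist p) / kerdist (cplx p) w ^+ 2)%:E <=
     (C * (rsqrt (1 - cmod w) * (dl / (dl + cmod (zt - w)))))%:E)%E.
Proof.
have [C C0 HC] := forelli_rudin.
have [B B0 HB] := int_rimball_ex.
exists (3 * C + 9 * B); first by rewrite addr_gt0 // mulr_gt0.
move=> zt w dl zt1 w1 dl0.
have mdisc : measurable (@disc R) by rewrite disc_cdisc; exact: measurable_cdisc.
set r := cmod (zt - w); have r0 : 0 <= r by exact: cmod_ge0.
set D := dl + r; have D0 : 0 < D by rewrite /D; lra.
have d0 : 0 < 1 - cmod w by rewrite subr_gt0.
have q0 := rsqrt_gt0 d0.
have [near|far] := ltP r (2 * dl).
  apply: (@le_trans _ _ (C * rsqrt (1 - cmod w))%:E).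
    apply: le_trans (HC w w1); apply: ge0_subset_integral => //.
    - exact: measurable_rimball.
    - by apply/measurable_EFinP; exact: measurable_frk.
    - by move=> p _; rewrite lee_fin frk_ge0.
    - by move=> p [].
  rewrite lee_fin; set x := dl / D.
  have x3 : 1 <= 3 * x by rewrite /x mulrA ler_pdivlMr // /D; lra.
  have x0 : 0 <= x by rewrite divr_ge0 // ltW.
  have Hq : rsqrt (1 - cmod w) <= rsqrt (1 - cmod w) * (3 * x) by rewrite ler_peMr // ltW.
  have H1 : C * rsqrt (1 - cmod w) <= C * (rsqrt (1 - cmod w) * (3 * x)) by rewrite ler_pM2l.
  apply: (le_trans H1); rewrite -subr_ge0.
  have -> : (3 * C + 9 * B) * (rsqrt (1 - cmod w) * x) -
    C * (rsqrt (1 - cmod w) * (3 * x)) = 9 * B * (rsqrt (1 - cmod w) * x) by ring.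
  by rewrite mulr_ge0 //; apply: mulr_ge0 => //; exact: ltW.
apply: (@le_trans _ _ (\int[Lam]_(p in rimball zt dl) (9 / D ^+ 2 * rsqrt (rimdist p))%:E)%E).
  apply: ge0_le_integral => //.
  - exact: measurable_rimball.
  - by move=> p _; rewrite lee_fin frk_ge0.
  - by apply/measurable_EFinP; exact: measurable_frk.
  - apply/measurable_EFinP; apply: measurable_funM => //; apply: measurable_rsqrt; exact: measurable_rimdist.
  - move=> p [p1 pd]; rewrite lee_fin mulrC ler_wpM2r ?rsqrt_ge0 //.
    (* With r >= 2 dl the triangle inequality gives kerdist >= r - dl >= r / 2, while D <= 3 r /
       2. *)
    have H : D / 3 <= kerdist (cplx p) w.
      apply: le_trans (kerdist_dist p1 w1).
      have : r <= cmod (zt - cplx p) + cmod (cplx p - w).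
        exact: cmod_tri.
      by rewrite /D; lra.
    have -> : 9 / D ^+ 2 = (D / 3) ^- 2 by field; rewrite gt_eqF.
    rewrite lef_pV2 ?posrE ?exprn_gt0 ?divr_gt0 ?kerdist_gt0 //.
    by rewrite ler_pXn2r ?nnegrE ?kerdist_ge0 // divr_ge0 // ltW.
have c0 : 0 <= 9 / D ^+ 2 by rewrite divr_ge0 // exprn_ge0 // ltW.
rewrite (_ : (\int[Lam]_(p in rimball zt dl) (9 / D ^+ 2 * rsqrt (rimdist p))%:E =
   (9 / D ^+ 2)%:E * \int[Lam]_(p in rimball zt dl) (rsqrt (rimdist p))%:E)%E); last first.
  rewrite -ge0_integralZl_EFin //.
  - exact: measurable_rimball.
  - by move=> p _; rewrite lee_fin rsqrt_ge0.
  - by apply/measurable_EFinP; apply: measurable_rsqrt; exact: measurable_rimdist.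
apply: (@le_trans _ _ ((9 / D ^+ 2)%:E * (B * dl * Num.sqrt dl)%:E)%E).
  by apply: lee_wpmul2l; [rewrite lee_fin | exact: HB].
rewrite -EFinM lee_fin.
set d := 1 - cmod w in d0 q0 *.
have dD : d <= D.
  by have := d_le_dist w zt1; rewrite -/d -/r /D; lra.
have s0 : 0 < Num.sqrt d by rewrite sqrtr_gt0.
have t0 : 0 < Num.sqrt dl by rewrite sqrtr_gt0.
(* Both d and dl are at most D: the first because 1 - |w| is the distance from w to the circle. This
   trades the missing sqrt dl / D for 1 / sqrt d. *)
have H : Num.sqrt d * Num.sqrt dl <= D.
  rewrite -(sqr_sqrtr (ltW D0)) expr2; apply: ler_pM; rewrite ?sqrtr_ge0 //; apply: ler_wsqrtr => //.
  by rewrite /D lerDl.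
have -> : 9 / D ^+ 2 * (B * dl * Num.sqrt dl) = 9 * B * (rsqrt d * (dl / D)) * (Num.sqrt d * Num.sqrt dl / D).
  by rewrite /rsqrt; field; rewrite !gt_eqF.
have A0 : 0 <= rsqrt d * (dl / D) by rewrite mulr_ge0 ?divr_ge0 // ltW.
apply: (@le_trans _ _ (9 * B * (rsqrt d * (dl / D)))).
  have B9 : 0 <= 9 * B by rewrite mulr_ge0 // ltW.
  by apply: ler_piMr; [exact: mulr_ge0 B9 A0 | rewrite ler_pdivrMr // mul1r].
by rewrite ler_wpM2r // lerDr mulr_ge0 // ltW.
Qed.

End forelli_rudin.

(** * The weight *)

Lemma lebesgue_itv_co (R : realType) (a b : R) : a < b -> lebesgue_measure `[a, b[ = (b - a)%:E.
Proof. by move=> ab; rewrite lebesgue_measure_itv /= lte_fin ab -EFinD. Qed.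

Section weight.
Variables (R : realType) (K : R -> R) (hK : WQ K).
Local Notation lam := (@lebesgue_measure R).
Local Notation Lam := (lam \x lam)%E.

(* [WQ] says nothing about [K] on the negative reals; with this extension
   monotonicity and measurability hold on the whole line. *)
Definition KK (x : R) := K (Num.max 0 x).

Lemma KK_E x : 0 <= x -> KK x = K x.
Proof. by move=> x0; rewrite /KK max_r. Qed.

Lemma KK_ge0 x : 0 <= KK x.
Proof. by apply: (WQ_ge0 hK); rewrite le_max lexx. Qed.

Lemma le_KK x y : x <= y -> KK x <= KK y.
Proof.
move=> xy; apply: (WQ_nondecreasing hK); first by rewrite le_max lexx.
by rewrite ge_max !le_max lexx /= xy orbT.
Qed.

Lemma KK_le0 x : x <= 0 -> KK x = 0.
Proof. by move=> x0; rewrite /KK max_l //; case: (WQ_K1 hK). Qed.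

Lemma measurable_KK d (T : measurableType d) (D : set T) (f : T -> R) :
  measurable_fun D f -> measurable_fun D (fun x => KK (f x)).
Proof.
move=> mf; have mK : measurable_fun setT KK by apply: nondecreasing_measurable => //; exact: le_KK.
exact: (measurableT_comp mK).
Qed.

(** Iterated (K4) gives growth of order p, where 2^p exceeds the doubling constant. The argument s
    <= 1 is halved, rather than t doubled, so that (K4) is always applied on [0, 1/2], however large
    l t may be. *)
Lemma KK_doubling : exists p : nat, forall l s t : R, 1 <= l -> s <= 1 -> s <= l * t ->
  KK s <= (2 * l) ^+ p * KK t.
Proof.
have [CK CK1 HCK] := WQ_K4 hK.
have c12 : 1 < 2 :> R by rewrite ltr1n.
have [p0 /andP[_ Hp]] := pow_bracket c12 CK1; exists p0.+1 => l s t l1 s1 st.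
have C0 : 0 < CK by exact: lt_le_trans CK1.
have dbl n : forall s t : R, s <= 1 -> s <= 2 ^+ n * t -> KK s <= CK ^+ n * KK t.
  elim: n => [|n IH] u v u1 uv.
    by rewrite expr0 mul1r; apply: le_KK; rewrite expr0 mul1r in uv.
  have [u0|u0] := leP u 0; first by rewrite KK_le0 // mulr_ge0 ?exprn_ge0 ?KK_ge0 // ltW.
  have H : KK u <= CK * KK (u / 2).
    have E : u = 2 * (u / 2) by rewrite mulrCA mulfV ?mulr1.
    rewrite !KK_E ?divr_ge0 ?(ltW u0) // {1}E; apply: HCK.
    by rewrite divr_ge0 ?(ltW u0) //= -[leRHS]mul1r ler_wpM2r ?invr_ge0.
  apply: (le_trans H); rewrite exprS -mulrA ler_pM2l //; apply: IH; first lra.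
  by rewrite ler_pdivrMr // mulrC mulrA -exprS.
have [m /andP[m1 m2]] := pow_bracket c12 l1.
have [t0|t0] := leP t 0.
  have s0 : s <= 0 by apply: (le_trans st); rewrite mulr_ge0_le0 // (le_trans ler01).
  by rewrite !KK_le0 // mulr0.
apply: le_trans (dbl m.+1 s t s1 _) _.
  by apply: (le_trans st); rewrite ler_wpM2r // ltW.
rewrite ler_wpM2r ?KK_ge0 //.
apply: (@le_trans _ _ ((2 ^+ p0.+1) ^+ m.+1)).
  by rewrite lerXn2r ?nnegrE ?exprn_ge0 // ltW.
rewrite -exprM mulnC exprM; have l0 : 0 <= l by exact: le_trans l1.
apply: lerXn2r; rewrite ?nnegrE ?exprn_ge0 ?mulr_ge0 //.
by rewrite exprS ler_pM2l.
Qed.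

Lemma phiK_bounds s : 0 <= s <= 1 -> (0 <= phiK K s <= 1)%E.
Proof.
move=> /andP[s0 s1]; have [_ Kpos] := WQ_K1 hK.
have in1 : `]0%R, 1%R]%classic (1 : R) by rewrite /= in_itv /= ltr01 lexx.
apply/andP; split.
  apply: (@le_trans _ _ (K (s * 1) / K 1)%:E).
    by rewrite lee_fin divr_ge0 // (WQ_ge0 hK) ?mulr1.
  by apply: ereal_sup_ubound; exists 1.
apply: ub_ereal_sup => _ /= [t + <-]; rewrite in_itv /= => /andP[t0 t1].
rewrite lee_fin ler_pdivrMr ?Kpos // mul1r; apply: (WQ_nondecreasing hK).
  by rewrite mulr_ge0 // ltW.
by rewrite ler_piMl // ltW.
Qed.

Lemma le_phiK s s' : 0 <= s -> s <= s' -> (phiK K s <= phiK K s')%E.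
Proof.
move=> s0 ss; have [_ Kpos] := WQ_K1 hK.
apply: ub_ereal_sup => _ /= [t + <-]; rewrite in_itv /= => /andP[t0 t1].
apply: (@le_trans _ _ (K (s' * t) / K t)%:E); last first.
  by apply: ereal_sup_ubound; exists t => //=; rewrite in_itv /= t0.
rewrite lee_fin ler_wpM2r ?invr_ge0 ?(ltW (Kpos _ t0)) //.
by apply: (WQ_nondecreasing hK); rewrite ?mulr_ge0 ?ler_wpM2r // ltW.
Qed.

(** Integral test for the non-decreasing function phi_K: the values at 2^(-n-1) are summable because
    phi_K(s) / s is integrable on ]0, 1[. *)
Lemma phi_summable : exists (phi : nat -> R) (S : R), [/\ forall n, 0 <= phi n,
  forall N, \sum_(0 <= n < N) phi n <= S &
  forall n t, 0 <= t <= 1 -> KK (2^-1 ^+ n.+1 * t) <= phi n * KK t].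
Proof.
have [_ Kpos] := WQ_K1 hK.
have [sigma [_ HJ _]] := WQ_K3 hK.
(* Truncation to [0, 1], where phi_K is finite; it makes [h] a monotone, hence measurable, function
   on the whole line. *)
pose cl (s : R) := Num.max 0 (Num.min 1 s).
pose h s := fine (phiK K (cl s)).
have clb s : 0 <= cl s <= 1 by rewrite /cl le_max lexx /= ge_max ler01 /= ge_min lexx.
have hE s : (h s)%:E = phiK K (cl s).
  rewrite /h fineK //; have /andP[h1 h2] := phiK_bounds (clb s).
  by rewrite fin_real // (lt_le_trans _ h1) ?(le_lt_trans h2) // ?ltry ?ltNyr.
have h0 s : 0 <= h s by rewrite -lee_fin hE; case/andP: (phiK_bounds (clb s)).
have hm s s' : s <= s' -> h s <= h s'.
  move=> ss; rewrite -lee_fin !hE; apply: le_phiK; first by case/andP: (clb s).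
  rewrite /cl ge_max !le_max lexx /=; apply/orP; right.
  by rewrite le_min !ge_min lexx /= ss orbT.
have mh : measurable_fun setT h by exact: nondecreasing_measurable.
have cl_id s : 0 <= s -> s <= 1 -> cl s = s by move=> s0 s1; rewrite /cl min_r // max_r.
pose f s := h s * s^-1.
have half n : 0 < (2^-1 : R) ^+ n by rewrite exprn_gt0 // invr_gt0.
have half1 n : (2^-1 : R) ^+ n <= 1 by rewrite exprn_ile1 ?invr_ge0 // invf_le1 // ler1n.
pose phi n := h (2^-1 ^+ n.+1).
pose U N : set R := `[(2^-1) ^+ N, 1[%classic.
have mU N : measurable (U N) by exact: measurable_itv.
have U0 N x : U N x -> 0 < x.
  by rewrite /U /= in_itv /= => /andP[x1 _]; exact: lt_le_trans (half N) x1.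
have mf (D : set R) : (forall x, D x -> 0 < x) -> measurable_fun D (fun x => (f x)%:E).
  move=> D0; apply/measurable_EFinP.
  apply: measurable_funM; first exact: (measurable_funS measurableT (@subsetT _ _)).
  apply: (@eq_measurable_fun _ _ _ _ D (fun x : R => (Num.max 0 x)^-1)).
    by move=> x; rewrite inE => /D0 x0; rewrite max_r // ltW.
  apply: measurable_funV_ge0; first by move=> x; rewrite le_max lexx.
  exact: measurable_maxr.
have f0 x : 0 < x -> 0 <= f x by move=> x0; rewrite mulr_ge0 // invr_ge0 ltW.
(* On [2^(-N-1), 2^(-N)[ the integrand is at least [phi N] times 2^N, and the interval has length
   2^(-N-1). *)
have step N : ((\sum_(0 <= n < N) (phi n / 2))%:E <= \int[lam]_(x in U N) (f x)%:E)%E.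
  elim: N => [|N IH].
    by rewrite big_geq //; apply: integral_ge0 => x /U0 x0; rewrite lee_fin f0.
  pose I : set R := `[(2^-1) ^+ N.+1, 2^-1 ^+ N[%classic.
  have mI : measurable I by exact: measurable_itv.
  have hN : (2^-1 : R) ^+ N.+1 <= 2^-1 ^+ N by rewrite exprS ler_piMl ?(ltW (half N)) // invf_le1 // ler1n.
  have UE : U N.+1 = U N `|` I.
    rewrite setUC /U /I; apply/seteqP; split => x /=; rewrite !in_itv /=.
      by move=> /andP[x1 x2]; have [xN|xN] := ltP x (2^-1 ^+ N); [left|right]; apply/andP.
    by case=> /andP[x1 x2]; apply/andP; split => //; [exact: lt_le_trans x2 (half1 N)|exact: le_trans x1].
  have I0 x : I x -> 0 < x.
    by rewrite /I /= in_itv /= => /andP[x1 _]; exact: lt_le_trans (half N.+1) x1.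
  rewrite UE ge0_integral_setU //; last 3 first.
  - by apply: mf => x [/U0|/I0].
  - by move=> x [/U0|/I0] x0; rewrite lee_fin f0.
  - rewrite disj_set2E; apply/eqP/seteqP; split => x //= []; rewrite /U /I /= !in_itv /=.
    by move=> /andP[x1 _] /andP[_ x2]; move: (lt_le_trans x2 x1); rewrite ltxx.
  rewrite big_nat_recr //= EFinD; apply: leeD => //.
  apply: (@le_trans _ _ (\int[lam]_(x in I) (phi N * 2 ^+ N)%:E)%E).
    rewrite (@integral_cst _ _ _ lam I mI) [X in (_ * X)%E](_ : _ = (2^-1 ^+ N.+1)%:E).
      rewrite -EFinM lee_fin exprS exprVn le_eqVlt; apply/orP; left; apply/eqP.
      by field; rewrite expf_neq0.
    have hN' : (2^-1 : R) ^+ N.+1 < 2^-1 ^+ N by rewrite exprS gtr_pMl // invf_lt1 // ltr1n.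
    by apply: (etrans (lebesgue_itv_co hN')); rewrite exprS; congr EFin; field.
  apply: ge0_le_integral => //.
  - by move=> x _; rewrite lee_fin mulr_ge0 ?exprn_ge0 //; exact: h0.
  - exact: mf I0.
  - move=> x Ix; have x0 := I0 _ Ix; move: Ix; rewrite /I /= in_itv /= => /andP[x1 x2].
    rewrite lee_fin /f /phi; apply: ler_pM; rewrite ?h0 ?exprn_ge0 //; first exact: hm.
    by rewrite -[2 ^+ N]invrK lef_pV2 ?posrE ?invr_gt0 ?exprn_gt0 // -exprVn ltW.
  exact: mU.
pose J := (\int[lam]_(s in `]0%R, 1%R[) (phiK K s * s^-1%:E))%E.
have JE : J = (\int[lam]_(s in `]0%R, 1%R[) (f s)%:E)%E.
  apply: eq_integral => x; rewrite inE /= in_itv /= => /andP[x0 x1].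
  by rewrite /f EFinM hE cl_id // ltW.
have J01 x : `]0%R, 1%R[%classic x -> (0 : R) < x by rewrite /= in_itv /= => /andP[].
have J0 : (0 <= J)%E by rewrite JE; apply: integral_ge0 => x /J01 x0; rewrite lee_fin f0.
exists phi, (2 * fine J); split => //.
- by move=> n; exact: h0.
- move=> N; suff : \sum_(0 <= n < N) (phi n / 2) <= fine J.
    by rewrite -mulr_suml ler_pdivrMr // [fine J * 2]mulrC.
  rewrite -lee_fin fineK; last by rewrite fin_real // (lt_le_trans _ J0) ?ltNyr.
  apply: (le_trans (step N)); rewrite JE; apply: ge0_subset_integral => //.
  - exact: measurable_itv.
  - exact: mf J01.
  - by move=> x /J01 x0; rewrite lee_fin f0.
  - by move=> x Ux; have x0 := U0 _ _ Ux; move: Ux; rewrite /U /= !in_itv /= x0 => /andP[].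
- move=> n t /andP[t0 t1]; have [->|tn] := eqVneq t 0.
    by rewrite mulr0 !KK_le0 // mulr0.
  have tp : 0 < t by rewrite lt_neqAle eq_sym tn.
  have Kt : 0 < K t by exact: Kpos.
  rewrite !KK_E ?(mulr_ge0 (ltW (half _))) // -ler_pdivrMr // -lee_fin /phi hE cl_id ?half1 ?(ltW (half _)) //.
  by apply: ereal_sup_ubound; exists t => //=; rewrite in_itv /= tp.
Qed.

End weight.

(** * The main estimate *)

Section schur.
Variable R : realType.
Local Notation lam := (@lebesgue_measure R).
Local Notation Lam := (lam \x lam)%E.

(* The library's sigma-finite instance on [product_measure1] is not found by
   unification, whence this copy of the planar Lebesgue measure. *)
Section plane_measure.
Variable T : realType.
Definition plane_measure : set (plane T) -> \bar T := (@lebesgue_measure T \x @lebesgue_measure T)%E.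

HB.instance Definition _ := Measure.on plane_measure.

Let sigma_finite_plane : sigma_finite setT plane_measure.
Proof.
have /sigma_finiteP [F [TF ndF Foo]] := sigma_finiteT (@lebesgue_measure T).
exists (fun n => F n `*` F n).
  rewrite -setXTT {1}TF {1}TF predeqE => -[x y]; split.
    move=> [/= [n _ Fnx] [k _ Gky]]; exists (maxn n k) => //; split.
    - by move: x Fnx; exact/subsetPset/ndF/leq_maxl.
    - by move: y Gky; exact/subsetPset/ndF/leq_maxr.
  by move=> [n _ []/= ? ?]; split; exists n.
move=> k; have [mk kf] := Foo k; split; first exact: measurableX.
by rewrite /plane_measure product_measure1E// lte_mul_pinfty// ge0_fin_numE.
Qed.

HB.instance Definition _ := @Measure_isSigmaFinite.Build _ _ _ plane_measure sigma_finite_plane.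

End plane_measure.

Section plane_tonelli.
Variables (phi : plane R -> plane R -> R) (A B : set (plane R)).
Hypotheses (mA : measurable A) (mB : measurable B).
Hypothesis mf : measurable_fun (A `*` B) (fun p => phi p.1 p.2).
Hypothesis f0 : forall x y, A x -> B y -> 0 <= phi x y.

Let LS : {sigma_finite_measure set (plane R) -> \bar R} := @plane_measure R.

Lemma measurable_plane1 : measurable_fun A (fun x => \int[Lam]_(y in B) (phi x y)%:E)%E.
Proof. exact: (@measurable_tonelli1 _ _ _ _ _ LS _ _ phi mA mB mf f0). Qed.

Lemma measurable_plane2 : measurable_fun B (fun y => \int[Lam]_(x in A) (phi x y)%:E)%E.
Proof. exact: (@measurable_tonelli2 _ _ _ _ _ LS _ _ phi mA mB mf f0). Qed.

Lemma tonelli_plane : (\int[Lam]_(x in A) \int[Lam]_(y in B) (phi x y)%:E =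
  \int[Lam]_(y in B) \int[Lam]_(x in A) (phi x y)%:E)%E.
Proof. exact: (@tonelli_on _ _ _ _ _ LS LS _ _ phi mA mB mf f0). Qed.

End plane_tonelli.

(** The assumption for all s > 0 is the pointwise h^2 <= u v in the form of the arithmetic-geometric
    mean inequality. It can be integrated term by term, also when the integral of u is infinite. *)
Lemma cauchy_schwarz_amgm d (T : measurableType d) (mu : {measure set T -> \bar R}) (D : set T)
  (h u v : T -> R) (x b : R) : measurable D -> measurable_fun D h -> measurable_fun D u -> measurable_fun D v ->
  (forall t, D t -> 0 <= h t) -> (forall t, D t -> 0 <= u t) -> (forall t, D t -> 0 <= v t) ->
  (forall s t, 0 < s -> D t -> h t <= 2^-1 * (s * u t + s^-1 * v t)) ->
  0 <= x -> 0 < b -> (x%:E <= \int[mu]_(t in D) (h t)%:E)%E -> (\int[mu]_(t in D) (v t)%:E <= b%:E)%E ->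
  ((x ^+ 2)%:E <= b%:E * \int[mu]_(t in D) (u t)%:E)%E.
Proof.
move=> mD mh mu' mv h0 u0 v0 huv x0 b0 xh vb.
have muE : measurable_fun D (fun t => (u t)%:E) by apply/measurable_EFinP.
have mvE : measurable_fun D (fun t => (v t)%:E) by apply/measurable_EFinP.
have u0E t : D t -> (0 <= (u t)%:E)%E by move=> Dt; rewrite lee_fin u0.
have v0E t : D t -> (0 <= (v t)%:E)%E by move=> Dt; rewrite lee_fin v0.
have U0 : (0 <= \int[mu]_(t in D) (u t)%:E)%E by exact: integral_ge0.
have [x00|xn] := eqVneq x 0.
  by rewrite x00 expr2 mulr0 mule_ge0 // lee_fin ltW.
have xp : 0 < x by rewrite lt_neqAle eq_sym xn.
have key s : 0 < s -> (x%:E <= 2^-1%:E * (s%:E * \int[mu]_(t in D) (u t)%:E + (s^-1 * b)%:E))%E.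
  move=> s0; apply: (le_trans xh).
  have mw : measurable_fun D (fun t => s * u t + s^-1 * v t).
    by apply: measurable_funD; apply: measurable_funM.
  apply: (@le_trans _ _ (\int[mu]_(t in D) (2^-1 * (s * u t + s^-1 * v t))%:E)%E).
    apply: ge0_le_integral => //.
    - by apply/measurable_EFinP.
    - by apply/measurable_EFinP; apply: measurable_funM.
    - by move=> t Dt; rewrite lee_fin huv.
  rewrite (_ : (\int[mu]_(t in D) (2^-1 * (s * u t + s^-1 * v t))%:E =
    2^-1%:E * \int[mu]_(t in D) (s * u t + s^-1 * v t)%:E)%E); last first.
    rewrite -ge0_integralZl_EFin // ?invr_ge0 //; last by apply/measurable_EFinP.
    by move=> t Dt; rewrite lee_fin addr_ge0 // mulr_ge0 ?u0 ?v0 ?invr_ge0 // ltW.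
  apply: lee_wpmul2l; first by rewrite lee_fin invr_ge0.
  rewrite (_ : (\int[mu]_(t in D) (s * u t + s^-1 * v t)%:E =
    s%:E * \int[mu]_(t in D) (u t)%:E + s^-1%:E * \int[mu]_(t in D) (v t)%:E)%E).
    by apply: leeD => //; rewrite EFinM; apply: lee_wpmul2l => //; rewrite lee_fin invr_ge0 ltW.
  rewrite -!ge0_integralZl_EFin // ?invr_ge0 ?(ltW s0) //.
  rewrite -ge0_integralD //.
  - by move=> t Dt; rewrite lee_fin mulr_ge0 ?u0 // ltW.
  - by apply/measurable_EFinP; apply: measurable_funM.
  - by move=> t Dt; rewrite lee_fin mulr_ge0 ?v0 // invr_ge0 ltW.
  - by apply/measurable_EFinP; apply: measurable_funM.
(* The optimal parameter s = b / x. *)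
have := key _ (divr_gt0 b0 xp); move: U0; case: (\int[mu]_(t in D) (u t)%:E)%E => [A| |] //.
  rewrite !lee_fin => A0 /= H.
  have H1 : x * x <= 2^-1 * (b / x * A + (b / x)^-1 * b) * x by rewrite ler_pM2r.
  have E : 2^-1 * (b / x * A + (b / x)^-1 * b) * x = 2^-1 * (b * A + x ^+ 2) by field; rewrite !gt_eqF.
  by rewrite E -expr2 in H1; lra.
by move=> _ _; rewrite gt0_muley ?lte_fin // leey.
Qed.

End schur.

(** * Schur's test, boundary discs and Moebius weights *)

Section main_estimates.
Variables (R : realType) (K : R -> R) (hK : WQ K).
Local Notation lam := (@lebesgue_measure R).
Local Notation Lam := (lam \x lam)%E.
Local Notation KK := (KK K).
Implicit Types (zt z a : R[i]) (q : plane R).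

Variable p : nat.
Hypothesis Kdbl : forall l s t : R, 1 <= l -> s <= 1 -> s <= l * t -> KK s <= (2 * l) ^+ p * KK t.

(* A majorant of (1 - |w|^2)^b / |1 - z conj(w)|^(b + 2) for b >= p. *)
Definition majorant (z w : R[i]) := (1 - cmod w) ^+ p / kerdist z w ^+ p.+2.

Lemma majorant_ge0 z w : cmod w < 1 -> 0 <= majorant z w.
Proof. by move=> w1; rewrite divr_ge0 ?exprn_ge0 ?kerdist_ge0 // subr_ge0 ltW. Qed.

Lemma majorant_le z w : cmod z < 1 -> cmod w < 1 -> majorant z w <= (kerdist z w ^+ 2)^-1.
Proof.
move=> z1 w1; have o0 := kerdist_gt0 z1 w1.
rewrite /majorant -[p.+2]addn2 exprD invfM mulrA ler_piMl ?invr_ge0 ?exprn_ge0 ?kerdist_ge0 //.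
rewrite ler_pdivrMr ?exprn_gt0 // mul1r lerXn2r ?nnegrE ?kerdist_ge0 ?subr_ge0 ?(ltW w1) //.
exact: ge_oz2.
Qed.

(** Doubling replaces the weight at z on scale dl by the weight at w on scale dl + |zt - w|, at the
    cost (6 kerdist / (1 - |w|))^p. The numerator of [majorant] cancels exactly this power and
    leaves kerdist^(-2). The 3 in 6 = 2 * 3 comes from D <= 2 dl + kerdist. *)
Lemma KK_ratio zt z w dl : cmod zt = 1 -> cmod z < 1 -> cmod w < 1 -> cmod (zt - z) < dl ->
  KK ((1 - cmod z) / dl) * majorant z w <= 6 ^+ p * KK ((1 - cmod w) / (dl + cmod (zt - w))) / kerdist z w ^+ 2.
Proof.
move=> zt1 z1 w1 zd.
have o0 := kerdist_gt0 z1 w1.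
have dl0 : 0 < dl by exact: le_lt_trans (cmod_ge0 _) zd.
set D := dl + _; have D0 : 0 < D by rewrite ltr_pwDl ?cmod_ge0.
have dz0 : 0 < 1 - cmod z by rewrite subr_gt0.
have dw0 : 0 < 1 - cmod w by rewrite subr_gt0.
have dzl := d_le_dist z zt1; have dzo := ge_kerdist z1 w1; have dwo := ge_oz2 z1 w1.
have DE : D <= 2 * dl + kerdist z w.
  have := cmod_tri zt z w; have := kerdist_dist z1 w1; rewrite /D; lra.
have H : KK ((1 - cmod z) / dl) <= (2 * (3 * (kerdist z w / (1 - cmod w)))) ^+ p * KK ((1 - cmod w) / D).
  apply: Kdbl.
  - apply: (@le_trans _ _ (kerdist z w / (1 - cmod w))); first by rewrite ler_pdivlMr // mul1r.
    by rewrite ler_peMl ?ler1n // divr_ge0 // ltW.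
  - by rewrite ler_pdivrMr // mul1r; apply: le_trans dzl (ltW zd).
  - rewrite ler_pdivrMr //.
    have -> : 3 * (kerdist z w / (1 - cmod w)) * ((1 - cmod w) / D) * dl = 3 * kerdist z w * dl / D.
      by field; rewrite !gt_eqF.
    rewrite ler_pdivlMr //.
    set x := 1 - cmod z in dz0 dzl dzo *; set o := kerdist z w in o0 dzo dwo DE *.
    have xl : x <= dl by exact: le_trans dzl (ltW zd).
    apply: (@le_trans _ _ (x * (2 * dl + o))); first by rewrite ler_pM2l.
    have -> : x * (2 * dl + o) = 2 * (x * dl) + x * o by ring.
    have -> : 3 * o * dl = 2 * (o * dl) + dl * o by ring.
    by apply: lerD; [rewrite ler_pM2l // ler_pM2r | rewrite ler_pM2r].
apply: (@le_trans _ _ ((2 * (3 * (kerdist z w / (1 - cmod w)))) ^+ p * KK ((1 - cmod w) / D) * majorant z w)).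
  by rewrite ler_wpM2r // majorant_ge0.
have -> : 2 * (3 * (kerdist z w / (1 - cmod w))) = 6 * kerdist z w / (1 - cmod w) by field; rewrite gt_eqF.
rewrite /majorant -[p.+2]addn2 exprD expr_div_n exprMn le_eqVlt; apply/orP; left; apply/eqP.
by field; rewrite !gt_eqF ?exprn_gt0.
Qed.

Lemma measurable_majorant2 D : measurable_fun D (fun qw : plane R * plane R => majorant (cplx qw.1) (cplx qw.2)).
Proof.
apply: (measurable_funS measurableT (@subsetT _ D)).
apply: measurable_funM.
  apply: measurable_funX.
  have := measurableT_comp (@measurable_rimdist R setT) (@measurable_snd _ _ (plane R) (plane R)).
  exact.
apply: measurable_funV_ge0; first by move=> qw; rewrite exprn_ge0 ?kerdist_ge0.
by apply: measurable_funX; exact: measurable_oz2.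
Qed.

Lemma measurable_majorantr D z : measurable_fun D (fun w => majorant z (cplx w)).
Proof.
apply: measurable_funM; first by apply: measurable_funX; exact: measurable_rimdist.
apply: measurable_funV_ge0; first by move=> qw; rewrite exprn_ge0 ?kerdist_ge0.
apply: measurable_funX; rewrite (_ : (fun w => _) = (fun w => kerdist (cplx w) z)); first exact: measurable_kerdist.
by apply/funext => w; rewrite ozC.
Qed.

Let mdisc : measurable (@disc R).
Proof. by rewrite disc_cdisc; exact: measurable_cdisc. Qed.

Variables (CF CL : R).
Hypotheses (CF0 : 0 < CF) (CL0 : 0 < CL).
Hypothesis HF : forall w, cmod w < 1 ->
  (\int[Lam]_(q in @disc R) (rsqrt (rimdist q) / kerdist (cplx q) w ^+ 2)%:E <= (CF * rsqrt (1 - cmod w))%:E)%E.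
Hypothesis HL : forall zt w dl, cmod zt = 1 -> cmod w < 1 -> 0 < dl ->
  (\int[Lam]_(q in rimball zt dl) (rsqrt (rimdist q) / kerdist (cplx q) w ^+ 2)%:E <=
     (CL * (rsqrt (1 - cmod w) * (dl / (dl + cmod (zt - w)))))%:E)%E.

(** In the application G is the modulus of the step function c, P is |F'| up to a constant, and X
    bounds the square of the discrete norm of c, up to the normalization of area. *)
Variables (G P : plane R -> R) (X : R).
Hypotheses (mG : measurable_fun setT G) (G0 : forall q, 0 <= G q) (X0 : 0 <= X).
Hypothesis HX : forall zt dl, cmod zt = 1 -> 0 < dl ->
  (\int[Lam]_(q in rimball zt dl) (G q ^+ 2 * KK (rimdist q / dl))%:E <= X%:E)%E.
Hypotheses (mP : measurable_fun (@disc R) P) (P0 : forall q, 0 <= P q).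
Hypothesis HP : forall q, @disc R q ->
  ((P q)%:E <= \int[Lam]_(w in @disc R) (G w * majorant (cplx q) (cplx w))%:E)%E.

Let mGD D : measurable_fun D G.
Proof. exact: (measurable_funS measurableT (@subsetT _ D)). Qed.

Lemma measurable_sqrt_rimdist D : measurable_fun D (fun w : plane R => Num.sqrt (rimdist w)).
Proof.
apply: (measurableT_comp (continuous_measurable_fun (@sqrt_continuous R))); exact: measurable_rimdist.
Qed.

Lemma int_indic_rimball zt dl (F : plane R -> R) :
  (\int[Lam]_(q in @disc R) (F q * \1_(rimball zt dl) q)%:E <= \int[Lam]_(q in rimball zt dl) (F q)%:E)%E.
Proof.
rewrite [leLHS]integral_mkcond [leRHS]integral_mkcond le_eqVlt; apply/orP; left; apply/eqP.
apply: eq_integral => q _; rewrite !patchE indicE.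
case: (boolP (q \in rimball zt dl)) => [|_]; last by rewrite mulr0; case: ifP.
by rewrite inE => -[q1 _]; rewrite mulr1 ifT // inE.
Qed.

Lemma rimdist_gt0 q : @disc R q -> 0 < rimdist q. Proof. by move=> q1; rewrite subr_gt0. Qed.

(* Schur's test with the weight (1 - |w|)^(-1/2). *)
Lemma schur_test q : @disc R q -> ((P q ^+ 2)%:E <= (CF * rsqrt (rimdist q))%:E *
  \int[Lam]_(w in @disc R) (G w ^+ 2 * Num.sqrt (rimdist w) * majorant (cplx q) (cplx w))%:E)%E.
Proof.
move=> q1.
have d0 : 0 < CF * rsqrt (rimdist q) by rewrite mulr_gt0 // rsqrt_gt0 // rimdist_gt0.
pose v w := rsqrt (rimdist w) * majorant (cplx q) (cplx w).
have mv : measurable_fun (@disc R) v.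
  by apply: measurable_funM; [apply: measurable_rsqrt; exact: measurable_rimdist | exact: measurable_majorantr].
apply: (@cauchy_schwarz_amgm R _ _ Lam _ (fun w => G w * majorant (cplx q) (cplx w)) _ v (P q)) => //.
- by apply: measurable_funM => //; exact: measurable_majorantr.
- apply: measurable_funM; last exact: measurable_majorantr.
  by apply: measurable_funM; [exact: measurable_funX | exact: measurable_sqrt_rimdist].
- by move=> w w1; rewrite mulr_ge0 // majorant_ge0.
- by move=> w w1; rewrite mulr_ge0 ?majorant_ge0 // mulr_ge0 ?exprn_ge0 ?sqrtr_ge0.
- by move=> w w1; rewrite mulr_ge0 ?majorant_ge0 // rsqrt_ge0.
- move=> s w s0 w1; have m0 := majorant_ge0 (cplx q) w1; rewrite /v /rsqrt.
  have s1 : 0 < Num.sqrt (rimdist w) by rewrite sqrtr_gt0 rimdist_gt0.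
  set m := majorant _ _ in m0 *; set r := Num.sqrt (rimdist w) in s1 *; set g := G w.
  rewrite -subr_ge0.
  have -> : 2^-1 * (s * (g ^+ 2 * r * m) + s^-1 * (r^-1 * m)) - g * m = 2^-1 * m / (s * r) * (s * r * g - 1) ^+ 2.
    by field; rewrite !gt_eqF.
  apply: mulr_ge0; last exact: sqr_ge0.
  by apply: divr_ge0; apply: mulr_ge0 => //; exact: ltW.
- exact: HP.
- apply: le_trans (HF q1); apply: ge0_le_integral => //.
  - by move=> w w1; rewrite lee_fin mulr_ge0 ?rsqrt_ge0 ?majorant_ge0.
  - by apply/measurable_EFinP.
  - by apply/measurable_EFinP; exact: measurable_frk.
  - by move=> w w1; rewrite lee_fin /v ler_wpM2l ?rsqrt_ge0 // ozC majorant_le.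
Qed.

(** Schur's test, then Tonelli with q integrated first. [KK_ratio] moves the weight to w, and the
    local Forelli-Rudin estimate leaves the factor dl / D w. This decay makes the sum over the rings
    D w ~ 2^n dl converge, each ring being bounded by X at radius 2^(n+1) dl. *)
Lemma ball_weighted_bound zt dl : cmod zt = 1 -> 0 < dl ->
  (\int[Lam]_(q in rimball zt dl) (P q ^+ 2 * KK (rimdist q / dl))%:E <= (CF * 6 ^+ p * CL * (4 ^+ p * X * 2))%:E)%E.
Proof.
move=> zt1 dl0.
have mB : measurable (rimball zt dl) by exact: measurable_rimball.
pose phi (q w : plane R) := CF * rsqrt (rimdist q) * KK (rimdist q / dl) * (G w ^+ 2 * Num.sqrt (rimdist w) * majorant (cplx q) (cplx w)).
pose D w := dl + cmod (zt - cplx w).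
have D0 w : 0 < D w by rewrite ltr_pwDl ?cmod_ge0.
have mKd E e : measurable_fun E (fun q : plane R => KK (rimdist q / e)).
  by apply: measurable_KK => //; apply: measurable_funM => //; exact: measurable_rimdist.
have mKD : measurable_fun (@disc R) (fun w => KK (rimdist w / D w)).
  apply: measurable_KK => //; apply: measurable_funM; first exact: measurable_rimdist.
  apply: measurable_funV_ge0; first by move=> w; rewrite ltW.
  apply: measurable_funD => //; exact: (measurable_funS measurableT (@subsetT _ _) (measurable_cdist zt)).
have mDV : measurable_fun (@disc R) (fun w => dl / D w).
  apply: measurable_funM => //.
  apply: measurable_funV_ge0; first by move=> w; rewrite ltW.
  apply: measurable_funD => //; exact: (measurable_funS measurableT (@subsetT _ _) (measurable_cdist zt)).
pose psi w := G w ^+ 2 * KK (rimdist w / D w) * (dl / D w).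
have psi0 w : 0 <= psi w.
  apply: mulr_ge0; first by apply: mulr_ge0; [exact: exprn_ge0 | exact: KK_ge0 hK _].
  by rewrite divr_ge0 // ltW.
have mpsi : measurable_fun (@disc R) psi.
  by apply: measurable_funM => //; apply: measurable_funM => //; exact: measurable_funX.
have m2 E (F : plane R -> R) : measurable_fun setT F -> measurable_fun E (fun qw : plane R * plane R => F qw.1).
  move=> mF; apply: (measurable_funS measurableT (@subsetT _ E)).
  exact: (measurableT_comp mF measurable_fst).
have m3 E (F : plane R -> R) : measurable_fun setT F -> measurable_fun E (fun qw : plane R * plane R => F qw.2).
  move=> mF; apply: (measurable_funS measurableT (@subsetT _ E)).
  exact: (measurableT_comp mF measurable_snd).
have mphi : measurable_fun (rimball zt dl `*` @disc R) (fun qw => phi qw.1 qw.2).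
  apply: measurable_funM.
    apply: (m2 _ (fun q => CF * rsqrt (rimdist q) * KK (rimdist q / dl))).
    apply: measurable_funM => //; apply: measurable_funM => //; apply: measurable_rsqrt; exact: measurable_rimdist.
  apply: measurable_funM; last exact: measurable_majorant2.
  apply: (m3 _ (fun w => G w ^+ 2 * Num.sqrt (rimdist w))).
  by apply: measurable_funM; [exact: measurable_funX | exact: measurable_sqrt_rimdist].
have phi0 q w : rimball zt dl q -> @disc R w -> 0 <= phi q w.
  move=> _ w1; rewrite /phi mulr_ge0 //.
    by rewrite !mulr_ge0 ?rsqrt_ge0 ?(KK_ge0 hK) // ltW.
  by rewrite mulr_ge0 ?majorant_ge0 // mulr_ge0 ?exprn_ge0 ?sqrtr_ge0.
have step1 : (\int[Lam]_(q in rimball zt dl) (P q ^+ 2 * KK (rimdist q / dl))%:E <=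
   \int[Lam]_(q in rimball zt dl) \int[Lam]_(w in @disc R) (phi q w)%:E)%E.
  have mI q : measurable_fun (@disc R) (fun w : plane R => G w ^+ 2 * Num.sqrt (rimdist w) * majorant (cplx q) (cplx w)).
    apply: measurable_funM; last exact: measurable_majorantr.
    by apply: measurable_funM; [exact: measurable_funX | exact: measurable_sqrt_rimdist].
  have I0 q w : @disc R w -> 0 <= G w ^+ 2 * Num.sqrt (rimdist w) * majorant (cplx q) (cplx w).
    by move=> w1; rewrite mulr_ge0 ?majorant_ge0 // mulr_ge0 ?exprn_ge0 ?sqrtr_ge0.
  apply: ge0_le_integral => //.
  - by move=> q _; rewrite lee_fin mulr_ge0 ?exprn_ge0 ?(KK_ge0 hK).
  - apply/measurable_EFinP; apply: measurable_funM => //; apply: measurable_funX.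
    by apply: (measurable_funS mdisc _ mP) => q [].
  - exact: (measurable_plane1 mB mdisc mphi phi0).
  - move=> q qB; have q1 : @disc R q by case: qB.
    rewrite (_ : (\int[Lam]_(w in @disc R) (phi q w)%:E = (CF * rsqrt (rimdist q) * KK (rimdist q / dl))%:E *
       \int[Lam]_(w in @disc R) (G w ^+ 2 * Num.sqrt (rimdist w) * majorant (cplx q) (cplx w))%:E)%E); last first.
      rewrite -ge0_integralZl_EFin //.
      - by move=> w w1; rewrite lee_fin I0.
      - by apply/measurable_EFinP.
      - by rewrite !mulr_ge0 ?rsqrt_ge0 ?(KK_ge0 hK) // ltW.
    rewrite mulrC [(CF * _ * _)%R]mulrC !EFinM -muleA; apply: lee_wpmul2l.
      by rewrite lee_fin (KK_ge0 hK).
    by rewrite -EFinM; exact: schur_test.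
apply: (le_trans step1).
rewrite (tonelli_plane mB mdisc mphi phi0).
have step2 : (\int[Lam]_(w in @disc R) \int[Lam]_(q in rimball zt dl) (phi q w)%:E <=
   \int[Lam]_(w in @disc R) (CF * 6 ^+ p * CL * psi w)%:E)%E.
  apply: ge0_le_integral => //.
  - by move=> w w1; apply: integral_ge0 => q qB; rewrite lee_fin phi0.
  - exact: (measurable_plane2 mB mdisc mphi phi0).
  - by apply/measurable_EFinP; apply: measurable_funM.
  - move=> w w1; set c := CF * 6 ^+ p * (G w ^+ 2 * Num.sqrt (rimdist w) * KK (rimdist w / D w)).
    have c0 : 0 <= c.
      rewrite /c; apply: mulr_ge0; first by rewrite mulr_ge0 ?exprn_ge0 // ltW.
      by rewrite mulr_ge0 ?(KK_ge0 hK) // mulr_ge0 ?sqrtr_ge0 ?exprn_ge0.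
    apply: (@le_trans _ _ (\int[Lam]_(q in rimball zt dl) (c * (rsqrt (rimdist q) / kerdist (cplx q) (cplx w) ^+ 2))%:E)%E).
      apply: ge0_le_integral => //.
      - by move=> q qB; rewrite lee_fin phi0.
      - apply/measurable_EFinP; apply: measurable_funM.
          apply: measurable_funM => //; apply: measurable_funM => //; apply: measurable_rsqrt; exact: measurable_rimdist.
        apply: measurable_funM => //.
        rewrite (_ : (fun q => _) = (fun q => majorant (cplx q) (cplx w))) //.
        apply: measurable_funM => //.
        apply: measurable_funV_ge0; first by move=> q; rewrite exprn_ge0 ?kerdist_ge0.
        by apply: measurable_funX; exact: measurable_kerdist.
      - by apply/measurable_EFinP; apply: measurable_funM => //; exact: measurable_frk.
      - move=> q [q1 qd]; rewrite lee_fin /phi /c.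
        have := KK_ratio zt1 q1 w1 qd; rewrite -/(D w) -/(rimdist q) -/(rimdist w).
        set k1 := KK _; set k2 := KK _; set m := majorant _ _; set o := kerdist _ _ => Hk.
        have H : CF * rsqrt (rimdist q) * (G w ^+ 2 * Num.sqrt (rimdist w)) * (k1 * m) <=
                 CF * rsqrt (rimdist q) * (G w ^+ 2 * Num.sqrt (rimdist w)) * (6 ^+ p * k2 / o ^+ 2).
          apply: ler_wpM2l Hk; apply: mulr_ge0; first by rewrite mulr_ge0 ?rsqrt_ge0 // ltW.
          by rewrite mulr_ge0 ?sqrtr_ge0 ?exprn_ge0.
        apply: le_trans (le_trans H _); rewrite le_eqVlt; apply/orP; left; apply/eqP; ring.
    rewrite (_ : (\int[Lam]_(q in rimball zt dl) (c * (rsqrt (rimdist q) / kerdist (cplx q) (cplx w) ^+ 2))%:E =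
      c%:E * \int[Lam]_(q in rimball zt dl) (rsqrt (rimdist q) / kerdist (cplx q) (cplx w) ^+ 2)%:E)%E); last first.
      rewrite -ge0_integralZl_EFin //; first by move=> q _; rewrite lee_fin frk_ge0.
      by apply/measurable_EFinP; exact: measurable_frk.
    apply: (@le_trans _ _ (c%:E * (CL * (rsqrt (1 - cmod (cplx w)) * (dl / D w)))%:E)%E).
      by apply: lee_wpmul2l; [rewrite lee_fin | exact: HL].
    rewrite -EFinM lee_fin /c /psi /rsqrt -/(rimdist w) le_eqVlt; apply/orP; left; apply/eqP.
    have s1 : 0 < Num.sqrt (rimdist w) by rewrite sqrtr_gt0 rimdist_gt0.
    by field; rewrite !gt_eqF.
apply: (le_trans step2).
have step3 : (\int[Lam]_(w in @disc R) (psi w)%:E <= (4 ^+ p * X * 2)%:E)%E.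
  (* The exponent n + 1 because D w < 2^(n+1) dl on the ring; replacing D w by this radius in the
     weight costs the factor 4^p. *)
  pose dn n := 2 ^+ n.+1 * dl.
  have dn0 n : 0 < dn n by rewrite mulr_gt0 // exprn_gt0.
  pose g n q := 4 ^+ p * 2^-1 ^+ n * (G q ^+ 2 * KK (rimdist q / dn n) * \1_(rimball zt (dn n)) q).
  have mg n : measurable_fun (@disc R) (fun q => G q ^+ 2 * KK (rimdist q / dn n) * \1_(rimball zt (dn n)) q).
    apply: measurable_funM; last by apply: measurable_indic; exact: measurable_rimball.
    by apply: measurable_funM => //; exact: measurable_funX.
  have g0 n q : 0 <= G q ^+ 2 * KK (rimdist q / dn n) * \1_(rimball zt (dn n)) q.
    by rewrite mulr_ge0 // mulr_ge0 ?exprn_ge0 ?(KK_ge0 hK).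
  have cn0 n : 0 <= 4 ^+ p * 2^-1 ^+ n :> R by rewrite mulr_ge0 ?exprn_ge0 ?invr_ge0.
  apply: (@int_le_series R _ _ Lam (@disc R) _ g (fun n => 4 ^+ p * X * 2^-1 ^+ n)) => //.
  - by move=> n; apply: measurable_funM.
  - by move=> n q _; rewrite /g mulr_ge0.
  - move=> w w1.
    have x1 : 1 <= D w / dl by rewrite ler_pdivlMr // mul1r lerDl cmod_ge0.
    have c12 : 1 < 2 :> R by rewrite ltr1n.
    have [n /andP[n1 n2]] := pow_bracket c12 x1.
    rewrite ler_pdivlMr // in n1; rewrite ltr_pdivrMr // in n2.
    exists n; rewrite /g indicE mem_set ?mulr1; last first.
      by split => //; apply: le_lt_trans n2; rewrite lerDr ltW.
    have wD : rimdist w <= D w by apply: (le_trans (d_le_dist _ zt1)); rewrite lerDr ltW.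
    have dw0 := rimdist_gt0 w1.
    have H1 : KK (rimdist w / D w) <= (2 * 2) ^+ p * KK (rimdist w / dn n).
      apply: Kdbl; first by rewrite ler1n.
        by rewrite ler_pdivrMr // mul1r.
      have -> : 2 * (rimdist w / dn n) = rimdist w / (2 ^+ n * dl).
        by rewrite /dn exprS; field; rewrite !gt_eqF ?exprn_gt0.
      by rewrite ler_pM2l // lef_pV2 // posrE // mulr_gt0 // exprn_gt0.
    have H2 : dl / D w <= 2^-1 ^+ n.
      rewrite ler_pdivrMr // exprVn mulrC ler_pdivlMr ?exprn_gt0 // mulrC //.
    rewrite -natrM in H1; rewrite /psi.
    apply: (@le_trans _ _ (G w ^+ 2 * (4 ^+ p * KK (rimdist w / dn n)) * 2^-1 ^+ n)).
      apply: ler_pM => //.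
      - by rewrite mulr_ge0 ?(KK_ge0 hK) ?exprn_ge0.
      - by rewrite divr_ge0 // ltW.
      - by apply: ler_wpM2l H1; exact: exprn_ge0.
    by rewrite le_eqVlt; apply/orP; left; apply/eqP; ring.
  - move=> n; rewrite (_ : (\int[Lam]_(q in @disc R) (g n q)%:E = (4 ^+ p * 2^-1 ^+ n)%:E *
      \int[Lam]_(q in @disc R) (G q ^+ 2 * KK (rimdist q / dn n) * \1_(rimball zt (dn n)) q)%:E)%E); last first.
      rewrite -ge0_integralZl_EFin //; first by move=> q _; rewrite lee_fin.
      by apply/measurable_EFinP.
    apply: (@le_trans _ _ ((4 ^+ p * 2^-1 ^+ n)%:E * X%:E)%E).
      apply: lee_wpmul2l; first by rewrite lee_fin.
      apply: le_trans (int_indic_rimball _ _ _) (HX zt1 (dn0 n)).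
    by rewrite -EFinM lee_fin mulrAC.
  - move=> N; rewrite -mulr_sumr; apply: ler_wpM2l (geo_half R N).
    by rewrite mulr_ge0 ?exprn_ge0.
have c0 : 0 <= CF * 6 ^+ p * CL by rewrite !mulr_ge0 ?exprn_ge0 // ltW.
rewrite (_ : (\int[Lam]_(w in @disc R) (CF * 6 ^+ p * CL * psi w)%:E =
  (CF * 6 ^+ p * CL)%:E * \int[Lam]_(w in @disc R) (psi w)%:E)%E); last first.
  rewrite -ge0_integralZl_EFin //; last by apply/measurable_EFinP.
  by move=> w _; rewrite lee_fin.
by rewrite [(_ * (4 ^+ p * X * 2))%:E]EFinM; apply: lee_wpmul2l; rewrite ?lee_fin.
Qed.

Lemma cmod_mobius a z : cmod (mobius a z) = cmod (z - a) / kerdist z a.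
Proof. by rewrite /mobius cmodM cmodV cmodBC /kerdist [a^* * z]mulrC. Qed.

(** From 1 - |phi_a|^2 = (1 - |z|^2) (1 - |a|^2) / kerdist^2: each numerator loses a factor 2, and
    kerdist >= (1 - |a| + |zt - z|) / 3, so 36 = 2 * 2 * 9. *)
Lemma mobius_defect a z zt : cmod a < 1 -> cmod z < 1 -> cmod (zt - a) = 1 - cmod a ->
  1 - cmod (mobius a z) ^+ 2 <= 36 * (1 - cmod a) * (1 - cmod z) / ((1 - cmod a) + cmod (zt - z)) ^+ 2.
Proof.
move=> a1 z1 zta; have o0 := kerdist_gt0 z1 a1; rewrite cmod_mobius.
set r := cmod (zt - z); set dl := 1 - cmod a in zta *; set d := 1 - cmod z.
have dl0 : 0 < dl by rewrite subr_gt0.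
have d0 : 0 < d by rewrite subr_gt0.
have D0 : 0 < dl + r by rewrite ltr_pwDl ?cmod_ge0.
have DO : dl + r <= 3 * kerdist z a.
  have := cmod_tri zt a z; have := kerdist_dist z1 a1; have := ge_oz2 z1 a1.
  rewrite -/r -/dl zta cmodBC; lra.
have E : 1 - (cmod (z - a) / kerdist z a) ^+ 2 = (1 - cmod z ^+ 2) * (1 - cmod a ^+ 2) / kerdist z a ^+ 2.
  rewrite expr_div_n -{1}(@divff _ (kerdist z a ^+ 2)) ?gt_eqF ?exprn_gt0 // -mulrBl; congr (_ / _).
  by rewrite kerdist_sqr addrAC subrr add0r.
rewrite E.
have H1 : 1 - cmod z ^+ 2 <= 2 * d.
  have := cmod_ge0 z; rewrite /d => z0; rewrite -subr_ge0.
  have -> : 2 * (1 - cmod z) - (1 - cmod z ^+ 2) = (1 - cmod z) ^+ 2 by ring.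
  exact: sqr_ge0.
have H2 : 1 - cmod a ^+ 2 <= 2 * dl.
  rewrite -subr_ge0 /dl; have -> : 2 * (1 - cmod a) - (1 - cmod a ^+ 2) = (1 - cmod a) ^+ 2 by ring.
  exact: sqr_ge0.
have H3 : 0 <= 1 - cmod z ^+ 2 by rewrite subr_ge0 exprn_ile1 ?cmod_ge0 // ltW.
have H4 : 0 <= 1 - cmod a ^+ 2 by rewrite subr_ge0 exprn_ile1 ?cmod_ge0 // ltW.
rewrite ler_pdivrMr ?exprn_gt0 //.
apply: (@le_trans _ _ (2 * d * (2 * dl))); first exact: ler_pM.
rewrite [leRHS]mulrAC ler_pdivlMr ?exprn_gt0 //.
have H5 : (dl + r) ^+ 2 <= 9 * kerdist z a ^+ 2.
  have -> : 9 * kerdist z a ^+ 2 = (3 * kerdist z a) ^+ 2 by ring.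
  by apply: lerXn2r => //; rewrite nnegrE ltW // mulr_gt0.
have -> : 36 * dl * d * kerdist z a ^+ 2 = 2 * d * (2 * dl) * (9 * kerdist z a ^+ 2) by ring.
by rewrite ler_pM2l // !mulr_gt0.
Qed.

Variables (phi : nat -> R) (S : R).
Hypotheses (phi0 : forall n, 0 <= phi n) (HS : forall N, \sum_(0 <= n < N) phi n <= S).
Hypothesis Hphi : forall n t, 0 <= t <= 1 -> KK (2^-1 ^+ n.+1 * t) <= phi n * KK t.

Lemma measurable_mobius D a : measurable_fun D (fun q : plane R => KK (1 - cmod (mobius a (cplx q)) ^+ 2)).
Proof.
apply: (measurable_funS measurableT (@subsetT _ D)).
apply: measurable_KK => //; apply: measurable_funB => //; apply: measurable_funX.
rewrite (_ : (fun q : plane R => _) = (fun q : plane R => cmod (a - cplx q) / kerdist (cplx q) a)).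
  apply: measurable_funM; first exact: measurable_cdist.
  by apply: measurable_funV_ge0; [move=> q; exact: kerdist_ge0 | exact: measurable_kerdist].
by apply/funext => q; rewrite cmod_mobius cmodBC.
Qed.

(* On the ring of points at distance about 2^n (1 - |a|) from a / |a| the weight
   K(1 - |phi_a|^2) is at most a constant times
   phi_K(2^-n) K((1 - |q|) / (2^n (1 - |a|))), and the phi_K(2^-n) are summable. *)
Lemma mobius_weighted_bound a : cmod a < 1 ->
  (\int[Lam]_(q in @disc R) (P q ^+ 2 * KK (1 - cmod (mobius a (cplx q)) ^+ 2))%:E <=
   ((2 * 144) ^+ p * (CF * 6 ^+ p * CL * (4 ^+ p * X * 2)) * S)%:E)%E.
Proof.
move=> a1; have [zt zt1 zta] := circle_proj a1.
set XX := CF * _ * _ * _; set dl := 1 - cmod a in zta; have dl0 : 0 < dl by rewrite subr_gt0.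
have XX0 : 0 <= XX by rewrite !mulr_ge0 ?exprn_ge0 // ltW.
set C := (2 * 144) ^+ p : R; have C0 : 0 <= C by rewrite exprn_ge0 // mulr_ge0.
pose dn n := 2 ^+ n.+1 * dl.
have dn0 n : 0 < dn n by rewrite mulr_gt0 // exprn_gt0.
pose g n q := C * phi n * (P q ^+ 2 * KK (rimdist q / dn n) * \1_(rimball zt (dn n)) q).
have mg n : measurable_fun (@disc R) (fun q => P q ^+ 2 * KK (rimdist q / dn n) * \1_(rimball zt (dn n)) q).
  apply: measurable_funM; last by apply: measurable_indic; exact: measurable_rimball.
  apply: measurable_funM; first exact: measurable_funX.
  by apply: measurable_KK => //; apply: measurable_funM => //; exact: measurable_rimdist.
have g0 n q : 0 <= P q ^+ 2 * KK (rimdist q / dn n) * \1_(rimball zt (dn n)) q.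
  by rewrite mulr_ge0 // mulr_ge0 ?exprn_ge0 ?(KK_ge0 hK).
have cn0 n : 0 <= C * phi n by exact: mulr_ge0.
apply: (@int_le_series R _ _ Lam (@disc R) _ g (fun n => C * XX * phi n)) => //.
- by apply: measurable_funM; [exact: measurable_funX | exact: measurable_mobius].
- by move=> n; apply: measurable_funM.
- by move=> q _; rewrite mulr_ge0 ?exprn_ge0 ?(KK_ge0 hK).
- by move=> n q _; rewrite /g mulr_ge0.
- move=> q q1; set D := dl + cmod (zt - cplx q).
  have D0 : 0 < D by rewrite ltr_pwDl ?cmod_ge0.
  have x1 : 1 <= D / dl by rewrite ler_pdivlMr // mul1r lerDl cmod_ge0.
  have c12 : 1 < 2 :> R by rewrite ltr1n.
  have [n /andP[n1 n2]] := pow_bracket c12 x1.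
  rewrite ler_pdivlMr // in n1; rewrite ltr_pdivrMr // in n2.
  exists n; rewrite /g indicE mem_set ?mulr1; last first.
    by split => //; apply: le_lt_trans n2; rewrite lerDr ltW.
  have wD : rimdist q <= D by apply: (le_trans (d_le_dist _ zt1)); rewrite lerDr ltW.
  have dq0 := rimdist_gt0 q1.
  have t01 : 0 <= rimdist q / dn n <= 1.
    rewrite divr_ge0 ?(ltW dq0) ?(ltW (dn0 n)) //= ler_pdivrMr // mul1r.
    by apply: (le_trans wD); rewrite ltW.
  have H1 : KK (1 - cmod (mobius a (cplx q)) ^+ 2) <= C * KK (2^-1 ^+ n.+1 * (rimdist q / dn n)).
    apply: Kdbl; first by rewrite ler1n.
      by rewrite gerBl exprn_ge0 ?cmod_ge0.
    apply: (le_trans (mobius_defect a1 q1 zta)); rewrite -/dl -/D -/(rimdist q).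
    (* 144 = 36 * 4: the radius [dn n] and the argument of phi_K both carry the exponent n + 1,
       while the ring is bounded below by 2^n. *)
    have -> : 144 * (2^-1 ^+ n.+1 * (rimdist q / dn n)) = 36 * dl * rimdist q / (2 ^+ n * dl) ^+ 2.
      by rewrite /dn exprVn exprS; field; rewrite !gt_eqF ?exprn_gt0.
    rewrite ler_pM2l; last by rewrite !mulr_gt0.
    rewrite lef_pV2 ?posrE ?exprn_gt0 ?mulr_gt0 ?exprn_gt0 //.
    by rewrite lerXn2r ?nnegrE ?mulr_ge0 ?exprn_ge0 ?(ltW D0) ?(ltW dl0).
  have H2 := le_trans H1 (ler_wpM2l C0 (Hphi n t01)).
  apply: (le_trans (ler_wpM2l (exprn_ge0 2 (P0 q)) H2)).
  by rewrite le_eqVlt; apply/orP; left; apply/eqP; ring.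
- move=> n; rewrite (_ : (\int[Lam]_(q in @disc R) (g n q)%:E = (C * phi n)%:E *
    \int[Lam]_(q in @disc R) (P q ^+ 2 * KK (rimdist q / dn n) * \1_(rimball zt (dn n)) q)%:E)%E); last first.
    rewrite -ge0_integralZl_EFin //; first by move=> q _; rewrite lee_fin.
    by apply/measurable_EFinP.
  apply: (@le_trans _ _ ((C * phi n)%:E * XX%:E)%E).
    apply: lee_wpmul2l; first by rewrite lee_fin.
    apply: le_trans (int_indic_rimball _ _ _) (ball_weighted_bound zt1 (dn0 n)).
  by rewrite -EFinM lee_fin mulrAC.
- move=> N; rewrite -mulr_sumr; apply: ler_wpM2l (HS N).
  exact: mulr_ge0.
Qed.

End main_estimates.

Section schur_main.
Variables (R : realType) (K : R -> R) (hK : WQ K).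
Local Notation lam := (@lebesgue_measure R).
Local Notation Lam := (lam \x lam)%E.

Lemma schur_bound : exists p : nat, exists2 A : R, 0 < A & forall (G P : plane R -> R) (X : R),
  measurable_fun setT G -> (forall q, 0 <= G q) -> 0 <= X ->
  (forall zt dl, cmod zt = 1 -> 0 < dl ->
    (\int[Lam]_(q in rimball zt dl) (G q ^+ 2 * KK K (rimdist q / dl))%:E <= X%:E)%E) ->
  measurable_fun (@disc R) P -> (forall q, 0 <= P q) ->
  (forall q, @disc R q ->
    ((P q)%:E <= \int[Lam]_(w in @disc R) (G w * majorant p (cplx q) (cplx w))%:E)%E) ->
  forall a, cmod a < 1 ->
  (\int[Lam]_(q in @disc R) (P q ^+ 2 * KK K (1 - cmod (mobius a (cplx q)) ^+ 2))%:E <= (A * X)%:E)%E.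
Proof.
have [p Kdbl] := KK_doubling hK.
have [CF CF0 HF] := forelli_rudin R.
have [CL CL0 HL] := forelli_rudin_local R.
have [phi [S [phi0 HS Hphi]]] := phi_summable hK.
have S0 : 0 <= S by have := HS 0%N; rewrite big_geq.
(* S + 1 in place of S keeps the constant positive. *)
exists p, ((2 * 144) ^+ p * (CF * 6 ^+ p * CL * (4 ^+ p * 2)) * (S + 1)).
  by rewrite !mulr_gt0 ?exprn_gt0 ?mulr_gt0 // ltr_wpDl.
move=> G P X mG G0 X0 HX mP P0 HP a a1.
apply: (le_trans (mobius_weighted_bound hK Kdbl CF0 CL0 HF HL mG G0 X0 HX mP P0 HP phi0 HS Hphi a1)).
rewrite lee_fin; set C := (2 * 144) ^+ p : R; set E := CF * 6 ^+ p * CL.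
have -> : C * (E * (4 ^+ p * 2)) * (S + 1) * X = C * (E * (4 ^+ p * X * 2)) * S + C * (E * (4 ^+ p * X * 2)).
  by ring.
have C0 : 0 <= C by apply: exprn_ge0; rewrite mulr_ge0.
have E0 : 0 <= E by apply: mulr_ge0 (ltW CL0); apply: mulr_ge0 (ltW CF0) _; exact: exprn_ge0.
by rewrite lerDl; apply: mulr_ge0 C0 (mulr_ge0 E0 _); rewrite !mulr_ge0 ?exprn_ge0.
Qed.

End schur_main.

(** * Polar cells and Carleson boxes *)

Section angles.
Variable R : realType.
Implicit Types (t u : R).

Lemma cos_small t : `|t| < 2 * pi -> cos t = 1 -> t = 0.
Proof.
move=> tb c1; have [//|t0] := eqVneq t 0.
have tp : 0 < `|t| by rewrite normr_gt0.
rewrite -cos_norm in c1; have := @sin_gt0_pi R (`|t| / 2).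
have -> : 0 < `|t| / 2 < pi.
  by rewrite divr_gt0 //= ltr_pdivrMr // mulrC.
move=> /(_ isT) sp.
have := cos_mulr2n (`|t| / 2); have -> : (`|t| / 2) *+ 2 = `|t| by rewrite -mulr_natr; field.
rewrite c1.
have := cos2Dsin2 (`|t| / 2) => E.
have s2 : 0 < sin (`|t| / 2) ^+ 2 by rewrite exprn_gt0.
rewrite mulr2n; lra.
Qed.

Lemma polar_angle_unique t u : `|t - u| < 2 * pi -> cos t = cos u -> sin t = sin u -> t = u.
Proof.
move=> tu ct st; apply/eqP; rewrite -subr_eq0; apply/eqP; apply: cos_small => //.
by rewrite cosB ct st -!expr2 cos2Dsin2.
Qed.

Lemma cosD2piz t (k : int) : cos (t + 2 * pi * k%:~R) = cos t.
Proof.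
have H n x : cos (x + 2 * pi * n%:R) = cos x :> R.
  have -> : 2 * pi * n%:R = (pi *+ 2) *+ n :> R by rewrite -[in RHS]mulr_natr -[pi *+ 2]mulr_natl.
  exact: (periodicn (@cosD2pi R)).
case: k => n; first exact: H.
by rewrite -(H n.+1) NegzE mulrNz mulrN -addrA addNr addr0.
Qed.

Lemma sinD2piz t (k : int) : sin (t + 2 * pi * k%:~R) = sin t.
Proof.
have H n x : sin (x + 2 * pi * n%:R) = sin x :> R.
  have -> : 2 * pi * n%:R = (pi *+ 2) *+ n :> R by rewrite -[in RHS]mulr_natr -[pi *+ 2]mulr_natl.
  exact: (periodicn (@sinD2pi R)).
case: k => n; first exact: H.
by rewrite -(H n.+1) NegzE mulrNz mulrN -addrA addNr addr0.
Qed.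

Lemma angle_in t a : exists2 k : int, a <= t + 2 * pi * k%:~R & t + 2 * pi * k%:~R < a + 2 * pi.
Proof.
have p0 : 0 < 2 * pi :> R by rewrite mulr_gt0 // pi_gt0.
set x := (a - t) / (2 * pi).
have xE : x * (2 * pi) = a - t by rewrite /x divfK // gt_eqF.
have /andP[x1 x2] := ceil_itv x.
exists (Num.ceil x).
  by rewrite -lerBlDl -xE mulrC ler_pM2l.
rewrite -ltrBrDl addrAC -xE [ltLHS]mulrC (_ : x * (2 * pi) + 2 * pi = (x + 1) * (2 * pi)); last by ring.
by rewrite ltr_pM2r // -ltrBlDr; move: x1; rewrite intrB.
Qed.

(** On [0, pi/4] the mean value theorem with cos >= 1/2, on [pi/4, pi/2] the bound sin >= 1/2; in
    both cases pi >= 2 finishes. The weak constant pi is the one that the normalized arclength asks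
    for in [ball_in_box]. *)
Lemma jordan t : `|t| <= pi / 2 -> `|t| <= pi * `|sin t|.
Proof.
suff H u : 0 <= u -> u <= pi / 2 -> u <= pi * sin u.
  move=> tb; apply: (le_trans (H _ (normr_ge0 t) tb)); rewrite ler_pM2l ?pi_gt0 //.
  have [t0|t0] := leP 0 t; first by rewrite ger0_norm // ler_norm.
  by rewrite ltr0_norm // sinN -normrN ler_norm.
move=> u0 u2; have p2 := pi_ge2 R.
pose c : R := cos (pi / 4); pose s : R := sin (pi / 4).
have c0 : 0 <= c by apply: cos_ge0_pihalf; apply/andP; split; lra.
have c2 : c ^+ 2 = 2^-1.
  have := cos_mulr2n (pi / 4 : R); have -> : (pi / 4) *+ 2 = pi / 2 :> R by rewrite -mulr_natr; field.
  by rewrite cos_pihalf -/c mulr2n => E; lra.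
have c1 : 2^-1 <= c by nra.
have [u4|u4] := leP u (pi / 4).
  have [->|un] := eqVneq u 0; first by rewrite sin0 mulr0.
  have up : 0 < u by rewrite lt_neqAle eq_sym un.
  have [x xu E] := @MVT R sin cos 0 u up (fun x _ => is_derive_sin x) (continuous_subspaceT (@continuous_sin R)).
  rewrite sin0 !subr0 in E; rewrite E mulrA.
  move: xu; rewrite in_itv /= => /andP[x0 xu].
  have cx : c <= cos x.
    have := @ltr_cos R (pi / 4) x; rewrite !in_itv /= => H.
    rewrite leNgt; apply/negP; rewrite H //; last 2 first.
    - by apply/andP; split; lra.
    - by apply/andP; split; lra.
    by rewrite ltNge ltW // (lt_le_trans xu).
  apply: ler_peMl => //; nra.
have s0 : 2^-1 <= s.
  have := @sin2cos2 R (pi / 4); rewrite -/s -/c c2 => E.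
  have : 0 <= s by apply: sin_ge0_pi; apply/andP; split; lra.
  nra.
have su : s <= sin u.
  have := @ltr_sin R u (pi / 4); rewrite !in_itv /= => H.
  rewrite leNgt; apply/negP; rewrite H //; last 2 first.
  - by apply/andP; split; lra.
  - by apply/andP; split; lra.
  by rewrite ltNge ltW.
nra.
Qed.

End angles.

(** * Polar coordinates *)

Section polar.
Variable R : realType.
Implicit Types (p q : plane R) (t u r : R).

Lemma cmod_polar r t : 0 <= r -> cmod (cplx (polar r t)) = r.
Proof.
move=> r0; rewrite cmodE /cplx /polar /= !exprMn -mulrDr cos2Dsin2 mulr1 sqrtr_sqr ger0_norm //.
Qed.

(** Unlike [carg] it takes values in [0, 2 pi[, the range of the cell bounds. At the origin the
    quotient is 0 and the value is pi / 2. *)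
Definition ang p : R := let v := acos (p.1 / cmod (cplx p)) in if 0 <= p.2 then v else 2 * pi - v.

Lemma ratio_bound p : -1 <= p.1 / cmod (cplx p) <= 1.
Proof.
rewrite -ler_norml normrM normfV (ger0_norm (cmod_ge0 _)).
have [->|c0] := eqVneq (cmod (cplx p)) 0; first by rewrite invr0 mulr0.
have cp : 0 < cmod (cplx p) by rewrite lt_neqAle eq_sym c0 cmod_ge0.
by rewrite ler_pdivrMr // mul1r; exact: (Re_le_cmod (cplx p)).
Qed.

Lemma ratio_strict p : p.2 != 0 -> -1 < p.1 / cmod (cplx p) < 1.
Proof.
move=> y0; have E := cmod_cplx p; have y2 : 0 < p.2 ^+ 2 by rewrite exprn_even_gt0.
have c0 := cmod_ge0 (cplx p).
have cp : 0 < cmod (cplx p).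
  rewrite lt_neqAle c0 andbT eq_sym; apply/eqP => c1; move: E; rewrite c1 expr2 mul0r => E.
  by have := sqr_ge0 p.1; lra.
rewrite -ltr_norml normrM normfV (ger0_norm c0) ltr_pdivrMr // mul1r.
rewrite -(@ltr_pXn2r _ 2) ?nnegrE // E real_normK ?num_real //; lra.
Qed.

Lemma ang_bounds p : 0 <= ang p < 2 * pi.
Proof.
have pp := pi_gt0 R; have rb := ratio_bound p.
rewrite /ang; case: ifPn => [_|]; [|rewrite -ltNge => y0].
  rewrite acos_ge0 //=; apply: le_lt_trans (acos_lepi rb) _; lra.
have y1 : p.2 != 0 by rewrite lt_eqF.
have /andP[r1 r2] := ratio_strict y1.
have a0 : 0 < acos (p.1 / cmod (cplx p)) by apply: acos_gt0; rewrite (ltW r1).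
by have := acos_lepi rb => a1; apply/andP; split; lra.
Qed.

Lemma polar_ang p : p = polar (cmod (cplx p)) (ang p).
Proof.
have rb := ratio_bound p; have E := cmod_cplx p; set r := cmod (cplx p) in rb E *.
have r0 : 0 <= r by exact: cmod_ge0.
have [rz|rn] := eqVneq r 0.
  rewrite rz /polar !mul0r; have := sqr_ge0 p.1; have := sqr_ge0 p.2.
  rewrite rz expr2 mul0r in E; move=> h1 h2.
  case: p E h1 h2 {rb r r0 rz} => x y /= E h1 h2.
  by congr pair; apply/eqP; rewrite -sqrf_eq0; apply/eqP; lra.
have rp : 0 < r by rewrite lt_neqAle eq_sym rn.
have cE : cos (ang p) = p.1 / r.
  rewrite /ang -/r; case: ifP => _; first by rewrite acosK // in_itv.
  have -> : 2 * pi - acos (p.1 / r) = - acos (p.1 / r) + 2 * pi * 1%:~R by rewrite mulr1 addrC.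
  by rewrite cosD2piz cosN acosK // in_itv.
have sq : Num.sqrt (1 - (p.1 / r) ^+ 2) = `|p.2| / r.
  have -> : 1 - (p.1 / r) ^+ 2 = (p.2 / r) ^+ 2.
    have -> : 1 = (p.1 ^+ 2 + p.2 ^+ 2) / r ^+ 2 by rewrite -E divff // expf_neq0.
    by rewrite !expr_div_n -mulrBl addrAC subrr add0r.
  by rewrite sqrtr_sqr normrM normfV (ger0_norm r0).
have sE : sin (ang p) = p.2 / r.
  rewrite /ang -/r; case: ifPn => [y0|]; first by rewrite sin_acos // sq ger0_norm.
  rewrite -ltNge => y0.
  have -> : 2 * pi - acos (p.1 / r) = - acos (p.1 / r) + 2 * pi * 1%:~R by rewrite mulr1 addrC.
  by rewrite sinD2piz sinN sin_acos // sq ltr0_norm // mulNr opprK.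
rewrite /polar cE sE ![r * _]mulrC !divfK //; by case: (p).
Qed.

Lemma polar_eq_ang r t p : 0 < r -> p = polar r t -> exists k : int, t = ang p + 2 * pi * k%:~R.
Proof.
move=> r0 pE; have rE : cmod (cplx p) = r by rewrite pE cmod_polar // ltW.
have := polar_ang p; rewrite rE {1}pE => -[c s].
have rn : r != 0 by rewrite gt_eqF.
have [k k1 k2] := angle_in (ang p) t; exists k.
apply: polar_angle_unique.
- by rewrite distrC ger0_norm ?subr_ge0 //; rewrite ltrBlDl.
- by rewrite cosD2piz; apply: (mulfI rn).
- by rewrite sinD2piz; apply: (mulfI rn).
Qed.

(** The truncation [cl] to [-1, 1] changes none of the quotients that occur and makes acos monotone
    on the whole line, hence measurable. *)
Lemma measurable_ang : measurable_fun setT ang.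
Proof.
pose cl (x : R) := Num.max (-1) (Num.min 1 x).
have clb x : -1 <= cl x <= 1 by rewrite /cl le_max lexx /= ge_max ge_min lexx /= andbT; lra.
have clm x y : x <= y -> cl x <= cl y.
  move=> xy; rewrite /cl ge_max !le_max lexx /=; apply/orP; right.
  by rewrite le_min !ge_min lexx /= xy orbT.
have macl : measurable_fun setT (fun x : R => acos (cl x)).
  apply: nonincreasing_measurable => // x y xy.
  rewrite leNgt; apply/negP => h.
  have := @ltr_cos R (acos (cl x)) (acos (cl y)).
  rewrite !in_itv /= !acos_ge0 ?acos_lepi //= => /(_ isT isT).
  by rewrite h !acosK ?in_itv //= ltNge clm.
have mv : measurable_fun setT (fun p => acos (p.1 / cmod (cplx p))).
  rewrite (_ : (fun p => _) = (fun p => acos (cl (p.1 / cmod (cplx p))))).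
    apply: (measurableT_comp macl); apply: measurable_funM => //.
    by apply: measurable_funV_ge0; [move=> p; exact: cmod_ge0 | exact: measurable_cmod].
  apply/funext => p; have /andP[h1 h2] := ratio_bound p.
  by rewrite /cl min_r // max_r.
rewrite /ang; apply: measurable_fun_ifT => //.
- by apply: measurable_fun_ler.
- by apply: measurable_funB.
Qed.

End polar.

(** * Measurability and disjointness of cells *)

Section cells.
Variable R : realType.
Local Notation lam := (@lebesgue_measure R).
Local Notation Lam := (lam \x lam)%E.
Implicit Types (p q : plane R) (t u r : R).

(* [polar_box] with a canonical angle: it differs from [polar_box] at the origin
   only, and the cells of one generation are disjoint. *)
Definition cell (N : nat) (j k : 'I_(2 ^ N)) : set (plane R) :=
  [set p | j%:R / 2 ^+ N <= cmod (cplx p) ^+ 2 < j.+1%:R / 2 ^+ N /\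
           2 * pi * k%:R / 2 ^+ N <= ang p < 2 * pi * k.+1%:R / 2 ^+ N].

Lemma measurable_co_preimage (f : plane R -> R) (a b : R) : measurable_fun setT f ->
  measurable [set p | a <= f p < b].
Proof.
move=> mf; rewrite (_ : [set p | _] = f @^-1` `[a, b[); last first.
  by apply/seteqP; split => p /=; rewrite in_itv.
by rewrite -[X in measurable X]setTI; apply: mf => //; exact: measurable_itv.
Qed.

Lemma measurable_cell N j k : measurable (@cell N j k).
Proof.
apply: measurableI; apply: measurable_co_preimage; last exact: measurable_ang.
by apply: measurable_funX; exact: measurable_cmod.
Qed.

Lemma cell_sub N j k : @cell N j k `<=` @polar_box R N j k.
Proof.
move=> p [H1 H2]; exists (cmod (cplx p)), (ang p); split => //; first exact: cmod_ge0.
exact: polar_ang.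
Qed.

Let e2 (N : nat) : 0 < (2 : R) ^+ N. Proof. by rewrite exprn_gt0. Qed.

Lemma ord_ratio_le1 N (j : 'I_(2 ^ N)) : j.+1%:R / 2 ^+ N <= 1 :> R.
Proof. by rewrite ler_pdivrMr // mul1r -natrX ler_nat. Qed.

Lemma cell_disc N j k : @cell N j k `<=` @disc R.
Proof.
move=> p [/andP[_ H1] _]; have := lt_le_trans H1 (ord_ratio_le1 j).
by rewrite expr_lt1 // cmod_ge0.
Qed.

Lemma polar_box_disc N j k : @polar_box R N j k `<=` @disc R.
Proof.
move=> _ [r [t [r0 /andP[_ H1] _ ->]]]; suff : cmod (cplx (polar r t)) < 1 by [].
rewrite cmod_polar //; by have := lt_le_trans H1 (ord_ratio_le1 j); rewrite expr_lt1.
Qed.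

Lemma polar_box_cell N j k p : @polar_box R N j k p -> p = (0, 0) \/ @cell N j k p.
Proof.
move=> [r [t [r0 H1 H2 pE]]]; have [rz|rn] := eqVneq r 0.
  by left; rewrite pE rz /polar !mul0r.
right; have rp : 0 < r by rewrite lt_neqAle eq_sym rn.
have rE : cmod (cplx p) = r by rewrite pE cmod_polar.
have [m tE] := polar_eq_ang rp pE.
have pp := pi_gt0 R.
have tang : t = ang p.
  apply: polar_angle_unique; last 2 first.
  - by rewrite tE cosD2piz.
  - by rewrite tE sinD2piz.
  have /andP[a1 a2] := ang_bounds p; move: H2 => /andP[t1 t2].
  have t1' : 0 <= t.
    by apply: le_trans t1; rewrite divr_ge0 ?mulr_ge0 // ?ltW.
  have t2' : t < 2 * pi.
    apply: (lt_le_trans t2); rewrite -mulrA -[leRHS]mulr1; apply: ler_wpM2l; last exact: ord_ratio_le1.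
    by rewrite mulr_ge0 // ltW.
  by rewrite ltr_norml; apply/andP; split; lra.
by split; rewrite ?rE // -tang.
Qed.

Lemma measurable_point0 (A : set (plane R)) : A `<=` [set ((0, 0) : plane R)] -> measurable A.
Proof.
have m0 : measurable [set ((0, 0) : plane R)].
  rewrite (_ : [set _] = [set (0 : R)] `*` [set (0 : R)]); first by apply: measurableX; exact: measurable_set1.
  by apply/seteqP; split => -[x y] /= [-> ->].
by move=> /subset_set1[->|->].
Qed.

Lemma polar_boxE N j k : @polar_box R N j k = @cell N j k `|` (@polar_box R N j k `&` [set (0, 0)]).
Proof.
apply/seteqP; split => p; last by case=> [/cell_sub|[]].
by move=> H; case: (polar_box_cell H) => [p0|]; [right; split | left].
Qed.

Lemma measurable_polar_box N j k : measurable (@polar_box R N j k).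
Proof.
rewrite polar_boxE; apply: measurableU; first exact: measurable_cell.
by apply: measurable_point0 => p [].
Qed.

Lemma nat_cell N (x : R) : 0 <= x -> x < 1 -> exists j : 'I_(2 ^ N), j%:R / 2 ^+ N <= x < j.+1%:R / 2 ^+ N.
Proof.
move=> x0 x1; have y0 : 0 <= x * 2 ^+ N by rewrite mulr_ge0 // ltW.
have /andP[n1 n2] := truncn_itv y0.
have nlt : (Num.truncn (x * 2 ^+ N) < 2 ^ N)%N.
  rewrite -(ltr_nat R) natrX; apply: (le_lt_trans n1); rewrite gtr_pMl //.
by exists (Ordinal nlt); rewrite /= ler_pdivrMr // ltr_pdivlMr // n1.
Qed.

Lemma cell_cover N p : @disc R p -> exists j k, @cell N j k p.
Proof.
move=> p1; have c0 := cmod_ge0 (cplx p); have pp := pi_gt0 R.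
have [j Hj] : exists j : 'I_(2 ^ N), j%:R / 2 ^+ N <= cmod (cplx p) ^+ 2 < j.+1%:R / 2 ^+ N.
  by apply: nat_cell; rewrite ?exprn_ge0 // expr_lt1.
have P2 : 0 < 2 * pi :> R by rewrite mulr_gt0.
have /andP[a1 a2] := ang_bounds p.
have [k /andP[k1 k2]] : exists k : 'I_(2 ^ N), k%:R / 2 ^+ N <= ang p / (2 * pi) < k.+1%:R / 2 ^+ N.
  by apply: nat_cell; rewrite ?divr_ge0 ?(ltW P2) // ltr_pdivrMr // mul1r.
exists j, k; split => //.
rewrite ler_pdivlMr // in k1; rewrite ltr_pdivrMr // in k2.
by rewrite -mulrA mulrC k1 -mulrA [ltRHS]mulrC k2.
Qed.

Lemma nat_cell_inj N (i j : nat) (x : R) : i%:R / 2 ^+ N <= x < i.+1%:R / 2 ^+ N ->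
  j%:R / 2 ^+ N <= x < j.+1%:R / 2 ^+ N -> i = j.
Proof.
move=> /andP[i1 i2] /andP[j1 j2].
rewrite !ler_pdivrMr // in i1 j1; rewrite !ltr_pdivlMr // in i2 j2.
have := le_lt_trans i1 j2; have := le_lt_trans j1 i2; rewrite !ltr_nat !ltnS => h1 h2.
by apply/eqP; rewrite eqn_leq h1 h2.
Qed.

Lemma cell_unique N j k j' k' p : @cell N j k p -> @cell N j' k' p -> j = j' /\ k = k'.
Proof.
move=> [H1 H2] [H1' H2']; split; apply: val_inj => /=; first exact: nat_cell_inj H1 H1'.
have P2 : 0 < 2 * pi :> R by rewrite mulr_gt0 // pi_gt0.
have H (i : nat) : (2 * pi * i%:R / 2 ^+ N <= ang p < 2 * pi * i.+1%:R / 2 ^+ N) ->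
   (i%:R / 2 ^+ N <= ang p / (2 * pi) < i.+1%:R / 2 ^+ N).
  rewrite -!mulrA !(mulrA 2 pi) => /andP[h1 h2].
  by rewrite ler_pdivlMr // ltr_pdivrMr // mulrC h1 mulrC.
by exact: nat_cell_inj (H _ H2) (H _ H2').
Qed.

Lemma sum_cell (V : pzRingType) N (f : 'I_(2 ^ N) -> 'I_(2 ^ N) -> V) (b : 'I_(2 ^ N) -> 'I_(2 ^ N) -> V) p j0 k0 :
  @cell N j0 k0 p -> (forall j k, b j k = (p \in @cell N j k)%:R) ->
  \sum_j \sum_k f j k * b j k = f j0 k0.
Proof.
move=> H bE; rewrite (bigD1 j0) //= (bigD1 k0) //= bE mem_set // mulr1.
rewrite big1 ?addr0; last first.
  move=> k kn; rewrite bE (_ : (p \in _) = false) ?mulr0 //.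
  by apply/negP; rewrite inE => H'; case: (cell_unique H H') => _ E; rewrite E eqxx in kn.
rewrite big1 ?addr0 // => j jn; rewrite big1 // => k _.
rewrite bE (_ : (p \in _) = false) ?mulr0 //.
by apply/negP; rewrite inE => H'; case: (cell_unique H H') => E _; rewrite E eqxx in jn.
Qed.

(** An arc is given by an interval of angles anywhere on the line, so the box is a countable union
    over the lifts ang + 2 pi k, up to the origin. *)
Lemma measurable_carleson I h : is_arc I h -> measurable (@carleson_box R I h).
Proof.
move=> [/andP[h0 h1] [a [bl [br IE]]]].
pose itv := Interval (BSide bl a) (BSide br (a + 2 * pi * h)).
pose A (k : int) := [set p : plane R | ang p + 2 * pi * k%:~R \in itv].
have mA k : measurable (A k).
  rewrite (_ : A k = (fun p => ang p + 2 * pi * k%:~R) @^-1` [set` itv]) //.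
  have mf : measurable_fun setT (fun p : plane R => ang p + 2 * pi * k%:~R).
    by apply: measurable_funD => //; exact: measurable_ang.
  by rewrite -[X in measurable X]setTI; apply: mf => //; exact: measurable_itv.
pose Q0 := [set p : plane R | 1 - h <= cmod (cplx p) < 1] `&` \bigcup_k A k.
have mQ0 : measurable Q0.
  apply: measurableI; first by apply: measurable_co_preimage; exact: measurable_cmod.
  by apply: countable_bigcupT_measurable.
have QE : @carleson_box R I h `<=` Q0 `|` [set (0, 0)].
  move=> p [r [t [r0 rb It pE]]]; have [rz|rn] := eqVneq r 0.
    by right; rewrite pE rz /polar !mul0r.
  left; have rE : cmod (cplx p) = r by rewrite pE cmod_polar.
  split; first by suff : 1 - h <= cmod (cplx p) < 1 by []; rewrite rE.
  move: It; rewrite IE => -[t' it' [c s]].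
  have rp : 0 < r by rewrite lt_neqAle eq_sym rn.
  have pE' : p = polar r t' by rewrite pE /polar; rewrite !mul1r in c s; rewrite c s.
  by have [k tk] := polar_eq_ang rp pE'; exists k => //; rewrite /A /= -tk.
have EQ : Q0 `<=` @carleson_box R I h.
  move=> p [rb [k _ Ak]]; exists (cmod (cplx p)), (ang p + 2 * pi * k%:~R); split => //.
  - exact: cmod_ge0.
  - by rewrite IE; exists (ang p + 2 * pi * k%:~R).
  - by rewrite {1}(polar_ang p) /polar cosD2piz sinD2piz.
rewrite (_ : carleson_box I h = Q0 `|` (carleson_box I h `&` [set (0, 0)])).
  by apply: measurableU => //; apply: measurable_point0 => p [].
apply/seteqP; split => p; last by case=> [/EQ|[]].
by move=> Hp; case: (QE _ Hp) => [|p0]; [left | right; split].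
Qed.

End cells.

(** * Boundary discs, Carleson boxes and Moebius maps *)

Section arcs.
Variable R : realType.
Implicit Types (p q : plane R) (t u r h : R).

Lemma norm_sin_le u : `|sin u| <= `|u|.
Proof.
suff H (x : R) : 0 < x -> `|sin x| <= x.
  have [->|un] := eqVneq u 0; first by rewrite sin0.
  have [u0|u0] := leP 0 u; first by rewrite [leRHS]ger0_norm // H // lt_neqAle eq_sym un.
  by rewrite -normrN -sinN [leRHS]ltr0_norm // H // oppr_gt0.
move=> x0.
have [y _ E] := @MVT R sin cos 0 x x0 (fun y _ => is_derive_sin y) (continuous_subspaceT (@continuous_sin R)).
rewrite sin0 !subr0 in E; rewrite E normrM (gtr0_norm x0) -[leRHS]mul1r ler_pM2r //.
exact: cos_max.
Qed.

Lemma polar_dist_sqr r r' t u :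
  cmod (cplx (polar r t) - cplx (polar r' u)) ^+ 2 = r ^+ 2 + r' ^+ 2 - 2 * r * r' * cos (t - u).
Proof.
rewrite cmod_sqr cReB cImB /cplx /polar cosB.
have -> : (complex.Re (((r * cos t, r * sin t).1 +i* (r * cos t, r * sin t).2)) = r * cos t)%R by [].
have -> : (complex.Im (((r * cos t, r * sin t).1 +i* (r * cos t, r * sin t).2)) = r * sin t)%R by [].
have -> : (complex.Re (((r' * cos u, r' * sin u).1 +i* (r' * cos u, r' * sin u).2)) = r' * cos u)%R by [].
have -> : (complex.Im (((r' * cos u, r' * sin u).1 +i* (r' * cos u, r' * sin u).2)) = r' * sin u)%R by [].
have Et := cos2Dsin2 t; have Eu := cos2Dsin2 u.
transitivity (r ^+ 2 * (cos t ^+ 2 + sin t ^+ 2) + r' ^+ 2 * (cos u ^+ 2 + sin u ^+ 2)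
  - 2 * r * r' * (cos t * cos u + sin t * sin u)); first by ring.
by rewrite Et Eu !mulr1.
Qed.

Lemma polar_dist_angle t u : cmod (cplx (polar 1 t) - cplx (polar 1 u)) <= `|t - u|.
Proof.
rewrite -(@ler_pXn2r _ 2) ?nnegrE ?cmod_ge0 // polar_dist_sqr real_normK ?num_real //.
set x := t - u; have -> : x = (x / 2) *+ 2 by rewrite -mulr_natr; field.
rewrite cos_mulr2n cos2sin2 -[(x / 2) *+ 2]mulr_natl exprMn.
have -> : 1 ^+ 2 + 1 ^+ 2 - 2 * 1 * 1 * ((1 - sin (x / 2) ^+ 2) *+ 2 - 1) = 2 ^+ 2 * sin (x / 2) ^+ 2.
  by rewrite -mulr_natl; ring.
rewrite ler_pM2l ?exprn_gt0 // -[leLHS]real_normK ?num_real // -[leRHS]real_normK ?num_real //.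
by rewrite lerXn2r ?nnegrE // norm_sin_le.
Qed.

Lemma polar_circle (zt : R[i]) : cmod zt = 1 -> exists th, zt = cplx (polar 1 th).
Proof.
move=> zt1; exists (ang (complex.Re zt, complex.Im zt)).
have E : zt = cplx ((complex.Re zt, complex.Im zt) : plane R) by case: zt {zt1}.
by rewrite -{1}zt1 {2}E -polar_ang -E.
Qed.

Lemma disc_in_box : exists I : set (plane R), is_arc I 1 /\ @disc R `<=` carleson_box I 1.
Proof.
exists [set polar 1 t | t in [set` Interval (BSide true 0) (BSide false (0 + 2 * pi * 1))]].
split.
  by split; [rewrite ltr01 lexx | exists 0, true, false].
move=> p p1; exists (cmod (cplx p)), (ang p); split.
- exact: cmod_ge0.
- by rewrite subrr cmod_ge0.
- exists (ang p) => //=; rewrite in_itv /= add0r mulr1.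
  by have /andP[-> a2] := ang_bounds p; rewrite ltW.
- exact: polar_ang.
Qed.

(** A point within dl of zt deviates in angle by u with |sin u| < dl, hence |u| <= pi dl by
    [jordan]. This is exactly half the angle of an arc of normalized length dl, so the scale is
    preserved. *)
Lemma ball_in_box (zt : R[i]) dl : cmod zt = 1 -> 0 < dl -> dl <= 1 ->
  exists I : set (plane R), is_arc I dl /\ rimball zt dl `<=` carleson_box I dl.
Proof.
move=> zt1 dl0 dl1; have [th zE] := polar_circle zt1.
pose a := th - pi * dl; have pp := pi_gt0 R.
exists [set polar 1 t | t in [set` Interval (BSide true a) (BSide false (a + 2 * pi * dl))]].
split; first by split; [rewrite dl0 | exists a, true, false].
move=> p [p1 pd]; set r := cmod (cplx p).
have r0 : 0 <= r by exact: cmod_ge0.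
have rdl : 1 - dl < r by have := le_lt_trans (d_le_dist (cplx p) zt1) pd; rewrite -/r; lra.
(* The lift of the angle in [th - pi, th + pi[. *)
have [k k1 k2] := angle_in (ang p) (th - pi).
set t := ang p + 2 * pi * k%:~R in k1 k2.
have pE : p = polar r t by rewrite {1}(polar_ang p) /polar cosD2piz sinD2piz.
have dE : cmod (zt - cplx p) ^+ 2 = 1 + r ^+ 2 - 2 * r * cos (t - th).
  by rewrite {1}zE {1}pE polar_dist_sqr expr1n mulr1 -(cosN (th - t)) opprB.
have d2 : cmod (zt - cplx p) ^+ 2 < dl ^+ 2 by rewrite ltr_pXn2r ?nnegrE ?cmod_ge0 // ltW.
set u := t - th in dE.
have u1 : - pi <= u by rewrite /u; lra.
have u2 : u < pi by rewrite /u; lra.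
(* An obtuse angle would give distance at least 1, against dl <= 1. *)
have cu : 0 <= cos u.
  rewrite leNgt; apply/negP => cu.
  have : dl ^+ 2 <= 1 by rewrite exprn_ile1 // ltW.
  have : 0 <= r ^+ 2 by exact: sqr_ge0.
  have : 2 * r * cos u <= 0 by rewrite mulr_ge0_le0 ?mulr_ge0 // ltW.
  by move=> h1 h2 h3; move: d2; rewrite dE; lra.
have uh : `|u| <= pi / 2.
  rewrite leNgt; apply/negP => uh.
  have : cos `|u| < cos (pi / 2).
    rewrite ltr_cos // in_itv /=; apply/andP; split; rewrite ?normr_ge0 //; try lra.
    by rewrite ler_norml u1 ltW.
  by rewrite cos_pihalf cos_norm ltNge cu.
have su : `|sin u| < dl.
  rewrite -(@ltr_pXn2r _ 2) ?nnegrE ?normr_ge0 ?(ltW dl0) // real_normK ?num_real //.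
  apply: le_lt_trans d2; rewrite dE sin2cos2 -subr_ge0.
  have -> : 1 + r ^+ 2 - 2 * r * cos u - (1 - cos u ^+ 2) = (r - cos u) ^+ 2 by ring.
  exact: sqr_ge0.
have ub : `|u| <= pi * dl.
  by apply: (le_trans (jordan uh)); rewrite ler_pM2l // ltW.
exists r, t; split => //.
- by rewrite (ltW rdl).
- exists t => //; rewrite /= in_itv /= /a; move: ub; rewrite ler_norml /u => /andP[h1 h2].
  by apply/andP; split; lra.
Qed.

(** Test point for a box: on it |1 - z conj(a)| = O(h), so 1 - |phi_a(z)|^2 is at least of order (1
    - |z|) / h. *)
Lemma box_mobius (I : set (plane R)) h : is_arc I h -> exists2 a : R[i], cmod a < 1 &
  forall p, carleson_box I h p -> [/\ @disc R p, 0 <= (1 - cmod (cplx p)) / h <= 1 &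
   (1 - cmod (cplx p)) / h <= 100 * (1 - cmod (mobius a (cplx p)) ^+ 2)].
Proof.
move=> [/andP[h0 h1] [al [bl [br IE]]]].
pose th := al + pi * h; have pp := pi_gt0 R; have p4 := pihalf_lt2 R.
pose zt := cplx (polar 1 th); have zt1 : cmod zt = 1 by exact: cmod_polar.
(* The point at depth h below the midpoint of the arc; it is 0 for the full circle. *)
pose a := (1 - h)%:C * zt.
have aE : cmod a = 1 - h by rewrite cmodM cmod_real zt1 mulr1 ger0_norm // subr_ge0.
have a1 : cmod a < 1 by rewrite aE; lra.
exists a => // p [r [t [r0 /andP[rh r1] It pE]]].
have rE : cmod (cplx p) = r by rewrite pE cmod_polar.
have p1 : @disc R p by rewrite /disc /= -[X in is_true X]/(cmod (cplx p) < 1) rE.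
have rb : 0 <= (1 - r) / h <= 1.
  by rewrite divr_ge0 ?subr_ge0 ?(ltW r1) ?(ltW h0) //= ler_pdivrMr //; lra.
split => //; first by rewrite rE.
move: It; rewrite IE => -[t' it' pt].
have tth : `|t' - th| <= pi * h.
  have /andP[t1 t2] : al <= t' <= al + 2 * pi * h.
    by move: it'; rewrite /= in_itv => /andP[b1 b2]; case: bl br b1 b2 {IE} => [] [] /= b1 b2; apply/andP; split => //; apply: ltW.
  by rewrite ler_norml /th; apply/andP; split; lra.
have d1 : cmod (zt - cplx p) <= pi * h + h.
  apply: (le_trans (cmod_tri _ (cplx (polar 1 t)) _)); apply: lerD.
    by rewrite -pt cmodBC; apply: le_trans tth; exact: polar_dist_angle.
  have -> : cplx (polar 1 t) - cplx p = (1 - r)%:C * cplx (polar 1 t).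
    rewrite pE /cplx /polar /=; apply/eqP; rewrite eq_complex /=; apply/andP; split; apply/eqP; ring.
  by rewrite cmodM cmod_real cmod_polar // mulr1 ger0_norm; lra.
have o1 : kerdist (cplx p) a <= 10 * h.
  (* From |zt| = 1. The two terms are at most pi h + h and h, so 10 h is a generous bound, and its
     square gives the constant 100. *)
  have -> : kerdist (cplx p) a = cmod ((zt - cplx p) * zt^* + h%:C * (cplx p * zt^*)).
    rewrite /kerdist /a; congr cmod.
    have zz : zt * zt^* = 1 by rewrite mulc_conj zt1 expr1n.
    rewrite rmorphM /= conj_real mulrBl zz rmorphB /=; ring.
  apply: (le_trans (cmodD _ _)); rewrite !cmodM cmod_conj zt1 !mulr1 cmod_real (gtr0_norm h0) rE.
  have : h * r <= h by rewrite ler_piMr // ltW.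
  have : pi * h <= 4 * h by rewrite ler_pM2r //; lra.
  lra.
have o0 := kerdist_gt0 p1 a1.
rewrite cmod_mobius rE.
have E : 1 - (cmod (cplx p - a) / kerdist (cplx p) a) ^+ 2 = (1 - r ^+ 2) * (1 - cmod a ^+ 2) / kerdist (cplx p) a ^+ 2.
  rewrite expr_div_n -{1}(@divff _ (kerdist (cplx p) a ^+ 2)) ?gt_eqF ?exprn_gt0 // -mulrBl; congr (_ / _).
  by rewrite kerdist_sqr rE addrAC subrr add0r.
rewrite E mulrA ler_pdivlMr ?exprn_gt0 // mulrAC ler_pdivrMr // -mulrA.
have H1 : 1 - r <= 1 - r ^+ 2 by rewrite lerD2l lerN2 expr2 ler_piMr // ltW.
have H2 : h <= 1 - cmod a ^+ 2.
  rewrite aE; have -> : 1 - (1 - h) ^+ 2 = h + h * (1 - h) by ring.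
  by rewrite lerDl mulr_ge0 ?subr_ge0 // ltW.
have H3 : kerdist (cplx p) a ^+ 2 <= (10 * h) ^+ 2.
  by rewrite lerXn2r ?nnegrE ?(ltW o0) // mulr_ge0 // ltW.
apply: (@le_trans _ _ ((1 - r) * (10 * h) ^+ 2)); first by rewrite ler_wpM2l // subr_ge0 ltW.
have -> : (1 - r) * (10 * h) ^+ 2 = 100 * ((1 - r) * h) * h by ring.
rewrite [leRHS]mulrA ler_pM2r // ler_pM2l //; apply: ler_pM => //; last exact: ltW.
by rewrite subr_ge0 ltW.
Qed.

End arcs.

(** * Packet sums as integral transforms *)

Section area.
Variable R : realType.
Local Notation lam := (@lebesgue_measure R).
Local Notation Lam := (lam \x lam)%E.
Implicit Types (p q : plane R).

Lemma dA_E (A : set (plane R)) : dA R A = ((pi^-1)%:E * Lam A)%E.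
Proof. by []. Qed.

Lemma measurable_disc : measurable (@disc R).
Proof. by rewrite disc_cdisc; exact: measurable_cdisc. Qed.

Lemma dA_disc_lty : (dA R (@disc R) < +oo)%E.
Proof.
rewrite dA_E disc_cdisc; apply: lte_mul_pinfty => //; first by rewrite lee_fin invr_ge0 pi_ge0.
exact: Lam_cdisc_lty.
Qed.

Lemma dA_point0 : dA R [set (0, 0)] = 0%E.
Proof.
rewrite dA_E (_ : [set _] = [set (0 : R)] `*` [set (0 : R)]); last first.
  by apply/seteqP; split => -[x y] /= [-> ->].
have -> : Lam ([set (0 : R)] `*` [set (0 : R)]) = (lam [set 0%R] * lam [set 0%R])%E.
  by apply: product_measure1E; exact: measurable_set1.
by rewrite lebesgue_measure_set1 !mule0.
Qed.

Lemma ge0_integral_dA (D : set (plane R)) (f : plane R -> \bar R) : measurable D ->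
  measurable_fun D f -> (forall q, D q -> (0 <= f q)%E) ->
  (\int[dA R]_(q in D) f q = (pi^-1)%:E * \int[Lam]_(q in D) f q)%E.
Proof. by move=> mD mf f0; rewrite /dA ge0_integral_mscale. Qed.

Lemma dA_integrable (D : set (plane R)) (f : plane R -> \bar R) : measurable D ->
  Lam.-integrable D f -> (dA R).-integrable D f.
Proof.
move=> mD /integrableP[mf fi]; apply/integrableP; split => //.
rewrite ge0_integral_dA //; last by apply: measurableT_comp.
by apply: lte_mul_pinfty => //; rewrite lee_fin invr_ge0 pi_ge0.
Qed.

Lemma Rintegral_dA (D : set (plane R)) (f : plane R -> R) : measurable D ->
  Lam.-integrable D (EFin \o f) -> Rintegral (dA R) D f = pi^-1 * Rintegral Lam D f.
Proof.
move=> mD fi; have mf := measurable_int _ fi.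
rewrite /Rintegral integralE [in RHS]integralE.
rewrite !ge0_integral_dA //; last 2 first.
- exact: measurable_funeneg.
- exact: measurable_funepos.
have := integrable_pos_fin_num mD fi; have := integrable_neg_fin_num mD fi.
case: (integral _ _ _) => // x _; case: (integral _ _ _) => // y _.
by rewrite -!EFinM -!EFinB /= mulrBr.
Qed.

Lemma cintegral_dA (D : set (plane R)) (F : plane R -> R[i]) : measurable D ->
  cintegrable Lam D F -> cintegral (dA R) D F = (pi^-1)%:C * cintegral Lam D F.
Proof.
move=> mD [F1 F2]; rewrite /cintegral !Rintegral_dA //.
by apply/eqP; rewrite eq_complex /=; apply/andP; split; apply/eqP; ring.
Qed.

Lemma dA_cintegrable (D : set (plane R)) (F : plane R -> R[i]) : measurable D ->
  cintegrable Lam D F -> cintegrable (dA R) D F.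
Proof. by move=> mD [F1 F2]; split; exact: dA_integrable. Qed.

(** Polar boxes and cells differ at the origin only, a null set; indicators of the disjoint cells
    then turn sums over boxes into integrals over the disc. *)
Lemma Rint_box N (j k : 'I_(2 ^ N)) (f : plane R -> R) : (dA R).-integrable (@disc R) (EFin \o f) ->
  Rintegral (dA R) (polar_box j k) f = Rintegral (dA R) (@disc R) (fun q => \1_(cell j k) q * f q).
Proof.
move=> fi; rewrite /Rintegral; congr fine.
have m0 : measurable [set ((0, 0) : plane R)] by exact: measurable_point0.
have fi1 : (dA R).-integrable (polar_box j k) (EFin \o f).
  apply: integrableS fi; [exact: measurable_disc | exact: measurable_polar_box | exact: polar_box_disc].
have fi2 : (dA R).-integrable (cell j k) (EFin \o f).
  apply: integrableS fi; [exact: measurable_disc | exact: measurable_cell | exact: cell_disc].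
rewrite (negligible_integral m0 (measurable_polar_box _ _) fi1 dA_point0).
transitivity (\int[dA R]_(q in cell j k) (f q)%:E)%E.
  rewrite (negligible_integral m0 (measurable_cell _ _) fi2 dA_point0).
  congr (integral _ _ _); apply/seteqP; split => q [H qn]; split => //; last exact: cell_sub.
  by case: (polar_box_cell H).
rewrite [LHS]integral_mkcond [RHS]integral_mkcond; apply: eq_integral => q _; rewrite !patchE indicE.
case: (boolP (q \in cell j k)) => [|_]; last by rewrite mul0r; case: ifP.
by rewrite inE => H; rewrite mul1r ifT // inE; exact: cell_disc H.
Qed.

Lemma cint_box N (j k : 'I_(2 ^ N)) (F : plane R -> R[i]) : cintegrable (dA R) (@disc R) F ->
  cintegral (dA R) (polar_box j k) F = cintegral (dA R) (@disc R) (fun q => (\1_(cell j k) q)%:C * F q).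
Proof.
move=> [F1 F2]; rewrite /cintegral !Rint_box //.
by congr (_ +i* _); apply: eq_Rintegral => q _; rewrite ?cReM ?cImM /= mul0r ?subr0 ?addr0.
Qed.

Lemma cintegral_sum d (T : measurableType d) (mu : {measure set T -> \bar R}) (D : set T)
  (I : Type) (s : seq I) (F : I -> T -> R[i]) : measurable D ->
  (forall i, cintegrable mu D (F i)) -> cintegrable mu D (fun x => \sum_(i <- s) F i x) /\
  cintegral mu D (fun x => \sum_(i <- s) F i x) = \sum_(i <- s) cintegral mu D (F i).
Proof.
move=> mD Fi; elim: s => [|i s [IH1 IH2]].
  have E : (fun x : T => \sum_(i <- [::]) F i x) = (fun=> 0) by apply/funext => x; rewrite big_nil.
  rewrite E big_nil; split; first by split; exact: integrable0.
  by have := cintegral_cst mu mD 0; rewrite mul0r.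
have E : (fun x : T => \sum_(i <- i :: s) F i x) = (fun x => F i x + \sum_(i <- s) F i x).
  by apply/funext => x; rewrite big_cons.
by rewrite E big_cons; split; [exact: cintegrableD | rewrite cintegralD // IH2].
Qed.

Section transform.
Variables (b : R) (b0 : 0 <= b).

(** The density of dA_b with respect to dA. *)
Definition wt q : R := (b + 1) * (1 - cmod (cplx q) ^+ 2) `^ b.

Lemma wt_ge0 q : 0 <= wt q.
Proof. by rewrite mulr_ge0 ?powR_ge0 // addr_ge0. Qed.

Lemma measurable_wt D : measurable_fun D wt.
Proof.
apply: (measurable_funS measurableT (@subsetT _ D)); apply: measurable_funM => //.
apply: (measurableT_comp (measurable_powR b)).
by apply: measurable_funB => //; apply: measurable_funX; exact: measurable_cmod.
Qed.

Lemma wt_le q : @disc R q -> wt q <= b + 1.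
Proof.
move=> q1; have c0 := cmod_ge0 (cplx q).
have h0 : 0 <= 1 - cmod (cplx q) ^+ 2 by rewrite subr_ge0 exprn_ile1 // ltW.
rewrite /wt ler_piMr ?addr_ge0 //.
have P1 : 1 `^ b = 1 :> R by rewrite powR1.
rewrite -[leRHS]P1.
by apply: ge0_ler_powR; rewrite ?nnegrE // gerBl exprn_ge0.
Qed.

Definition stepf N (c : 'I_(2 ^ N) -> 'I_(2 ^ N) -> R[i]) q : R[i] :=
  \sum_j \sum_k c j k * (\1_(cell j k) q)%:C.

Lemma stepf_cell N (c : 'I_(2 ^ N) -> 'I_(2 ^ N) -> R[i]) j k q : cell j k q -> stepf c q = c j k.
Proof.
move=> H; apply: (sum_cell _ H) => j' k'.
by rewrite indicE; case: (_ \in _); rewrite ?rmorph1 ?rmorph0.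
Qed.

Lemma cintegrable_wt (F : plane R -> R[i]) k : (forall q, @disc R q -> cmod (F q) <= k) ->
  measurable_fun (@disc R) (fun q => complex.Re (F q)) -> measurable_fun (@disc R) (fun q => complex.Im (F q)) ->
  cintegrable (dA R) (@disc R) (fun q => F q * (wt q)%:C).
Proof.
move=> Fk m1 m2.
apply: (@bounded_cintegrable _ _ _ _ _ measurable_disc _ (k * (b + 1)) dA_disc_lty).
- apply: eq_measurable_fun (measurable_funM m1 (@measurable_wt _)) => q _.
  by rewrite cReM mulr0 subr0.
- apply: eq_measurable_fun (measurable_funM m2 (@measurable_wt _)) => q _.
  by rewrite cImM mulr0 add0r.
move=> q q1; rewrite cmodM cmod_real (ger0_norm (wt_ge0 q)).
by apply: ler_pM; rewrite ?cmod_ge0 ?wt_ge0 ?wt_le ?Fk.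
Qed.

Lemma Lker_cintegrable z (F : plane R -> R[i]) : cmod z < 1 -> cintegrable (dA R) (@disc R) F ->
  cintegrable (dA R) (@disc R) (fun q => Lker b z (cplx q) * F q).
Proof.
move=> z1 Fi; have [m1 m2] := disc_measurable_ReIm (lexx 1) (fun w => @ccont_Lker R b z w b0 z1).
apply: (cintegrableM (k := 2 * (1 - cmod z) `^ (- (b + 2))) measurable_disc Fi m1 m2).
by move=> q q1; apply: cmod_Lker => //; exact: ltW.
Qed.

Lemma measurable_stepf N (c : 'I_(2 ^ N) -> 'I_(2 ^ N) -> R[i]) :
  measurable_fun setT (fun q => complex.Re (stepf c q)) /\ measurable_fun setT (fun q => complex.Im (stepf c q)).
Proof.
have ReS (I : Type) (s : seq I) (F : I -> R[i]) : complex.Re (\sum_(i <- s) F i) = \sum_(i <- s) complex.Re (F i).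
  by elim: s => [|i s IH]; rewrite ?big_nil // !big_cons cReD IH.
have ImS (I : Type) (s : seq I) (F : I -> R[i]) : complex.Im (\sum_(i <- s) F i) = \sum_(i <- s) complex.Im (F i).
  by elim: s => [|i s IH]; rewrite ?big_nil // !big_cons cImD IH.
split.
- rewrite (_ : (fun q => _) = (fun q => \sum_j \sum_k complex.Re (c j k) * \1_(cell j k) q)).
    apply: measurable_sum => j; apply: measurable_sum => k; apply: measurable_funM => //.
    by apply: measurable_indic; exact: measurable_cell.
  apply/funext => q; rewrite ReS; apply: eq_bigr => j _; rewrite ReS; apply: eq_bigr => k _.
  by rewrite cReM mulr0 subr0.
- rewrite (_ : (fun q => _) = (fun q => \sum_j \sum_k complex.Im (c j k) * \1_(cell j k) q)).
    apply: measurable_sum => j; apply: measurable_sum => k; apply: measurable_funM => //.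
    by apply: measurable_indic; exact: measurable_cell.
  apply/funext => q; rewrite ImS; apply: eq_bigr => j _; rewrite ImS; apply: eq_bigr => k _.
  by rewrite cImM mulr0 add0r.
Qed.

Lemma stepf_bounded N (c : 'I_(2 ^ N) -> 'I_(2 ^ N) -> R[i]) q : @disc R q ->
  cmod (stepf c q) <= \sum_j \sum_k cmod (c j k).
Proof.
move=> q1; have [j [k H]] := cell_cover N q1; rewrite (stepf_cell c H).
rewrite (bigD1 j) //= (bigD1 k) //= -addrA lerDl addr_ge0 //.
  by apply: sumr_ge0 => i _; exact: cmod_ge0.
by apply: sumr_ge0 => i _; apply: sumr_ge0 => i' _; exact: cmod_ge0.
Qed.

Lemma stepf_cintegrable N (c : 'I_(2 ^ N) -> 'I_(2 ^ N) -> R[i]) :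
  cintegrable (dA R) (@disc R) (fun q => stepf c q * (wt q)%:C).
Proof.
have [m1 m2] := measurable_stepf c.
by apply: (cintegrable_wt (@stepf_bounded N c)); apply: (measurable_funS measurableT (@subsetT _ _)).
Qed.

(** Linearity of the integral: the finite combination of packets is the L_b-transform of the step
    function. *)
Lemma packet_sumE N (c : 'I_(2 ^ N) -> 'I_(2 ^ N) -> R[i]) z : cmod z < 1 ->
  packet_sum b c z = cintegral (dA R) (@disc R) (fun q => Lker b z (cplx q) * (stepf c q * (wt q)%:C)).
Proof.
move=> z1.
have wi : cintegrable (dA R) (@disc R) (fun q => (wt q)%:C).
  apply: (eq_cintegrable measurable_disc _ (@cintegrable_wt (fun=> 1) 1 _ _ _)) => //.
  - by move=> q _; rewrite mul1r.
  - by move=> q _; rewrite cmod1.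
have Li := Lker_cintegrable z1 wi.
have ind0 j k : cintegrable (dA R) (@disc R) (fun q => (\1_(@cell R N j k) q)%:C * (Lker b z (cplx q) * (wt q)%:C)).
  apply: (cintegrableM (k := 1) measurable_disc Li).
  - by apply: measurable_indic; exact: measurable_cell.
  - exact: measurable_cst.
  - by move=> q _; rewrite cmod_real ger0_norm // indicE; case: (_ \in _) => //; rewrite ler01.
have indi j k : cintegrable (dA R) (@disc R) (fun q => c j k * ((\1_(@cell R N j k) q)%:C * (Lker b z (cplx q) * (wt q)%:C))).
  exact: (cintegrableZ measurable_disc).
have pE j k : c j k * packet b j k z =
   cintegral (dA R) (@disc R) (fun q => c j k * ((\1_(@cell R N j k) q)%:C * (Lker b z (cplx q) * (wt q)%:C))).
  by rewrite (cintegralZ measurable_disc _ (ind0 j k)) /packet cint_box.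
have S1 j := cintegral_sum (index_enum 'I_(2 ^ N)) measurable_disc (indi j).
have [S2 S3] := cintegral_sum (index_enum 'I_(2 ^ N)) measurable_disc (fun j => (S1 j).1).
transitivity (\sum_j \sum_k cintegral (dA R) (@disc R) (fun q => c j k * ((\1_(@cell R N j k) q)%:C * (Lker b z (cplx q) * (wt q)%:C)))).
  by rewrite /packet_sum; apply: eq_bigr => j _; apply: eq_bigr => k _; exact: pE.
rewrite (eq_bigr _ (fun j _ => esym (S1 j).2)) -S3; apply: eq_cintegral => q _.
rewrite /stepf mulr_suml mulr_sumr; apply: eq_bigr => j _.
rewrite mulr_suml mulr_sumr; apply: eq_bigr => k _; ring.
Qed.

End transform.

End area.

(** * The discrete norm as a supremum of box integrals *)

Section Xnorm.
Variables (R : realType) (K : R -> R) (hK : WQ K).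
Local Notation lam := (@lebesgue_measure R).
Local Notation Lam := (lam \x lam)%E.
Implicit Types (p q : plane R).

Lemma measurable_cmodF d (T : measurableType d) (D : set T) (F : T -> R[i]) :
  measurable_fun D (fun x => complex.Re (F x)) -> measurable_fun D (fun x => complex.Im (F x)) ->
  measurable_fun D (fun x => cmod (F x)).
Proof.
move=> m1 m2; rewrite (_ : (fun x => cmod _) = (fun x => Num.sqrt (complex.Re (F x) ^+ 2 + complex.Im (F x) ^+ 2))).
  apply: (measurableT_comp (continuous_measurable_fun (@sqrt_continuous R))).
  by apply: measurable_funD; exact: measurable_funX.
by apply/funext => x; rewrite cmodE.
Qed.

Lemma carleson_disc (I : set (plane R)) h : carleson_box I h `<=` @disc R.
Proof.
move=> _ [r [t [r0 /andP[_ r1] _ ->]]]; suff : cmod (cplx (polar r t)) < 1 by [].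
by rewrite cmod_polar.
Qed.

Lemma measurable_KKdd D h : measurable_fun D (fun q : plane R => KK K (rimdist q / h)).
Proof. by apply: measurable_KK => //; apply: measurable_funM => //; exact: measurable_rimdist. Qed.

(** Cells are disjoint, so |sum c_R 1_R|^2 = sum |c_R|^2 1_R off a null set, and the finite sum
    becomes one integral over the box. *)
Lemma X_sumE N (c : 'I_(2 ^ N) -> 'I_(2 ^ N) -> R[i]) (I : set (plane R)) h : is_arc I h ->
  (\sum_(j < 2 ^ N) \sum_(k < 2 ^ N) (cmod (c j k) ^+ 2)%:E *
     \int[dA R]_(p in polar_box j k `&` carleson_box I h) (K ((1 - cmod (cplx p)) / h))%:E =
   \int[Lam]_(q in carleson_box I h) (pi^-1 * (cmod (stepf c q) ^+ 2 * KK K (rimdist q / h)))%:E)%E.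
Proof.
move=> Ih; have [/andP[h0 h1] _] := Ih; have mQ := measurable_carleson Ih.
set Q := carleson_box I h in mQ *; have pi0 : 0 <= pi^-1 :> R by rewrite invr_ge0 pi_ge0.
pose a j k := cmod (c j k) ^+ 2.
have mu (j k : 'I_(2 ^ N)) : measurable_fun Q (fun q => pi^-1 * (a j k * \1_(cell j k) q * KK K (rimdist q / h))).
  apply: measurable_funM => //; apply: measurable_funM; last exact: measurable_KKdd.
  by apply: measurable_funM => //; apply: measurable_indic; exact: measurable_cell.
have u0 (j k : 'I_(2 ^ N)) q : 0 <= pi^-1 * (a j k * \1_(cell j k) q * KK K (rimdist q / h)).
  by rewrite mulr_ge0 // mulr_ge0 ?(KK_ge0 hK) // mulr_ge0 // exprn_ge0 // cmod_ge0.
have term j k : ((cmod (c j k) ^+ 2)%:E *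
     \int[dA R]_(p in polar_box j k `&` Q) (K ((1 - cmod (cplx p)) / h))%:E =
   \int[Lam]_(q in Q) (pi^-1 * (a j k * \1_(cell j k) q * KK K (rimdist q / h)))%:E)%E.
  have m0 : measurable [set ((0, 0) : plane R)] by exact: measurable_point0.
  have mPQ : measurable (polar_box j k `&` Q) by apply: measurableI => //; exact: measurable_polar_box.
  have mCQ : measurable (cell j k `&` Q) by apply: measurableI => //; exact: measurable_cell.
  have k0 q : (0 <= (KK K (rimdist q / h))%:E)%E by rewrite lee_fin (KK_ge0 hK).
  have mK D : measurable_fun D (fun q : plane R => (KK K (rimdist q / h))%:E).
    by apply/measurable_EFinP; exact: measurable_KKdd.
  have -> : (\int[dA R]_(p in polar_box j k `&` Q) (K ((1 - cmod (cplx p)) / h))%:E =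
     \int[dA R]_(q in polar_box j k `&` Q) (KK K (rimdist q / h))%:E)%E.
    apply: eq_integral => q; rewrite inE => -[_ /carleson_disc q1].
    by rewrite KK_E // divr_ge0 ?(ltW h0) // subr_ge0 ltW.
  rewrite (ge0_negligible_integral m0 mPQ (mK _) (fun q _ => k0 q) (dA_point0 R)).
  have -> : (polar_box j k `&` Q) `\` [set (0, 0)] = (cell j k `&` Q) `\` [set ((0, 0) : plane R)].
    apply/seteqP; split => q [[H1 H2] qn]; split => //; split => //; last exact: cell_sub.
    by case: (polar_box_cell H1).
  rewrite -(@ge0_negligible_integral _ _ _ (dA R) _ _ _ m0 mCQ (mK _) (fun q _ => k0 q) (dA_point0 R)).
  rewrite ge0_integral_dA // muleA -EFinM -ge0_integralZl_EFin //; last by rewrite mulr_ge0 // exprn_ge0 // cmod_ge0.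
  rewrite [LHS]integral_mkcond [RHS]integral_mkcond; apply: eq_integral => q _; rewrite !patchE indicE in_setI.
  case: (q \in cell j k); case: (q \in Q) => //=; last by rewrite mulr0 mul0r mulr0.
  by rewrite mulr1 -EFinM /a mulrCA mulrA.
rewrite (eq_bigr _ (fun j _ => eq_bigr _ (fun k _ => term j k))).
have muE j k : measurable_fun Q (fun q => (pi^-1 * (a j k * \1_(@cell R N j k) q * KK K (rimdist q / h)))%:E).
  by apply/measurable_EFinP.
have u0E j k q : Q q -> (0 <= (pi^-1 * (a j k * \1_(@cell R N j k) q * KK K (rimdist q / h)))%:E)%E.
  by move=> _; rewrite lee_fin.
rewrite (eq_bigr _ (fun j _ => esym (ge0_integral_sum Lam mQ (muE j) (u0E j) (index_enum _)))).
rewrite -(ge0_integral_sum Lam mQ (fun j => emeasurable_sum (index_enum _) (fun k => muE j k))); last first.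
  by move=> j q Qq; apply: sume_ge0 => k _; exact: u0E.
apply: eq_integral => q; rewrite inE => /carleson_disc q1.
have [j0 [k0 H]] := cell_cover N q1.
transitivity (\sum_j \sum_k pi^-1 * (a j k * \1_(@cell R N j k) q * KK K (rimdist q / h)))%:E.
  by rewrite -sumEFin; apply: eq_bigr => j _; rewrite -sumEFin.
congr EFin; rewrite (stepf_cell c H) -/(a j0 k0).
rewrite -(@sum_cell R R N a (fun j k => \1_(cell j k) q) q j0 k0 H); last by move=> j k; rewrite indicE.
rewrite mulr_suml mulr_sumr; apply: eq_bigr => j _.
by rewrite mulr_suml mulr_sumr; apply: eq_bigr.
Qed.

Lemma X_normP N (c : 'I_(2 ^ N) -> 'I_(2 ^ N) -> R[i]) (r : R) : 0 <= r ->
  (X_norm K c <= (Num.sqrt r)%:E)%E <-> forall I h, is_arc I h ->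
  (\int[Lam]_(q in carleson_box I h) (pi^-1 * (cmod (stepf c q) ^+ 2 * KK K (rimdist q / h)))%:E <= r%:E)%E.
Proof.
move=> r0; have -> : (Num.sqrt r)%:E = sqrte r%:E by [].
rewrite /X_norm lee_sqrt ?lee_fin //; split => [H I h Ih | H].
  rewrite -X_sumE //; apply: le_trans H; apply: ereal_sup_ubound.
  by exists (I, h).
by apply: ub_ereal_sup => _ [[I h] Ih <-]; rewrite X_sumE //; exact: H.
Qed.

(** For dl <= 1 the disc lies in a box of the same scale. For dl > 1 the box of the full circle
    contains the whole disc, and enlarging the denominator only lowers K. *)
Lemma ball_bound (G : plane R -> R) (X : R) : measurable_fun setT G -> (forall q, 0 <= G q) ->
  (forall I h, is_arc I h ->
    (\int[Lam]_(q in carleson_box I h) (G q ^+ 2 * KK K (rimdist q / h))%:E <= X%:E)%E) ->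
  forall zt dl, cmod zt = 1 -> 0 < dl ->
  (\int[Lam]_(q in rimball zt dl) (G q ^+ 2 * KK K (rimdist q / dl))%:E <= X%:E)%E.
Proof.
move=> mG G0 H zt dl zt1 dl0.
have mGK D h : measurable_fun D (fun q : plane R => (G q ^+ 2 * KK K (rimdist q / h))%:E).
  apply/measurable_EFinP; apply: measurable_funM; last exact: measurable_KKdd.
  by apply: measurable_funX; exact: (measurable_funS measurableT (@subsetT _ D)).
have GK0 h q : (0 <= (G q ^+ 2 * KK K (rimdist q / h))%:E)%E.
  by rewrite lee_fin mulr_ge0 ?exprn_ge0 ?(KK_ge0 hK).
have [d1|d1] := leP dl 1.
  have [I [Ih BI]] := ball_in_box zt1 dl0 d1.
  apply: le_trans (H _ _ Ih); apply: ge0_subset_integral => //.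
  - exact: measurable_rimball.
  - exact: measurable_carleson Ih.
have [I [Ih DI]] := disc_in_box R.
apply: le_trans (H _ _ Ih).
apply: (@le_trans _ _ (\int[Lam]_(q in rimball zt dl) (G q ^+ 2 * KK K (rimdist q / 1))%:E)%E).
  apply: ge0_le_integral => //; first exact: measurable_rimball.
  move=> q [q1 _]; rewrite lee_fin ler_wpM2l ?exprn_ge0 //; apply: le_KK => //.
  by rewrite divr1 ler_pdivrMr // ler_peMr ?ltW // subr_gt0.
apply: ge0_subset_integral => //.
- exact: measurable_rimball.
- exact: measurable_carleson Ih.
- by move=> q [q1 _]; exact: DI.
Qed.

End Xnorm.

(** * Packet sums lie in Q_K *)

Section upper.
Variables (R : realType) (K : R -> R) (hK : WQ K).
Local Notation lam := (@lebesgue_measure R).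
Local Notation Lam := (lam \x lam)%E.
Implicit Types (q : plane R).

Lemma mobius_defect_ge0 (a z : R[i]) : cmod a < 1 -> cmod z < 1 -> 0 <= 1 - cmod (mobius a z) ^+ 2.
Proof.
move=> a1 z1; rewrite subr_ge0 exprn_ile1 ?cmod_ge0 // cmod_mobius ler_pdivrMr ?kerdist_gt0 // mul1r.
exact: kerdist_dist.
Qed.

Lemma QK_integrand_ge0 (f : R[i] -> R[i]) a q : cmod a < 1 -> @disc R q ->
  (0 <= (cmod (cderive f (cplx q)) ^+ 2 * K (1 - cmod (mobius a (cplx q)) ^+ 2))%:E)%E.
Proof.
move=> a1 q1; rewrite lee_fin mulr_ge0 ?exprn_ge0 ?cmod_ge0 //.
by apply: (WQ_ge0 hK); exact: mobius_defect_ge0.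
Qed.

Lemma QK_seminorm_sqr_ge0 (f : R[i] -> R[i]) : (0 <= QK_seminorm_sqr K f)%E.
Proof.
have z1 : cmod (0 : R[i]) < 1 by rewrite cmod0.
apply: (@le_trans _ _ (\int[dA R]_(q in @disc R) (cmod (cderive f (cplx q)) ^+ 2 *
    K (1 - cmod (mobius 0 (cplx q)) ^+ 2))%:E)%E); last by apply: ereal_sup_ubound; exists 0.
by apply: integral_ge0 => q q1; exact: QK_integrand_ge0.
Qed.

(** By 1 - |q|^2 <= 2 (1 - |q|) the b-th power of (1 - |q|) / kerdist appears; this ratio is at most
    1, so for b >= p its p-th power dominates. *)
Lemma Bk_wt_le (b : R) (p : nat) z q : p%:R <= b -> cmod z < 1 -> @disc R q ->
  cmod (Bk (b + 2) z (cplx q)) * wt b q <= (b + 1) * 2 `^ b * majorant p z (cplx q).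
Proof.
move=> pb z1 q1; have b0 : 0 <= b by apply: le_trans pb.
have q1' : cmod (cplx q) <= 1 by exact: ltW.
have o0 := kerdist_gt0 z1 q1; set o := kerdist z (cplx q) in o0 *.
have d0 : 0 < rimdist q by exact: rimdist_gt0.
have c0 := cmod_ge0 (cplx q).
have dO : rimdist q <= o by exact: ge_oz2.
have E1 : (1 - cmod (cplx q) ^+ 2) `^ b <= 2 `^ b * rimdist q `^ b.
  rewrite -powRM ?(ltW d0) //; apply: ge0_ler_powR => //.
  - by rewrite nnegrE subr_ge0 exprn_ile1.
  - by rewrite nnegrE mulr_ge0 // ltW.
  - rewrite -subr_ge0 /rimdist; set r := cmod _.
    have -> : 2 * (1 - r) - (1 - r ^+ 2) = (1 - r) ^+ 2 by ring.
    exact: sqr_ge0.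
have E2 : rimdist q `^ b * o `^ (- b) <= (rimdist q / o) ^+ p.
  have x0 : 0 < rimdist q / o by rewrite divr_gt0.
  have -> : rimdist q `^ b * o `^ (- b) = (rimdist q / o) `^ b.
    by rewrite powRM ?invr_ge0 ?(ltW o0) ?(ltW d0) // -powR_inv1 ?(ltW o0) // -powRrM mulN1r.
  have x1 : rimdist q / o <= 1 by rewrite ler_pdivrMr // mul1r.
  have -> : b = p%:R + (b - p%:R) by rewrite subrKC.
  rewrite powRD ?(gt_eqF x0) ?implybT // powR_mulrn ?(ltW x0) //.
  rewrite ler_piMr ?exprn_ge0 ?(ltW x0) //.
  have P1 : 1 `^ (b - p%:R) = 1 :> R by rewrite powR1.
  by rewrite -[leRHS]P1; apply: ge0_ler_powR; rewrite ?nnegrE ?subr_ge0 // ltW.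
rewrite cmod_Bk -/(kerdist z (cplx q)) -/o /wt.
have -> : o `^ (- (b + 2)) = o `^ (- b) / o ^+ 2.
  rewrite opprD powRD ?(gt_eqF o0) ?implybT //; congr (_ * _).
  by rewrite powRN powR_mulrn // ltW.
have o2 : 0 < o ^- 2 by rewrite invr_gt0 exprn_gt0.
have -> : majorant p z (cplx q) = (rimdist q / o) ^+ p / o ^+ 2.
  by rewrite /majorant -/o -/(rimdist q) -[p.+2]addn2 exprD expr_div_n; field; rewrite ?expf_neq0 ?gt_eqF.
have -> : o `^ (- b) / o ^+ 2 * ((b + 1) * (1 - cmod (cplx q) ^+ 2) `^ b) =
  (b + 1) * (o `^ (- b) * (1 - cmod (cplx q) ^+ 2) `^ b) / o ^+ 2 by ring.
rewrite !mulrA ler_pM2r // -!mulrA ler_pM2l; last by rewrite ltr_wpDl.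
apply: (@le_trans _ _ (o `^ (- b) * (2 `^ b * rimdist q `^ b))); first by rewrite ler_wpM2l ?powR_ge0.
rewrite mulrCA [_ * rimdist q `^ b]mulrC; apply: ler_wpM2l => //; exact: powR_ge0.
Qed.

Variables (p : nat) (A : R) (A0 : 0 < A).
Hypothesis schur : forall (G P : plane R -> R) (X : R),
  measurable_fun setT G -> (forall q, 0 <= G q) -> 0 <= X ->
  (forall zt dl, cmod zt = 1 -> 0 < dl ->
    (\int[Lam]_(q in rimball zt dl) (G q ^+ 2 * KK K (rimdist q / dl))%:E <= X%:E)%E) ->
  measurable_fun (@disc R) P -> (forall q, 0 <= P q) ->
  (forall q, @disc R q ->
    ((P q)%:E <= \int[Lam]_(w in @disc R) (G w * majorant p (cplx q) (cplx w))%:E)%E) ->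
  forall a, cmod a < 1 ->
  (\int[Lam]_(q in @disc R) (P q ^+ 2 * KK K (1 - cmod (mobius a (cplx q)) ^+ 2))%:E <= (A * X)%:E)%E.

Variables (b : R) (pb : p%:R <= b).
Let b0 : 0 <= b. Proof. by apply: le_trans pb. Qed.

Section one_packet_sum.
Variables (N : nat) (c : 'I_(2 ^ N) -> 'I_(2 ^ N) -> R[i]).

Definition packet_sum_deriv z : R[i] :=
  cintegral (dA R) (@disc R) (fun q => Bk (b + 2) z (cplx q) * (stepf c q * (wt b q)%:C)).

Lemma hol_packet_sum z : cmod z < 1 -> hol (packet_sum b c) z (packet_sum_deriv z).
Proof.
move=> z1; have [r r0 Hr] := disc_open z1.
have H := @hol_Lker_integral R (dA R) (@disc R) b _ z (@measurable_disc R) (fun _ x => x) b0 (stepf_cintegrable b0 c) z1.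
apply: (hol_ext r0 _ H) => h hr.
by rewrite packet_sumE //; exact: Hr.
Qed.

Lemma packet_sum0 : packet_sum b c 0 = 0.
Proof.
rewrite packet_sumE ?cmod0 //.
transitivity (cintegral (dA R) (@disc R) (fun=> 0 : R[i])).
  apply: eq_cintegral => q _; rewrite /Lker (_ : cintegral _ _ _ = 0) ?mul0r //.
  transitivity (cintegral lam `[0, 1] (fun=> 0 : R[i])).
    by apply: eq_cintegral => t _; rewrite mul0r.
  by have := cintegral_cst lam (measurable_itv `[0, 1]) 0; rewrite mul0r.
by have := cintegral_cst (dA R) (@measurable_disc R) 0; rewrite mul0r.
Qed.

Let G q := cmod (stepf c q).

Let mG : measurable_fun setT G.
Proof. by have [m1 m2] := measurable_stepf c; exact: measurable_cmodF. Qed.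

(** 2 from [cmod_cintegral], 1/pi from the normalization of dA, and the rest from [Bk_wt_le]. *)
Let C1 := 2 * (pi^-1 * ((b + 1) * 2 `^ b)).

Let C10 : 0 < C1.
Proof.
rewrite /C1; apply: mulr_gt0 => //; apply: mulr_gt0; first by rewrite invr_gt0 pi_gt0.
by apply: mulr_gt0; [rewrite ltr_wpDl | rewrite powR_gt0].
Qed.

Lemma packet_sum_deriv_le q : @disc R q ->
  ((cmod (packet_sum_deriv (cplx q)) / C1)%:E <= \int[Lam]_(w in @disc R) (G w * majorant p (cplx q) (cplx w))%:E)%E.
Proof.
move=> q1; have mdisc : measurable (@disc R) := (@measurable_disc R).
have lD : (Lam (@disc R) < +oo)%E by rewrite disc_cdisc; exact: Lam_cdisc_lty.
have d0 : 0 < 1 - cmod (cplx q) by rewrite subr_gt0.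
pose S := \sum_j \sum_k cmod (c j k).
pose g w := G w * majorant p (cplx q) (cplx w).
have mg : measurable_fun (@disc R) g.
  apply: measurable_funM; first exact: (measurable_funS measurableT (@subsetT _ _)).
  exact: measurable_majorantr.
have g0 w : @disc R w -> 0 <= g w by move=> w1; rewrite mulr_ge0 ?cmod_ge0 ?majorant_ge0.
have gb w : @disc R w -> `|g w| <= S * ((1 - cmod (cplx q)) ^+ 2)^-1.
  move=> w1; rewrite ger0_norm ?g0 //; apply: ler_pM; rewrite ?cmod_ge0 ?majorant_ge0 ?stepf_bounded //.
  apply: (le_trans (majorant_le _ q1 w1)); rewrite lef_pV2 ?posrE ?exprn_gt0 ?kerdist_gt0 //.
  by rewrite lerXn2r ?nnegrE ?kerdist_ge0 ?(ltW d0) // ge_kerdist.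
have gL : Lam.-integrable (@disc R) (EFin \o g) := bounded_integrable mdisc lD mg gb.
pose k1 := (b + 1) * 2 `^ b.
have k1g : Lam.-integrable (@disc R) (EFin \o (fun w => k1 * g w)) by exact: integrableZlr.
have k1A : (dA R).-integrable (@disc R) (EFin \o (fun w => k1 * g w)) by exact: dA_integrable.
have Fi : cintegrable (dA R) (@disc R) (fun w => Bk (b + 2) (cplx q) (cplx w) * (stepf c w * (wt b w)%:C)).
  have [m1 m2] := Bk_measurable (b + 2) q1.
  apply: (cintegrableM (k := (1 - cmod (cplx q)) `^ (- (b + 2))) mdisc (stepf_cintegrable b0 c) m1 m2).
  by move=> w w1; apply: cmod_Bk_le => //; rewrite ?addr_ge0 // ltW.
have H : cmod (packet_sum_deriv (cplx q)) <= 2 * Rintegral (dA R) (@disc R) (fun w => k1 * g w).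
  apply: (cmod_cintegral mdisc Fi k1A) => w w1; rewrite !cmodM cmod_real (ger0_norm (wt_ge0 b0 w)).
  rewrite mulrCA /g [k1 * _]mulrCA; apply: ler_wpM2l; first exact: cmod_ge0.
  exact: Bk_wt_le.
rewrite Rintegral_dA // RintegralZl // in H.
have -> : (\int[Lam]_(w in @disc R) (G w * majorant p (cplx q) (cplx w))%:E = (Rintegral Lam (@disc R) g)%:E)%E.
  by rewrite /Rintegral fineK //; exact: integrable_fin_num.
rewrite lee_fin ler_pdivrMr //; apply: (le_trans H).
by rewrite le_eqVlt; apply/orP; left; apply/eqP; rewrite /C1 -/k1; ring.
Qed.

(** The derivative of a holomorphic function is holomorphic, hence continuous. *)
Lemma measurable_packet_sum_deriv : measurable_fun (@disc R) (fun q => cmod (packet_sum_deriv (cplx q))).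
Proof.
have cc w : cmod w < 1 -> ccont packet_sum_deriv w.
  by move=> w1; have [d Hd] := hol_deriv hol_packet_sum w1; exact: hol_ccont Hd.
have [m1 m2] := disc_measurable_ReIm (lexx 1) cc.
exact: measurable_cmodF.
Qed.

(** [schur] applies to G = |stepf c| and P = |F'| / C1; membership in Q_K follows because F vanishes
    at 0. *)
Lemma packet_sum_QK : (X_norm K c <= 1)%E ->
  QK0 K (packet_sum b c) /\ (QK_seminorm_sqr K (packet_sum b c) <= (C1 ^+ 2 * A)%:E)%E.
Proof.
have pp := pi_gt0 R; have pi0 : 0 < pi^-1 :> R by rewrite invr_gt0.
move=> Xc; have HX : forall I h, is_arc I h ->
    (\int[Lam]_(q in carleson_box I h) (G q ^+ 2 * KK K (rimdist q / h))%:E <= pi%:E)%E.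
  move=> I h Ih; have X1 : (X_norm K c <= (Num.sqrt 1)%:E)%E by rewrite sqrtr1.
  have := (X_normP hK c ler01).1 X1 I h Ih.
  have mQ := measurable_carleson Ih.
  rewrite (_ : (\int[Lam]_(q in carleson_box I h) (pi^-1 * (cmod (stepf c q) ^+ 2 * KK K (rimdist q / h)))%:E =
    (pi^-1)%:E * \int[Lam]_(q in carleson_box I h) (G q ^+ 2 * KK K (rimdist q / h))%:E)%E); last first.
    rewrite -ge0_integralZl_EFin ?(ltW pi0) //.
    - by move=> q _; rewrite lee_fin mulr_ge0 ?exprn_ge0 ?(KK_ge0 hK) ?cmod_ge0.
    - apply/measurable_EFinP; apply: measurable_funM; last exact: measurable_KKdd.
      by apply: measurable_funX; exact: (measurable_funS measurableT (@subsetT _ _)).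
  by rewrite -lee_pdivlMl // invrK mule1.
have G0 q : 0 <= G q by exact: cmod_ge0.
have sn : (QK_seminorm_sqr K (packet_sum b c) <= (C1 ^+ 2 * A)%:E)%E.
  apply: ub_ereal_sup => _ [a a1 <-].
  pose P q := cmod (packet_sum_deriv (cplx q)) / C1.
  have mP : measurable_fun (@disc R) P by apply: measurable_funM => //; exact: measurable_packet_sum_deriv.
  have P0 q : 0 <= P q by rewrite divr_ge0 ?cmod_ge0 // ltW.
  (* X = pi, as the discrete norm is taken with dA and [schur] with Lebesgue measure; the factor
     1/pi of the seminorm cancels it. *)
  have := schur mG G0 (ltW pp) (ball_bound hK mG G0 HX) mP P0 packet_sum_deriv_le a1.
  have mI : measurable_fun (@disc R) (fun q => P q ^+ 2 * KK K (1 - cmod (mobius a (cplx q)) ^+ 2)).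
    by apply: measurable_funM; [exact: measurable_funX | exact: measurable_mobius].
  have I0 q : 0 <= P q ^+ 2 * KK K (1 - cmod (mobius a (cplx q)) ^+ 2).
    by rewrite mulr_ge0 ?exprn_ge0 ?(KK_ge0 hK).
  have -> : (\int[dA R]_(p0 in @disc R) (cmod (cderive (packet_sum b c) (cplx p0)) ^+ 2 *
      K (1 - cmod (mobius a (cplx p0)) ^+ 2))%:E =
    \int[dA R]_(q in @disc R) (C1 ^+ 2 * (P q ^+ 2 * KK K (1 - cmod (mobius a (cplx q)) ^+ 2)))%:E)%E.
    apply: eq_integral => q; rewrite inE => q1.
    have /cderivableP[_ ->] := hol_packet_sum q1.
    rewrite KK_E ?mobius_defect_ge0 //.
    by congr EFin; rewrite mulrA /P -exprMn [C1 * _]mulrC divfK // gt_eqF.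
  rewrite ge0_integral_dA //; last 3 first.
  - exact: (@measurable_disc R).
  - by apply/measurable_EFinP; apply: measurable_funM.
  - by move=> q _; rewrite lee_fin mulr_ge0 ?exprn_ge0 // ltW.
  rewrite (_ : (\int[Lam]_(q in @disc R) (C1 ^+ 2 * (P q ^+ 2 * KK K (1 - cmod (mobius a (cplx q)) ^+ 2)))%:E =
    (C1 ^+ 2)%:E * \int[Lam]_(q in @disc R) (P q ^+ 2 * KK K (1 - cmod (mobius a (cplx q)) ^+ 2))%:E)%E); last first.
    rewrite -ge0_integralZl_EFin ?exprn_ge0 ?(ltW C10) //;
      do ?[exact: (@measurable_disc R) | by apply/measurable_EFinP | by move=> q _; rewrite lee_fin].
  move=> H; apply: (@le_trans _ _ ((pi^-1)%:E * ((C1 ^+ 2)%:E * (A * pi)%:E))%E).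
    apply: lee_wpmul2l; first by rewrite lee_fin ltW.
    by apply: lee_wpmul2l => //; rewrite lee_fin exprn_ge0 // ltW.
  rewrite -!EFinM lee_fin le_eqVlt; apply/orP; left; apply/eqP.
  by rewrite mulrCA; congr (_ * _); rewrite mulrCA mulVf ?mulr1 // gt_eqF.
split => //; split; last exact: packet_sum0.
split; first by move=> z z1; have /cderivableP[] := hol_packet_sum z1.
rewrite /QK_norm packet_sum0 cmod0 add0e /QK_seminorm.
have := QK_seminorm_sqr_ge0 (packet_sum b c).
by case: (QK_seminorm_sqr _ _) sn => //= r _ _; rewrite ltry.
Qed.

End one_packet_sum.
End upper.

(** * Approximation by packet sums *)

Section cell_diameter.
Variable R : realType.

Lemma polar_dist (r r' t u : R) : 0 <= r' ->
  cmod (cplx (polar r t) - cplx (polar r' u)) <= `|r - r'| + r' * `|t - u|.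
Proof.
move=> r0; have S (x y : R) s : cplx (polar x s) - cplx (polar y s) = (x - y)%:C * cplx (polar 1 s).
  by rewrite /cplx /polar /=; apply/eqP; rewrite eq_complex /=; apply/andP; split; apply/eqP; ring.
apply: (le_trans (cmod_tri _ (cplx (polar r' t)) _)); apply: lerD.
  by rewrite S cmodM cmod_real cmod_polar // mulr1.
have -> : cplx (polar r' t) - cplx (polar r' u) = r'%:C * (cplx (polar 1 t) - cplx (polar 1 u)).
  by rewrite /cplx /polar /=; apply/eqP; rewrite eq_complex /=; apply/andP; split; apply/eqP; ring.
by rewrite cmodM cmod_real ger0_norm // ler_wpM2l // polar_dist_angle.
Qed.

(** The radial grid is uniform in r^2, so near the origin only |r - r'|^2 <= |r^2 - r'^2| <= 4^(-m)
    is available; hence the even generation 2 m and the diameter O(2^(-m)). The angular part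
    contributes at most 8 / 2^m. *)
Lemma cell_diam m (j k : 'I_(2 ^ (m + m))) (p q : plane R) : cell j k p -> cell j k q ->
  cmod (cplx p - cplx q) <= 9 / 2 ^+ m.
Proof.
set s : R := 2 ^+ m; have s1 : 1 <= s by rewrite exprn_ege1 // ler1n.
have sE : (2 : R) ^+ (m + m) = s * s by rewrite exprD.
have p4 := pihalf_lt2 R; have pp := pi_gt0 R.
move=> Hp Hq; have q1 := cell_disc Hq.
case: Hp Hq; rewrite !sE => /andP[p1 p2] /andP[p3 p5] [/andP[q2 q3] /andP[q4 q5]].
rewrite !sE in q2 q3 q4 q5.
rewrite (polar_ang p) (polar_ang q); set r := cmod (cplx p) in p1 p2 *; set r' := cmod (cplx q) in q1 q2 q3 *.
have r0 : 0 <= r by exact: cmod_ge0.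
have r0' : 0 <= r' by exact: cmod_ge0.
have r1' : r' <= 1 by exact: ltW.
have ss0 : 0 < s * s by nra.
have nE (n : nat) : n.+1%:R / (s * s) = n%:R / (s * s) + (s * s)^-1 :> R by rewrite -natr1 mulrDl mul1r.
have H1 : `|r - r'| <= s^-1.
  have rr : `|r - r'| ^+ 2 <= (s^-1) ^+ 2.
    apply: (@le_trans _ _ `|r ^+ 2 - r' ^+ 2|).
      rewrite subr_sqr normrM expr2; apply: ler_wpM2l => //.
      by rewrite ler_norml (ger0_norm (addr_ge0 r0 r0')); apply/andP; split; lra.
    rewrite [leRHS]expr2 -invfM; rewrite !nE in p2 q3.
    by rewrite ler_norml; apply/andP; split; lra.
  by rewrite -(@ler_pXn2r _ 2) ?nnegrE ?invr_ge0 // (le_trans ler01).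
have H2 : `|ang p - ang q| <= 4 * 2 / (s * s).
  have kE : 2 * pi * k.+1%:R / (s * s) = 2 * pi * k%:R / (s * s) + 2 * pi / (s * s) :> R.
    by rewrite -natr1; field; rewrite gt_eqF // (lt_le_trans ltr01).
  rewrite kE in p5 q5; apply: (@le_trans _ _ (2 * pi / (s * s))).
    by rewrite ler_norml; apply/andP; split; lra.
  by rewrite ler_pM2r ?invr_gt0 //; lra.
apply: (le_trans (polar_dist _ _ _ r0')).
have H3 : r' * `|ang p - ang q| <= 8 / s.
  apply: (@le_trans _ _ (1 * (4 * 2 / (s * s)))); first exact: ler_pM.
  have -> : 4 * 2 = 8 :> R by rewrite -natrM.
  have sp : 0 < s by exact: lt_le_trans s1.
  have -> : 1 * (8 / (s * s)) = 8 / s / s by field; rewrite gt_eqF.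
  by rewrite ler_pdivrMr // ler_peMr // divr_ge0 // ltW.
have -> : 9 / s = s^-1 + 8 / s by field; rewrite gt_eqF // (lt_le_trans ltr01).
exact: lerD.
Qed.

(* Shrinking an e-approximation by e makes it dominated by the approximated
   function. *)
Definition shrink (e : R) (v : R[i]) : R[i] := if cmod v <= e then 0 else v * (1 - e / cmod v)%:C.

Lemma shrink_le (e : R) v : 0 <= e -> cmod (shrink e v) <= Num.max 0 (cmod v - e).
Proof.
move=> e0; rewrite /shrink; case: (boolP (cmod v <= e)) => [_|]; first by rewrite cmod0 le_max lexx.
rewrite -ltNge => ve; have v0 : 0 < cmod v by exact: le_lt_trans ve.
rewrite cmodM cmod_real ger0_norm ?subr_ge0 ?ler_pdivrMr ?mul1r ?(ltW ve) //.
by rewrite mulrBr mulr1 mulrCA divff ?gt_eqF // mulr1 le_max lexx orbT.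
Qed.

Lemma shrink_dist (e : R) v : 0 <= e -> cmod (shrink e v - v) <= e.
Proof.
move=> e0; rewrite /shrink; case: (boolP (cmod v <= e)) => [ve|]; first by rewrite sub0r cmodN.
rewrite -ltNge => ve; have v0 : 0 < cmod v by exact: le_lt_trans ve.
have -> : v * (1 - e / cmod v)%:C - v = - (v * (e / cmod v)%:C) by rewrite rmorphB /= rmorph1; ring.
rewrite cmodN cmodM cmod_real ger0_norm ?divr_ge0 ?(ltW v0) // mulrCA divff ?gt_eqF // mulr1 //.
Qed.

Lemma rcont_inv (t : R) : 0 < t -> rcont (fun s => s^-1) t.
Proof.
move=> t0; have tn : t != 0 by rewrite gt_eqF.
apply: (@rderiv_rcont _ _ _ (- t ^- 2 *: 1)); apply/rdP; apply: is_deriveV.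
exact: tn.
Qed.

Lemma cmod_le_add (u v : R[i]) : cmod u <= cmod (u - v) + cmod v.
Proof. by rewrite -{1}(subrK v u); exact: cmodD. Qed.

Lemma mid_lt (x : R) : x < 1 -> x < (1 + x) / 2 /\ (1 + x) / 2 < 1.
Proof. by move=> x1; split; lra. Qed.

Lemma far_bound (x y d d' a c : R) : `|x - y| <= d -> d < d' -> d' <= c - a -> c < y -> a <= x.
Proof. by rewrite ler_norml => /andP[]; lra. Qed.

End cell_diameter.

(** * The damped derivative and its approximation by step functions *)

Section dilation.
Variables (R : realType) (b rho : R) (df : R[i] -> R[i]).
Hypotheses (b0 : 0 < b) (rho0 : 0 < rho) (rho1 : rho < 1).
Hypothesis cdf : forall w, cmod w < 1 -> ccont df w.

(* The last factor is ((rho^2 - |w|^2)_+ / (1 - |w|^2))^b: it is at most 1 and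
   turns the weight of dA_b into that of the reproducing formula on |w| < rho. *)
Definition damped w : R[i] := df w * (pw b (1 - (1 - rho ^+ 2) / (1 - cmod w ^+ 2)))%:C.

Let s0 (w : R[i]) : cmod w < 1 -> 0 < 1 - cmod w ^+ 2.
Proof. by move=> w1; rewrite subr_gt0 expr_lt1 ?cmod_ge0. Qed.

Lemma damped_le w : cmod w < 1 -> cmod (damped w) <= cmod (df w).
Proof.
move=> w1; rewrite /damped cmodM cmod_real ger0_norm ?pw_ge0 // ler_piMr ?cmod_ge0 //.
apply: pw_le1 => //; rewrite gerBl divr_ge0 ?(ltW (s0 w1)) //.
by rewrite subr_ge0 exprn_ile1 // ltW.
Qed.

Lemma damped_eq0 w : cmod w < 1 -> rho <= cmod w -> damped w = 0.
Proof.
move=> w1 rw; rewrite /damped pw_le0 ?mulr0 // subr_le0 ler_pdivlMr ?s0 // mul1r lerD2l lerN2.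
by rewrite lerXn2r ?nnegrE ?cmod_ge0 // ltW.
Qed.

Lemma damped_pw w : cmod w < 1 -> damped w * ((1 - cmod w ^+ 2) `^ b)%:C = df w * (pw b (sw rho w))%:C.
Proof.
move=> w1; have t0 := s0 w1; rewrite /damped -mulrA -rmorphM /=; congr (_ * (_)%:C).
set t := 1 - cmod w ^+ 2 in t0 *.
have E : 1 - (1 - rho ^+ 2) / t = sw rho w / t.
  have -> : sw rho w = t - (1 - rho ^+ 2) by rewrite /sw /t; ring.
  by field; rewrite gt_eqF.
rewrite E; have [h|h] := ltP 0 (sw rho w).
  by rewrite !pw_gt0E ?divr_gt0 // -powRM ?divr_ge0 ?(ltW h) ?(ltW t0) // divfK // gt_eqF.
by rewrite !pw_le0 // ?mul0r // mulr_le0_ge0 // invr_ge0 ltW.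
Qed.

Lemma ccont_damped w : cmod w < 1 -> ccont damped w.
Proof.
move=> w1; apply: ccontM (cdf w1) _.
apply: (ccont_rcont (F := pw b) (S := fun w => 1 - (1 - rho ^+ 2) / (1 - cmod w ^+ 2))).
  exact: rcont_pw.
have H1 : ccont (fun w => ((1 - cmod w ^+ 2)^-1)%:C) w.
  by apply: (ccont_rcont (F := fun s => s^-1) (S := fun w => 1 - cmod w ^+ 2)); [exact: rcont_inv (s0 w1) | exact: ccont_sqr].
have H2 := ccontB (ccont_cst 1 w) (ccontM (ccont_cst (1 - rho ^+ 2)%:C w) H1).
move=> e /H2[r r0 Hr]; exists r => // h /Hr.
by rewrite -!rmorphM -(rmorph1 (@real_complex R)) -!rmorphB.
Qed.

(** Compactness gives uniformity for |w| <= rho2, a radius strictly between rho and 1; beyond it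
    both points lie where the damped function vanishes. *)
Lemma damped_uniform e : 0 < e -> exists2 d, 0 < d & forall w w', cmod w < 1 -> cmod w' < 1 ->
  cmod (w' - w) < d -> cmod (damped w' - damped w) <= e.
Proof.
move=> e0; pose rho2 := (1 + rho) / 2; have [rr2 r21] : rho < rho2 /\ rho2 < 1 := mid_lt rho1.
pose P d w := forall w', cmod w' < 1 -> cmod (w' - w) < d -> cmod (damped w' - damped w) <= e.
have [|d0 d00 Hd] := @near_disc_uniform R P rho2.
  move=> w wr; have w1 : cmod w < 1 by exact: le_lt_trans r21.
  have e2 : 0 < e / 2 by rewrite divr_gt0.
  have [r r0 Hr] := ccont_damped w1 e2; have r2 : 0 < r / 2 by rewrite divr_gt0.
  exists (r / 2) => //; exists (r / 2) => // w' w'r d /andP[dp dr] w'' w''1 w''d.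
  have A u : cmod (u - w) < r -> cmod (damped u - damped w) <= e / 2.
    by move=> /Hr; rewrite subrKC.
  apply: (le_trans (cmod_tri _ (damped w) _)).
  have h1 : cmod (damped w'' - damped w) <= e / 2.
    apply: A; apply: (le_lt_trans (cmod_tri _ w' _)); rewrite [ltRHS]splitr.
    by apply: ltrD => //; exact: lt_trans dr.
  have h2 : cmod (damped w' - damped w) <= e / 2.
    by apply: A; apply: (lt_le_trans w'r); rewrite ler_pdivrMr // ler_peMr ?ltW // ltr1n.
  by rewrite cmodBC in h2; rewrite [leRHS]splitr; exact: lerD.
(* With d1 <= rho2 - rho, a point within d1 of some w with |w| > rho2 still has modulus at least
   rho. *)
pose d1 := Num.min (d0 / 2) (rho2 - rho).
have d10 : 0 < d1 by rewrite lt_min divr_gt0 // subr_gt0.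
have d1d : d1 < d0 by rewrite gt_min; apply/orP; left; rewrite ltr_pdivrMr // ltr_pMr // ltr1n.
have d1r : d1 <= rho2 - rho by rewrite ge_min lexx orbT.
exists d1 => // w w' w1 w'1 ww.
have [wr|wr] := leP (cmod w) rho2.
  by apply: (Hd d1 _ w wr w' w'1 ww); rewrite d10.
have h' : rho <= cmod w' := far_bound (cmod_dist w' w) ww d1r wr.
by rewrite !damped_eq0 ?subrr ?cmod0 ?(ltW e0) // ltW // (lt_trans rr2).
Qed.

(** The sampled values are shrunk by e/2, the oscillation on a cell: the error becomes at most e,
    and the shrunk value is below |g| at every point of the cell, hence below |f'|. *)
Lemma step_approx e : 0 < e -> exists (N : nat) (c : 'I_(2 ^ N) -> 'I_(2 ^ N) -> R[i]),
  forall q, @disc R q -> cmod (stepf c q) <= cmod (df (cplx q)) /\ cmod (stepf c q - damped (cplx q)) <= e.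
Proof.
move=> e0; have e2 : 0 < e / 2 by rewrite divr_gt0.
have [d d0 Hd] := damped_uniform e2.
have [m Hm] := half_pow_lt 9 d0.
(* The default point of [xget] is harmless, since only cells that contain some q of the disc are
   evaluated. *)
exists (m + m)%N, (fun j k => shrink (e / 2) (damped (cplx (xget ((0, 0) : plane R) (cell j k))))) => q q1.
have [j [k jk]] := cell_cover (m + m) q1; rewrite (stepf_cell _ jk).
have [xjk] : {x | x = xget ((0, 0) : plane R) (cell j k)} by exists (xget ((0, 0) : plane R) (cell j k)).
have Hx : cell j k (xget ((0, 0) : plane R) (cell j k)) by apply: xgetPex; exists q.
set x := xget _ _ in Hx *; move=> _.
have H := Hd _ _ q1 (cell_disc Hx) (le_lt_trans (cell_diam Hx jk) Hm).
have E := ltW e2; split.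
  apply: (le_trans (shrink_le _ E)); rewrite ge_max cmod_ge0 /= lerBlDr.
  apply: (le_trans (cmod_le_add _ (damped (cplx q)))); rewrite addrC; apply: lerD; [exact: damped_le | exact: H].
apply: (le_trans (cmod_tri _ (damped (cplx x)) _)); rewrite [leRHS]splitr.
apply: lerD; [exact: shrink_dist | exact: H].
Qed.

End dilation.

(** * The discrete norm controlled by Moebius integrals *)

Section lower_norm.
Variables (R : realType) (K : R -> R) (hK : WQ K).
Local Notation lam := (@lebesgue_measure R).
Local Notation Lam := (lam \x lam)%E.
Implicit Types (q : plane R).
Variable p : nat.
Hypothesis Kdbl : forall l s t : R, 1 <= l -> s <= 1 -> s <= l * t -> KK K s <= (2 * l) ^+ p * KK K t.

Let mdisc : measurable (@disc R) := @measurable_disc R.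

(** By [box_mobius] and doubling, K((1 - |q|) / h) <= 200^p K(1 - |phi_a|^2) on the box, so each box
    integral is below a Moebius integral; the factor 200^p is put into the assumption on c. *)
Lemma X_norm_le1 N (c : 'I_(2 ^ N) -> 'I_(2 ^ N) -> R[i]) (g : plane R -> R) :
  measurable_fun (@disc R) g ->
  (forall q, @disc R q -> (2 * 100) ^+ p * cmod (stepf c q) ^+ 2 <= g q ^+ 2) ->
  (forall a, cmod a < 1 ->
    (\int[dA R]_(q in @disc R) (g q ^+ 2 * K (1 - cmod (mobius a (cplx q)) ^+ 2))%:E <= 1)%E) ->
  (X_norm K c <= 1)%E.
Proof.
move=> mg cg Hg; have pp := pi_gt0 R; have pi0 : 0 < pi^-1 :> R by rewrite invr_gt0.
have [m1 m2] := measurable_stepf c.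
have ms D : measurable_fun D (fun q => cmod (stepf c q)).
  by apply: (measurable_funS measurableT (@subsetT _ D)); exact: measurable_cmodF.
have -> : 1%E = (Num.sqrt 1)%:E :> \bar R by rewrite sqrtr1.
apply/(X_normP hK c ler01) => I h Ih; have mQ := measurable_carleson Ih.
have [a a1 Ha] := box_mobius Ih.
have QD : carleson_box I h `<=` @disc R by exact: carleson_disc.
pose v q := pi^-1 * (g q ^+ 2 * KK K (1 - cmod (mobius a (cplx q)) ^+ 2)).
have mv : measurable_fun (@disc R) v.
  apply: measurable_funM => //; apply: measurable_funM; first exact: measurable_funX.
  exact: measurable_mobius.
have v0 q : 0 <= v q.
  rewrite /v; apply: mulr_ge0; first exact: ltW.
  by apply: mulr_ge0; [exact: sqr_ge0 | exact: KK_ge0 hK _].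
apply: (@le_trans _ _ (\int[Lam]_(q in carleson_box I h) (v q)%:E)%E).
  apply: ge0_le_integral => //.
  - move=> q _; rewrite lee_fin; apply: mulr_ge0; first exact: ltW.
    by apply: mulr_ge0; [exact: sqr_ge0 | exact: KK_ge0 hK _].
  - apply/measurable_EFinP; apply: measurable_funM => //; apply: measurable_funM.
      by apply: measurable_funX; exact: ms.
    exact: measurable_KKdd.
  - by apply/measurable_EFinP; exact: (measurable_funS mdisc QD mv).
  - move=> q qQ; have [q1 /andP[_ h1] h2] := Ha q qQ; rewrite lee_fin ler_pM2l //.
    have H : KK K (rimdist q / h) <= (2 * 100) ^+ p * KK K (1 - cmod (mobius a (cplx q)) ^+ 2).
      by apply: Kdbl => //; rewrite ler1n.
    apply: (le_trans (ler_wpM2l (sqr_ge0 _) H)).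
    rewrite mulrA [_ * (2 * 100) ^+ p]mulrC; apply: ler_wpM2r; [exact: KK_ge0 hK _ | exact: cg].
apply: (@le_trans _ _ (\int[Lam]_(q in @disc R) (v q)%:E)%E).
  apply: ge0_subset_integral => //; first by apply/measurable_EFinP.
  by move=> q _; rewrite lee_fin.
apply: le_trans (Hg a a1); rewrite le_eqVlt; apply/orP; left; apply/eqP.
have E : (\int[dA R]_(q in @disc R) (g q ^+ 2 * K (1 - cmod (mobius a (cplx q)) ^+ 2))%:E =
   \int[dA R]_(q in @disc R) (g q ^+ 2 * KK K (1 - cmod (mobius a (cplx q)) ^+ 2))%:E)%E.
  by apply: eq_integral => q; rewrite inE => q1; rewrite KK_E // mobius_defect_ge0.
have mI : measurable_fun (@disc R) (fun q => g q ^+ 2 * KK K (1 - cmod (mobius a (cplx q)) ^+ 2)).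
  by apply: measurable_funM; [exact: measurable_funX | exact: measurable_mobius].
have I0 q : 0 <= g q ^+ 2 * KK K (1 - cmod (mobius a (cplx q)) ^+ 2).
  by apply: mulr_ge0; [exact: sqr_ge0 | exact: KK_ge0 hK _].
rewrite E ge0_integral_dA //; last 2 first.
- by apply/measurable_EFinP.
- by move=> q _; rewrite lee_fin.
rewrite -ge0_integralZl_EFin ?(ltW pi0) //; last by apply/measurable_EFinP.
by move=> q _; rewrite lee_fin.
Qed.

End lower_norm.

Lemma Rintegral_supp (R : realType) d (T : measurableType d) (mu : {measure set T -> \bar R}) (D D' : set T) (H : T -> R) :
  measurable D -> measurable D' -> D' `<=` D ->
  (forall q, D q -> ~ D' q -> H q = 0) -> Rintegral mu D H = Rintegral mu D' H.
Proof.
move=> mD mD' DD H0; rewrite /Rintegral; congr fine.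
rewrite [LHS]integral_mkcond [RHS]integral_mkcond; apply: eq_integral => q _; rewrite !patchE.
have [h|h] := boolP (q \in D').
  by rewrite mem_set //; apply: DD; rewrite inE in h.
have [Dq|//] := boolP (q \in D).
by rewrite H0 //; [rewrite inE in Dq | move=> D'q; rewrite mem_set in h].
Qed.

Lemma cintegral_supp (R : realType) d (T : measurableType d) (mu : {measure set T -> \bar R}) (D D' : set T) (H : T -> R[i]) :
  measurable D -> measurable D' -> D' `<=` D ->
  (forall q, D q -> ~ D' q -> H q = 0) -> cintegral mu D H = cintegral mu D' H.
Proof.
move=> mD mD' DD H0; rewrite /cintegral.
by rewrite (Rintegral_supp mu mD mD' DD) ?(Rintegral_supp mu mD mD' DD) // => q h1 h2; rewrite (H0 q h1 h2).
Qed.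

Lemma cintegral_eq0 (R : realType) d (T : measurableType d) (mu : {measure set T -> \bar R}) (D : set T)
  (H : T -> R[i]) : (forall q, D q -> H q = 0) -> cintegral mu D H = 0.
Proof.
by move=> H0; rewrite /cintegral /Rintegral !integral0_eq // => q /H0 ->.
Qed.

(** * Dilates of f as transforms *)

Section representation.
Variables (R : realType) (b rho : R) (f df : R[i] -> R[i]).
Hypotheses (b0 : 0 < b) (rho0 : 0 < rho) (rho1 : rho < 1).
Hypothesis hf : forall z, cmod z < 1 -> hol f z (df z).
Hypothesis f0 : f 0 = 0.
Local Notation lam := (@lebesgue_measure R).
Local Notation Lam := (lam \x lam)%E.
Implicit Types (q : plane R).

Let mdisc : measurable (@disc R) := @measurable_disc R.
Let b0' : 0 <= b := ltW b0.

(** [repro] will be applied to f' and asks for two further derivatives. *)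
Lemma hol_chain : exists ddf dddf : R[i] -> R[i], (forall z, cmod z < 1 -> hol df z (ddf z)) /\
  (forall z, cmod z < 1 -> hol ddf z (dddf z)).
Proof.
have pick (u v : R[i] -> R[i]) : (forall z, cmod z < 1 -> hol u z (v z)) ->
    exists w : R[i] -> R[i], forall z, cmod z < 1 -> hol v z (w z).
  move=> Hu; have /choice[w Hw] : forall z : R[i], exists d, cmod z < 1 -> hol v z d.
    move=> z; have [z1|z1] := boolP (cmod z < 1); last by exists 0.
    by have [d Hd] := hol_deriv Hu z1; exists d.
  by exists w.
have [ddf H1] := pick _ _ hf; have [dddf H2] := pick _ _ H1.
by exists ddf, dddf.
Qed.

Lemma ccont_df w : cmod w < 1 -> ccont df w.
Proof. by move=> w1; have [d Hd] := hol_deriv hf w1; exact: hol_ccont Hd. Qed.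

Local Notation g := (damped b rho df).

Lemma damped_cintegrable : cintegrable (dA R) (@disc R) (fun q => g (cplx q) * (wt b q)%:C).
Proof.
have [m1 m2] := disc_measurable_ReIm (lexx 1) (fun w => @ccont_damped R b rho df b0 ccont_df w).
have [k k0 Hk] := @ccont_bounded R df rho (fun w wr => ccont_df (le_lt_trans wr rho1)).
have gk q : @disc R q -> cmod (g (cplx q)) <= k.
  move=> q1; have [h|h] := leP rho (cmod (cplx q)); first by rewrite damped_eq0 // cmod0.
  by apply: (le_trans (damped_le df b0 rho0 rho1 q1)); apply: Hk; exact: ltW.
exact: (@cintegrable_wt R b b0' (fun q => g (cplx q)) k gk m1 m2).
Qed.

Definition damped_transform z : R[i] := cintegral (dA R) (@disc R) (fun q => Lker b z (cplx q) * (g (cplx q) * (wt b q)%:C)).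

(** By [damped_pw] the damping turns the weight of dA_b into (b + 1) (rho^2 - |w|^2)^b on |w| < rho,
    and the integral becomes the reproducing formula for f'. *)
Lemma damped_transform_deriv z : cmod z < 1 -> hol damped_transform z ((pi^-1 * (b + 1) * kappa b rho)%:C * df ((rho ^+ 2)%:C * z)).
Proof.
move=> z1; have H := @hol_Lker_integral R (dA R) (@disc R) b _ z mdisc (fun _ x => x) b0' damped_cintegrable z1.
suff <- : cintegral (dA R) (@disc R) (fun q => Bk (b + 2) z (cplx q) * (g (cplx q) * (wt b q)%:C)) =
  (pi^-1 * (b + 1) * kappa b rho)%:C * df ((rho ^+ 2)%:C * z) by [].
have [ddf [dddf [h1 h2]]] := hol_chain.
have h3 w : cmod w < 1 -> ccont dddf w by move=> w1; have [d Hd] := hol_deriv h2 w1; exact: hol_ccont Hd.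
have rep := repro b0 rho0 rho1 z1 h1 h2 h3.
have mr : measurable (cdisc rho : set (plane R)) by exact: measurable_cdisc.
have rD : cdisc rho `<=` @disc R by move=> q /= qr; exact: lt_trans qr rho1.
have Ki := @kern_integrable R b rho b0 rho1 z df z1 ccont_df.
rewrite (cintegral_supp (dA R) mdisc mr rD); last first.
  by move=> q q1 /negP; rewrite -leNgt => qr; rewrite damped_eq0 // mul0r mulr0.
have -> : cintegral (dA R) (cdisc rho) (fun q => Bk (b + 2) z (cplx q) * (g (cplx q) * (wt b q)%:C)) =
   cintegral (dA R) (cdisc rho) (fun q => (b + 1)%:C * (kern b rho z (cplx q) * df (cplx q))).
  apply: eq_cintegral => q qr; have q1 := rD q qr.
  have E := damped_pw rho df b0 q1; rewrite /kern /wt.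
  have -> (s t : R) : (s * t)%:C = s%:C * t%:C by rewrite rmorphM.
  have -> : b + 2 = b + 1 + 1 by ring.
  rewrite [g _ * _]mulrCA E; ring.
rewrite cintegralZ //; last exact: dA_cintegrable.
by rewrite cintegral_dA // rep !rmorphM; ring.
Qed.

Lemma Lker0 w : Lker b 0 w = 0.
Proof.
by rewrite /Lker; apply: cintegral_eq0 => t _; rewrite mul0r.
Qed.

Lemma damped_transform_0 : damped_transform 0 = 0.
Proof.
by rewrite /damped_transform; apply: cintegral_eq0 => t _; rewrite Lker0 mul0r.
Qed.

(** The division by rho^2 compensates the inner derivative of f(rho^2 z). *)
Definition dilation_const : R := pi^-1 * (b + 1) * kappa b rho / rho ^+ 2.

Lemma damped_transform_E z : cmod z < 1 -> damped_transform z = dilation_const%:C * f ((rho ^+ 2)%:C * z).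
Proof.
move=> z1; pose G w := damped_transform w - dilation_const%:C * f (0 + (rho ^+ 2)%:C * w).
have r2 : rho ^+ 2 <= 1 by rewrite expr_le1 ?ltW.
have r20 : rho ^+ 2 != 0 by rewrite expf_neq0 // gt_eqF.
have hG w : cmod w < 1 -> hol G w 0.
  move=> w1; have w1' : cmod ((rho ^+ 2)%:C * w) < 1.
    rewrite cmodM cmod_real ger0_norm ?sqr_ge0 //.
    by apply: le_lt_trans w1; apply: ler_piMl => //; exact: cmod_ge0.
  have H1 : hol f (0 + (rho ^+ 2)%:C * w) (df ((rho ^+ 2)%:C * w)) by rewrite add0r; exact: hf.
  have := holB (damped_transform_deriv w1) (holZ dilation_const%:C (hol_affine H1)).
  have -> : (pi^-1 * (b + 1) * kappa b rho)%:C * df ((rho ^+ 2)%:C * w) -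
     dilation_const%:C * ((rho ^+ 2)%:C * df ((rho ^+ 2)%:C * w)) = 0.
    apply/eqP; rewrite subr_eq0 mulrA; apply/eqP; congr (_ * _).
    by rewrite -rmorphM /dilation_const mulfVK.
  exact.
have := @mvt_c R G (fun=> 0) 0 z 0; rewrite subr0 mulr0 mul0r => H.
have : cmod (G z - G 0) <= 0.
  apply: H => [t /andP[t0 t1]|t _]; last by rewrite cmod0.
  rewrite add0r; apply: hG; rewrite cmodM cmod_real ger0_norm //.
  by apply: le_lt_trans z1; apply: ler_piMl => //; exact: cmod_ge0.
have -> : G 0 = 0 by rewrite /G damped_transform_0 mulr0 addr0 f0 mulr0 subrr.
rewrite subr0 => H0.
have /cmod_eq0/eqP : cmod (G z) = 0 by apply/eqP; rewrite eq_le H0 cmod_ge0.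
by rewrite subr_eq0 add0r => /eqP.
Qed.

(** Depends on z and b but neither on rho nor on the step function; a bound for each z is enough for
    Fatou's lemma. *)
Definition transform_bound z : R := 2 * (2 * (1 - cmod z) `^ (- (b + 2)) * (b + 1) * fine (dA R (@disc R))).

Lemma damped_transform_approx e N (c : 'I_(2 ^ N) -> 'I_(2 ^ N) -> R[i]) z : 0 < e -> cmod z < 1 ->
  (forall q, @disc R q -> cmod (stepf c q - g (cplx q)) <= e) ->
  cmod (packet_sum b c z - dilation_const%:C * f ((rho ^+ 2)%:C * z)) <= transform_bound z * e.
Proof.
move=> e0 z1 ce; rewrite -damped_transform_E // packet_sumE // /damped_transform -cintegralB //; last 2 first.
- exact: Lker_cintegrable (stepf_cintegrable b0' c).
- exact: Lker_cintegrable damped_cintegrable.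
have E : cintegral (dA R) (@disc R) (fun q => Lker b z (cplx q) * (stepf c q * (wt b q)%:C) -
      Lker b z (cplx q) * (g (cplx q) * (wt b q)%:C)) =
   cintegral (dA R) (@disc R) (fun q => Lker b z (cplx q) * (stepf c q * (wt b q)%:C -
       g (cplx q) * (wt b q)%:C)).
  by apply: eq_cintegral => q _; rewrite mulrBr.
rewrite E; set l := 2 * (1 - cmod z) `^ (- (b + 2)).
have -> : transform_bound z * e = 2 * (l * (e * (b + 1)) * fine (dA R (@disc R))) by rewrite /transform_bound /l; ring.
apply: cmod_cintegral_bounded => //; first exact: dA_disc_lty.
  by apply: Lker_cintegrable => //; apply: cintegrableB => //; [exact: stepf_cintegrable | exact: damped_cintegrable].
move=> q q1; rewrite -mulrBl !cmodM cmod_real; apply: ler_pM => //; do ?[exact: cmod_ge0].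
- by apply: mulr_ge0 => //; exact: cmod_ge0.
- by apply: cmod_Lker => //; exact: ltW.
- rewrite ger0_norm ?wt_ge0 //; apply: ler_pM => //; [exact: cmod_ge0 | exact: wt_ge0 | exact: ce | exact: wt_le].
Qed.

Variables (K : R -> R) (hK : WQ K) (p : nat).
Hypothesis Kdbl : forall l s t : R, 1 <= l -> s <= 1 -> s <= l * t -> KK K s <= (2 * l) ^+ p * KK K t.
Hypothesis Hf : forall a, cmod a < 1 ->
    (\int[dA R]_(q in @disc R) (cmod (df (cplx q)) ^+ 2 * K (1 - cmod (mobius a (cplx q)) ^+ 2))%:E <= 1)%E.

Lemma packet_approx e : 0 < e -> exists N (c : 'I_(2 ^ N) -> 'I_(2 ^ N) -> R[i]), (X_norm K c <= 1)%E /\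
  forall z, cmod z < 1 ->
    cmod ((Num.sqrt ((2 * 100) ^+ p))%:C * packet_sum b c z - dilation_const%:C * f ((rho ^+ 2)%:C * z)) <= transform_bound z * e.
Proof.
move=> e0; have [N [c Hc]] := step_approx b0 rho0 rho1 ccont_df e0.
set B := Num.sqrt _; have B0 : 0 < B by rewrite sqrtr_gt0 exprn_gt0.
(* Dividing by B, with B^2 = 200^p, absorbs the loss in [X_norm_le1]. *)
pose c' j k := (B^-1)%:C * c j k.
have Es q : stepf c' q = (B^-1)%:C * stepf c q.
  rewrite /stepf mulr_sumr; apply: eq_bigr => j _; rewrite mulr_sumr; apply: eq_bigr => k _.
  by rewrite /c'; ring.
exists N, c'; split.
  have [m1 m2] := disc_measurable_ReIm (lexx 1) ccont_df.
  apply: (X_norm_le1 hK Kdbl (g := fun q => cmod (df (cplx q)))) Hf => [|q q1].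
    exact: measurable_cmodF.
  have Bi0 : 0 <= B^-1 by rewrite invr_ge0 ltW.
  have B2 : B ^+ 2 = (2 * 100) ^+ p by rewrite sqr_sqrtr // exprn_ge0.
  rewrite Es cmodM cmod_real (ger0_norm Bi0) -B2 -exprMn mulrA mulfV ?gt_eqF // mul1r.
  by rewrite lerXn2r ?nnegrE ?cmod_ge0 //; have [] := Hc q q1.
move=> z z1; have -> : B%:C * packet_sum b c' z = packet_sum b c z.
  rewrite /packet_sum mulr_sumr; apply: eq_bigr => j _; rewrite mulr_sumr; apply: eq_bigr => k _.
  by rewrite /c' !mulrA -rmorphM mulfV ?mul1r // gt_eqF.
by apply: damped_transform_approx => // q q1; have [] := Hc q q1.
Qed.

End representation.

(** Uniformity in rho >= 1/2 keeps the normalization of the approximants bounded as rho -> 1. *)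
Lemma dilation_const_ge (R : realType) (b : R) : 0 < b -> exists2 t0 : R, 0 < t0 &
  forall rho, 2^-1 <= rho -> rho < 1 -> t0 <= dilation_const b rho.
Proof.
move=> b0; have pi0 : 0 < pi^-1 :> R by rewrite invr_gt0 pi_gt0.
have b1 : 0 < b + 1 by rewrite addr_gt0.
exists (pi^-1 * (b + 1) * (16^-1 * pw b 8^-1)).
  have w0 : 0 < pw b 8^-1 by rewrite /pw powR_gt0 // lt_max invr_gt0 ltr0n orbT.
  by apply: mulr_gt0; [exact: mulr_gt0 | apply: mulr_gt0 => //; rewrite invr_gt0].
move=> rho r2 r1; have r0 : 0 < rho by apply: lt_le_trans r2; rewrite invr_gt0.
have k1 := kappa_lower b0 r1 r2; rewrite /dilation_const -[leRHS]mulrA; apply: ler_pM => //.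
- by rewrite mulr_ge0 // ltW.
- by rewrite mulr_ge0 ?invr_ge0 // /pw powR_ge0.
- apply: (le_trans k1); apply: ler_peMr; last by rewrite invf_ge1 ?exprn_gt0 // exprn_ile1 // ltW.
  by apply: le_trans k1; rewrite mulr_ge0 ?invr_ge0 // /pw powR_ge0.
Qed.

Lemma dilation_defect (R : realType) (u e : R) : 0 < u -> u <= e -> u <= 1 -> `|(1 - u) ^+ 2 - 1| <= 2 * e.
Proof.
move=> u0 ue u1; have -> : (1 - u) ^+ 2 - 1 = - (u * (2 - u)) by ring.
by rewrite normrN ger0_norm; nra.
Qed.

(** * Passage to the limit by Fatou's lemma *)

Section fatou_bound.
Variables (R : realType) (K : R -> R) (hK : WQ K) (b : R) (p : nat).
Hypothesis b0 : 0 < b.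
Hypothesis Kdbl : forall l s t : R, 1 <= l -> s <= 1 -> s <= l * t -> KK K s <= (2 * l) ^+ p * KK K t.
Variable t0 : R.
Hypothesis t00 : 0 < t0.
Hypothesis Ht0 : forall rho, 2^-1 <= rho -> rho < 1 -> t0 <= dilation_const b rho.
Variable mu : {measure set (plane R) -> \bar R}.
Implicit Types (q : plane R).

Let mdisc : measurable (@disc R) := @measurable_disc R.

Lemma measurable_cmod_sqr (F : R[i] -> R[i]) : (forall z, cmod z < 1 -> ccont F z) ->
  measurable_fun (@disc R) (fun q => (cmod (F (cplx q)) ^+ 2)%:E).
Proof.
move=> cF; have [m1 m2] := disc_measurable_ReIm (lexx 1) cF.
by apply/measurable_EFinP; apply: measurable_funX; exact: measurable_cmodF.
Qed.

Lemma L2_sqrZ (F : R[i] -> R[i]) (t : R) : (forall z, cmod z < 1 -> ccont F z) ->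
  L2_sqr mu (fun z => t%:C * F z) = ((t ^+ 2)%:E * L2_sqr mu F)%E.
Proof.
move=> cF; rewrite /L2_sqr -ge0_integralZl_EFin ?sqr_ge0 //.
- by apply: eq_integral => q _; rewrite cmodM cmod_real exprMn real_normK ?num_real.
- by move=> q _; rewrite lee_fin sqr_ge0.
- exact: measurable_cmod_sqr.
Qed.

(** The packet sums [phi n], rescaled by B / s n, converge pointwise to f; each rescaled sum has
    norm in L^2(mu) bounded by the discrete capacity, with the factor B / s n <= B / t0. *)
Lemma L2_sqr_le_capacity (f : R[i] -> R[i]) : QK0 K f -> (QK_seminorm_sqr K f <= 1)%E ->
  (L2_sqr mu f <= ((Num.sqrt ((2 * 100) ^+ p) / t0) ^+ 2)%:E * discrete_capacity K b mu)%E.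
Proof.
move=> [[fa _] f0] f1; set B := Num.sqrt _; have B0 : 0 <= B by exact: sqrtr_ge0.
have hf z : cmod z < 1 -> hol f z (cderive f z).
  by move=> /fa Hz; apply/cderivableP.
have Hf a : cmod a < 1 ->
    (\int[dA R]_(q in @disc R) (cmod (cderive f (cplx q)) ^+ 2 * K (1 - cmod (mobius a (cplx q)) ^+ 2))%:E <= 1)%E.
  by move=> a1; apply: le_trans f1; apply: ereal_sup_ubound; exists a.
pose e n : R := n.+1%:R^-1; have e0 n : 0 < e n by rewrite invr_gt0.
(* n + 2 makes rho at least 1/2 from the start, as [dilation_const_ge] requires. *)
pose rho n : R := 1 - n.+2%:R^-1.
have rho2 n : 2^-1 <= rho n.
  have : (n.+2%:R : R)^-1 <= 2^-1 by rewrite lef_pV2 ?posrE // ler_nat.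
  by rewrite /rho; move: (n.+2%:R^-1) => u; lra.
have rho1 n : rho n < 1 by rewrite /rho ltrBlDr ltrDl invr_gt0.
have rho0 n : 0 < rho n by apply: lt_le_trans (rho2 n); rewrite invr_gt0.
have /choice[phi Hphi] : forall n, exists phi : R[i] -> R[i],
    (exists N (c : 'I_(2 ^ N) -> 'I_(2 ^ N) -> R[i]), (X_norm K c <= 1)%E /\ phi = packet_sum b c) /\
    forall z, cmod z < 1 ->
     cmod (B%:C * phi z - (dilation_const b (rho n))%:C * f ((rho n ^+ 2)%:C * z)) <= transform_bound b z * e n.
  move=> n; have [N [c [c1 c2]]] := packet_approx b0 (rho0 n) (rho1 n) hf f0 hK Kdbl Hf (e0 n).
  by exists (packet_sum b c); split => //; exists N, c.
pose s n := dilation_const b (rho n); have s0 n : t0 <= s n by exact: Ht0.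
have s00 n : 0 < s n by exact: lt_le_trans (s0 n).
have cphi n z : cmod z < 1 -> ccont (phi n) z.
  move=> z1; have [[N [c [_ ->]]] _] := Hphi n.
  by apply: hol_ccont (@hol_packet_sum R 0 b _ N c z z1); exact: ltW.
pose F n z := (B / s n)%:C * phi n z.
have cF n z : cmod z < 1 -> ccont (F n) z by move=> z1; apply: ccontM (ccont_cst _ _) (cphi n z z1).
have LF n : (L2_sqr mu (F n) <= ((B / t0) ^+ 2)%:E * discrete_capacity K b mu)%E.
  rewrite /F L2_sqrZ; last exact: cphi.
  apply: lee_pmul.
  - by rewrite lee_fin sqr_ge0.
  - by apply: integral_ge0 => q _; rewrite lee_fin sqr_ge0.
  - have h1 : 0 <= B / s n by apply: divr_ge0 => //; exact: ltW (s00 n).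
    have h2 : 0 <= B / t0 by apply: divr_ge0 => //; exact: ltW t00.
    rewrite lee_fin lerXn2r ?nnegrE //.
    by apply: ler_wpM2l => //; rewrite lef_pV2 ?posrE.
  - have [[N [c [c1 ->]]] _] := Hphi n.
    apply: le_trans (ereal_sup_ubound _); last by exists N.
    by apply: ereal_sup_ubound; exists c.
have dist n z : cmod z < 1 -> cmod (F n z - f ((rho n ^+ 2)%:C * z)) <= t0^-1 * transform_bound b z * e n.
  move=> z1; have -> : F n z - f ((rho n ^+ 2)%:C * z) =
      ((s n)^-1)%:C * (B%:C * phi n z - (s n)%:C * f ((rho n ^+ 2)%:C * z)).
    rewrite mulrBr !mulrA -!rmorphM mulVf ?gt_eqF // mul1r /F.
    by rewrite [B / _]mulrC.
  have [_ H] := Hphi n; rewrite cmodM cmod_real ger0_norm ?invr_ge0 ?(ltW (s00 n)) // -mulrA.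
  by apply: ler_pM; [rewrite invr_ge0 ltW | exact: cmod_ge0 | rewrite lef_pV2 ?posrE | exact: H].
have lim1 z : cmod z < 1 -> cmod (F n z) @[n --> \oo] --> cmod (f z).
  move=> z1; apply/cvgrPdist_le => d d0; have d2 : 0 < d / 2 by rewrite divr_gt0.
  have [r r0 Hr] := hol_cont (hf z z1) d2.
  pose L := t0^-1 * transform_bound b z.
  have L0 : 0 <= L.
    rewrite /L /transform_bound; apply: mulr_ge0; first by rewrite invr_ge0 ltW.
    apply: mulr_ge0 => //; apply: mulr_ge0; last exact: fine_ge0.
    by rewrite !mulr_ge0 ?powR_ge0 // addr_ge0 // ltW.
  have del0 : 0 < Num.min (r / 2) (d / 2 / (L + 1)) by rewrite lt_min !divr_gt0 // ltr_wpDl.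
  near=> n; have : e n < Num.min (r / 2) (d / 2 / (L + 1)).
    by near: n; exact: (near_infty_natSinv_lt (PosNum del0)).
  rewrite lt_min => /andP[e1 e2]; rewrite distrC.
  apply: (le_trans (cmod_dist _ _)); apply: (le_trans (cmod_tri _ (f ((rho n ^+ 2)%:C * z)) _)).
  rewrite [leRHS]splitr; apply: lerD.
    apply: (le_trans (dist n z z1)); rewrite -/L.
    apply: (@le_trans _ _ ((L + 1) * (d / 2 / (L + 1)))); last by rewrite mulrC divfK // gt_eqF // ltr_wpDl.
    by apply: ler_pM => //; [exact: ltW | rewrite lerDl | exact: ltW].
  have -> : (rho n ^+ 2)%:C * z = z + (rho n ^+ 2 - 1)%:C * z by rewrite rmorphB rmorph1 mulrBl mul1r subrKC.
  apply: Hr; rewrite cmodM cmod_real.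
  have c1 : `|rho n ^+ 2 - 1| <= 2 * e n.
    have u1 : n.+2%:R^-1 <= e n by rewrite lef_pV2 ?posrE // ler_nat.
    have u0 : 0 < n.+2%:R^-1 :> R by rewrite invr_gt0.
    by apply: dilation_defect => //; rewrite invf_le1 // ler1n.
  apply: (@le_lt_trans _ _ (2 * e n)); last by rewrite mulrC -ltr_pdivlMr.
  by rewrite -[leRHS]mulr1; apply: ler_pM => //; [exact: cmod_ge0 | exact: ltW].
have lim q : @disc R q -> (cmod (F n (cplx q)) ^+ 2)%:E @[n --> \oo] --> (cmod (f (cplx q)) ^+ 2)%:E.
  move=> q1; apply: cvg_EFin; first by near=> n.
  apply: cvgM; apply: lim1 => //.
(* The integrand is identified with the lower limit of the approximants on the disc; the integrals
   of these are bounded term by term by [LF]. *)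
apply: (@le_trans _ _ (limn_einf (fun n => \int[mu]_(q in @disc R) (cmod (F n (cplx q)) ^+ 2)%:E)%E)).
  apply: le_trans (fatou mu mdisc _ _) => [|n|n q _].
  - rewrite /L2_sqr le_eqVlt; apply/orP; left; apply/eqP; apply: eq_integral => q /set_mem q1.
    by rewrite (cvg_limn_einf_sup (lim q q1)).1.
  - exact: measurable_cmod_sqr (cF n).
  - by rewrite lee_fin sqr_ge0.
rewrite limn_einf_lim; apply: lime_le; first exact: is_cvg_einfs.
apply: nearW => n; apply: le_trans (LF n); apply: ereal_inf_lbound; exists n => //=.
Unshelve. all: by end_near.
Qed.

End fatou_bound.

(** * Homogeneity of the seminorm and of the capacity *)

Section scaling.
Variables (R : realType) (K : R -> R) (hK : WQ K).
Implicit Types (q : plane R) (f : R[i] -> R[i]) (mu : {measure set (plane R) -> \bar R}).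

Let mdisc : measurable (@disc R) := @measurable_disc R.

Lemma sqrte_lty (x : \bar R) : (0 <= x)%E -> (sqrte x < +oo)%E = (x < +oo)%E.
Proof. by move=> x0; rewrite -!ge0_fin_numE ?sqrte_ge0 // sqrte_fin_num. Qed.

Lemma sqrte_le1 (x : \bar R) : (0 <= x)%E -> (sqrte x <= 1)%E = (x <= 1)%E.
Proof. by move=> x0; rewrite -[in RHS](lee_sqrt _ (y := 1%E)) //= sqrtr1. Qed.

Lemma QK0P f : QK0 K f <-> [/\ analytic_on_disc f, f 0 = 0 & (QK_seminorm_sqr K f < +oo)%E].
Proof.
have s0 := QK_seminorm_sqr_ge0 hK f.
have E : f 0 = 0 -> (QK_norm K f < +oo)%E = (QK_seminorm_sqr K f < +oo)%E.
  by move=> f0; rewrite /QK_norm f0 cmod0 add0e sqrte_lty.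
split=> [[[f1 f2] f0]|[f1 f0 f2]]; first by split => //; rewrite -E.
by split => //; split => //; rewrite E.
Qed.

Lemma analytic_hol f : analytic_on_disc f -> forall z, cmod z < 1 -> hol f z (cderive f z).
Proof. by move=> fa z /fa Hz; apply/cderivableP. Qed.

Lemma analytic_ccont f : analytic_on_disc f -> forall z, cmod z < 1 -> ccont f z.
Proof. by move=> fa z z1; exact: hol_ccont (analytic_hol fa z1). Qed.

Lemma QK0Z f (t : R) : QK0 K f -> QK0 K (fun z => (t%:C * f z)%R) /\
  (QK_seminorm_sqr K (fun z => (t%:C * f z)%R) <= (t ^+ 2)%:E * QK_seminorm_sqr K f)%E.
Proof.
move=> /QK0P[fa f0 fs]; have s0 := QK_seminorm_sqr_ge0 hK f.
have dE z : cmod z < 1 -> cderivable (fun z => (t%:C * f z)%R) z /\ cderive (fun z => (t%:C * f z)%R) z = t%:C * cderive f z.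
  by move=> z1; apply/cderivableP; apply: holZ; exact: analytic_hol.
have H : (QK_seminorm_sqr K (fun z => (t%:C * f z)%R) <= (t ^+ 2)%:E * QK_seminorm_sqr K f)%E.
  apply: ub_ereal_sup => _ /= [a a1 <-].
  have -> : (\int[dA R]_(q in @disc R) (cmod (cderive (fun z => (t%:C * f z)%R) (cplx q)) ^+ 2 *
      K (1 - cmod (mobius a (cplx q)) ^+ 2))%:E =
    (t ^+ 2)%:E * \int[dA R]_(q in @disc R) (cmod (cderive f (cplx q)) ^+ 2 *
      KK K (1 - cmod (mobius a (cplx q)) ^+ 2))%:E)%E.
    rewrite -ge0_integralZl_EFin ?sqr_ge0 //.
    - apply: eq_integral => q /set_mem q1; rewrite (dE _ q1).2 cmodM cmod_real exprMn real_normK ?num_real //.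
      by rewrite -mulrA KK_E // mobius_defect_ge0.
    - by move=> q q1; rewrite lee_fin mulr_ge0 ?sqr_ge0 // KK_ge0.
    - apply/measurable_EFinP; apply: measurable_funM; last exact: measurable_mobius.
      apply: measurable_funX.
      have cd z : cmod z < 1 -> ccont (cderive f) z.
        by move=> z1; have [d Hd] := hol_deriv (analytic_hol fa) z1; exact: hol_ccont Hd.
      by have [m1 m2] := disc_measurable_ReIm (lexx 1) cd; exact: measurable_cmodF.
  apply: lee_wpmul2l; first by rewrite lee_fin sqr_ge0.
  apply: ereal_sup_ubound; exists a => //=; apply: eq_integral => q /set_mem q1.
  by rewrite KK_E // mobius_defect_ge0.
split; last exact: H.
apply/QK0P; split; first by move=> z z1; exact: (dE z z1).1.
  by rewrite f0 mulr0.
apply: le_lt_trans H _; apply: lte_mul_pinfty => //; first by rewrite lee_fin sqr_ge0.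
Qed.

Lemma L2_sqr_ge0 mu f : (0 <= L2_sqr mu f)%E.
Proof. by apply: integral_ge0 => q _; rewrite lee_fin sqr_ge0. Qed.

Lemma QK0_capacity_ge0 mu : (0 <= QK0_capacity K mu)%E.
Proof.
have hz z : hol (fun=> 0 : R[i]) z 0 by exact: hol_cst.
have dz z : cderivable (fun=> 0 : R[i]) z /\ cderive (fun=> 0 : R[i]) z = 0 by apply/cderivableP.
have s0 : (QK_seminorm_sqr K (fun=> 0%R) <= 0)%E.
  apply: ub_ereal_sup => _ /= [a _ <-]; rewrite integral0_eq // => q _.
  by rewrite (dz _).2 cmod0 expr0n mul0r.
apply: (le_trans (L2_sqr_ge0 mu (fun=> 0%R))); apply: ereal_sup_ubound; exists (fun=> 0) => //; split.
  apply/QK0P; split => //; first by move=> z _; have [] := dz z.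
  exact: le_lt_trans s0 _.
by rewrite /QK_seminorm sqrte_le1 ?QK_seminorm_sqr_ge0 //; exact: le_trans s0 _.
Qed.

(** Rescaling by s^(-1/2) brings f into the unit ball. The parameter s > 0 is any bound of the
    squared seminorm, which may itself be 0. *)
Lemma QK0_capacity_ub mu f (s : R) : 0 < s -> QK0 K f -> (QK_seminorm_sqr K f <= s%:E)%E ->
  (L2_sqr mu f <= s%:E * QK0_capacity K mu)%E.
Proof.
move=> s0 Qf fs; have /QK0P[fa _ _] := Qf.
have t2 : (Num.sqrt s)^-1 ^+ 2 = s^-1 by rewrite exprVn sqr_sqrtr // ltW.
have [Qg gs] := QK0Z (Num.sqrt s)^-1 Qf; rewrite t2 in gs.
have g1 : (QK_seminorm_sqr K (fun z => ((Num.sqrt s)^-1%:C * f z)%R) <= 1)%E.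
  apply: (le_trans gs); apply: (@le_trans _ _ ((s^-1)%:E * s%:E)%E).
    by apply: lee_wpmul2l => //; rewrite lee_fin invr_ge0 ltW.
  by rewrite -EFinM mulVf // gt_eqF.
have : (L2_sqr mu (fun z => ((Num.sqrt s)^-1%:C * f z)%R) <= QK0_capacity K mu)%E.
  apply: ereal_sup_ubound; exists (fun z => ((Num.sqrt s)^-1%:C * f z)%R) => //; split => //.
  by rewrite /QK_seminorm sqrte_le1 // QK_seminorm_sqr_ge0.
rewrite L2_sqrZ; last exact: analytic_ccont.
rewrite t2 => H.
have -> : L2_sqr mu f = (s%:E * ((s^-1)%:E * L2_sqr mu f))%E by rewrite muleA -EFinM mulfV ?mul1e // gt_eqF.
by apply: lee_wpmul2l => //; rewrite lee_fin ltW.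
Qed.

(** Since the seminorm may vanish, f cannot be normalized by it; [QK0_capacity_ub] is applied with
    slightly larger s. *)
Lemma QK0_capacity_le_seminorm mu f : (QK0_capacity K mu < +oo)%E -> QK0 K f ->
  (L2_sqr mu f <= QK0_capacity K mu * QK_seminorm_sqr K f)%E.
Proof.
move=> Doo Qf; have /QK0P[fa f0 soo] := Qf; have s0 := QK_seminorm_sqr_ge0 hK f.
have D0 := QK0_capacity_ge0 mu.
move: (@QK0_capacity_ub mu) Doo D0; case: (QK0_capacity K mu) => [D||] // HD _ D0.
move: soo s0 HD; case E : (QK_seminorm_sqr K f) => [s||] // _ s0 HD.
rewrite !lee_fin in D0 s0; rewrite -EFinM; apply/lee_addgt0Pr => e e0.
have D1 : 0 < D + 1 by rewrite ltr_wpDl.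
(* The surplus e / (D + 1) times D is at most e. *)
have e1 : 0 < s + e / (D + 1) by rewrite ltr_wpDl // divr_gt0.
apply: le_trans (HD f (s + e / (D + 1)) e1 Qf _) _.
  by rewrite E lee_fin lerDl ltW // divr_gt0.
rewrite -EFinM -EFinD lee_fin mulrDl mulrC lerD2l mulrAC.
by rewrite ler_pdivrMr // ler_pM2l // lerDl.
Qed.

End scaling.

(** * Comparison of the two capacities *)

Local Open Scope ereal_scope.

Theorem theorem4p2 (R : realType) (K : R -> R) (hK : WQ K) :
  exists b0 : R, forall b : R, (b0 <= b)%R ->
    (forall mu : {finite_measure set (plane R) -> \bar R},
      mu (~` @disc R) = 0 ->
      (exists2 C : R, (0 <= C)%R &
         forall f, QK0 K f -> L2_sqr mu f <= C%:E * QK_seminorm_sqr K f)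
      <-> discrete_capacity K b mu < +oo) /\
    (exists2 A : R, (0 < A)%R &
      forall mu : {finite_measure set (plane R) -> \bar R},
        mu (~` @disc R) = 0 ->
        discrete_capacity K b mu <= A%:E * QK0_capacity K mu /\
        QK0_capacity K mu <= A%:E * discrete_capacity K b mu).
Proof.
(* Two doubling exponents: p bounds b from below, p' enters the constant [A2] of the converse
   estimate. *)
have [p [A A0 schur]] := schur_bound hK; have [p' Kdbl] := KK_doubling hK.
(* b >= p is needed for the majorant of the kernel, b >= 1 for b > 0, which makes the weight vanish
   continuously on |w| = rho. *)
exists (Num.max 1 p%:R)%R => b; rewrite ge_max => /andP[b1 pb].
have b0 : (0 < b)%R by exact: lt_le_trans b1.
have [t0 t00 Ht0] := dilation_const_ge b0.
pose A1 := ((2 * (pi^-1 * ((b + 1) * 2 `^ b))) ^+ 2 * A)%R.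
pose A2 := ((Num.sqrt ((2 * 100) ^+ p') / t0) ^+ 2)%R.
have A10 : (0 < A1)%R.
  by rewrite mulr_gt0 // exprn_gt0 // mulr_gt0 // mulr_gt0 ?invr_gt0 ?pi_gt0 // mulr_gt0 ?powR_gt0 // addr_gt0.
have A20 : (0 < A2)%R by rewrite exprn_gt0 // divr_gt0 // sqrtr_gt0 exprn_gt0.
have up N (c : 'I_(2 ^ N) -> 'I_(2 ^ N) -> R[i]) : X_norm K c <= 1 ->
    QK0 K (packet_sum b c) /\ QK_seminorm_sqr K (packet_sum b c) <= A1%:E.
  exact: (packet_sum_QK hK schur pb).
have lo (mu : {measure set (plane R) -> \bar R}) : QK0_capacity K mu <= A2%:E * discrete_capacity K b mu.
  apply: ub_ereal_sup => _ /= [f [Qf f1] <-].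
  apply: (L2_sqr_le_capacity hK b0 Kdbl t00 Ht0 mu Qf).
  by rewrite -sqrte_le1 // QK_seminorm_sqr_ge0.
split=> [mu _|].
  split=> [[C C0 HC]|Doo].
    apply: (@le_lt_trans _ _ (C%:E * A1%:E)); last by rewrite -EFinM ltry.
    apply: ub_ereal_sup => _ /= [N _ <-]; apply: ub_ereal_sup => _ /= [c c1 <-].
    have [Qc cA] := up N c c1; apply: (le_trans (HC _ Qc)).
    by apply: lee_wpmul2l.
  have D : QK0_capacity K mu < +oo.
    by apply: le_lt_trans (lo mu) _; apply: lte_mul_pinfty => //; rewrite lee_fin ltW.
  exists (fine (QK0_capacity K mu)).
    by rewrite fine_ge0 // QK0_capacity_ge0.
  move=> f Qf; rewrite fineK; last by rewrite ge0_fin_numE // QK0_capacity_ge0.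
  exact: QK0_capacity_le_seminorm.
exists (Num.max A1 A2) => [|mu _]; first by rewrite lt_max A10.
split.
  apply: ub_ereal_sup => _ /= [N _ <-]; apply: ub_ereal_sup => _ /= [c c1 <-].
  have [Qc cA] := up N c c1; apply: QK0_capacity_ub => //; first by rewrite lt_max A10.
  by apply: (le_trans cA); rewrite lee_fin le_max lexx.
apply: (le_trans (lo mu)); apply: lee_wpmul2r; last by rewrite lee_fin le_max lexx orbT.
(* The discrete capacity is nonnegative because [A2] > 0 times it dominates the nonnegative capacity
   of Q_K. *)
by rewrite -(pmule_rge0 _ (x := A2%:E)) //; exact: le_trans (QK0_capacity_ge0 hK mu) (lo mu).
Qed.
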